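(* Let $M$ be a smooth real manifold, $\mathfrak{Z}(M)$ a distribution of complex vector fields on $M$, $E\xrightarrow{\pi}M$ a smooth complex vector bundle of rank $r$ and $\nabla$ a $\mathbb{C}$-linear connection on $E$. If $\mathfrak{Z}(M)$ is subelliptic at a point $p_0\in M$, then any weak solution $u\in L^2_{\mathrm{loc}}(M,E)$ of $$\nabla_Zu\in\mathcal{C}^\infty(M,E)\qquad\forall Z\in\mathfrak{Z}(M)$$ is equal, almost everywhere in an open neighborhood $U$ of $p_0$ in $M$, to a smooth section of $E$. Here the displayed condition means that for every $Z\in\mathfrak{Z}(M)$ there is $f_Z\in\mathcal{C}^\infty(M,E)$ such that $$\int_Mh(u,\nabla_Z^*v)\,d\lambda_g=\int_Mh(f_Z,v)\,d\lambda_g$$ for all $v\in\mathcal{C}^\infty(M,E)$ with compact support in $M$.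
   Context: $\mathcal{C}^\infty(M)$ denotes complex valued smooth functions, $\mathcal{C}^\infty_0(U)$ those with compact support in the open set $U$, $\mathfrak{X}^{\mathbb{C}}(M)$ the smooth complex vector fields. A distribution of complex vector fields is a $\mathcal{C}^\infty(M)$-submodule $\mathfrak{Z}(M)\subset\mathfrak{X}^{\mathbb{C}}(M)$ (rank not necessarily constant). $\|\cdot\|_s$ is the Sobolev norm of order $s$ and $\|\cdot\|_0$ the $L^2$ norm with respect to a Riemannian metric on $M$. $\mathfrak{Z}(M)$ is subelliptic at $p$ if there are an open neighborhood $U$ of $p$, constants $\epsilon>0$, $C>0$ and $L_1,\dots,L_n\in\mathfrak{Z}(M)$ with $\|u\|_\epsilon^2\le C(\|u\|_0^2+\sum_{j=1}^n\|L_j(u)\|_0^2)$ for all $u\in\mathcal{C}^\infty_0(U)$. For a complex vector field $Z$, $\nabla_Z=\nabla_{\mathrm{Re}Z}+i\nabla_{\mathrm{Im}Z}$ acts on smooth sections of $E$. Fix a smooth Riemannian metric $g$ on $M$, with Lebesgue density $d\lambda_g$, and a smooth Hermitian metric $h$ on the fibers of $E$; $\nabla_Z^*$ is the formal adjoint, defined by $\int_Mh(\nabla_Z^*u,v)d\lambda_g=\int_Mh(u,\nabla_Zv)d\lambda_g$ for smooth sections $u,v$ with $\mathrm{supp}(u)\cap\mathrm{supp}(v)$ compact. *)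

(* Defs.v *)
From HB Require Import structures.
From mathcomp Require Import all_boot all_order all_algebra.
From mathcomp Require Import all_classical all_reals all_analysis.
From mathcomp Require Import complex.
Set Implicit Arguments. Unset Strict Implicit. Unset Printing Implicit Defensive.
Import Order.TTheory GRing.Theory Num.Theory.
Import numFieldNormedType.Exports.
Local Open Scope classical_set_scope.
Local Open Scope ring_scope.
Local Open Scope complex_scope.

Definition tuple_cons (R : realType) (n : nat) (x : measurableTypeR R * n.-tuple R) :
  n.+1.-tuple R := [tuple of x.1 :: x.2].

Lemma measurable_tuple_cons (R : realType) (n : nat) :
  measurable_fun [set: measurableTypeR R * n.-tuple R] (@tuple_cons R n).
Proof. exact: (measurable_cons (measurable_fst) (measurable_snd)). Qed.

Section leb_step.
Context (R : realType) (n : nat).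
Variable mu : {sigma_finite_measure set (n.-tuple R) -> \bar R}.

Definition leb_step : set (n.+1.-tuple R) -> \bar R :=
  pushforward ((@lebesgue_measure R) \x mu)%E (@tuple_cons R n).

Let leb_step0 : leb_step set0 = 0%E.
Proof. by rewrite /leb_step /pushforward preimage_set0 measure0. Qed.

Let leb_step_ge0 A : (0 <= leb_step A)%E.
Proof. by rewrite /leb_step /pushforward measure_ge0. Qed.

Let mpre (A : set (n.+1.-tuple R)) :
  measurable A -> measurable (@tuple_cons R n @^-1` A).
Proof. by move=> mA; rewrite -[X in measurable X]setTI; exact: measurable_tuple_cons. Qed.

Let leb_step_sigma_additive : semi_sigma_additive leb_step.
Proof.
move=> F mF tF mUF; rewrite /leb_step /pushforward preimage_bigcup.
apply: measure_semi_sigma_additive.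
- by move=> n'; exact: mpre.
- apply/trivIsetP => /= i j _ _ ij; rewrite -preimage_setI.
  by move/trivIsetP : tF => /(_ _ _ _ _ ij) ->//; rewrite preimage_set0.
- by rewrite -preimage_bigcup; exact: mpre.
Qed.

HB.instance Definition _ := isMeasure.Build _ _ _ leb_step
  leb_step0 leb_step_ge0 leb_step_sigma_additive.

Let leb_step_sigma_finite : sigma_finite setT leb_step.
Proof.
have [G TG Goo] : sigma_finite setT ((@lebesgue_measure R) \x mu)%E.
  have /sigma_finiteP[F [TF ndF Foo]] := sigma_finiteT (@lebesgue_measure R).
  have /sigma_finiteP[G [TG ndG Goo]] := sigma_finiteT mu.
  exists (fun k => F k `*` G k).
    rewrite -setXTT TF TG predeqE => -[x y]; split.
      move=> [/= [i _ Fx] [j _ Gy]]; exists (maxn i j) => //; split.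
      - by move: x Fx; exact/subsetPset/ndF/leq_maxl.
      - by move: y Gy; exact/subsetPset/ndG/leq_maxr.
    by move=> [i _ []/= ? ?]; split; exists i.
  move=> k; have [? ?] := Foo k; have [? ?] := Goo k.
  split; first exact: measurableX.
  by rewrite product_measure1E// lte_mul_pinfty// ge0_fin_numE.
pose s (t : n.+1.-tuple R) : measurableTypeR R * n.-tuple R :=
  (tnth t ord0, [tuple of behead t]).
have ms : measurable_fun [set: n.+1.-tuple R] s.
  by apply: measurable_fun_pair;
    [exact: measurable_tnth|exact: measurable_behead].
have sK t : tuple_cons (s t) = t by rewrite [RHS]tuple_eta.
have cK t : s (tuple_cons t) = t.
  by case: t => a t; congr pair; apply/val_inj.
exists (fun k => s @^-1` G k).
  by rewrite -preimage_bigcup -TG preimage_setT.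
move=> k; have [mG Gk] := Goo k; split.
  by rewrite -[X in measurable X]setTI; exact: ms.
rewrite /leb_step /pushforward -comp_preimage.
by rewrite (_ : s \o _ = id) //; apply/funext => t; exact: cK.
Qed.

HB.instance Definition _ := Measure_isSigmaFinite.Build _ _ _ leb_step
  leb_step_sigma_finite.

End leb_step.

Fixpoint leb (R : realType) (n : nat) :
    {sigma_finite_measure set (n.-tuple R) -> \bar R} :=
  if n is m.+1 then leb_step (leb R m) else \d_([tuple] : 0.-tuple R).

Lemma leb_box (R : realType) n (A : 'I_n -> set R) :
  (forall i, measurable (A i)) ->
  leb R n [set t | forall i, A i (tnth t i)] =
  (\prod_(i < n) (@lebesgue_measure R (A i)))%E.
Proof.
elim: n A => [|n IH] A mA.
  by rewrite big_ord0 /= diracE mem_set// => -[].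
rewrite big_ord_recl /= /leb_step /pushforward.
have -> : @tuple_cons R n @^-1` [set t | forall i, A i (tnth t i)] =
    A ord0 `*` [set t | forall i, A (lift ord0 i) (tnth t i)].
  apply/seteqP; split=> -[a t] /=.
    move=> H; split; first by have := H ord0.
    by move=> i /=; have := H (lift ord0 i); rewrite tnthS.
  move=> [Ha Ht] i; have [->//|[j ->]] : i = ord0 \/ exists j, i = lift ord0 j.
    by case: (unliftP ord0 i) => [j|] ->; [right; exists j|left].
  by rewrite tnthS; exact: Ht.
have mT : measurable [set t : n.-tuple R | forall i, A (lift ord0 i) (tnth t i)].
  rewrite (_ : [set _ | _] = \bigcap_(i in [set: 'I_n])
    ((fun t => tnth t i) @^-1` A (lift ord0 i))); last first.
    by apply/seteqP; split => t /= H; [move=> i _|move=> i]; exact: H.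
  apply: fin_bigcap_measurable => // i _.
  by rewrite -[X in measurable X]setTI; exact: measurable_tnth.
rewrite product_measure1E; last 2 first.
- exact: mA.
- exact: mT.
by rewrite (IH (fun i => A (lift ord0 i))).
Qed.

Definition rowt (R : realType) (n : nat) (t : n.-tuple R) : 'rV[R]_n :=
  \row_i tnth t i.

Section complex_valued.
Context (R : realType).
Local Notation C := R[i].

Definition normsq (z : C) : R := complex.Re z ^+ 2 + complex.Im z ^+ 2.

Definition cexp (theta : R) : C := cos theta +i* sin theta.

Definition cintegral d (T : measurableType d) (mu : {measure set T -> \bar R})
    (f : T -> C) : C :=
  (\int[mu]_x complex.Re (f x)) +i* (\int[mu]_x complex.Im (f x)).

Definition dotrow n (x y : 'rV[R]_n) : R := (x *m y^T) 0 0.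

Definition fourier n (f : 'rV[R]_n -> C) (xi : 'rV[R]_n) : C :=
  cintegral (leb R n) (fun t => cexp (- dotrow (rowt t) xi) * f (rowt t)).

(* Squared Sobolev norm of order s on R^n; with this normalization, order 0 is
   the squared L^2 norm (Plancherel). *)
Definition sobolev_sq n (s : R) (f : 'rV[R]_n -> C) : \bar R :=
  (((2 * pi) ^- n)%:E *
   \int[leb R n]_t ((1 + dotrow (rowt t) (rowt t)) `^ s
                    * normsq (fourier f (rowt t)))%:E)%E.

Definition partial n (i : 'I_n) (f : 'rV[R]_n -> R) (x : 'rV[R]_n) : R :=
  'D_(delta_mx 0 i) f x.

Fixpoint Ck n (k : nat) (U : set 'rV[R]_n) (f : 'rV[R]_n -> R) : Prop :=
  (forall x, U x -> {for x, continuous f}) /\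
  (if k is k'.+1 then forall i : 'I_n,
     (forall x, U x -> derivable f x (delta_mx 0 i)) /\ Ck k' U (partial i f)
   else True).

(* Meaningful for open U only. *)
Definition smooth n (U : set 'rV[R]_n) (f : 'rV[R]_n -> R) : Prop :=
  forall k, Ck k U f.

End complex_valued.

(* cinv is only specified on the image of the chart. *)
Record chart (R : realType) (M : topologicalType) (n : nat) := Chart {
  cdom : set M;
  cmap : M -> 'rV[R]_n;
  cinv : 'rV[R]_n -> M;
  cdom_open : open cdom;
  cim_open : open (cmap @` cdom);
  cmapK : forall x, cdom x -> cinv (cmap x) = x;
  cmap_continuous : forall x, cdom x -> {for x, continuous cmap};
  cinv_continuous : forall y, (cmap @` cdom) y -> {for y, continuous cinv} }.

Definition chart_compatible (R : realType) (M : topologicalType) (n : nat)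
    (c1 c2 : chart R M n) : Prop :=
  forall j, smooth (cmap c1 @` (cdom c1 `&` cdom c2))
                   (fun y => cmap c2 (cinv c1 y) 0 j).

(* Smooth manifold of dimension n. The chart chosen around x serves to identify
   the tangent space at x with R^n and its complexification with C^n. Base
   points are only needed to form Borel measurable spaces. *)
Record manifold (R : realType) (n : nat) := Manifold {
  mcarrier :> ptopologicalType;
  manifold_hausdorff : hausdorff_space mcarrier;
  manifold_second_countable : @second_countable mcarrier;
  atlas : set (chart R mcarrier n);
  chart_at : mcarrier -> chart R mcarrier n;
  chart_at_atlas : forall x, atlas (chart_at x);
  chart_at_dom : forall x, cdom (chart_at x) x;
  atlas_compatible : forall c1 c2, atlas c1 -> atlas c2 ->
    chart_compatible c1 c2 }.

Section manifold_calculus.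
Context (R : realType) (n : nat) (M : manifold R n).
Local Notation C := R[i].

Definition borel := g_sigma_algebraType (@open M).

Definition smooth_on (W : set M) (f : M -> R) : Prop :=
  forall c, atlas c -> smooth (cmap c @` (cdom c `&` W)) (f \o cinv c).

Definition csmooth_on (W : set M) (f : M -> C) : Prop :=
  smooth_on W (fun x => complex.Re (f x)) /\ smooth_on W (fun x => complex.Im (f x)).

Definition csmooth := csmooth_on setT.

(* Jacobian of the change of coordinates from c1 to c2 at x; it acts on row
   vectors from the right. *)
Definition jac (c1 c2 : chart R M n) (x : M) : 'M[R]_n :=
  'J (cmap c2 \o cinv c1) (cmap c1 x).

(* The value at x is given by its components in the coordinates chart_at x. *)
Definition rvfield := M -> 'rV[R]_n.
Definition cvfield := M -> 'rV[C]_n.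

Definition components (c : chart R M n) (Z : cvfield) (x : M) : 'rV[C]_n :=
  Z x *m map_mx (real_complex R) (jac (chart_at x) c x).

Definition smooth_cvfield (Z : cvfield) : Prop :=
  forall c, atlas c ->
  forall j, csmooth_on (cdom c) (fun x => components c Z x 0 j).

Definition smooth_rvfield (X : rvfield) : Prop :=
  smooth_cvfield (fun x => map_mx (real_complex R) (X x)).

Definition re_vfield (Z : cvfield) : rvfield := fun x => map_mx (@complex.Re R) (Z x).
Definition im_vfield (Z : cvfield) : rvfield := fun x => map_mx (@complex.Im R) (Z x).

Definition cpartial (c : chart R M n) (i : 'I_n) (f : M -> C) (x : M) : C :=
  partial i (fun y => complex.Re (f (cinv c y))) (cmap c x) +i*
  partial i (fun y => complex.Im (f (cinv c y))) (cmap c x).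

Definition vf_apply (Z : cvfield) (f : M -> C) (x : M) : C :=
  \sum_i Z x 0 i * cpartial (chart_at x) i f x.

Definition is_distribution (ZM : set cvfield) : Prop :=
  [/\ forall Z, ZM Z -> smooth_cvfield Z,
      ZM (fun=> 0),
      forall Z1 Z2, ZM Z1 -> ZM Z2 -> ZM (fun x => Z1 x + Z2 x) &
      forall f Z, csmooth f -> ZM Z -> ZM (fun x => f x *: Z x)].

Definition metric_in (c : chart R M n) (g : M -> 'M[R]_n) (x : M) : 'M[R]_n :=
  let J := jac c (chart_at x) x in J *m g x *m J^T.

Definition is_riemannian_metric (g : M -> 'M[R]_n) : Prop :=
  [/\ forall x, (g x)^T = g x,
      forall x (v : 'rV[R]_n), v != 0 -> 0 < (v *m g x *m v^T) 0 0 &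
      forall c, atlas c ->
      forall i j, smooth_on (cdom c) (fun x => metric_in c g x i j)].

(* This determines lam uniquely, since countably many charts cover M. *)
Definition is_riemannian_density (g : M -> 'M[R]_n)
    (lam : {measure set borel -> \bar R}) : Prop :=
  forall c, atlas c -> forall A : set borel, measurable A -> A `<=` cdom c ->
  lam A = (\int[leb R n]_(t in [set t | (cmap c @` A) (rowt t)])
             (Num.sqrt (\det (metric_in c g (cinv c (rowt t)))))%:E)%E.

Definition l2_sq (lam : {measure set borel -> \bar R}) (f : M -> C) : \bar R :=
  (\int[lam]_x (normsq (f x))%:E)%E.

Definition test_function (U : set M) (f : M -> C) : Prop :=
  let S := closure [set x | f x != 0] in
  [/\ csmooth f, compact S & S `<=` U].

Definition in_coordinates (c : chart R M n) (f : M -> C) : 'rV[R]_n -> C :=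
  fun y => if y \in cmap c @` cdom c then f (cinv c y) else 0.

(* The Sobolev norm of functions supported in a chart domain is the one of R^n
   read in the chart; near p, all charts give equivalent norms, so that the
   choice of c is immaterial after shrinking U. *)
Definition subelliptic (lam : {measure set borel -> \bar R})
    (ZM : set cvfield) (p : M) : Prop :=
  exists (c : chart R M n) (U : set M) (eps K : R) (m : nat)
         (L : 'I_m -> cvfield),
    [/\ [/\ atlas c, open U, U p & U `<=` cdom c],
        0 < eps, 0 < K, forall j, ZM (L j) &
        forall f, test_function U f ->
        (sobolev_sq eps (in_coordinates c f) <=
         K%:E * (l2_sq lam f + \sum_(j < m) l2_sq lam (vf_apply (L j) f)))%E].

End manifold_calculus.

(* Outside tdom the maps tfwd and tbwd are unspecified. *)
Record trivialization (R : realType) (n : nat) (M : manifold R n) (r : nat)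
    (E : M -> lmodType R[i]) := Trivialization {
  tdom : set M;
  tfwd : forall x, E x -> 'rV[R[i]]_r;
  tbwd : forall x, 'rV[R[i]]_r -> E x;
  tdom_open : open tdom;
  tfwd_linear : forall x, tdom x -> linear (@tfwd x);
  tfwdK : forall x, tdom x -> cancel (@tfwd x) (tbwd x);
  tbwdK : forall x, tdom x -> cancel (tbwd x) (@tfwd x) }.

(* Smooth complex vector bundle of rank r, given by its fibers together with a
   covering family of local trivializations with smooth transition matrices. *)
Record vbundle (R : realType) (n : nat) (M : manifold R n) (r : nat) := VBundle {
  fiber :> M -> lmodType R[i];
  trivs : set (trivialization r fiber);
  trivs_cover : forall x, exists2 t, trivs t & tdom t x;
  trivs_compatible : forall t1 t2, trivs t1 -> trivs t2 -> forall i j,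
    csmooth_on (tdom t1 `&` tdom t2)
      (fun x => tfwd t2 (tbwd t1 x (delta_mx 0 i)) 0 j) }.

Section bundle_calculus.
Context (R : realType) (n : nat) (M : manifold R n) (r : nat)
        (E : vbundle M r).
Local Notation C := R[i].

Definition section := forall x : M, E x.

Definition smooth_section (s : section) : Prop :=
  forall t, trivs t ->
  forall j, csmooth_on (tdom t) (fun x => tfwd t (s x) 0 j).

Definition measurable_section (s : section) : Prop :=
  forall t, trivs t -> forall j,
    measurable_fun (tdom t : set (borel M)) (fun x => complex.Re (tfwd t (s x) 0 j)) /\
    measurable_fun (tdom t : set (borel M)) (fun x => complex.Im (tfwd t (s x) 0 j)).

Definition supp (s : section) : set M := closure [set x | s x != 0].

Definition connection := rvfield M -> section -> section.

(* With f ranging over complex functions, the Leibniz rule contains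
   C-homogeneity in the section. *)
Definition is_connection (nabla : connection) : Prop :=
  [/\ forall X s, smooth_rvfield X -> smooth_section s ->
        smooth_section (nabla X s),
      forall X Y s, smooth_rvfield X -> smooth_rvfield Y -> smooth_section s ->
        forall x, nabla (fun y => X y + Y y) s x = nabla X s x + nabla Y s x,
      forall (f : M -> R) X s, smooth_on setT f -> smooth_rvfield X ->
        smooth_section s ->
        forall x, nabla (fun y => f y *: X y) s x = (f x)%:C *: nabla X s x,
      forall X s t, smooth_rvfield X -> smooth_section s -> smooth_section t ->
        forall x, nabla X (fun y => s y + t y) x = nabla X s x + nabla X t x &
      forall X (f : M -> C) s, smooth_rvfield X -> csmooth f ->
        smooth_section s ->
        forall x, nabla X (fun y => f y *: s y) x =
          vf_apply (fun y => map_mx (real_complex R) (X y)) f x *: s x +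
          f x *: nabla X s x].

Definition cnabla (nabla : connection) (Z : cvfield M) (s : section) : section :=
  fun x => nabla (re_vfield Z) s x + (0 +i* 1) *: nabla (im_vfield Z) s x.

(* Linear in the first argument. *)
Definition is_hermitian_metric (h : forall x : M, E x -> E x -> C) : Prop :=
  [/\ forall x a u v w, h x (a *: u + v) w = a * h x u w + h x v w,
      forall x u v, h x v u = ((h x u v)^*)%C,
      forall x u, u != 0 -> 0 < h x u u &
      forall t, trivs t -> forall i j, csmooth_on (tdom t)
        (fun x => h x (tbwd t x (delta_mx 0 i)) (tbwd t x (delta_mx 0 j)))].

Definition pairing (h : forall x : M, E x -> E x -> C)
    (lam : {measure set (borel M) -> \bar R}) (u v : section) : C :=
  cintegral lam (fun x => h x (u x) (v x)).

Definition is_formal_adjoint (h : forall x : M, E x -> E x -> C)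
    (lam : {measure set (borel M) -> \bar R}) (D D' : section -> section) : Prop :=
  (forall u, smooth_section u -> smooth_section (D' u)) /\
  forall u v, smooth_section u -> smooth_section v ->
    compact (supp u `&` supp v) -> pairing h lam (D' u) v = pairing h lam u (D v).

Definition l2loc (h : forall x : M, E x -> E x -> C)
    (lam : {measure set (borel M) -> \bar R}) (u : section) : Prop :=
  measurable_section u /\
  forall A : set (borel M), compact (A : set M) ->
    (\int[lam]_(x in A) (complex.Re (h x (u x) (u x)))%:E < +oo)%E.

(* nabla_adj Z stands for the formal adjoint of nabla_Z. *)
Definition weak_solution (h : forall x : M, E x -> E x -> C)
    (lam : {measure set (borel M) -> \bar R})
    (nabla_adj : cvfield M -> section -> section) (ZM : set (cvfield M))
    (u : section) : Prop :=
  forall Z, ZM Z -> exists2 f, smooth_section f &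
    forall v, smooth_section v -> compact (supp v) ->
      pairing h lam u (nabla_adj Z v) = pairing h lam f v.

End bundle_calculus.

(* Main.v *)
(* In a chart, a trivialization and a dual frame, the weak equations become a
first-order system for the components of u, so these generate, together with
the right-hand sides, a family of L^2 functions stable under the weak action of
the L_j. Convolution-type operators whose kernels are concentrated in
|x - y| <= t are stable under commutation with smooth vector fields: hence, for
w the image under such an operator of a member of the family, the L_j w are
bounded like w, uniformly in t. The subelliptic estimate then bounds |w|_eps,
and interpolating |dw|^2 <= h^(2 eps - 2) |w|_eps^2 + h^2 |d^2 w|^2 shows that
each derivative of w costs less than the trivial factor 1/t, by a power of t.
Iterating, the derivatives of all orders of the mollifications of u at scale t
are O(t^(-1/2)), and so are the t-derivatives of these: hence the mollifications
converge in C^infinity as t -> 0, and the limit is u almost everywhere. *)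
Require Import Defs.
From HB Require Import structures.
From mathcomp Require Import all_boot all_order all_algebra.
From mathcomp Require Import all_classical all_reals all_analysis.
From mathcomp Require Import measurable_realfun complex ring lra zify.
Set Implicit Arguments. Unset Strict Implicit. Unset Printing Implicit Defensive.
Import Order.TTheory GRing.Theory Num.Theory.
Import numFieldNormedType.Exports.
Local Open Scope classical_set_scope.
Local Open Scope ring_scope.

(** The estimate improves each derivative only by a fixed power of $t$, so no bound at a fixed order
    is good enough by itself. With [sigma] half of min(eps, 1), derivatives of order $b$ have $L^2$
    norm $O(t^{-b(1-\sigma)})$: this grows with $b$, but so does the surplus $b\sigma$ over the
    trivial $t^{-b}$. A descent cashes it in. The $t$-derivative of an order $k$ derivative of a
    mollification is a sum of order $k+1$ derivatives of mollifications with other profiles, so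
    integrating in $t$ trades one order for one power of $t$; from an order high enough for the
    surplus to cover also the $n$ derivatives spent on the sup bound, one descends to $O(t^{-1/2})$.
    The substitution $t=r^2$ makes that a Lipschitz bound in $r$. On the bundle, the formal adjoint
    is known only through an integral identity: its locality and its coefficients are recovered by
    testing this identity, before the weak equation can be read in coordinates. The Sobolev norm is
    a Fourier integral evaluated only on test functions, so a Plancherel identity for these
    suffices. *)

Local Notation mfunT := (measurable_fun setT).
Local Notation mfunM := measurable_funM.
Local Notation mfunD := measurable_funD.
Local Notation mcompT := measurableT_comp.
Local Notation mEFinP := measurable_EFinP.
Local Notation cont_mfun := continuous_measurable_fun.
Local Notation mfubini_F := measurable_fun_fubini_tonelli_F.

(** * Smooth functions *)
Section continuous_closure.
Context (R : realType) (T : topologicalType).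
Implicit Types f g : T -> R.

Lemma contM f g : continuous f -> continuous g -> continuous (fun x => f x * g x).
Proof. by move=> cf cg x; exact: (cvgM (cf x) (cg x)). Qed.

Lemma contD f g : continuous f -> continuous g -> continuous (fun x => f x + g x).
Proof. by move=> cf cg x; exact: (cvgD (cf x) (cg x)). Qed.

Lemma contN f : continuous f -> continuous (fun x => - f x).
Proof. by move=> cf x; exact: (cvgN (cf x)). Qed.

Lemma contB f g : continuous f -> continuous g -> continuous (fun x => f x - g x).
Proof. by move=> cf cg x; exact: (cvgB (cf x) (cg x)). Qed.

Lemma contV f : (forall x, f x != 0) -> continuous f -> continuous (fun x => (f x)^-1).
Proof. by move=> f0 cf x; exact: (cvgV (f0 x) (cf x)). Qed.

Lemma cont_cst (c : R) : continuous (fun _ : T => c).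
Proof. by move=> x; exact: cvg_cst. Qed.

Lemma cont_comp (U : topologicalType) (g : R -> U) f : continuous g -> continuous f -> continuous (fun x => g (f x)).
Proof. by move=> cg cf x; apply: (@continuous_comp _ _ _ f g); [exact: cf|exact: cg]. Qed.

Lemma contX f k : continuous f -> continuous (fun x => f x ^+ k).
Proof. by move=> cf; apply: (cont_comp (g := fun z => z ^+ k)) => //; exact: exprn_continuous. Qed.

End continuous_closure.

Lemma cont_id (R : realType) : continuous (fun x : R => x).
Proof. by move=> x; exact: cvg_id. Qed.

Lemma derive_continuous (R : realType) (f g : R -> R) : (forall x, is_derive x (1 : R) f (g x)) -> continuous f.
Proof.
by move=> df x; apply/differentiable_continuous/derivable1_diffP; have [] := df x.
Qed.

Section Ck_calculus.
Context (R : realType) (n : nat).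
Notation X := 'rV[R]_n.
Notation ev i := (delta_mx 0 i : X).
Implicit Types (U V : set X) (f g : X -> R) (k : nat).

Lemma Ck_pred k U f : Ck k.+1 U f -> Ck k U f.
Proof.
elim: k f => [|k IH] f [cf H]; first by split.
by split => // i; have [df /IH] := H i.
Qed.

Lemma Ck_le j k U f : (j <= k)%N -> Ck k U f -> Ck j U f.
Proof.
move=> jk; rewrite -(subnK jk); elim: (k - j)%N => [//|m IH] /=.
by move=> H; apply: IH; exact: Ck_pred H.
Qed.

Lemma Ck_cont k U f x : Ck k U f -> U x -> {for x, continuous f}.
Proof. by case: k => [|k] [+ _]; apply. Qed.

Lemma Ck_derivable k U f x i : Ck k.+1 U f -> U x -> derivable f x (ev i).
Proof. by move=> [_ /(_ i)[+ _]]; apply. Qed.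

Lemma Ck_partial k U f i : Ck k.+1 U f -> Ck k U (partial i f).
Proof. by move=> [_ /(_ i)[]]. Qed.

Lemma Ck_sub k U V f : V `<=` U -> Ck k U f -> Ck k V f.
Proof.
move=> VU; elim: k f => [|k IH] f [cf H]. by split => // x /VU; exact: cf.
split; first by move=> x /VU; exact: cf.
move=> i; have [df Hf] := H i; split; last exact: IH.
by move=> x /VU; exact: df.
Qed.

(** [Ck] asks for continuity and partial derivatives in the ambient space at each point of the set,
    so it is a condition on single points. *)
Lemma Ck_local k U f : (forall x, U x -> exists2 V : set X, V x & Ck k V f) -> Ck k U f.
Proof.
elim: k f => [|k IH] f H. by split => // x /H[V Vx [+ _]]; exact.
split; first by move=> x /H[V Vx [+ _]]; exact.
move=> i; split. by move=> x /H[V Vx [_ /(_ i)[+ _]]]; exact.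
by apply: IH => x /H[V Vx [_ /(_ i)[_ ?]]]; exists V.
Qed.

Lemma near_open U f g x : open U -> {in U, f =1 g} -> U x -> \near x, f x = g x.
Proof.
move=> oU fg Ux; have : nbhs x U by exact: open_nbhs_nbhs.
by apply: filterS => y Uy; apply: fg; rewrite inE.
Qed.

Lemma Ck_ext k U f g : open U -> {in U, f =1 g} -> Ck k U f -> Ck k U g.
Proof.
move=> oU; elim: k f g => [|k IH] f g fg [cf H]. split => // x Ux; rewrite /prop_for /continuous_at -fg ?inE//.
  by apply: cvg_trans (cf x Ux); exact: (near_eq_cvg (near_open oU fg Ux)).
split. move=> x Ux; rewrite /prop_for /continuous_at -fg ?inE//.
  by apply: cvg_trans (cf x Ux); exact: (near_eq_cvg (near_open oU fg Ux)).
move=> i; have [df Hi] := H i; split. by move=> x Ux; exact: (near_eq_derivable (near_open oU fg Ux) (df x Ux)).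
apply: IH Hi => x; rewrite inE => Ux; apply: near_eq_derive.
exact: (near_open oU fg Ux).
Qed.

Lemma Ck_cst k U (c : R) : Ck k U (fun=> c).
Proof.
elim: k c => [|k IH] c. by split => // x _; exact: cst_continuous.
split; first by move=> x _; exact: cst_continuous.
move=> i; split; first by move=> x _; exact: derivable_cst.
rewrite (_ : partial i _ = fun=> 0); first exact: IH.
by apply/funext => x; rewrite /partial derive_cst.
Qed.

Lemma partialD i f g x : derivable f x (ev i) -> derivable g x (ev i) ->
  partial i (fun y => f y + g y) x = partial i f x + partial i g x.
Proof. by move=> df dg; rewrite -[LHS]/('D_(ev i) (f + g) x) deriveD. Qed.

Lemma partialM i f g x : derivable f x (ev i) -> derivable g x (ev i) ->
  partial i (fun y => f y * g y) x = partial i f x * g x + f x * partial i g x.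
Proof.
move=> df dg; rewrite /partial (deriveM df dg) addrC.
by congr (_ + _); rewrite -[LHS]/(_ * _) mulrC.
Qed.

Lemma CkD k U f g : open U -> Ck k U f -> Ck k U g -> Ck k U (fun x => f x + g x).
Proof.
move=> oU; elim: k f g => [|k IH] f g [cf Hf] [cg Hg]. split => // x Ux; exact: (cvgD (cf x Ux) (cg x Ux)).
split; first by move=> x Ux; exact: (cvgD (cf x Ux) (cg x Ux)).
move=> i; have [df {}Hf] := Hf i; have [dg {}Hg] := Hg i.
split; first by move=> x Ux; apply: (derivableD (df x Ux) (dg x Ux)).
apply: Ck_ext (IH _ _ Hf Hg) => // x; rewrite inE => Ux.
by rewrite partialD//; [exact: df|exact: dg].
Qed.

Lemma CkM k U f g : open U -> Ck k U f -> Ck k U g -> Ck k U (fun x => f x * g x).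
Proof.
move=> oU; elim: k f g => [|k IH] f g Hf0 Hg0; have [cf Hf] := Hf0; have [cg Hg] := Hg0.
  by split => // x Ux; exact: (cvgM (cf x Ux) (cg x Ux)).
split; first by move=> x Ux; exact: (cvgM (cf x Ux) (cg x Ux)).
move=> i; have [df {}Hf] := Hf i; have [dg {}Hg] := Hg i.
split; first by move=> x Ux; apply: (derivableM (df x Ux) (dg x Ux)).
have := CkD oU (IH _ _ Hf (Ck_pred Hg0)) (IH _ _ (Ck_pred Hf0) Hg).
apply: Ck_ext => // x; rewrite inE => Ux.
by rewrite partialM//; [exact: df|exact: dg].
Qed.

Lemma CkZ k U (c : R) f : open U -> Ck k U f -> Ck k U (fun x => c * f x).
Proof. by move=> oU; apply: CkM => //; exact: Ck_cst. Qed.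

Lemma CkN k U f : open U -> Ck k U f -> Ck k U (fun x => - f x).
Proof.
by move=> oU /(CkZ (-1) oU); apply: Ck_ext => // x _; rewrite mulN1r.
Qed.

Lemma CkB k U f g : open U -> Ck k U f -> Ck k U g -> Ck k U (fun x => f x - g x).
Proof. by move=> oU cf cg; apply: CkD => //; exact: CkN. Qed.

Lemma Ck_sum k U (I : Type) (r : seq I) (P : pred I) (F : I -> X -> R) : open U -> (forall i, P i -> Ck k U (F i)) ->
  Ck k U (fun x => \sum_(i <- r | P i) F i x).
Proof.
move=> oU H; elim: r => [|i r IH]. by apply: Ck_ext (Ck_cst _ _ 0) => // x _; rewrite big_nil.
have [Pi|nPi] := boolP (P i); last first. by apply: Ck_ext IH => // x _; rewrite big_cons (negbTE nPi).
by apply: Ck_ext (CkD oU (H _ Pi) IH) => // x _; rewrite big_cons Pi.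
Qed.

Lemma Ck_prod k U (I : Type) (r : seq I) (P : pred I) (F : I -> X -> R) : open U -> (forall i, P i -> Ck k U (F i)) ->
  Ck k U (fun x => \prod_(i <- r | P i) F i x).
Proof.
move=> oU H; elim: r => [|i r IH]. by apply: Ck_ext (Ck_cst _ _ 1) => // x _; rewrite big_nil.
have [Pi|nPi] := boolP (P i); last first. by apply: Ck_ext IH => // x _; rewrite big_cons (negbTE nPi).
by apply: Ck_ext (CkM oU (H _ Pi) IH) => // x _; rewrite big_cons Pi.
Qed.

Lemma is_derive_coord (i j : 'I_n) (x : X) : is_derive x (ev i) (fun y : X => y 0 j) (i == j)%:R.
Proof.
have dc : differentiable (fun y : X => y 0 j) x by exact: differentiable_coord.
apply: DeriveDef; first exact: diff_derivable.
rewrite /derive (_ : (fun h => _) = fun h => h^-1 * h * (i == j)%:R); last first.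
  apply/funext => h; rewrite /= !mxE/= addrK -mulrA eq_sym. by rewrite -[LHS]/(_ * _).
apply: cvg_lim => //; apply/cvgrPdist_le => e e0; near=> h.
rewrite mulVf ?mul1r ?subrr ?normr0 ?ltW//.
by near: h; exact: nbhs_dnbhs_neq.
Unshelve. all: by end_near. Qed.

Lemma Ck_coord k U i : Ck k U (fun x => x 0 i).
Proof.
case: k => [|k]; first by split => // x _; exact: coord_continuous.
split; first by move=> x _; exact: coord_continuous.
move=> j; split; first by move=> x _; have [] := is_derive_coord j i x.
rewrite (_ : partial j _ = fun=> (j == i)%:R); first exact: Ck_cst.
by apply/funext => x; rewrite /partial (@derive_val _ _ _ _ _ _ _ (is_derive_coord j i x)).
Qed.

End Ck_calculus.

(** * Mean value theorem along lines; differentiability of C^1 functions *)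

Section line.
Context (R : realType) (V : normedModType R).

Lemma is_derive_line (f : V -> R) (y v : V) (s : R) : derivable f (s *: v + y) v ->
  is_derive s (1 : R) (fun s : R => f (s *: v + y)) ('D_v f (s *: v + y)).
Proof.
move=> df; have E : (fun h : R => h^-1 *: ((fun s : R => f (s *: v + y)) (h *: (1 : R) + s)
    - f (s *: v + y))) = fun h => h^-1 *: (f (h *: v + (s *: v + y)) - f (s *: v + y)).
  by apply/funext => h; rewrite -[h *: (1 : R)]/(h * 1) mulr1 scalerDl addrA.
by apply: DeriveDef; rewrite /derivable /derive /= E.
Qed.

(** The sign of [a] is arbitrary, so both directions from [y] are treated at once; the intermediate
    point is located only by its absolute value. *)
Lemma line_MVT (f : V -> R) (y v : V) (a : R) : (forall s, `|s| <= `|a| -> derivable f (s *: v + y) v) ->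
  exists2 c, `|c| <= `|a| & f (a *: v + y) - f y = a * 'D_v f (c *: v + y).
Proof.
move=> df; pose g s := f (s *: v + y).
have gd s : `|s| <= `|a| -> is_derive s (1 : R) g ('D_v f (s *: v + y)). by move=> /df; exact: is_derive_line.
have cg p q : (forall s, p <= s <= q -> `|s| <= `|a|) -> {within `[p, q], continuous g}.
  move=> H; apply: derivable_within_continuous => s; rewrite in_itv /= => /H /gd. by move=> [].
have g0 : g 0 = f y by rewrite /g scale0r add0r.
have [a0|a0] := leP 0 a.
- have H s : 0 <= s <= a -> `|s| <= `|a|. by move=> /andP[s0 sa]; rewrite !ger0_norm.
  have [|c|c] := @MVT_segment R g (fun s => 'D_v f (s *: v + y)) 0 a a0.
  + move=> s; rewrite in_itv/= => /andP[s0 sa]; apply/gd/H; rewrite ltW//=; exact: ltW.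
  + exact: cg.
  + rewrite in_itv/= => /H ca; rewrite g0 subr0 => E; exists c => //. by rewrite mulrC -E.
- have H s : a <= s <= 0 -> `|s| <= `|a|. by move=> /andP[s0 sa]; rewrite !ler0_norm ?lerN2// ltW.
  have [|c|c] := @MVT_segment R g (fun s => 'D_v f (s *: v + y)) a 0 (ltW a0).
  + move=> s; rewrite in_itv/= => /andP[s0 sa]; apply/gd/H; rewrite ltW//=; exact: ltW.
  + exact: cg.
  + rewrite in_itv/= => /H ca; rewrite g0 sub0r => E; exists c => //.
    by rewrite -opprB -[f y]g0 -/(g a) g0 E mulrN opprK mulrC.
Qed.

End line.

Lemma differentiable_eps (R : realType) (V W : normedModType R) (f : V -> W)
    (df : {linear V -> W}) (x : V) : continuous df -> (forall e : R, 0 < e -> \forall h \near (0 : V),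
     `|f (h + x) - (f x + df h)| <= e * `|h|) -> differentiable f x /\ 'd f x = df :> (V -> W).
Proof.
move=> cdf H.
have key : f \o shift x = cst (f x) + df +o_ 0 id by apply/eqaddoP => e /H.
have dE := diff_unique cdf key.
by split => //; apply/diff_locallyP; rewrite dE.
Qed.

Lemma near_forall (T : topologicalType) (I : finType) (x : T) (P : I -> T -> Prop) :
  (forall i, \forall y \near x, P i y) -> \forall y \near x, forall i, P i y.
Proof. by move=> H; apply: filter_forall. Qed.

Section C1_diff.
Context (R : realType) (n : nat).
Notation X := 'rV[R]_n.
Notation ev i := (delta_mx 0 i : X).

(** The increment is split along the coordinate path from [x] to [h + x]: the mean value theorem on
    each edge and continuity of the partial derivatives bound the remainder. *)
Lemma C1_diff (U : set X) (f : X -> R) x : open U -> Ck 1 U f -> U x ->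
  differentiable f x /\ forall v, 'd f x v = \sum_i v 0 i * partial i f x.
Proof.
move=> oU Hf Ux.
pose L (v : X) := \sum_i v 0 i * partial i f x.
have Ll : linear L. move=> a u v; rewrite /L scaler_sumr -big_split/=; apply: eq_bigr => i _.
  by rewrite !mxE mulrDl -mulrA.
pose LM := GRing.isLinear.Build _ _ _ _ _ Ll.
pose LL : {linear X -> R} := HB.pack L LM.
have cL : continuous LL. move=> y; apply: (@Ck_cont _ _ 0 setT) => //.
  apply: Ck_sum => [|i _]; first exact: openT. by apply: CkM; [exact: openT|exact: Ck_coord|exact: Ck_cst].
have key (e : R) : 0 < e -> \forall h \near (0 : X), `|f (h + x) - (f x + L h)| <= e * `|h|. move=> e0.
  (* The tolerance is divided by [n.+1] rather than [n], so that it makes sense in dimension 0. *)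
  have [d d0 Hd] : exists2 d, 0 < d & forall y, `|x - y| < d -> U y /\
      forall i, `|partial i f x - partial i f y| <= e / n.+1%:R.
    have : \forall y \near x, U y /\ forall i, `|partial i f x - partial i f y| <= e / n.+1%:R.
      apply: filterI; first exact: open_nbhs_nbhs. pose P i y : Prop := `|partial i f x - partial i f y| <= e / n.+1%:R.
      apply: (@near_forall _ _ x P) => i; have := Ck_cont (Ck_partial i Hf) Ux.
      by move=> /cvgrPdist_le; apply; rewrite divr_gt0.
    by move=> /nbhs_ballP[d d0 Hd]; exists d => // y yd; apply: Hd; rewrite -ball_normE.
  apply/nbhs_ballP; exists d => //= h; rewrite -ball_normE/= sub0r normrN => hd.
  (* [p j] has already moved in the coordinates below [j]. In the maximum norm no point of the path
     is farther from [x] than the norm of [h]. *)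
  pose p j : X := (\row_i (if (i < j)%N then h 0 i else 0)) + x. have pS (j : 'I_n) : p j.+1 = h 0 j *: ev j + p j.
    rewrite /p addrA; congr (_ + _); apply/rowP => i; rewrite !mxE /= ltnS leq_eqVlt.
    have [->|ij] := eqVneq i j; first by rewrite eqxx ltnn mulr1 addr0.
    by rewrite mulr0 add0r (negbTE (ij : val i != val j)). have hcoord i : `|h 0 i| <= `|h|.
    by rewrite [leRHS]/Num.Def.normr/= mx_normrE; exact: (le_bigmax _ _ (0, i)).
  have pd (j : 'I_n) c : `|c| <= `|h 0 j| -> `|x - (c *: ev j + p j)| < d. move=> cj; apply: le_lt_trans hd.
    rewrite /p addrA opprD addrCA subrr addr0 normrN.
    rewrite [leLHS]/Num.Def.normr/= mx_normrE (bigmax_le _ (normr_ge0 _))//= => -[a i] _ /=.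
    rewrite !mxE/= (ord1 a) eqxx/=. have [->|ij] := eqVneq i j; first by rewrite ltnn addr0 mulr1 (le_trans cj).
    by rewrite mulr0 add0r; case: ifP => // _; rewrite normr0. have -> : f (h + x) - (f x + L h) =
      \sum_(j < n) ((f (p j.+1) - f (p j)) - h 0 j * partial j f x).
    rewrite big_split/= sumrN opprD addrA; congr (_ - _).
    rewrite -(big_mkord xpredT (fun j => f (p j.+1) - f (p j))) telescope_sumr//. congr (f _ - f _); rewrite /p.
      by congr (_ + _); apply/rowP => i; rewrite mxE ltn_ord.
    by rewrite -[LHS]add0r; congr (_ + _); apply/rowP => i; rewrite !mxE.
  apply: (@le_trans _ _ (\sum_(j < n) (`|h| * (e / n.+1%:R)))).
    apply: le_trans (ler_norm_sum _ _ _) _; apply: ler_sum => j _. have [|c cj] := @line_MVT R _ f (p j) (ev j) (h 0 j).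
      move=> s sj; have [Us _] := Hd _ (pd j s sj). exact: (Ck_derivable Hf Us).
    rewrite -pS => ->; rewrite -mulrBr normrM ler_pM// distrC. by have [_] := Hd _ (pd j c cj); apply.
  rewrite sumr_const card_ord -[leLHS]mulr_natr -mulrA [leRHS]mulrC ler_wpM2l//.
  by rewrite mulrAC ler_pdivrMr// ler_pM2l// ler_nat.
have [dx dE] := differentiable_eps cL key.
by split => // v; rewrite dE.
Qed.
End C1_diff.

Lemma continuous_row (R : realType) (T : topologicalType) n (phi : T -> 'rV[R]_n) x :
  (forall j, {for x, continuous (fun y => phi y 0 j)}) -> {for x, continuous phi}.
Proof.
move=> H; apply/cvgrPdist_le => e e0.
pose P j y : Prop := `|phi x 0 j - phi y 0 j| <= e.
have : \forall y \near x, forall j, P j y. by apply: near_forall => j; move/cvgrPdist_le : (H j); apply.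
apply: filterS => y Hy.
rewrite [leLHS]/Num.Def.normr/= mx_normrE (bigmax_le _ (ltW e0))//= => -[a i] _ /=.
by rewrite !mxE (ord1 a); exact: Hy.
Qed.

Lemma differentiable_row (R : realType) (V : normedModType R) n (phi : V -> 'rV[R]_n) x :
  (forall j, differentiable (fun y => phi y 0 j : R) x) -> differentiable phi x.
Proof.
move=> H; pose L (v : V) : 'rV[R]_n := \row_j 'd (fun y => phi y 0 j : R) x v.
have Ll : linear L by move=> a u v; apply/rowP => j; rewrite !mxE linearP.
pose LM := GRing.isLinear.Build _ _ _ _ _ Ll.
pose LL : {linear V -> 'rV[R]_n} := HB.pack L LM.
have cL : continuous LL. move=> v; apply: continuous_row => j.
  rewrite (_ : (fun y => _) = 'd (fun y => phi y 0 j : R) x). by have /diff_locallyP[+ _] := H j; apply.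
  by apply/funext => w; rewrite mxE.
apply: (proj1 (@differentiable_eps _ _ _ phi LL x cL _)) => e e0.
pose P j (h : V) : Prop := `|phi (h + x) 0 j - (phi x 0 j + 'd (fun y => phi y 0 j : R) x h)| <= e * `|h|.
have : \forall h \near (0 : V), forall j, P j h. apply: near_forall => j; have /diff_locallyP[_ /eqaddoP] := H j.
  by move=> /(_ e e0).
apply: filterS => h Hh.
rewrite [leLHS]/Num.Def.normr/= mx_normrE (bigmax_le _)//=; first by rewrite mulr_ge0// ltW.
by move=> -[a i] _ /=; rewrite !mxE (ord1 a); exact: Hh.
Qed.

(** * Chain rule and closure properties of smooth functions *)

Section chain_rule.
Context (R : realType).

Lemma partial_comp m n (U : set 'rV[R]_m) (V : set 'rV[R]_n)
    (phi : 'rV[R]_m -> 'rV[R]_n) (f : 'rV[R]_n -> R) (x : 'rV[R]_m) i : open U -> open V -> U x -> V (phi x) ->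
  (forall j, Ck 1 U (fun y => phi y 0 j)) -> Ck 1 V f -> derivable (fun y => f (phi y)) x (delta_mx 0 i) /\
  partial i (fun y => f (phi y)) x = \sum_j partial j f (phi x) * partial i (fun y => phi y 0 j) x.
Proof.
move=> oU oV Ux Vx Hphi Hf.
have [df fE] := C1_diff oV Hf Vx.
have dphi : differentiable phi x. by apply: differentiable_row => j; have [] := C1_diff oU (Hphi j) Ux.
have dc : differentiable (f \o phi) x by exact: differentiable_comp.
split; first exact: diff_derivable.
rewrite /partial -[LHS]/('D__ (f \o phi) x) deriveE// diff_comp//= fE.
apply: eq_bigr => j _; rewrite mulrC; congr (_ * _).
rewrite -deriveE// derive_mx ?mxE//.
exact: diff_derivable.
Qed.

Lemma Ck_comp m n k (U : set 'rV[R]_m) (V : set 'rV[R]_n) (phi : 'rV[R]_m -> 'rV[R]_n) (f : 'rV[R]_n -> R) :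
  open U -> open V -> (forall x, U x -> V (phi x)) -> (forall j, Ck k U (fun y => phi y 0 j)) -> Ck k V f ->
  Ck k U (fun y => f (phi y)).
Proof.
move=> oU oV UV; elim: k phi f UV => [|k IH] phi f UV Hphi Hf. split => // x Ux; apply: (@continuous_comp _ _ _ phi f).
    by apply: continuous_row => j; exact: Ck_cont (Hphi j) Ux. exact: Ck_cont Hf (UV _ Ux).
have H1 x i : U x -> _ := fun Ux => partial_comp i oU oV Ux (UV _ Ux)
  (fun j => Ck_le (isT : (1 <= k.+1)%N) (Hphi j)) (Ck_le (isT : (1 <= k.+1)%N) Hf).
split. move=> x Ux; apply: (@continuous_comp _ _ _ phi f).
    by apply: continuous_row => j; exact: Ck_cont (Hphi j) Ux. exact: Ck_cont Hf (UV _ Ux).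
move=> i; split; first by move=> x Ux; have [] := H1 x i Ux.
apply: (@Ck_ext _ _ _ _ (fun x => \sum_j partial j f (phi x) * partial i (fun y => phi y 0 j) x)) => //.
  by move=> x; rewrite inE => Ux; have [_ ->] := H1 x i Ux.
apply: Ck_sum => // j _; apply: CkM => //. by apply: IH => // [l|]; [exact/Ck_pred/Hphi|exact: Ck_partial].
exact: Ck_partial.
Qed.

End chain_rule.

Section smooth_closure.
Context (R : realType) (n : nat).
Notation X := 'rV[R]_n.
Implicit Types (U : set X) (f g : X -> R).

Lemma smoothD U f g : open U -> smooth U f -> smooth U g -> smooth U (fun x => f x + g x).
Proof. by move=> oU Hf Hg k; exact: CkD. Qed.

Lemma smoothM U f g : open U -> smooth U f -> smooth U g -> smooth U (fun x => f x * g x).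
Proof. by move=> oU Hf Hg k; exact: CkM. Qed.

Lemma smoothN U f : open U -> smooth U f -> smooth U (fun x => - f x).
Proof. by move=> oU Hf k; exact: CkN. Qed.

Lemma smoothB U f g : open U -> smooth U f -> smooth U g -> smooth U (fun x => f x - g x).
Proof. by move=> oU Hf Hg k; exact: CkB. Qed.

Lemma smooth_cst U (c : R) : smooth U (fun=> c).
Proof. by move=> k; exact: Ck_cst. Qed.

Lemma smooth_coord U i : smooth U (fun x : X => x 0 i).
Proof. by move=> k; exact: Ck_coord. Qed.

Lemma smooth_ext U f g : open U -> {in U, f =1 g} -> smooth U f -> smooth U g.
Proof. by move=> oU fg Hf k; exact: Ck_ext (Hf k). Qed.

Lemma smooth_sub U V f : V `<=` U -> smooth U f -> smooth V f.
Proof. by move=> VU Hf k; exact: Ck_sub (Hf k). Qed.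

Lemma smooth_sum U (I : Type) (r : seq I) (P : pred I) (F : I -> X -> R) :
  open U -> (forall i, P i -> smooth U (F i)) -> smooth U (fun x => \sum_(i <- r | P i) F i x).
Proof. by move=> oU H k; apply: Ck_sum => // i /H. Qed.

Lemma smooth_prod U (I : Type) (r : seq I) (P : pred I) (F : I -> X -> R) :
  open U -> (forall i, P i -> smooth U (F i)) -> smooth U (fun x => \prod_(i <- r | P i) F i x).
Proof. by move=> oU H k; apply: Ck_prod => // i /H. Qed.

Lemma smooth_partial U f i : smooth U f -> smooth U (partial i f).
Proof. by move=> Hf k; exact: (Ck_partial i (Hf k.+1)). Qed.

Lemma smooth_local U f : (forall x, U x -> exists2 V : set X, V x & smooth V f) -> smooth U f.
Proof. by move=> H k; apply: Ck_local => x /H[V Vx Hf]; exists V. Qed.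

Lemma smooth_cont U f x : smooth U f -> U x -> {for x, continuous f}.
Proof. by move=> Hf; exact: Ck_cont (Hf 0%N). Qed.

Lemma smooth_der U f x i : smooth U f -> U x -> derivable f x (delta_mx 0 i).
Proof. by move=> Hf Ux; exact: Ck_derivable (Hf 1%N) Ux. Qed.

Lemma smooth_affine U (s : R) (y : X) f : open U -> smooth setT f -> smooth U (fun x => f (s *: (x - y))).
Proof.
move=> oU Hf k; apply: (@Ck_comp _ _ _ _ _ setT (fun x => s *: (x - y))) => //.
- exact: openT.
- move=> j; apply: (@Ck_ext _ _ _ _ (fun x : X => s * (x 0 j - y 0 j))) => //. by move=> x _; rewrite !mxE.
  by apply: CkZ => //; apply: CkB => //; [exact: Ck_coord|exact: Ck_cst].
Qed.

Lemma partial_affine (s : R) (y : X) f x i : smooth setT f ->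
  partial i (fun x => f (s *: (x - y))) x = s * partial i f (s *: (x - y)).
Proof.
move=> Hf.
have [|_ ->] := @partial_comp R n n setT setT (fun x => s *: (x - y)) f x i openT openT I I _ (Hf 1%N).
  move=> j; apply: (@Ck_ext _ _ _ _ (fun x : X => s * (x 0 j - y 0 j))) => //.
  - exact: openT.
  - by move=> z _; rewrite !mxE.
  - by apply: CkZ => //; [exact: openT|apply: CkB; [exact: openT|exact: Ck_coord|exact: Ck_cst]].
have E j : partial i (fun y0 : X => (s *: (y0 - y)) 0 j) x = s * (i == j)%:R.
  have := is_deriveZ s (is_deriveB (is_derive_coord i j x) (is_derive_cst (y 0 j) x _)).
  move=> [_ E1]; rewrite -[RHS]/(s *: (i == j)%:R) -[(i == j)%:R]subr0 -E1 /partial.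
  by congr ('D__ _ _); apply/funext => z; rewrite !mxE.
rewrite (bigD1 i)//= E eqxx mulr1 mulrC big1 ?addr0// => j ji.
by rewrite E eq_sym (negbTE ji) mulr0 mulr0.
Qed.

Lemma partial1_comp U f (g : R -> R) (dg : R) i x : open U -> Ck 1 U f -> U x -> is_derive (f x) (1 : R) g dg ->
  derivable (fun x => g (f x)) x (delta_mx 0 i) /\ partial i (fun x => g (f x)) x = dg * partial i f x.
Proof.
move=> oU Hf Ux [dD DE]; have [df fE] := C1_diff oU Hf Ux.
have dDf : differentiable g (f x) by exact/derivable1_diffP.
have dc : differentiable (g \o f) x by exact: differentiable_comp.
split; first exact: diff_derivable.
rewrite /partial -[LHS]/('D__ (g \o f) x) deriveE// diff_comp//= -[X in 'd _ _ X]deriveE//.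
by rewrite -[X in 'd _ _ X]mulr1 -[X in 'd _ _ X]/(_ *: (1 : R)) linearZ/= -deriveE// DE mulrC.
Qed.

(** The function of one variable is given as a sequence [D] of successive derivatives on [O]. This
    one form serves inverses, square roots, flat functions and cosines. *)
Lemma smooth1_comp U (O : set R) f (D : nat -> R -> R) j : open U -> (forall x, U x -> O (f x)) ->
  (forall k s, O s -> is_derive s (1 : R) (D k) (D k.+1 s)) -> smooth U f -> smooth U (fun x => D j (f x)).
Proof.
move=> oU UO HD Hf k; elim: k j => [|k IH] j. split => // x Ux; apply: (@continuous_comp _ _ _ f (D j)).
    exact: smooth_cont Hf Ux. by apply/differentiable_continuous/derivable1_diffP; have [] := HD j _ (UO _ Ux).
have H x i Ux := partial1_comp i oU (Hf 1%N) Ux (HD j _ (UO x Ux)).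
split. move=> x Ux; apply: (@continuous_comp _ _ _ f (D j)). exact: smooth_cont Hf Ux.
  by apply/differentiable_continuous/derivable1_diffP; have [] := HD j _ (UO _ Ux).
move=> i; split; first by move=> x Ux; have [] := H x i Ux.
apply: (@Ck_ext _ _ _ _ (fun x => D j.+1 (f x) * partial i f x)) => //.
  by move=> x; rewrite inE => Ux; have [_ ->] := H x i Ux.
by apply: CkM => //; exact: smooth_partial.
Qed.

Lemma smoothV U f : open U -> (forall x, U x -> f x != 0) -> smooth U f -> smooth U (fun x => (f x)^-1).
Proof.
move=> oU f0 Hf.
(* The k-th derivative of the inverse. *)
pose D k (s : R) := (-1) ^+ k * k`!%:R * s^-1 ^+ k.+1.
apply: (@smooth_ext _ (fun x => D 0%N (f x))) => //. by move=> x _; rewrite /D expr0 fact0 expr1 !mul1r.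
apply: (@smooth1_comp U [set s | s != 0]) => // k s /= s0.
have dV : is_derive s (1 : R) (fun s : R => s^-1) (- (s ^- 2) *: 1) by exact: is_deriveV.
have dX m : is_derive s (1 : R) (fun s : R => s^-1 ^+ m) (- (m%:R * s^-1 ^+ m.+1)). elim: m => [|m IH].
    rewrite mul0r oppr0; exact: is_derive_cst.
  have -> : (fun s : R => s^-1 ^+ m.+1) = (fun s : R => s^-1) * (fun s : R => s^-1 ^+ m).
    by apply/funext => z; rewrite exprS. apply: (is_derive_eq (is_deriveM dV IH)).
  rewrite -![_ *: _]/(_ * _) mulr1 -exprVn -natr1 !exprS; ring.
apply: (is_derive_eq (is_deriveZ ((-1) ^+ k * k`!%:R) (dX k.+1))).
rewrite /D -![_ *: _]/(_ * _) factS natrM !exprS; ring.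
Qed.

Lemma smooth_sqrt U f : open U -> (forall x, U x -> 0 < f x) -> smooth U f -> smooth U (fun x => Num.sqrt (f x)).
Proof.
move=> oU f0 Hf.
(* Falling factorial of 1/2, the coefficient of the k-th derivative of the square root. *)
pose c k : R := \prod_(i < k) (2^-1 - i%:R).
pose D k (s : R) := c k * s `^ (2^-1 - k%:R).
apply: (@smooth_ext _ (fun x => D 0%N (f x))) => //.
  move=> x; rewrite inE => Ux; rewrite /D /c big_ord0 mul1r subr0 powR12_sqrt//. exact/ltW/f0.
apply: (@smooth1_comp U [set s | 0 < s]) => // k s /= s0.
apply: (@is_derive_eq _ _ _ (D k) s 1 _ _ (is_deriveZ (c k) (is_derive1_powR (2^-1 - k%:R) s0))).
rewrite /D -![_ *: _]/(_ * _) /c big_ord_recr/= -mulrA; congr (_ * (_ * _ `^ _)).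
by rewrite -[k.+1%:R]natr1 opprD addrA.
Qed.

End smooth_closure.

(** * Flat functions, smooth steps and cutoffs *)

Section flat.
Context (R : realType).

(* The functions p(1/x) exp(-1/x) on x > 0, extended by 0; this family is stable
   under differentiation. *)
Definition flat (p : {poly R}) (x : R) : R := if 0 < x then p.[x^-1] * expR (- x^-1) else 0.

(** The exponential dominates every power of 1/x. A quadratic bound is what makes the derivative at
    0 exist and vanish. *)
Lemma flat_bound p : exists C, forall x, `|flat p x| <= C * x ^+ 2.
Proof.
have mon k (x : R) : 0 < x -> x^-1 ^+ k * expR (- x^-1) <= k.+2`!%:R * x ^+ 2. move=> x0.
  have := @expR_ge1Dxn R x^-1 k.+1. rewrite invr_ge0 (ltW x0) => /(_ isT) H.
  have : x^-1 ^+ k.+2 / k.+2`!%:R <= expR x^-1 by rewrite (le_trans _ H)// lerDr.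
  rewrite ler_pdivrMr ?ltr0n ?fact_gt0// mulrC => {}H.
  rewrite expRN ler_pdivrMr ?expR_gt0// mulrAC -ler_pdivrMr ?exprn_gt0//.
  by apply: le_trans H; rewrite -exprVn -exprD addn2.
exists (\sum_(i < size p) `|p`_i| * i.+2`!%:R) => x; rewrite /flat.
case: ifPn => [x0|_]; last by rewrite normr0 mulr_ge0 ?sqr_ge0// sumr_ge0// => i _; rewrite mulr_ge0.
rewrite normrM (ger0_norm (expR_ge0 _)) horner_coef.
apply: le_trans (ler_wpM2r (expR_ge0 _) (ler_norm_sum _ _ _)) _.
rewrite !mulr_suml ler_sum// => i _.
rewrite normrM -!mulrA ler_wpM2l// ger0_norm ?exprn_ge0 ?invr_ge0 ?(ltW x0)//.
exact: mon.
Qed.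

Lemma flat_derive p x : is_derive x (1 : R) (flat p) (flat ('X^2 * (p - p^`())) x).
Proof.
have [x0|x0|->] := ltgtP x 0.
- rewrite {2}/flat ltNge (ltW x0)/=. apply: near_eq_is_derive (is_derive_cst (0 : R) x 1).
  near=> y; have y0 : y < 0 by near: y; exact: lt_nbhsl. by rewrite /flat ltNge (ltW y0).
- rewrite {2}/flat x0.

  have xn0 : x != 0 by rewrite gt_eqF.
  have dV : is_derive x (1 : R) (fun s : R => s^-1) (- (x ^- 2) *: 1) by exact: is_deriveV.
  have dh : is_derive x^-1 (1 : R) (horner p) p^`().[x^-1].
    by apply: DeriveDef; [exact: derivable_horner|rewrite derivE derive1E].
  have d1 := @is_derive1_comp _ _ _ _ _ _ dh dV.
  have d2 := @is_derive1_comp _ expR _ _ _ _ (is_derive_expR _) (is_deriveN dV).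
  have H : is_derive x (1 : R) (fun y : R => p.[y^-1] * expR (- y^-1)) (('X^2 * (p - p^`())).[x^-1] * expR (- x^-1)).
    apply: (is_derive_eq (is_deriveM d1 d2)). rewrite !hornerE /= -![_ *: _]/(_ * _) mulr1 -exprVn; ring.
  apply: near_eq_is_derive H. near=> y; have y0 : 0 < y by near: y; exact: lt_nbhsr. by rewrite /flat y0.
- rewrite {2}/flat ltxx; have [C HC] := flat_bound p.
  have H : (fun h : R => h^-1 *: ((flat p) (h *: (1 : R) + 0) - flat p 0)) @ 0^' --> (0 : R).
    apply/cvgrPdist_le => e e0; near=> h.
    rewrite {2}/flat ltxx subr0 addr0 sub0r normrN -![_ *: _]/(_ * _) mulr1 normrM.
    have h0 : h != 0 by near: h; exact: nbhs_dnbhs_neq. apply: le_trans (ler_wpM2l (normr_ge0 _) (HC h)) _.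
    have -> : `|h^-1| * (C * h ^+ 2) = C * `|h|. by rewrite normfV -(real_normK (num_real h)); field; rewrite normr_eq0.
    have C0 : 0 < `|C| + 1 by rewrite ltr_wpDl. apply: (@le_trans _ _ ((`|C| + 1) * `|h|)).
      by rewrite ler_wpM2r// (le_trans (ler_norm _))// lerDl. rewrite mulrC -ler_pdivlMr//; near: h; apply: dnbhs0_le.
    by rewrite divr_gt0// ltr_wpDl. by apply: DeriveDef; [apply/cvg_ex; exists 0|apply: cvg_lim].
Unshelve. all: by end_near. Qed.

(** The k-th derivative of exp(-1/x) extended by 0: each differentiation replaces the polynomial p
    by X^2 (p - p'). *)
Definition flatD k : R -> R := flat (iter k (fun p => 'X^2 * (p - p^`())) 1).

Lemma flatD_derive k x : is_derive x (1 : R) (flatD k) (flatD k.+1 x).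
Proof. exact: flat_derive. Qed.

Lemma flatD0 x : flatD 0 x = if 0 < x then expR (- x^-1) else 0.
Proof. by rewrite /flatD /flat/= hornerC mul1r. Qed.

Lemma smooth_flat n (U : set 'rV[R]_n) (f : 'rV[R]_n -> R) : open U -> smooth U f -> smooth U (fun x => flatD 0 (f x)).
Proof.
by move=> oU; apply: (@smooth1_comp _ _ _ setT) => // k s _; exact: flatD_derive.
Qed.

(** Smooth transition from 0 on x <= 0 to 1 on x >= 1; the denominator is positive since x or 1 - x
    is. *)
Definition step (x : R) : R := flatD 0 x / (flatD 0 x + flatD 0 (1 - x)).

Lemma step_den x : 0 < flatD 0 x + flatD 0 (1 - x).
Proof.
rewrite !flatD0; case: (ltP 0 x) => x0; case: (ltP 0 (1 - x)) => x1.
- by rewrite addr_gt0// expR_gt0.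
- by rewrite addr0 expR_gt0.
- by rewrite add0r expR_gt0.
- by lra.
Qed.

Lemma step0 x : x <= 0 -> step x = 0.
Proof. by move=> x0; rewrite /step flatD0 ltNge x0 mul0r. Qed.

Lemma step1 x : 1 <= x -> step x = 1.
Proof.
move=> x1; have := step_den x; rewrite /step (flatD0 (1 - x)) ifF; last first. by apply/negbTE; rewrite -leNgt subr_le0.
by rewrite addr0 => x0; rewrite divff// gt_eqF.
Qed.

Lemma step_ge0 x : 0 <= step x.
Proof.
rewrite /step divr_ge0 ?(ltW (step_den _))//.
by rewrite flatD0; case: ifP => // _; rewrite expR_ge0.
Qed.

Lemma step_le1 x : step x <= 1.
Proof.
rewrite /step ler_pdivrMr ?step_den// mul1r lerDl.
by rewrite flatD0; case: ifP => // _; rewrite expR_ge0.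
Qed.

Lemma smooth_step n (U : set 'rV[R]_n) (f : 'rV[R]_n -> R) : open U -> smooth U f -> smooth U (fun x => step (f x)).
Proof.
move=> oU Hf; apply: smoothM => //; first exact: smooth_flat.
apply: smoothV => //; first by move=> x _; rewrite gt_eqF// step_den.
apply: smoothD => //; first exact: smooth_flat.
by apply: smooth_flat => //; apply: smoothB => //; exact: smooth_cst.
Qed.

End flat.

Lemma open_norm_gt (R : realType) (V : normedModType R) (y : V) (r : R) : open [set x : V | r < `|x - y|].
Proof.
have -> : [set x : V | r < `|x - y|] = (fun x : V => `|x - y|) @^-1` [set s | r < s] by [].
apply: open_comp; last exact: open_gt.
move=> x _; apply: (@continuous_comp _ _ _ (fun x : V => x - y) Num.Def.normr).
  by apply: cvgB; [exact: cvg_id|exact: cvg_cst].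
exact: norm_continuous.
Qed.

Section cutoff.
Context (R : realType) (n : nat).
Notation X := 'rV[R]_n.
Implicit Types (f g : X -> R) (y : X).

(* Vanishing on the open complement of the closed ball is stable under
   partial derivatives. *)
Definition supp_in (y0 : X) (r : R) (f : X -> R) : Prop := forall x, r < `|x - y0| -> f x = 0.

Lemma coord_le_norm (x : X) i : `|x 0 i| <= `|x|.
Proof.
by rewrite [leRHS]/Num.Def.normr/= mx_normrE; exact: (le_bigmax _ _ (0, i)).
Qed.

Lemma norm_row_le (x : X) (e : R) : 0 <= e -> (forall i, `|x 0 i| <= e) -> `|x| <= e.
Proof.
move=> e0 H; rewrite [leLHS]/Num.Def.normr/= mx_normrE (bigmax_le _)//= => -[a i] _.
by rewrite (ord1 a); exact: H.
Qed.

Lemma supp_in_partial y0 r f i : supp_in y0 r f -> supp_in y0 r (partial i f).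
Proof.
move=> Hf x xr; rewrite /partial (@near_eq_derive _ _ _ f (cst 0)) ?derive_cst//.
apply: (@near_open _ _ _ f (cst 0) x (open_norm_gt y0 r)) => //.
by move=> y; rewrite inE; exact: Hf.
Qed.

Lemma supp_inMr y0 r f g : supp_in y0 r g -> supp_in y0 r (fun x => f x * g x).
Proof. by move=> Hf x /Hf ->; rewrite mulr0. Qed.

Lemma compact_norm_le (y0 : X) (r : R) : compact [set x : X | `|x - y0| <= r].
Proof.
apply: bounded_closed_compact; last first. rewrite -[X in closed X]setCK; apply: open_closedC.
  rewrite (_ : ~` _ = [set x | r < `|x - y0|]); first exact: open_norm_gt.
  by apply/seteqP; split=> x /=; rewrite ltNge => /negP.
exists (r + `|y0|); split; first exact: num_real.
move=> M HM x /= xr; rewrite (le_trans _ (ltW HM))//.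
by rewrite -[X in `|X|](subrK y0) (le_trans (ler_normD _ _))// lerD2r.
Qed.

Lemma supp_bounded y0 r f : continuous f -> supp_in y0 r f -> exists2 C, 0 < C & forall x, `|f x| <= C.
Proof.
move=> cf Hf; have [r0|r0] := ltP r 0. by exists 1 => // x; rewrite Hf ?normr0// (lt_le_trans r0).
have : compact (f @` [set x : X | `|x - y0| <= r]). apply: continuous_compact; first exact: continuous_subspaceT.
  exact: compact_norm_le.
move=> /compact_bounded[M [_ HM]]; exists (`|M| + 1); first by rewrite ltr_wpDl.
have M1 : M < `|M| + 1 by rewrite (le_lt_trans (ler_norm _))// ltrDl.
move=> x; have [xr|xr] := ltP r `|x - y0|; first by rewrite Hf// normr0 addr_ge0.
by apply: (HM _ M1); exists x.
Qed.

(** A product over the coordinates, because balls of the maximum norm are cubes; the squares avoid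
    the absolute value and keep each factor smooth. *)
Definition cutoff (y0 : X) (r s : R) (x : X) : R := \prod_i step ((s ^+ 2 - (x 0 i - y0 0 i) ^+ 2) / (s ^+ 2 - r ^+ 2)).

Lemma smooth_cutoff (U : set X) y0 r s : open U -> smooth U (cutoff y0 r s).
Proof.
move=> oU; apply: smooth_prod => // i _; apply: smooth_step => //.
apply: smoothM => //; last exact: smooth_cst.
apply: smoothB => //; first exact: smooth_cst.
by apply: smoothM => //; apply: smoothB => //;
  [exact: smooth_coord|exact: smooth_cst|exact: smooth_coord|exact: smooth_cst].
Qed.

Lemma cutoff1 y0 r s x : 0 <= r -> r < s -> `|x - y0| <= r -> cutoff y0 r s x = 1.
Proof.
move=> r0 rs xr; rewrite /cutoff big1// => i _; apply: step1.
have rs2 : r ^+ 2 < s ^+ 2 by rewrite ltr_pXn2r// nnegrE ltW// (le_lt_trans r0).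
rewrite ler_pdivlMr ?subr_gt0// mul1r lerD2l lerN2.
rewrite -[leLHS]real_normK ?num_real// ler_pXn2r// ?nnegrE//.
by apply: le_trans xr; have := coord_le_norm (x - y0) i; rewrite !mxE.
Qed.

Lemma cutoff_supp y0 r s : 0 <= r -> r < s -> supp_in y0 s (cutoff y0 r s).
Proof.
move=> r0 rs x; have s0 := le_lt_trans r0 rs; rewrite ltNge => xs.
have [i Hi] : exists i, s < `|x 0 i - y0 0 i|. apply/existsP; apply: contraNT xs; rewrite negb_exists => /forallP H.
  apply: norm_row_le => [|i]; first exact: ltW. by have := H i; rewrite -leNgt !mxE.
rewrite /cutoff (bigD1 i)//= step0 ?mul0r// pmulr_lle0.
  rewrite subr_le0 -[leRHS]real_normK ?num_real// ler_pXn2r// ?nnegrE//; exact: ltW.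
by rewrite invr_gt0 subr_gt0 ltr_pXn2r// nnegrE// ltW.
Qed.

Lemma cutoff_ge0 y0 r s x : 0 <= cutoff y0 r s x.
Proof.
by rewrite prodr_ge0// => i _; exact: step_ge0.
Qed.

(** The segment is taken for both signs of [s] because [line_MVT] locates its intermediate point
    only by absolute value. *)
Lemma C1_lipschitz (U : set X) f (M : R) (x y : X) : open U -> Ck 1 U f ->
  (forall s : R, `|s| <= 1 -> U (s *: (x - y) + y)) ->
  (forall i z, U z -> `|partial i f z| <= M) -> `|f x - f y| <= n%:R * M * `|x - y|.
Proof.
move=> oU Hf Uxy HM.
have [|c c1] := @line_MVT R _ f y (x - y) 1. move=> s s1; rewrite normr1 in s1; apply: diff_derivable.
  by have [] := C1_diff oU Hf (Uxy s s1).
rewrite normr1 in c1; rewrite scale1r subrK mul1r => ->.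
have [df dE] := C1_diff oU Hf (Uxy c c1).
rewrite deriveE// dE (le_trans (ler_norm_sum _ _ _))//.
apply: (@le_trans _ _ (\sum_(i < n) M * `|x - y|)).
  by apply: ler_sum => i _; rewrite normrM mulrC ler_pM ?coord_le_norm// HM//; exact: Uxy.
by rewrite sumr_const card_ord -[X in X <= _]mulr_natl mulrA.
Qed.

Lemma supp_lipschitz y0 r f : smooth setT f -> supp_in y0 r f ->
  exists2 C, 0 < C & forall x y, `|f x - f y| <= C * `|x - y|.
Proof.
move=> sf Hf.
have H i : exists2 C, 0 < C & forall x, `|partial i f x| <= C. apply: (@supp_bounded y0 r); last exact: supp_in_partial.
  by move=> x; apply: (smooth_cont (smooth_partial i sf)).
have [C HC] := choice (fun i => let: ex_intro2 c c0 cP := H i in ex_intro _ c (conj c0 cP)).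
have S0 : 0 <= \sum_i C i by rewrite sumr_ge0// => i _; have [/ltW] := HC i.
exists (n%:R * (\sum_i C i) + 1); first by rewrite ltr_wpDl// mulr_ge0.
move=> x y; apply: (@le_trans _ _ (n%:R * (\sum_i C i) * `|x - y|)).
  apply: (@C1_lipschitz setT) => //; [exact: openT|move=> i z _]. have [_ /(_ z) h] := HC i; apply: le_trans h _.
  by rewrite (bigD1 i)//= lerDl sumr_ge0// => j _; have [/ltW] := HC j.
by rewrite ler_wpM2r// lerDl.
Qed.

End cutoff.

(** * Integration on R^n *)
Section tuples.
Context (R : realType).

Definition tupr n (x : 'rV[R]_n) : n.-tuple R := [tuple x 0 i | i < n].

Lemma tuprK n : cancel (@tupr n) (@rowt R n).
Proof. by move=> x; apply/rowP => i; rewrite mxE tnth_mktuple. Qed.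

Lemma rowt_cons n (a : R) (t : n.-tuple R) : rowt (tuple_cons ((a : measurableTypeR R), t)) 0 ord0 = a /\
  forall j, rowt (tuple_cons ((a : measurableTypeR R), t)) 0 (lift ord0 j) = rowt t 0 j.
Proof. by split=> [|j]; rewrite !mxE// tnthS. Qed.

Lemma mcoord n i : mfunT (fun t : n.-tuple R => rowt t 0 i).
Proof.
under eq_fun do rewrite mxE.
exact: measurable_tnth.
Qed.

(** An open set is the countable union of the rational boxes that it contains, and a box is
    measurable coordinate by coordinate. *)
Lemma mrowt_open n (O : set 'rV[R]_n) : open O -> measurable [set t : n.-tuple R | O (rowt t)].
Proof.
move=> oO.
pose B (q : n.-tuple rat * rat) := [set t : n.-tuple R | forall i, `|rowt t 0 i - ratr (tnth q.1 i)| < ratr q.2].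
pose G q := if pselect (B q `<=` [set t | O (rowt t)]) then B q else set0.
have mB q : measurable (B q). rewrite (_ : B q = \bigcap_(i in [set: 'I_n])
    ((fun t => rowt t 0 i) @^-1` ball (ratr (tnth q.1 i) : R) (ratr q.2))); last first. apply/seteqP; split => t /= H.
      by move=> i _; rewrite -ball_normE/= distrC; exact: H.
    by move=> i; have := H i I; rewrite /= -ball_normE/= distrC. apply: fin_bigcap_measurable => // i _.
  by rewrite -[X in measurable X]setTI; apply: mcoord => //; exact: measurable_ball.
rewrite (_ : [set _ | _] = \bigcup_q G q). apply: countable_bigcupT_measurable => // q.
  by rewrite /G; case: pselect => /= H; [exact: mB|exact: measurable0].
apply/seteqP; split => [t /= Ot|t [q _]]; last first. by rewrite /G; case: pselect => // H /H.
have /nbhs_ballP[e /= e0 He] : nbhs (rowt t) O by exact: open_nbhs_nbhs.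
(* Two points of a box of radius [r] are within 2r of each other, hence the bound e/2. *)
have [r] := @rat_in_itvoo R 0 (e / 2) (divr_gt0 e0 (ltr0Sn _ _)).
rewrite in_itv/= => /andP[r0 re].
have /choice[q Hq] : forall i, exists q : rat, `|rowt t 0 i - ratr q| < ratr r.
  move=> i; have [|q] := @rat_in_itvoo R (rowt t 0 i - ratr r) (rowt t 0 i + ratr r). by rewrite ltrD2l; lra.
  by rewrite in_itv/= => /andP[q1 q2]; exists q; rewrite ltr_norml; apply/andP; split; lra.
exists ([tuple q i | i < n], r) => //; rewrite /G; case: pselect => [_ i|]. by rewrite tnth_mktuple.
move=> nB; exfalso; apply: nB => s Hs /=; apply: He; rewrite -ball_normE/=.
have : `|rowt t - rowt s| <= ratr r + ratr r. apply: norm_row_le => [|i]; first by lra.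
  rewrite [X in `|X|]mxE [X in _ + X]mxE. have := Hq i; have := Hs i; rewrite tnth_mktuple.
  move=> /ltW h1 /ltW h2; rewrite -(subrKA (ratr (q i))) (le_trans (ler_normD _ _))//. by rewrite lerD// distrC.
by move=> /le_lt_trans; apply; lra.
Qed.

Lemma mrowt_cont n (f : 'rV[R]_n -> R) : continuous f ->
  mfunT (fun t : n.-tuple R => f (rowt t)).
Proof.
move=> cf; apply: (measurability _ (RGenOpens.measurableE R)) => //.
move=> _ [_ [a [b ->]] <-]; rewrite setTI.
have := @mrowt_open n (f @^-1` `]a, b[%classic).
apply; apply: open_comp => // x _; exact: cf.
Qed.

End tuples.

Section leb_tools.
Context (R : realType).
Notation mu := (@lebesgue_measure R).
Local Open Scope ereal_scope.

Lemma ge0_integral_leb_cons n (f : n.+1.-tuple R -> \bar R) : mfunT f -> (forall t, 0 <= f t) ->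
  \int[leb R n.+1]_t f t = \int[mu]_a \int[leb R n]_t f (tuple_cons ((a : measurableTypeR R), t)).
Proof.
move=> mf f0.
have := @ge0_integral_pushforward _ _ _ _ R _ (@measurable_tuple_cons R n) (mu \x leb R n) setT f measurableT mf (fun t _ => f0 t).
rewrite preimage_setT fubini_tonelli1; last 2 first.
- by apply: mcompT => //; exact: measurable_tuple_cons.
- by move=> x; exact: f0.
by move=> <-.
Qed.

Lemma integrable_leb_cons n (f : n.+1.-tuple R -> \bar R) : (leb R n.+1).-integrable setT f ->
  (mu \x leb R n).-integrable setT (f \o @tuple_cons R n).
Proof.
move=> /integrableP[mf fi]; apply/integrableP; split. by apply: mcompT => //; exact: measurable_tuple_cons.
have := @ge0_integral_leb_cons n (abse \o f).
rewrite /= => E; move: fi; rewrite E//; last exact: mcompT.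
rewrite fubini_tonelli1//.
by do 2!apply: mcompT => //; exact: measurable_tuple_cons.
Qed.

Lemma integral_leb_cons n (f : n.+1.-tuple R -> \bar R) : (leb R n.+1).-integrable setT f -> \int[leb R n.+1]_t f t =
  \int[mu]_a \int[leb R n]_t f (tuple_cons ((a : measurableTypeR R), t)).
Proof.
move=> fi.
have fc := integrable_leb_cons fi; have /integrableP[mf _] := fi.
have := @integral_pushforward _ _ _ _ R _ (@measurable_tuple_cons R n) (mu \x leb R n) setT f mf.
rewrite preimage_setT -integral12_prod_meas1// => <-//.
Qed.

Lemma integral_leb_prod n (q : 'I_n -> R -> R) :
  (forall i, mfunT (q i)) -> (forall i x, (0 <= q i x)%R) ->
  \int[leb R n]_t (\prod_(i < n) q i (rowt t 0 i))%:E = \prod_(i < n) \int[mu]_x (q i x)%:E.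
Proof.
elim: n q => [|n IH] q mq q0. under eq_integral do rewrite big_ord0. by rewrite big_ord0 integral_cst// mul1e /= diracT.
rewrite ge0_integral_leb_cons; last 2 first.
- apply/mEFinP; apply: measurable_prod => i _. by apply: (mcompT (mq i)); exact: mcoord.
- by move=> t; rewrite lee_fin prodr_ge0.
rewrite big_ord_recl -[X in _ * X](IH (fun i => q (lift ord0 i)))//.
rewrite -ge0_integralZr//; last 3 first.
- by apply/mEFinP; exact: mq.
- by move=> x _; rewrite lee_fin.
- by apply: integral_ge0 => t _; rewrite lee_fin prodr_ge0.
apply: eq_integral => a _; rewrite -ge0_integralZl//; last 3 first.
- apply/mEFinP; apply: measurable_prod => i _. by apply: (mcompT (mq _)); exact: mcoord.
- by move=> t _; rewrite lee_fin prodr_ge0.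
- by rewrite lee_fin.
apply: eq_integral => t _; rewrite big_ord_recl -EFinM.
have [-> H] := rowt_cons a t; congr (_ * _)%:E.
by apply: eq_bigr => i _; rewrite H.
Qed.

Lemma leb_closed_ball n (x : 'rV[R]_n) (r : R) : (0 <= r)%R ->
  leb R n [set t | (`|x - rowt t| <= r)%R] = ((2 * r) ^+ n)%:E.
Proof.
move=> r0.
have -> : [set t | (`|x - rowt t| <= r)%R] = [set t | forall i, `[x ord0 i - r, x ord0 i + r]%classic (tnth t i)]%R.
  apply/seteqP; split => t /= H. move=> i; rewrite in_itv/=; have := le_trans (coord_le_norm (x - rowt t) i) H.
    by rewrite !mxE ler_norml => /andP[h1 h2]; apply/andP; split; lra.
  apply: norm_row_le => // i; have := H i; rewrite in_itv/= !mxE ler_norml => /andP[h1 h2]. by apply/andP; split; lra.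
rewrite (@leb_box R n (fun i => `[x ord0 i - r, x ord0 i + r]%classic)%R)// (eq_bigr (fun=> (2 * r)%:E)); last first.
  move=> i _; rewrite lebesgue_measure_itv/= lte_fin.
  have [->|r1] := eqVneq r 0%R; first by rewrite subr0 addr0 ltxx mulr0.
  have r2 : (0 < r)%R by rewrite lt_neqAle eq_sym r1. rewrite ifT; last by lra. by rewrite -EFinD; congr EFin; lra.
by rewrite -(big_morph EFin (@EFinM R) erefl) prodr_const card_ord.
Qed.

End leb_tools.

(** * Integration by parts for compactly supported functions *)

Section supported.
Context (R : realType).
Notation mu := (@lebesgue_measure R).

Lemma ball_ltoo n (x : 'rV[R]_n) (r : R) : (leb R n [set t | (`|rowt t - x| <= r)%R] < +oo)%E.
Proof.
have [r0|r0] := leP 0 r. rewrite (_ : [set t | _] = [set t | `|x - rowt t| <= r]). by rewrite leb_closed_ball// ltry.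
  by apply/seteqP; split => t /=; rewrite distrC.
rewrite (_ : [set t | _] = set0) ?measure0 ?ltry//.
apply/seteqP; split => // t /= H.
by have := le_trans (normr_ge0 _) H; rewrite leNgt r0.
Qed.

Lemma mnorm_le n (x : 'rV[R]_n) (r : R) : measurable [set t : n.-tuple R | (`|rowt t - x| <= r)%R].
Proof.
rewrite -[X in measurable X]setCK; apply: measurableC.
rewrite (_ : ~` _ = [set t | [set z | r < `|z - x|] (rowt t)]).
  by apply: (mrowt_open (O := [set z | r < `|z - x|])); exact: open_norm_gt.
by apply/seteqP; split => t /=; rewrite ltNge => /negP.
Qed.

Lemma intg_supp n (y : 'rV[R]_n) (r C : R) (f : n.-tuple R -> R) :
  mfunT f -> (forall t, `|f t| <= C) -> (forall t, r < `|rowt t - y| -> f t = 0) ->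
  (leb R n).-integrable setT (EFin \o f).
Proof.
move=> mf fC f0; pose A := [set t : n.-tuple R | `|rowt t - y| <= r].
have -> : EFin \o f = (EFin \o f) \_ A. apply/funext => t; rewrite patchE; case: ifPn => //.
  by rewrite notin_setE /A /= => /negP; rewrite -ltNge => /f0 ->.
have mA : measurable A by exact: mnorm_le.
apply/(integrable_mkcond _ mA).
apply: measurable_bounded_integrable => //.
- exact: ball_ltoo.
- exact: measurable_funTS.
- by exists C; split; [exact: num_real|move=> M CM t _ /=; rewrite (le_trans (fC t))// ltW].
Qed.

Lemma intg_ccont n (y : 'rV[R]_n) (r : R) (f : 'rV[R]_n -> R) : continuous f -> supp_in y r f ->
  (leb R n).-integrable setT (fun t => (f (rowt t))%:E).
Proof.
move=> cf sf; have [C _ HC] := supp_bounded cf sf.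
apply: (@intg_supp n y r C (fun t => f (rowt t))) => //. exact: mrowt_cont.
by move=> t; exact: sf.
Qed.

Lemma FTC_supp (f F : R -> R) (r : R) : continuous f ->
  (forall x, is_derive x (1 : R) F (f x)) -> (forall x, r < `|x| -> F x = 0) -> (\int[mu]_x (f x)%:E = 0)%E.
Proof.
(* [s] exceeds [r] and is positive even for negative [r]: the interval is proper and [F] vanishes at
   both ends. *)
move=> cf dF F0; pose s := `|r| + 1.
have s0 : 0 < s by rewrite ltr_wpDl.
have rs : r < s by rewrite (le_lt_trans (ler_norm r))// ltrDl.
have f0 x : s < `|x| -> f x = 0. move=> sx; have [_ <-] := dF x.
  rewrite (@near_eq_derive _ _ _ F (cst 0)) ?derive_cst//. have : nbhs x [set y : R | s < `|y - 0|].
    by apply: open_nbhs_nbhs; split; [exact: open_norm_gt|rewrite /= subr0].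
  by apply: filterS => y /=; rewrite subr0 => /(lt_trans rs)/F0.
have -> : (\int[mu]_x (f x)%:E = \int[mu]_(x in `[(- s)%R, s]) (f x)%:E)%E.
  rewrite [RHS]integral_mkcond; apply: eq_integral => x _; rewrite patchE.
  case: ifPn => //; rewrite notin_setE/= in_itv/= => /negP. by rewrite -ler_norml -ltNge => /f0 ->.
rewrite (@continuous_FTC2 _ f F).
- by rewrite !F0 ?subee// ?normrN ger0_norm// ltW.
- by rewrite gtrN.
- exact: continuous_subspaceT.
- have dd x : derivable F x 1 by have [] := dF x.
  have cF : continuous F by move=> x; apply/differentiable_continuous/derivable1_diffP. split; first by move=> x _.
    by apply: cvg_at_right_filter; exact: cF. by apply: cvg_at_left_filter; exact: cF.
- by move=> x _; rewrite derive1E; have [_] := dF x.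
Qed.

(** Row-vector counterpart of [tuple_cons]; it isolates the coordinate on which one-dimensional
    calculus is done. *)
Definition mxcons n (a : R) (x : 'rV[R]_n) : 'rV[R]_n.+1 := \row_k (if unlift ord0 k is Some j then x 0 j else a).

Lemma mxcons0 n a (x : 'rV[R]_n) : mxcons a x 0 ord0 = a.
Proof. by rewrite mxE unlift_none. Qed.

Lemma mxconsS n a (x : 'rV[R]_n) j : mxcons a x 0 (lift ord0 j) = x 0 j.
Proof. by rewrite mxE liftK. Qed.

Lemma rowt_mxcons n a (t : n.-tuple R) : rowt (tuple_cons ((a : measurableTypeR R), t)) = mxcons a (rowt t).
Proof.
have [H0 HS] := rowt_cons a t; apply/rowP => k; rewrite [RHS]mxE.
by case: unliftP => [j|] -> //; rewrite HS.
Qed.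

Lemma mxcons_lineS n h a (x : 'rV[R]_n) j :
  mxcons a (h *: delta_mx 0 j + x) = h *: delta_mx 0 (lift ord0 j) + mxcons a x.
Proof.
apply/rowP => k; rewrite !mxE; case: unliftP => [l|] -> /=; last by rewrite mulr0 add0r.
by rewrite !mxE/= (inj_eq lift_inj).
Qed.

Lemma mxcons_line0 n h a (x : 'rV[R]_n) : mxcons (h + a) x = h *: delta_mx 0 ord0 + mxcons a x.
Proof.
apply/rowP => k; rewrite !mxE; case: unliftP => [l|] -> /=; last by rewrite mulr1.
by rewrite mulr0 add0r.
Qed.

Lemma ord_liftP n (k : 'I_n.+1) : k = ord0 \/ exists j, k = lift ord0 j.
Proof. by case: (unliftP ord0 k) => [j|] ->; [right; exists j|left]. Qed.

Lemma continuous_mxcons1 n (x : 'rV[R]_n) : continuous (fun a => mxcons a x).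
Proof.
move=> a; apply: continuous_row => k; have [->|[l ->]] := ord_liftP k.
  rewrite (_ : (fun y => _) = id); first exact: cvg_id. by apply/funext => b; rewrite mxcons0.
rewrite (_ : (fun y => _) = cst (x 0 l)); first exact: cst_continuous.
by apply/funext => b; rewrite mxconsS.
Qed.

Lemma continuous_mxcons2 n (a : R) : continuous (@mxcons n a).
Proof.
move=> x; apply: continuous_row => k; have [->|[l ->]] := ord_liftP k.
  rewrite (_ : (fun y => _) = cst a); first exact: cst_continuous. by apply/funext => b; rewrite mxcons0.
rewrite (_ : (fun y => _) = (fun y : 'rV[R]_n => y 0 l)); first exact: coord_continuous.
by apply/funext => b; rewrite mxconsS.
Qed.

Lemma partial_mxcons n (f : 'rV[R]_n.+1 -> R) a (x : 'rV[R]_n) l :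
  derivable f (mxcons a x) (delta_mx 0 (lift ord0 l)) -> derivable (fun x => f (mxcons a x)) x (delta_mx 0 l) /\
  partial l (fun x => f (mxcons a x)) x = partial (lift ord0 l) f (mxcons a x).
Proof.
have EE : (fun h : R => h^-1 *: (((fun x => f (mxcons a x)) \o shift x) (h *: delta_mx 0 l) - f (mxcons a x))) =
     (fun h : R => h^-1 *: ((f \o shift (mxcons a x)) (h *: delta_mx 0 (lift ord0 l)) - f (mxcons a x))).
  by apply/funext => h; rewrite /= mxcons_lineS.
by rewrite /derivable /partial /derive EE.
Qed.

Lemma Ck_mxcons n k (f : 'rV[R]_n.+1 -> R) a : Ck k setT f -> Ck k setT (fun x : 'rV[R]_n => f (mxcons a x)).
Proof.
elim: k f => [|k IH] f Hf.
  split => // x _; apply: (@continuous_comp _ _ _ (mxcons a) f); first exact: continuous_mxcons2.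
  exact: Ck_cont Hf I.
split. move=> x _; apply: (@continuous_comp _ _ _ (mxcons a) f); first exact: continuous_mxcons2.
  exact: Ck_cont Hf I.
move=> l; have H x := partial_mxcons (@Ck_derivable _ _ _ _ _ (mxcons a x) (lift ord0 l) Hf I).
split; first by move=> x _; have [] := H x.
rewrite (_ : partial l _ = fun x => partial (lift ord0 l) f (mxcons a x)). by apply: IH; exact: Ck_partial.
by apply/funext => x; have [] := H x.
Qed.

Lemma is_derive_mxcons0 n (f : 'rV[R]_n.+1 -> R) (x : 'rV[R]_n) a : Ck 1 setT f ->
  is_derive a (1 : R) (fun a => f (mxcons a x)) (partial ord0 f (mxcons a x)).
Proof.
move=> Hf; have := @is_derive_line _ _ f (mxcons 0 x) (delta_mx 0 ord0) a.
have EE b : b *: delta_mx 0 ord0 + mxcons 0 x = mxcons b x by rewrite -mxcons_line0 addr0.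
rewrite (_ : (fun s : R => _) = fun a => f (mxcons a x)) ?EE. by apply; exact: Ck_derivable Hf I.
by apply/funext => b; rewrite EE.
Qed.

Lemma supp_in_mxcons0 n y r (f : 'rV[R]_n.+1 -> R) (x : 'rV[R]_n) a : supp_in y r f ->
  r + `|y 0 ord0| < `|a| -> f (mxcons a x) = 0.
Proof.
move=> sf ha; apply: sf; apply: lt_le_trans (coord_le_norm _ ord0).
rewrite !mxE unlift_none; have := lerB_dist a (y 0 ord0); lra.
Qed.

Lemma supp_in_mxconsS n y r (f : 'rV[R]_n.+1 -> R) a : supp_in y r f ->
  supp_in (\row_l y 0 (lift ord0 l)) r (fun x : 'rV[R]_n => f (mxcons a x)).
Proof.
move=> sf x hx; apply: sf; apply: lt_le_trans hx _; apply: norm_row_le => // l.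
by have := coord_le_norm (mxcons a x - y) (lift ord0 l); rewrite !mxE liftK.
Qed.

(** For the first coordinate, Fubini puts the one-dimensional integral inside, where the fundamental
    theorem makes it 0. Any other coordinate is a coordinate of the slices, to which the induction
    applies. *)
Lemma integral_partial n (y : 'rV[R]_n) (r : R) (f : 'rV[R]_n -> R) (i : 'I_n) : Ck 1 setT f -> supp_in y r f ->
  (\int[leb R n]_t (partial i f (rowt t))%:E = 0)%E.
Proof.
elim: n y f i => [|n IH] y f; first by case.
move=> i Hf sf.
have cp j : continuous (partial j f). by move=> x; apply: (Ck_cont (Ck_partial j Hf)).
have fi : (leb R n.+1).-integrable setT (fun t => (partial i f (rowt t))%:E).
  by apply: (@intg_ccont _ y r) => //; exact: supp_in_partial.
rewrite integral_leb_cons//; have [iE|[j ->]] := ord_liftP i.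
- have E : (forall x, \int[mu]_a (partial ord0 f (mxcons a x))%:E = 0)%E.
    move=> x; apply: (@FTC_supp _ (fun a => f (mxcons a x)) (r + `|y 0 ord0|)).
    + move=> a; apply: (@continuous_comp _ _ _ (fun a => mxcons a x) (partial ord0 f)). exact: continuous_mxcons1.
      exact: cp.
    + by move=> a; exact: is_derive_mxcons0.
    + by move=> a; exact: supp_in_mxcons0 sf. have := Fubini (integrable_leb_cons fi); rewrite /= => ->.
  rewrite -[RHS](integral0 (leb R n) setT); apply: eq_integral => t _.
  by rewrite -[RHS](E (rowt t)) iE; apply: eq_integral => a _; rewrite rowt_mxcons.
- rewrite -[RHS](integral0 mu setT); apply: eq_integral => a _. under eq_integral do rewrite rowt_mxcons.
  rewrite -[RHS](IH _ _ j (Ck_mxcons a Hf) (supp_in_mxconsS a sf)). apply: eq_integral => t _; congr EFin; apply/esym.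
  by have [] := partial_mxcons (@Ck_derivable _ _ _ _ _ (mxcons a (rowt t)) (lift ord0 j) Hf I).
Qed.

End supported.

(** * Measures with a density; the du Bois-Reymond lemma *)

Section density_measure.
Context d (T : measurableType d) (R : realType) (mu : {measure set T -> \bar R}).
Variable f : T -> \bar R.
Hypothesis mf : mfunT f.
Hypothesis f0 : forall x, (0 <= f x)%E.

(** The proofs of measurability and sign are arguments, so that a measure structure can be attached
    to [density_measure mf f0]. *)
Definition density_measure (_ : mfunT f) (_ : forall x, (0 <= f x)%E) :
  set T -> \bar R := fun A => (\int[mu]_(x in A) f x)%E.

Notation nu := (density_measure mf f0).

Let nu0 : nu set0 = 0%E. Proof. exact: integral_set0. Qed.

Let nu_ge0 A : (0 <= nu A)%E. Proof. exact: integral_ge0. Qed.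

Let nu_sigma_additive : semi_sigma_additive nu.
Proof. exact: semi_sigma_additive_nng_induced. Qed.

HB.instance Definition _ := isMeasure.Build _ _ _ nu nu0 nu_ge0 nu_sigma_additive.

End density_measure.

Section du_bois_reymond.
Context (R : realType) (n : nat).
Notation T := (n.-tuple R).
Notation X := 'rV[R]_n.

Definition box (a b : 'I_n -> R) : set T := [set t | forall i, a i < tnth t i < b i].

Definition boxes : set (set T) := [set A | exists a b, A = box a b].

Lemma boxesI : setI_closed boxes.
Proof.
move=> _ _ [a [b ->]] [c [e ->]].
exists (fun i => Num.max (a i) (c i)), (fun i => Num.min (b i) (e i)).
apply/seteqP; split => t /=.
  by move=> [H1 H2] i; rewrite gt_max lt_min; have /andP[-> ->] := H1 i; have /andP[-> ->] := H2 i.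
move=> H; split=> i; have := H i; rewrite /= gt_max lt_min. by move=> /andP[/andP[-> _] /andP[-> _]].
by move=> /andP[/andP[_ ->] /andP[_ ->]].
Qed.

Lemma measurable_box a b : measurable (box a b).
Proof.
rewrite (_ : box a b = \bigcap_(i in [set: 'I_n]) ((fun t : T => tnth t i) @^-1` `]a i, b i[%classic)).
  apply: fin_bigcap_measurable => // i _.
  by rewrite -[X in measurable X]setTI; apply: measurable_tnth => //; exact: measurable_itv.
apply/seteqP; split => t /= H; first by move=> i _ /=; rewrite in_itv/=; exact: H.
by move=> i; have := H i I; rewrite /= in_itv.
Qed.

Lemma boxes_generate : @measurable _ T = <<s boxes >>.
Proof.
apply/seteqP; split; last first. apply: smallest_sub; first exact: sigma_algebra_measurable.
  by move=> _ [a [b ->]]; exact: measurable_box.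
apply: smallest_sub; first exact: smallest_sigma_algebra.
have H (i : 'I_n) : measurable_fun (setT : set (g_sigma_algebraType boxes))
    (fun t : g_sigma_algebraType boxes => tnth (t : T) i : R).
  apply: (measurability _ (RGenOpens.measurableE R)) => _ [_ [u [v ->]] <-]. rewrite setTI.
  (* A strip in one coordinate is the union over k of the boxes bounded by k in the other
     coordinates. *)
  rewrite (_ : _ @^-1` _ = \bigcup_k (box (fun j => if j == i then u else - k%:R)
      (fun j => if j == i then v else k%:R) : set (g_sigma_algebraType boxes))).
    apply: bigcup_measurable => k _; apply: sub_gen_smallest. by do 2!eexists.
  apply/seteqP; split => [t|t [k _]] /=; last first. by move=> /(_ i); rewrite eqxx in_itv.
  rewrite in_itv/= => /andP[ut tv]. have [k Hk] : exists k : nat, forall j, `|tnth (t : T) j| < k%:R.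
    exists (Num.bound (\sum_j `|tnth (t : T) j|)) => j. apply: le_lt_trans (archi_boundP _); last by apply: sumr_ge0.
    by rewrite (bigD1 j)//= lerDl sumr_ge0. exists k => // j; have := Hk j; rewrite ltr_norml => /andP[h1 h2].
  by case: eqP => [->|_]; rewrite ?ut ?tv// h1 h2.
apply: (big_ind (fun B => B `<=` <<s boxes >>)) => //. by move=> A B HA HB x [/HA|/HB].
move=> i _ A [B mB <-]; exact: (H i measurableT _ mB).
Qed.

(* On open boxes the indicator function is a limit of smooth functions with
   compact support; open boxes form a generating pi-system. *)
Lemma du_bois_reymond (y : X) (r : R) (f : T -> R) : 0 < r -> (leb R n).-integrable setT (EFin \o f) ->
  (forall phi s, s < r -> smooth setT phi -> supp_in y s phi -> (\int[leb R n]_t (f t * phi (rowt t))%:E = 0)%E) ->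
  {ae leb R n, forall t, `|rowt t - y| < r -> f t = 0}.
Proof.
move=> r0 fi Hf.
pose B := box (fun i => y 0 i - r) (fun i => y 0 i + r).
have mB : measurable B by exact: measurable_box.
have boxB a b : (forall i, y 0 i - r <= a i) -> (forall i, b i <= y 0 i + r) ->
    (\int[leb R n]_(t in box a b) (f t)%:E = 0)%E. move=> Ha Hb. pose d k : R := r / k.+2%:R.
  (* The shift by 2 in the denominator keeps [d k] strictly below [r], so r - d k is a legitimate
     radius for the support of [ph k]. *)
  have d0 k : 0 < d k by rewrite divr_gt0. have dr k : d k < r by rewrite /d ltr_pdivrMr// ltr_pMr// ltr1n.
  have d_0 : d k @[k --> \oo] --> 0. rewrite -(mulr0 r); apply: cvgM; first exact: cvg_cst.
    have H := @cvg_harmonic R; rewrite -cvg_shiftS in H; exact: H.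
  (* Equal to 1 where every face is at distance at least 2 d k, and to 0 where some face is within d
     k. *)
  pose ph k (x : X) := \prod_i (step ((x 0 i - a i) / d k - 1) * step ((b i - x 0 i) / d k - 1)).
  have sph k : smooth setT (ph k). have oT := @openT X.
    apply: smooth_prod => // i _; apply: smoothM => //; apply: smooth_step => //;
      (apply: smoothB => //; last exact: smooth_cst); apply: smoothM => //;
      try exact: smooth_cst; apply: smoothB => //; solve [exact: smooth_cst|exact: smooth_coord].
  have ph0 k x i : ph k x != 0 -> a i + d k < x 0 i < b i - d k.
    rewrite prodf_seq_neq0 => /allP/(_ i (mem_index_enum i)) /=. rewrite mulf_eq0 negb_or => /andP[h1 h2].
    have {h1} := contraNlt (fun h => introT eqP (step0 h)) h1.
    have {h2} := contraNlt (fun h => introT eqP (step0 h)) h2. rewrite ltrBrDr add0r ltr_pdivlMr// mul1r => h1.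
    by rewrite ltrBrDr add0r ltr_pdivlMr// mul1r => h2; apply/andP; split; lra. have ph01 k x : `|ph k x| <= 1.
    have H i : 0 <= step ((x 0 i - a i) / d k - 1) * step ((b i - x 0 i) / d k - 1) <= 1.
      by rewrite mulr_ge0 ?step_ge0// mulr_ile1 ?step_ge0 ?step_le1.
    rewrite ger0_norm; last by apply: prodr_ge0 => i _; have /andP[] := H i. by apply: prodr_ile1 => i _; exact: H.
  have E0 k : (\int[leb R n]_t (f t * ph k (rowt t))%:E = 0)%E. apply: (Hf _ (r - d k)) => //; first by rewrite gtrBl.
    move=> x xr; apply/eqP; apply: contraTT xr => /ph0 H; rewrite -leNgt.
    apply: norm_row_le => [|i]; first by rewrite subr_ge0 ltW. have /andP[h1 h2] := H i; rewrite !mxE ler_norml.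
    by have := Ha i; have := Hb i; move=> h3 h4; apply/andP; split; lra.
  have mf : mfunT f by have /integrableP[/mEFinP] := fi.
  have mph k : mfunT (fun t : T => ph k (rowt t)).
    apply: mrowt_cont => x; exact: smooth_cont (sph k) I.
  have := @dominated_convergence _ _ _ (leb R n) setT measurableT
    (fun k t => (f t * ph k (rowt t))%:E) (fun t => ((EFin \o f) \_ (box a b)) t) (abse \o (EFin \o f)). move=> [].
  - by move=> k; apply/mEFinP; exact: mfunM.
  - apply/(measurable_restrictT _ _).1 => //; first exact: measurable_box. exact/measurable_funTS/mEFinP.
  - apply/aeW => t _; rewrite patchE; case: ifPn => [/set_mem tB|tB]. apply: cvg_near_cst.
      have : \forall k \near \oo, forall i, 2 * d k <= tnth t i - a i /\ 2 * d k <= b i - tnth t i.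
        apply: filter_forall => i; have /andP[h1 h2] := tB i.
        have hm : 0 < Num.min (tnth t i - a i) (b i - tnth t i) / 2. by rewrite divr_gt0// lt_min !subr_gt0 h1 h2.
        move/cvgr0_norm_le : d_0 => /(_ _ hm); apply: filterS => k.
        by rewrite (ger0_norm (ltW (d0 k))) ler_pdivlMr// mulrC le_min => /andP.
      apply: filterS => k Hk; rewrite /ph big1 ?mulr1// => i _; have [h1 h2] := Hk i.
      by rewrite !step1 ?mulr1// lerBrDr ler_pdivlMr// mxE; lra. apply: cvg_near_cst; apply: nearW => k.
    suff -> : ph k (rowt t) = 0 by rewrite mulr0. apply/eqP; apply: contraNT tB => /ph0 H; apply/mem_set => i.
    by have /andP[] := H i; rewrite mxE => h1 h2; have := d0 k => h3; apply/andP; split; lra.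
  - by apply: integrable_abse.
  - apply/aeW => t k _ /=; rewrite lee_fin normrM ler_piMr//. move=> _ _ /=. under eq_fun do rewrite E0.
  move=> H; rewrite integral_mkcond. by apply/esym; apply: cvg_unique (cvg_cst _) H; exact: ereal_hausdorff.
pose fB := (EFin \o f) \_ B.
have fBi : (leb R n).-integrable setT fB. by apply/(integrable_mkcond _ mB); apply: integrableS fi.
have /integrableP[mfB _] := fBi.
have mp : mfunT (fB^\+)%E by exact: measurable_funepos.
have mn : mfunT (fB^\-)%E by exact: measurable_funeneg.
have p0 t : (0 <= fB^\+ t)%E by exact: funepos_ge0.
have n0 t : (0 <= fB^\- t)%E by exact: funeneg_ge0.
have fin A : measurable A -> (\int[leb R n]_(t in A) fB^\+ t \is a fin_num)%E /\
    (\int[leb R n]_(t in A) fB^\- t \is a fin_num)%E.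
  move=> mA; have fA : (leb R n).-integrable A fB by apply: integrableS fBi.
  by split; apply: integrable_fin_num => //; [exact: integrable_funepos|exact: integrable_funeneg].
have eqb a b : density_measure (leb R n) mp p0 (box a b) = density_measure (leb R n) mn n0 (box a b).
  have [fp fn] := fin _ (measurable_box a b). have : (\int[leb R n]_(t in box a b) fB t = 0)%E.
    rewrite -integral_mkcondr.
    rewrite (_ : box a b `&` B = box (fun i => Num.max (a i) (y 0 i - r)) (fun i => Num.min (b i) (y 0 i + r))).
      by apply: boxB => i; [rewrite le_max lexx orbT|rewrite ge_min lexx orbT]. apply/seteqP; split => t /=.
      by move=> [H1 H2] i; rewrite gt_max lt_min; have /andP[-> ->] := H1 i; have /andP[-> ->] := H2 i.
    move=> H; split=> i; have := H i; rewrite /= gt_max lt_min. by move=> /andP[/andP[-> _] /andP[-> _]].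
    by move=> /andP[/andP[_ ->] /andP[_ ->]]. rewrite integralE => /eqP; rewrite sube_eq ?add0e; last 2 first.
  - exact: fp.
  - exact: fin_num_adde_defl. by move=> /eqP.
(* The densities given by the positive and the negative part are finite measures that agree on
   boxes, hence everywhere: the integral of [fB] vanishes on every measurable set. *)
have eqA A : measurable A -> density_measure (leb R n) mp p0 A = density_measure (leb R n) mn n0 A.
  apply: (@measure_unique _ _ _ boxes (fun k => box (fun=> - k%:R) (fun=> k%:R)) boxes_generate boxesI).
  - by move=> k; do 2!eexists.
  - rewrite -subTset => t _. exists (Num.bound (\sum_j `|tnth (t : T) j|)) => // i /=.
    rewrite -ltr_norml; apply: le_lt_trans (archi_boundP _); last by apply: sumr_ge0.
    by rewrite (bigD1 i)//= lerDl sumr_ge0.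
  - by move=> _ [a [b ->]]; exact: eqb.
  - by move=> k; have [] := fin _ (measurable_box (fun=> - k%:R) (fun=> k%:R)); rewrite fin_numE => /andP[_ +] _; rewrite ltey.
have : ae_eq (leb R n) setT fB (cst 0%E). apply: integral_ae_eq => // A _ mA; rewrite integral0 integralE.
  have := eqA A mA; rewrite /density_measure => ->; rewrite subee//. by have [] := fin A mA.
apply: filterS => t /(_ I) /=; rewrite /fB patchE => + yr.
rewrite mem_set; first by move=> [].
move=> i; have := le_lt_trans (coord_le_norm _ i) yr.
by rewrite !mxE ltr_norml => /andP[h1 h2]; apply/andP; split; lra.
Qed.

End du_bois_reymond.

(** * Plancherel identity *)
Section line_integrals.
Context (R : realType).
Notation mu := (@lebesgue_measure R).

Lemma ge0_integral_halves (f : R -> R) : (forall x, 0 <= f x) -> continuous f ->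
  (\int[mu]_x (f x)%:E = \int[mu]_(x in `[0%R, +oo[) (f x)%:E + \int[mu]_(x in `[0%R, +oo[) (f (- x))%:E)%E.
Proof.
move=> f0 cf.
have mf : measurable_fun [set: R] f by exact: cont_mfun.
rewrite -(setUv `[0%R, +oo[) ge0_integral_setU//=; last 4 first.
- exact: measurableC.
- by apply/mEFinP; rewrite setUv.
- by move=> x _; rewrite lee_fin.
- exact/disj_setPCl.
congr (_ + _)%E.
rewrite setCitvr integral_itv_bndo_bndc; last exact/mEFinP/measurable_funTS.
rewrite -{1}oppr0 ge0_integration_by_substitutionNy//.
exact: continuous_subspaceT.
Qed.

Lemma ge0_FTC_halfline (f F : R -> R) (l : R) : (forall x, 0 <= f x) ->
  continuous f -> (forall x, is_derive x (1 : R) F (f x)) -> F x @[x --> +oo] --> l ->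
  (\int[mu]_(x in `[0%R, +oo[) (f x)%:E = (l - F 0)%:E)%E.
Proof.
move=> f0 cf dF Fl; have cF : continuous F.
  by move=> x; apply/differentiable_continuous/derivable1_diffP; have [] := dF x.
rewrite (@ge0_continuous_FTC2y _ f F 0 l) ?EFinB//.
- exact: continuous_subspaceT.
- by apply: cvg_at_right_filter; exact: cF.
- by move=> x _; rewrite derive1E; have [_] := dF x.
Qed.

(** Fourier transform of exp(-d |x|), of total mass 2 pi for every d. *)
Definition poisson (d z : R) : R := 2 * d / (d ^+ 2 + z ^+ 2).

Lemma poisson_ge0 d z : 0 < d -> 0 <= poisson d z.
Proof. by move=> d0; rewrite divr_ge0 ?mulr_ge0 ?addr_ge0 ?sqr_ge0// ltW. Qed.

(** The summand 1 keeps the integrand nonnegative, as the fundamental theorem on a half-line asks;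
    the phase [th] is what the induction on the dimension in [fourier_expw] consumes. *)
Lemma expcos_halfline (d z th : R) : 0 < d ->
  (\int[mu]_(x in `[0%R, +oo[) (expR (- (d * x)) * (1 + cos (z * x + th)))%:E =
  (d^-1 + (d * cos th - z * sin th) / (d ^+ 2 + z ^+ 2))%:E)%E.
Proof.
move=> d0; have D0 : d ^+ 2 + z ^+ 2 != 0 by rewrite gt_eqF// ltr_pwDl ?sqr_ge0// exprn_gt0.
pose F x := expR (- (d * x)) * (- d^-1 + (z * sin (z * x + th) - d * cos (z * x + th)) / (d ^+ 2 + z ^+ 2)).
have lin a b (x : R) : is_derive x (1 : R) (fun x => a * x + b) a.
  apply: (is_derive_eq (is_deriveD (is_deriveZ a (is_derive_id x (1 : R))) (is_derive_cst b x 1))).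
  by rewrite addr0 -![_ *: _]/(_ * _) mulr1.
have dexp x : is_derive x (1 : R) (fun x => expR (- (d * x))) (- d * expR (- (d * x))).
  have := @is_derive1_comp R expR (fun x => - d * x + 0) x _ _ (is_derive_expR _) (lin (- d) 0 x).
  rewrite (_ : _ \o _ = fun x => expR (- (d * x))); last first. by apply/funext => y; rewrite /= addr0 mulNr.
  by rewrite addr0 mulNr mulrC mulNr.
have dsin x : is_derive x (1 : R) (fun x => sin (z * x + th)) (cos (z * x + th) * z).
  exact: (@is_derive1_comp R sin (fun x => z * x + th) x _ _ (is_derive_sin _) (lin z th x)).
have dcos x : is_derive x (1 : R) (fun x => cos (z * x + th)) (- sin (z * x + th) * z).
  exact: (@is_derive1_comp R cos (fun x => z * x + th) x _ _ (is_derive_cos _) (lin z th x)).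
have dF x : is_derive x (1 : R) F (expR (- (d * x)) * (1 + cos (z * x + th))).
  have d1 := is_deriveZ (d ^+ 2 + z ^+ 2)^-1 (is_deriveB (is_deriveZ z (dsin x)) (is_deriveZ d (dcos x))).
  have d2 := is_deriveM (dexp x) (is_deriveD (is_derive_cst (- d^-1) x 1) d1).
  have -> : F = (fun x => expR (- (d * x))) * (cst (- d^-1) + (d ^+ 2 + z ^+ 2)^-1 \*:
     (z \*: (fun x : R => sin (z * x + th)) - d \*: (fun x : R => cos (z * x + th)))).
    apply/funext => y; rewrite /F; congr (_ * (_ + _)); rewrite mulrC. by []. apply: is_derive_eq d2 _.
  rewrite -![_ *: _]/(_ * _) !fctE /= -![_ *: _]/(_ * _).
  by move: (cos _) (sin _) (expR _) => cc ss e; field; rewrite D0 gt_eqF.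
have Fy : F x @[x --> +oo] --> 0. have E0 : expR (- (d * x)) @[x --> +oo] --> (0 : R).
    apply: (@cvg_comp _ _ _ (fun x : R => d * x) (fun y => expR (- y)) _ +oo).
      by apply: gt0_cvgMry => //; exact: cvg_id. exact: cvgr_expR. pose C := d^-1 + (`|z| + d) / (d ^+ 2 + z ^+ 2).
  have D1 : 0 < d ^+ 2 + z ^+ 2 by rewrite lt0r D0 addr_ge0 ?sqr_ge0. have bd x : `|F x| <= C * expR (- (d * x)).
    rewrite /F normrM (ger0_norm (expR_ge0 _)) mulrC ler_wpM2r ?expR_ge0//.
    apply: le_trans (ler_normD _ _) _; rewrite normrN gtr0_norm ?invr_gt0// lerD2l.
    rewrite normrM [X in _ * X]gtr0_norm ?invr_gt0// ler_wpM2r ?invr_ge0 ?(ltW D1)//.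
    apply: le_trans (ler_normB _ _) _; rewrite !normrM (gtr0_norm d0).
    apply: lerD; first by rewrite ler_piMr// ler_norml sin_geN1 sin_le1.
    by rewrite ler_piMr ?(ltW d0)// ler_norml cos_geN1 cos_le1. have CE : C * expR (- (d * x)) @[x --> +oo] --> (0 : R).
    by rewrite -(mulr0 C); apply: cvgM => //; exact: cvg_cst.
  apply: (@squeeze_cvgr _ _ _ _ (fun x => - (C * expR (- (d * x)))) (fun x => C * expR (- (d * x)))) => //.
    by apply: nearW => x; rewrite -ler_norml bd. by rewrite -oppr0; exact: cvgN.
rewrite (ge0_FTC_halfline _ _ dF Fy).
- congr EFin; rewrite /F !mulr0 oppr0 expR0 mul1r !add0r; field. by rewrite D0 gt_eqF.
- by move=> x; rewrite mulr_ge0 ?expR_ge0// -lerBlDl sub0r cos_geN1.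
- apply: contM; first exact: derive_continuous dexp. by apply: contD; [exact: cont_cst|exact: derive_continuous dcos].
Qed.

Lemma expcos_integral (d z th : R) : 0 < d -> (\int[mu]_x (expR (- (d * `|x|)) * (1 + cos (z * x + th)))%:E =
  (2 * d^-1 + cos th * poisson d z)%:E)%E.
Proof.
move=> d0; have cf : continuous (fun x : R => expR (- (d * `|x|)) * (1 + cos (z * x + th))). apply: contM.
    apply: (cont_comp (@continuous_expR R)); apply: contN; apply: contM; first exact: cont_cst. exact: norm_continuous.
  apply: contD; first exact: cont_cst. apply: (cont_comp (@continuous_cos R)); apply: contD; last exact: cont_cst.
  by apply: contM; [exact: cont_cst|exact: cont_id].
rewrite ge0_integral_halves//.
- transitivity ((d^-1 + (d * cos th - z * sin th) / (d ^+ 2 + z ^+ 2))%:E +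
    (d^-1 + (d * cos th - - z * sin th) / (d ^+ 2 + (- z) ^+ 2))%:E)%E.
    congr (_ + _)%E; rewrite -expcos_halfline//; apply: eq_integral => x;
      rewrite inE/= in_itv/= andbT => x0; first by rewrite ger0_norm. by rewrite normrN ger0_norm// mulrN mulNr.
  rewrite -EFinD; congr EFin; rewrite /poisson sqrrN; field.
  by rewrite (gt_eqF d0) gt_eqF// ltr_pwDl ?sqr_ge0// exprn_gt0.
Qed.

Lemma continuous_poisson (d x : R) : 0 < d -> continuous (fun s => poisson d (x - s)).
Proof.
move=> d0; apply: contM; first exact: cont_cst.
apply: contV; first by move=> s; rewrite gt_eqF// ltr_pwDl ?sqr_ge0// exprn_gt0.
apply: contD; first exact: cont_cst.
by apply: contX; apply: contB; [exact: cont_cst|exact: cont_id].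
Qed.

(** Each half-line contributes pi plus a multiple of an arctangent of x/d; the two arctangents are
    opposite. *)
Lemma poisson_integral (d x : R) : 0 < d -> (\int[mu]_s (poisson d (x - s))%:E = (2 * pi)%:E)%E.
Proof.
move=> d0.
have D y : 0 < d ^+ 2 + y ^+ 2 by rewrite ltr_pwDl ?sqr_ge0// exprn_gt0.
have cp (y : R) : continuous (fun s : R => poisson d (y - s)) by exact: continuous_poisson.
have lin a b (u : R) : is_derive u (1 : R) (fun u => a * u + b) a.
  apply: (is_derive_eq (is_deriveD (is_deriveZ a (is_derive_id u (1 : R))) (is_derive_cst b u 1))).
  by rewrite addr0 -![_ *: _]/(_ * _) mulr1.
have half y : (\int[mu]_(s in `[0%R, +oo[) (poisson d (y - s))%:E = (pi + 2 * atan (y / d))%:E)%E.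
  pose F (s : R) := 2 * atan (d^-1 * s + (- y / d)). have dF s : is_derive s (1 : R) F (poisson d (y - s)).
    apply: (is_derive_eq (is_deriveZ 2 (@is_derive1_comp R atan (fun s => d^-1 * s + (- y / d)) s _ _ (is_derive1_atan _) (lin _ _ s)))).
    rewrite -![_ *: _]/(_ * _) /poisson; have := D (y - s) => Dy; field. rewrite (gt_eqF d0) gt_eqF//= gt_eqF//.
  have Fy : F s @[s --> +oo] --> pi. rewrite [X in _ --> X](_ : pi = 2 * (pi / 2)); last by field.
    apply: cvgM; first exact: cvg_cst.
    apply: (@cvg_comp _ _ _ (fun s : R => d^-1 * s + - y / d) atan _ +oo); last exact: cvgy_atan. apply/cvgryPge => A.
    have : \forall s \near +oo, d * (A - - y / d) <= s by apply: nbhs_pinfty_ge; exact: num_real.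
    by apply: filterS => s; rewrite -lerBlDr ler_pdivlMl.
  rewrite (ge0_FTC_halfline _ (cp y) dF Fy); last by move=> s; exact: poisson_ge0.
  by rewrite /F mulr0 add0r mulNr atanN mulrN opprK.
rewrite ge0_integral_halves => [|s|//]; last exact: poisson_ge0.
rewrite half.
have -> : (\int[mu]_(s in `[0%R, +oo[) (poisson d (x - - s))%:E = (pi + 2 * atan (- x / d))%:E)%E.
  rewrite -half; apply: eq_integral => s _; rewrite /poisson opprK. by congr (_ / (_ + _))%:E; ring.
by rewrite -EFinD; congr EFin; rewrite mulNr atanN; ring.
Qed.

Lemma exp_integral (d : R) : 0 < d -> (\int[mu]_x (expR (- (d * `|x|)))%:E = (2 * d^-1)%:E)%E.
Proof.
(* The case z = 0 and phase pi/2, where the cosine is 0. *)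
move=> d0; rewrite -[2 * d^-1]addr0 -[X in _ + X](mul0r (poisson d 0)) -[X in _ + X * _](@cos_pihalf R).
rewrite -expcos_integral//; apply: eq_integral => x _.
by rewrite mul0r add0r cos_pihalf addr0 mulr1.
Qed.

Lemma continuous_expabs (d : R) : continuous (fun x : R => expR (- (d * `|x|))).
Proof.
apply: (cont_comp (@continuous_expR R)); apply: contN; apply: contM; first exact: cont_cst.
exact: norm_continuous.
Qed.

Lemma continuous_coslin (z th : R) : continuous (fun x : R => cos (z * x + th)).
Proof.
apply: (cont_comp (@continuous_cos R)); apply: contD; last exact: cont_cst.
by apply: contM; [exact: cont_cst|exact: cont_id].
Qed.

Lemma integrable_expcos (d z th : R) : 0 < d ->
  mu.-integrable setT (fun x => (expR (- (d * `|x|)) * cos (z * x + th))%:E).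
Proof.
move=> d0.
have me := cont_mfun (@continuous_expabs d).
have mc := cont_mfun (@continuous_coslin z th).
have i1 : mu.-integrable setT (fun x => (expR (- (d * `|x|)))%:E).
  apply/integrableP; split; first exact/mEFinP. under eq_integral do rewrite /= ger0_norm ?expR_ge0//.
  by rewrite exp_integral// ltry.
apply: le_integrable i1 => //. by apply/mEFinP; apply: mfunM.
by move=> x _; rewrite lee_fin normrM ler_piMr// ler_norml cos_geN1 cos_le1.
Qed.

Lemma expcos_integralE (d z th : R) : 0 < d ->
  (\int[mu]_x (expR (- (d * `|x|)) * cos (z * x + th))%:E = (cos th * poisson d z)%:E)%E.
Proof.
move=> d0.
have me := cont_mfun (@continuous_expabs d).
have mc := cont_mfun (@continuous_coslin z th).
have i1 : mu.-integrable setT (fun x => (expR (- (d * `|x|)))%:E).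
  apply/integrableP; split; first exact/mEFinP. under eq_integral do rewrite /= ger0_norm ?expR_ge0//.
  by rewrite exp_integral// ltry.
have i2 : mu.-integrable setT (fun x => (expR (- (d * `|x|)) * (1 + cos (z * x + th)))%:E). apply/integrableP; split.
    by apply/mEFinP; apply: mfunM => //; exact: mfunD. under eq_integral => x _.
    rewrite /= ger0_norm; last by rewrite mulr_ge0 ?expR_ge0// -lerBlDl sub0r cos_geN1. over.
  by rewrite expcos_integral// ltry.
transitivity (\int[mu]_x ((expR (- (d * `|x|)) * (1 + cos (z * x + th)))%:E - (expR (- (d * `|x|)))%:E))%E.
  by apply: eq_integral => x _; rewrite -EFinB; congr EFin; ring.
by rewrite integralB// expcos_integral// exp_integral// -EFinB; congr EFin; ring.
Qed.

End line_integrals.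

(** * Fubini for functions dominated by a product *)

Section product_integrals.
Context d1 d2 (T1 : measurableType d1) (T2 : measurableType d2) (R : realType).
Variables (m1 : {sigma_finite_measure set T1 -> \bar R}) (m2 : {sigma_finite_measure set T2 -> \bar R}).

(** Domination by u(x) v(y) with u and v integrable gives integrability on the product, hence both
    Fubini and the integrability of the partial integrals. *)
Lemma intg_prod_bound (f : T1 * T2 -> R) (u : T1 -> R) (v : T2 -> R) :
  mfunT f -> m1.-integrable setT (EFin \o u) ->
  m2.-integrable setT (EFin \o v) -> (forall x y, `|f (x, y)| <= u x * v y) ->
  (m1 \x m2)%E.-integrable setT (EFin \o f).
Proof.
move=> mf iu iv fuv; have [mu _] := integrableP _ _ _ iu; have [mv _] := integrableP _ _ _ iv.
apply/integrable12ltyP; first exact/mEFinP.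
apply: (@le_lt_trans _ _ (\int[m1]_x (`|u x|%:E * \int[m2]_y `|v y|%:E))%E); last first.
  have fv : (\int[m2]_y `|v y|%:E \is a fin_num)%E. by apply: integrable_fin_num => //; apply: (integrable_abse iv).
  rewrite -(fineK fv); under eq_integral do rewrite muleC. rewrite ge0_integralZl//; last 2 first.
  - by apply/mEFinP; apply: mcompT => //; exact/mEFinP.
  - by rewrite lee_fin fine_ge0//; exact: integral_ge0.
  rewrite lte_mul_pinfty//; last by have [_] := integrableP _ _ _ iu.
  by rewrite lee_fin fine_ge0//; exact: integral_ge0.
apply: ge0_le_integral => //.
- by move=> x _; exact: integral_ge0.
- have ma : mfunT (abse \o (EFin \o f)). by apply: mcompT => //; exact/mEFinP.
  exact: (@mfubini_F _ _ T1 T2 R m2 _ ma (fun=> abse_ge0 _)).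
- apply: emeasurable_funM => //. by apply/mEFinP; apply: mcompT => //; exact/mEFinP.
move=> x _; rewrite -ge0_integralZl//; last first.
  by apply/mEFinP; apply: mcompT => //; exact/mEFinP.
apply: ge0_le_integral => //.
- by apply/mEFinP; apply: mcompT => //; apply: mcompT mf _; exact: measurable_pair1.
- apply: emeasurable_funM => //; apply/mEFinP; apply: mcompT => //; exact/mEFinP.
move=> y _; rewrite lee_fin (le_trans (fuv x y))// -normrM ler_norm//.
Qed.

Variables (f : T1 * T2 -> R) (u : T1 -> R) (v : T2 -> R).
Hypotheses (mf : mfunT f) (iu : m1.-integrable setT (EFin \o u))
  (iv : m2.-integrable setT (EFin \o v)) (fuv : forall x y, `|f (x, y)| <= u x * v y).

Lemma integrable_section1 x : m2.-integrable setT (fun y => (f (x, y))%:E).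
Proof.
apply: (@le_integrable _ _ _ _ _ _ _ (fun y => (`|u x| * v y)%:E)) => //.
- by apply/mEFinP; apply: mcompT mf _; exact: measurable_pair1.
- move=> y _; rewrite lee_fin (le_trans (fuv x y))// (le_trans (ler_norm _))//. by rewrite !normrM normr_id.
- by have := integrableZl measurableT `|u x| iv.
Qed.

Lemma integrable_section2 y : m1.-integrable setT (fun x => (f (x, y))%:E).
Proof.
apply: (@le_integrable _ _ _ _ _ _ _ (fun x => (`|v y| * u x)%:E)) => //.
- by apply/mEFinP; apply: mcompT mf _; exact: measurable_pair2.
- move=> x _; rewrite lee_fin (le_trans (fuv x y))// (le_trans (ler_norm _))//. by rewrite !normrM normr_id mulrC.
- by have := integrableZl measurableT `|v y| iu.
Qed.

Lemma EFin_inner1 x : ((\int[m2]_y f (x, y))%R%:E = \int[m2]_y (f (x, y))%:E)%E.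
Proof. by rewrite /Rintegral fineK//; apply: integrable_fin_num => //; exact: integrable_section1. Qed.

Lemma EFin_inner2 y : ((\int[m1]_x f (x, y))%R%:E = \int[m1]_x (f (x, y))%:E)%E.
Proof. by rewrite /Rintegral fineK//; apply: integrable_fin_num => //; exact: integrable_section2. Qed.

Lemma intg_inner1 : m1.-integrable setT (fun x => (\int[m2]_y f (x, y))%:E).
Proof.
under eq_fun do rewrite EFin_inner1.
exact: (integrable_fubini_F (intg_prod_bound mf iu iv fuv)).
Qed.

Lemma Rintegral_Fubini : \int[m1]_x \int[m2]_y f (x, y) = \int[m2]_y \int[m1]_x f (x, y).
Proof.
rewrite /Rintegral; congr fine.
under eq_integral do rewrite EFin_inner1.
under [RHS]eq_integral do rewrite EFin_inner2.
exact: (Fubini (intg_prod_bound mf iu iv fuv)).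
Qed.

End product_integrals.

(** * Exponential damping and its Fourier transform *)

Section plancherel.
Context (R : realType) (n : nat).
Notation X := 'rV[R]_n.
Notation T := (n.-tuple R).

(** Damping factor in frequency. A product of one-dimensional exponentials has a transform that is
    computed with antiderivatives alone. *)
Definition expw (d : R) (xi : X) : R := \prod_i expR (- (d * `|xi 0 i|)).

Definition poissonw (d : R) (z : X) : R := \prod_i poisson d (z 0 i).

Lemma expw_ge0 d xi : 0 <= expw d xi.
Proof. by apply: prodr_ge0 => i _; exact: expR_ge0. Qed.

Lemma dotrowE (x y : X) : dotrow x y = \sum_i x 0 i * y 0 i.
Proof. by rewrite /dotrow mxE; apply: eq_bigr => i _; rewrite mxE. Qed.

Lemma measurable_expw d : mfunT (fun t : T => expw d (rowt t)).
Proof.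
apply: measurable_prod => i _; apply: mcompT => //.
apply: mcompT => //; apply: mfunM => //.
by apply: mcompT => //; exact: mcoord.
Qed.

Lemma integral_expw d : 0 < d -> (\int[leb R n]_t (expw d (rowt t))%:E = ((2 * d^-1) ^+ n)%:E)%E.
Proof.
move=> d0; rewrite (@integral_leb_prod R n (fun i x => expR (- (d * `|x|)))).
- rewrite (eq_bigr (fun=> (2 * d^-1)%:E)) => [|i _]; last exact: exp_integral.
  by rewrite -(big_morph EFin (@EFinM R) erefl) prodr_const card_ord.
- by move=> i; apply: cont_mfun; exact: continuous_expabs.
- by move=> i x; exact: expR_ge0.
Qed.

Lemma integrable_expw d : 0 < d -> (leb R n).-integrable setT (fun t : T => (expw d (rowt t))%:E).
Proof.
move=> d0; apply/integrableP; split. by apply/mEFinP; exact: measurable_expw.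
under eq_integral do rewrite /= ger0_norm ?expw_ge0//.
by rewrite integral_expw// ltry.
Qed.

Lemma integral_poissonw d (x : X) : 0 < d -> (\int[leb R n]_t (poissonw d (x - rowt t))%:E = ((2 * pi) ^+ n)%:E)%E.
Proof.
move=> d0; under eq_integral => t _. rewrite /poissonw (eq_bigr (fun i => poisson d (x 0 i - rowt t 0 i))) => [|i _].
    over. by rewrite mxE [X in _ + X]mxE.
rewrite /= (@integral_leb_prod R n (fun i s => poisson d (x 0 i - s))).
- rewrite (eq_bigr (fun=> (2 * pi)%:E)) => [|i _]; last exact: poisson_integral.
  by rewrite -(big_morph EFin (@EFinM R) erefl) prodr_const card_ord.
- by move=> i; apply: cont_mfun; exact: continuous_poisson.
- by move=> i s; exact: poisson_ge0.
Qed.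

End plancherel.

Lemma intg_expw_cos (R : realType) n d (z : 'I_n -> R) th : 0 < d -> (leb R n).-integrable setT
    (fun s : n.-tuple R => (expw d (rowt s) * cos (\sum_i z i * rowt s 0 i + th))%:E).
Proof.
move=> d0; apply: le_integrable (integrable_expw n d0) => //.
  apply/mEFinP; apply: mfunM; first exact: measurable_expw.
  apply: (mcompT (cont_mfun (@continuous_cos R))).
  apply: mfunD => //; apply: measurable_sum => i; apply: mfunM => //. exact: mcoord.
by move=> s _; rewrite lee_fin normrM ler_piMr// ler_norml cos_geN1 cos_le1.
Qed.

(** The first coordinate joins the phase of the integral in the others; the induction hypothesis
    returns the cosine of that phase, which is integrated by [expcos_integralE]. *)
Lemma fourier_expw (R : realType) n d (z : 'I_n -> R) th : 0 < d ->
  (\int[leb R n]_t (expw d (rowt t) * cos (\sum_i z i * rowt t 0 i + th))%:E = (cos th * \prod_i poisson d (z i))%:E)%E.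
Proof.
move=> d0; elim: n z th => [|n IH] z th. under eq_integral do rewrite /expw !big_ord0 mul1r add0r.
  by rewrite big_ord0 mulr1 integral_cst//= diracT mule1.
rewrite integral_leb_cons; last exact: intg_expw_cos.
under eq_integral => a _. rewrite (eq_integral (fun t => (expR (- (d * `|a|)))%:E * (expw d (rowt t) *
      cos (\sum_i z (lift ord0 i) * rowt t 0 i + (z ord0 * a + th)))%:E)%E); last first.
    move=> t _; have [H0 HS] := rowt_cons a t; rewrite /expw !big_ord_recl H0 -EFinM mulrA.
    congr (_ * _ * cos _)%:E; first by apply: eq_bigr => i _; rewrite HS.
    rewrite [RHS]addrA [_ + z ord0 * a]addrC; congr (_ + _ + _). by apply: eq_bigr => i _; rewrite HS.
  rewrite integralZl//; last exact: intg_expw_cos. rewrite IH -EFinM mulrA. over.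
rewrite /= big_ord_recl mulrA.
under eq_integral do rewrite EFinM.
rewrite integralZr//; first by rewrite expcos_integralE// -EFinM.
exact: integrable_expcos.
Qed.

Section quadratic_integral.
Context d1 d2 (T1 : measurableType d1) (T2 : measurableType d2) (R : realType).
Variables (m1 : {sigma_finite_measure set T1 -> \bar R}) (m2 : {sigma_finite_measure set T2 -> \bar R}).
Variables (p q : T1 -> T2 -> R) (w : T1 -> R) (g : T2 -> R).
Hypotheses (mp : mfunT (fun z : T1 * T2 => p z.1 z.2))
  (mq : mfunT (fun z : T1 * T2 => q z.1 z.2))
  (iw : m1.-integrable setT (EFin \o w)) (w0 : forall x, 0 <= w x)
  (ig : m2.-integrable setT (EFin \o g)) (pg : forall x y, `|p x y| <= g y) (qg : forall x y, `|q x y| <= g y).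

Let mw : mfunT w.
Proof. by have /integrableP[/mEFinP] := iw. Qed.

Let mg : mfunT g.
Proof. by have /integrableP[/mEFinP] := ig. Qed.

Let g0 y : 0 <= g y. Proof. exact: le_trans (normr_ge0 _) (pg point y). Qed.

Let m1of2 (h : T1 -> T2 -> R) x : mfunT (fun z : T1 * T2 => h z.1 z.2) -> mfunT (h x).
Proof.
move=> mh; rewrite (_ : h x = (fun z : T1 * T2 => h z.1 z.2) \o pair x)//.
by apply: mcompT mh _; exact: measurable_pair1.
Qed.

Let m2of2 (h : T1 -> T2 -> R) y : mfunT (fun z : T1 * T2 => h z.1 z.2) -> mfunT (h^~ y).
Proof.
move=> mh; rewrite (_ : h^~ y = (fun z : T1 * T2 => h z.1 z.2) \o pair^~ y)//.
by apply: mcompT mh _; exact: measurable_pair2.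
Qed.

Let ml (h : T1 -> R) : mfunT h -> mfunT (fun z : T1 * T2 => h z.1).
Proof. by move=> mh; exact: mcompT. Qed.

Let G := \int[m2]_y g y.

Let inner (h : T1 -> T2 -> R) : mfunT (fun z : T1 * T2 => h z.1 z.2) -> (forall x y, `|h x y| <= g y) ->
  [/\ forall x, m2.-integrable setT (fun y => (h x y)%:E), forall x, `|\int[m2]_y h x y| <= G &
     mfunT (fun x => w x * \int[m2]_y h x y)].
Proof.
move=> mh hg.
have ih x : m2.-integrable setT (fun y => (h x y)%:E).
  apply: le_integrable ig => //; first by apply/mEFinP; exact: m1of2.
  by move=> y _; rewrite lee_fin (le_trans (hg x y))// ler_norm.
split => // [x|]. apply: (@le_trans _ _ (\int[m2]_y `|h x y|)); first by apply: le_normr_Rintegral => //; exact: ih.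
  by apply: le_Rintegral => //; exact: integrable_abse (ih x).
have H : m1.-integrable setT (EFin \o (fun x => w x * \int[m2]_y h x y)).
  have := @intg_inner1 _ _ T1 T2 R m1 m2 (fun z => w z.1 * h z.1 z.2) w g (mfunM (ml mw) mh) iw ig.
  move=> H; have {}H := H (fun x y => _ : `|w x * h x y| <= w x * g y).
  have E x y : `|w x * h x y| <= w x * g y by rewrite normrM ger0_norm// ler_wpM2l.
  move: (H E); apply: eq_integrable => // x _ /=. by rewrite RintegralZl//; exact: ih.
by have /integrableP[/mEFinP] := H.
Qed.

Let iwg c : m1.-integrable setT (EFin \o (fun x => w x * c)).
Proof.
have := integrableZr measurableT c iw.
by apply: eq_integrable => // x _ /=; rewrite EFinM.
Qed.

Let iD (u v : T2 -> R) c d : m2.-integrable setT (EFin \o u) -> m2.-integrable setT (EFin \o v) ->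
  \int[m2]_y (c * u y + d * v y) = c * \int[m2]_y u y + d * \int[m2]_y v y.
Proof.
move=> iu iv; rewrite RintegralD//; first by rewrite !RintegralZl.
  by have := integrableZl measurableT c iu; apply: eq_integrable => // x _ /=; rewrite EFinM.
by have := integrableZl measurableT d iv; apply: eq_integrable => // x _ /=; rewrite EFinM.
Qed.

Let bnd x y c d K : 0 <= K -> `|c| <= w x * K -> `|d| <= w x * K -> `|c * p x y + d * q x y| <= w x * (K + K) * g y.
Proof.
move=> K0 Hc Hd; rewrite mulrDr mulrDl (le_trans (ler_normD _ _))//.
by rewrite !normrM lerD// ler_pM.
Qed.

(** A squared inner integral is a double integral; Fubini twice, with domination by [w] times [g],
    makes the integral over [T1], the frequency in the application, the innermost one. *)
Lemma integral_square : m1.-integrable setT (fun x => (w x * ((\int[m2]_y p x y) ^+ 2 + (\int[m2]_y q x y) ^+ 2))%:E) /\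
  \int[m1]_x (w x * ((\int[m2]_y p x y) ^+ 2 + (\int[m2]_y q x y) ^+ 2)) =
  \int[m2]_y \int[m2]_z \int[m1]_x (w x * (p x y * p x z + q x y * q x z)).
Proof.
have [ip PG mwP] := inner mp pg; have [iq QG mwQ] := inner mq qg.
pose P x := \int[m2]_y p x y; pose Q x := \int[m2]_y q x y.
have E x : \int[m2]_y (w x * P x * p x y + w x * Q x * q x y) = w x * (P x ^+ 2 + Q x ^+ 2).
  by rewrite iD -/(P x) -/(Q x); [ring|exact: ip|exact: iq].
have G0 : 0 <= G by exact: Rintegral_ge0.
have m1' : mfunT (fun z : T1 * T2 => w z.1 * P z.1 * p z.1 z.2 + w z.1 * Q z.1 * q z.1 z.2).
  by apply: mfunD; apply: mfunM => //;
    [apply: (ml (h := fun x => w x * P x))|apply: (ml (h := fun x => w x * Q x))].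
have b1 x y : `|w x * P x * p x y + w x * Q x * q x y| <= w x * (G + G) * g y.
  by apply: bnd => //; rewrite normrM (ger0_norm (w0 x)) ler_wpM2l//; [exact: PG|exact: QG].
split. have := intg_inner1 m1' (iwg (G + G)) ig b1. by apply: eq_integrable => // x _ /=; rewrite E.
transitivity (\int[m1]_x \int[m2]_y (w x * P x * p x y + w x * Q x * q x y)). by apply: eq_Rintegral => x _; rewrite E.
have /= -> := Rintegral_Fubini m1' (iwg (G + G)) ig b1.
apply: eq_Rintegral => y _.
transitivity (\int[m1]_x \int[m2]_z (w x * p x y * p x z + w x * q x y * q x z)).
  by apply: eq_Rintegral => x _; rewrite iD; [rewrite -/(P x) -/(Q x); ring|exact: ip|exact: iq].
have m2' : mfunT (fun z : T1 * T2 => w z.1 * p z.1 y * p z.1 z.2 + w z.1 * q z.1 y * q z.1 z.2).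
  apply: mfunD; apply: mfunM => //.
    by apply: (ml (h := fun x => w x * p x y)); apply: mfunM => //; exact: m2of2.
  by apply: (ml (h := fun x => w x * q x y)); apply: mfunM => //; exact: m2of2.
have b2 x z : `|w x * p x y * p x z + w x * q x y * q x z| <= w x * (g y + g y) * g z.
  by apply: bnd => //; rewrite normrM (ger0_norm (w0 x)) ler_wpM2l.
have /= -> := Rintegral_Fubini m2' (iwg (g y + g y)) ig b2.
by apply: eq_Rintegral => z _; apply: eq_Rintegral => x _; ring.
Qed.

End quadratic_integral.

(** * Poisson kernels as an approximate identity *)

Section approximate_identity.
Context (R : realType) (n : nat).
Notation X := 'rV[R]_n.
Notation T := (n.-tuple R).
Notation leb := (leb R n).

Lemma poissonwC d (x y : X) : poissonw d (x - y) = poissonw d (y - x).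
Proof.
rewrite -opprB; apply: eq_bigr => i _; rewrite /poisson.
by rewrite [(- (y - x)) 0 i]mxE sqrrN.
Qed.

Lemma poissonw_ge0 d (x : X) : 0 < d -> 0 <= poissonw d x.
Proof. by move=> d0; apply: prodr_ge0 => i _; exact: poisson_ge0. Qed.

Lemma poisson_max d (z : R) : 0 < d -> poisson d z <= 2 / d.
Proof.
move=> d0; rewrite /poisson ler_pdivrMr; last by rewrite ltr_pwDl ?sqr_ge0// exprn_gt0.
rewrite -[leLHS]mulr1 -!mulrA ler_pM2l// [d^-1 * _]mulrC ler_pdivlMr// mulr1 expr2.
by rewrite lerDl sqr_ge0.
Qed.

Lemma poissonw_max d (x : X) : 0 < d -> poissonw d x <= (2 / d) ^+ n.
Proof.
move=> d0; rewrite -[X in _ ^+ X](card_ord n) -prodr_const; apply: ler_prod => i _.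
by rewrite poisson_ge0// poisson_max.
Qed.

Lemma mpoisson d i : 0 < d -> mfunT (fun z : T * T => poisson d ((rowt z.1 - rowt z.2) 0 i)).
Proof.
move=> d0; have mf : mfunT (fun s : R => poisson d s).
  apply: cont_mfun; have := @continuous_poisson R d 0 d0.
  rewrite (_ : (fun s => poisson d (0 - s)) = poisson d)//. by apply/funext => s; rewrite /poisson sub0r sqrrN.
apply: (mcompT mf); under eq_fun do rewrite mxE [X in _ + X]mxE.
apply: measurable_funB. by apply: mcompT (mcoord i) _; exact: measurable_fst.
by apply: mcompT (mcoord i) _; exact: measurable_snd.
Qed.

(* [poissonw] with the i-th factor replaced by a multiple of the kernel of width 1 *)
Definition spread d (z : X) : R := \sum_i \prod_j (if j == i then 2 * d * poisson 1 (z 0 j) else poisson d (z 0 j)).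

Lemma spread_ge0 d z : 0 < d -> 0 <= spread d z.
Proof.
move=> d0; apply: sumr_ge0 => i _; apply: prodr_ge0 => j _.
case: ifP => _; last exact: poisson_ge0.
by rewrite mulr_ge0 ?poisson_ge0// mulr_ge0// (ltW d0).
Qed.

Lemma spreadC d (x y : X) : spread d (x - y) = spread d (y - x).
Proof.
rewrite -opprB; apply: eq_bigr => i _; apply: eq_bigr => j _; rewrite /poisson.
by rewrite [(- (y - x)) 0 j]mxE sqrrN.
Qed.

(** Away from the origin the kernel of width d is O(d); near it the weight z^2 compensates the peak.
    Both effects are captured by d times the kernel of width 1. *)
Lemma poisson_spread (d z : R) : 0 < d -> d <= 1 -> Num.min 1 (z ^+ 2) * poisson d z <= 2 * d * poisson 1 z.
Proof.
move=> d0 d1; rewrite /poisson expr1n mulr1.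
have z2 : 0 <= z ^+ 2 by exact: sqr_ge0.
have D0 : 0 < d ^+ 2 + z ^+ 2 by rewrite ltr_pwDl// exprn_gt0.
have D1 : 0 < 1 + z ^+ 2 by rewrite ltr_pwDl.
rewrite [leLHS]mulrA ler_pdivrMr// [leRHS](_ : _ = 4 * d * (d ^+ 2 + z ^+ 2) / (1 + z ^+ 2)); last first.
  by field; rewrite gt_eqF.
rewrite ler_pdivlMr//.
have [h|h] := leP 1 (z ^+ 2). rewrite mul1r; have : 0 <= d ^+ 2 by exact: sqr_ge0. nra.
have : 0 <= d * (d ^+ 2) by rewrite mulr_ge0 ?sqr_ge0 ?(ltW d0).
have : 0 <= d * (z ^+ 2) by rewrite mulr_ge0 ?(ltW d0).
have : 0 <= d * (z ^+ 2) * (1 - z ^+ 2)  by apply: mulr_ge0; [exact: mulr_ge0 (ltW d0) z2|rewrite subr_ge0 (ltW h)].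
nra.
Qed.

Lemma spread_le d (z : X) : 0 < d -> d <= 1 -> (\sum_i Num.min 1 (z 0 i ^+ 2)) * poissonw d z <= spread d z.
Proof.
move=> d0 d1; rewrite mulr_suml; apply: ler_sum => i _.
rewrite /poissonw (bigD1 i)//= [leRHS](bigD1 i)//= eqxx mulrA.
rewrite [X in _ <= _ * X](eq_bigr (fun j => poisson d (z 0 j))); last first. by move=> j /negbTE ->.
by rewrite ler_wpM2r ?poisson_spread// prodr_ge0// => j _; exact: poisson_ge0.
Qed.

Lemma mspread d : 0 < d -> mfunT (fun z : T * T => spread d (rowt z.1 - rowt z.2)).
Proof.
move=> d0; apply: measurable_sum => i; apply: measurable_prod => j _.
have [_|_] := eqVneq j i; last exact: mpoisson.
by apply: mfunM; [exact: measurable_cst|exact: mpoisson].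
Qed.

Lemma mpoissonw d : 0 < d -> mfunT (fun z : T * T => poissonw d (rowt z.1 - rowt z.2)).
Proof. by move=> d0; apply: measurable_prod => j _; exact: mpoisson. Qed.

Lemma sqr_norm_le (z : X) : `|z| ^+ 2 <= \sum_i z 0 i ^+ 2.
Proof.
have s0 : 0 <= \sum_i z 0 i ^+ 2 by rewrite sumr_ge0// => i _; exact: sqr_ge0.
rewrite -[leRHS]sqr_sqrtr// lerXn2r ?nnegrE ?sqrtr_ge0//.
apply: norm_row_le => [|i]; first exact: sqrtr_ge0.
rewrite -sqrtr_sqr ler_wsqrtr// (bigD1 i)//= lerDl sumr_ge0// => j _; exact: sqr_ge0.
Qed.

Lemma min1_sum (z : X) (c : R) : 0 <= c -> c <= 1 -> c <= `|z| ^+ 2 -> c <= \sum_i Num.min 1 (z 0 i ^+ 2).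
Proof.
move=> c0 c1 cz; have m0 i : 0 <= Num.min 1 (z 0 i ^+ 2) by rewrite le_min ler01 sqr_ge0.
have [[i Hi]|H] := pselect (exists i, 1 <= z 0 i ^+ 2). by rewrite (bigD1 i)//= min_l// (le_trans c1)// lerDl sumr_ge0.
apply: le_trans cz (le_trans (sqr_norm_le z) _); apply: ler_sum => i _.
by rewrite min_r// leNgt; apply/negP => /ltW h; apply: H; exists i.
Qed.

Lemma integral_spread d (x : X) : 0 < d ->
  (\int[leb]_t (spread d (x - rowt t))%:E = (n%:R * (2 * d * (2 * pi) ^+ n))%:E)%E.
Proof.
move=> d0; under eq_integral do rewrite /spread -sumEFin.
have mP (k : R) (u : R) : 0 < k -> mfunT (fun s : R => poisson k (u - s)).
  by move=> k0; apply: cont_mfun; exact: continuous_poisson.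
have E i (t : T) : \prod_j (if j == i then 2 * d * poisson 1 ((x - rowt t) 0 j) else poisson d ((x - rowt t) 0 j)) =
    \prod_j (if j == i then 2 * d * poisson 1 (x 0 j - rowt t 0 j) else poisson d (x 0 j - rowt t 0 j)).
  by apply: eq_bigr => j _; rewrite [(x - rowt t) 0 j]mxE [X in _ + X]mxE.
pose q i j (s : R) := if j == i then 2 * d * poisson 1 (x 0 j - s) else poisson d (x 0 j - s).
have q0 i j s : 0 <= q i j s. rewrite /q; case: ifP => _; last exact: poisson_ge0.
  by rewrite mulr_ge0 ?poisson_ge0// mulr_ge0// (ltW d0).
have mq i j : mfunT (q i j). case: (boolP (j == i)) => ji; rewrite /q ?ji ?(negbTE ji); last exact: mP.
  by apply: mfunM; [exact: measurable_cst|exact: mP].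
under eq_integral do under eq_bigr do rewrite E -/(q _ _ _).
rewrite ge0_integral_sum//; last 2 first.
- move=> i; apply/mEFinP; apply: measurable_prod => j _.
  by apply: (mcompT (mq i j)); exact: mcoord.
- by move=> i t _; rewrite lee_fin prodr_ge0// => j _; exact: q0.
rewrite (eq_bigr (fun=> (2 * d * (2 * pi) ^+ n)%:E)) => [|i _].
  by rewrite sumEFin sumr_const card_ord; congr EFin; rewrite [RHS]mulr_natl.
rewrite (@integral_leb_prod R n (q i))//.
rewrite (bigD1 i)//= (eq_bigr (fun=> (2 * pi)%:E)) => [|j ji]; last first. by rewrite /q (negbTE ji) poisson_integral.
rewrite /q eqxx.
rewrite -(big_morph EFin (@EFinM R) erefl) prodr_const.
under eq_integral do rewrite EFinM.
rewrite ge0_integralZl//; last 3 first.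
- by apply/mEFinP; exact: mP.
- by move=> s _; rewrite lee_fin poisson_ge0.
- by rewrite lee_fin mulr_ge0// ltW.
rewrite poisson_integral// -!EFinM; congr EFin; rewrite -[LHS]mulrA -exprS; congr (_ * _ ^+ _).
rewrite cardC1 card_ord prednK//.
by apply: leq_ltn_trans (ltn_ord i).
Qed.

Lemma tonelli_convolution (v : T -> R) (k : X -> R) (c : R) : mfunT v -> (forall t, 0 <= v t) ->
  mfunT (fun z : T * T => k (rowt z.1 - rowt z.2)) -> (forall x, 0 <= k x) ->
  (forall y, \int[leb]_x (k (rowt x - y))%:E = c%:E)%E ->
  (\int[leb]_x \int[leb]_y (v y * k (rowt x - rowt y))%:E = (\int[leb]_y (v y)%:E) * c%:E)%E.
Proof.
move=> mv v0 mk k0 kc.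
have mvk : mfunT (fun z : T * T => (v z.2 * k (rowt z.1 - rowt z.2))%:E).
  apply/mEFinP; apply: mfunM => //. by apply: mcompT mv _; exact: measurable_snd.
have vk0 (z : T * T) : (0 <= (v z.2 * k (rowt z.1 - rowt z.2))%:E)%E by rewrite lee_fin mulr_ge0.
have /= -> := @fubini_tonelli _ _ _ _ _ leb leb _ mvk vk0.
rewrite -ge0_integralZr//; last 3 first.
- exact/mEFinP.
- by move=> y _; rewrite lee_fin.
- by rewrite -(kc 0) integral_ge0// => x _; rewrite lee_fin.
apply: eq_integral => y _; under eq_integral do rewrite EFinM.
rewrite ge0_integralZl ?kc// ?lee_fin//.
- apply/mEFinP. rewrite (_ : (fun x : T => _) = (fun z : T * T => k (rowt z.1 - rowt z.2)) \o pair^~ y)//.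
  by apply: mcompT mk _; exact: measurable_pair2.
- by move=> x _; rewrite lee_fin.
Qed.

End approximate_identity.

(** * Plancherel identity by removal of the damping *)

Section plancherel_identity.
Context (R : realType) (n : nat).
Notation X := 'rV[R]_n.
Notation T := (n.-tuple R).
Notation leb := (leb R n).

Variables (y0 : X) (r : R) (f : X -> R[i]).
Notation a := (fun x => complex.Re (f x)).
Notation b := (fun x => complex.Im (f x)).
Hypotheses (sa : smooth setT a) (sb : smooth setT b) (za : supp_in y0 r a) (zb : supp_in y0 r b).

Let ca : continuous a. Proof. by move=> x; exact: smooth_cont sa I. Qed.
Let cb : continuous b. Proof. by move=> x; exact: smooth_cont sb I. Qed.

Let bounds : exists C, [/\ 0 < C, forall x, `|a x| <= C, forall x, `|b x| <= C,
  forall x y, `|a x - a y| <= C * `|x - y| & forall x y, `|b x - b y| <= C * `|x - y| ].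
Proof.
have [A A0 HA] := supp_bounded ca za; have [B B0 HB] := supp_bounded cb zb.
have [A' A'0 HA'] := supp_lipschitz sa za; have [B' B'0 HB'] := supp_lipschitz sb zb.
exists (A + B + A' + B'); split.
- by rewrite !addr_gt0.
- by move=> x; have := HA x; lra.
- by move=> x; have := HB x; lra.
- by move=> x y; apply: le_trans (HA' x y) _; rewrite ler_wpM2r//; lra.
- by move=> x y; apply: le_trans (HB' x y) _; rewrite ler_wpM2r//; lra.
Qed.

Let C := sval (cid bounds).
Let HC := svalP (cid bounds).

Let D : set T := [set t | `|rowt t - y0| <= r].

Let g (t : T) : R := (2 * C) * \1_D t.

Let mD : measurable D. Proof. exact: mnorm_le. Qed.

Let C0 : 0 < C. Proof. by have [] := HC. Qed.

Let ag t : `|a (rowt t)| + `|b (rowt t)| <= g t.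
Proof.
have [_ Ha Hb _ _] := HC; rewrite /g indicE; have := Ha (rowt t); have := Hb (rowt t).
have [/set_mem tD|] := boolP (t \in D); first by rewrite mulr1; rewrite -/C; lra.
rewrite notin_setE /D /= => /negP; rewrite -ltNge => h _ _.
by rewrite za// zb// normr0 addr0 mulr0.
Qed.

Let ig : leb.-integrable setT (EFin \o g).
Proof.
apply: (@intg_supp R n y0 r (2 * C)).
- by apply: mfunM.
- by move=> t; rewrite /g indicE ger0_norm ?mulr_ge0 ?(ltW C0)// ler_piMr ?mulr_ge0 ?(ltW C0)// lern1 leq_b1.
- move=> t h; rewrite /g indicE memNset ?mulr0//= => /le_lt_trans /(_ h). by rewrite ltxx.
Qed.

Let ma : mfunT (fun t : T => a (rowt t)).
Proof. exact: mrowt_cont. Qed.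
Let mb : mfunT (fun t : T => b (rowt t)).
Proof. exact: mrowt_cont. Qed.

Let th (xi x : T) := dotrow (rowt x) (rowt xi).
Let p (xi x : T) := cos (th xi x) * a (rowt x) + sin (th xi x) * b (rowt x).
Let q (xi x : T) := cos (th xi x) * b (rowt x) - sin (th xi x) * a (rowt x).

Let mth : mfunT (fun z : T * T => th z.1 z.2).
Proof.
rewrite /th; under eq_fun do rewrite dotrowE.
apply: measurable_sum => i; apply: mfunM.
  by apply: mcompT (mcoord i) _; exact: measurable_snd.
by apply: mcompT (mcoord i) _; exact: measurable_fst.
Qed.

Let mcos : mfunT (fun z : T * T => cos (th z.1 z.2)).
Proof. exact: mcompT (cont_mfun (@continuous_cos R)) mth. Qed.
Let msin : mfunT (fun z : T * T => sin (th z.1 z.2)).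
Proof. exact: mcompT (cont_mfun (@continuous_sin R)) mth. Qed.
Let ma2 : mfunT (fun z : T * T => a (rowt z.2)).
Proof. by apply: mcompT ma _; exact: measurable_snd. Qed.
Let mb2 : mfunT (fun z : T * T => b (rowt z.2)).
Proof. by apply: mcompT mb _; exact: measurable_snd. Qed.

Let mp : mfunT (fun z : T * T => p z.1 z.2).
Proof. by apply: mfunD; apply: mfunM. Qed.
Let mq : mfunT (fun z : T * T => q z.1 z.2).
Proof. by apply: measurable_funB; apply: mfunM. Qed.

Let pg xi x : `|p xi x| <= g x.
Proof.
apply: le_trans (ag x); apply: le_trans (ler_normD _ _) _; rewrite !normrM.
by apply: lerD; rewrite ler_piMl// ler_norml ?cos_geN1 ?cos_le1 ?sin_geN1 ?sin_le1.
Qed.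
Let qg xi x : `|q xi x| <= g x.
Proof.
apply: le_trans (ag x); apply: le_trans (ler_normB _ _) _; rewrite !normrM addrC.
by apply: lerD; rewrite ler_piMl// ler_norml ?cos_geN1 ?cos_le1 ?sin_geN1 ?sin_le1.
Qed.

Lemma fourierE xi : normsq (fourier f (rowt xi)) = (\int[leb]_x p xi x) ^+ 2 + (\int[leb]_x q xi x) ^+ 2.
Proof.
rewrite /normsq /fourier /cintegral /=; congr (_ ^+ 2 + _ ^+ 2); apply: eq_Rintegral => x _; rewrite /p /q /th;
  case: (f (rowt x)) => u v /=; rewrite cosN sinN; ring.
Qed.

Let cc (x y : T) : R := a (rowt x) * a (rowt y) + b (rowt x) * b (rowt y).

Let iwd d : 0 < d -> leb.-integrable setT (EFin \o (fun xi : T => expw d (rowt xi))).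
Proof. exact: integrable_expw. Qed.

(** Expanding the squared modulus leaves waves with frequency variable dual to x - y, whose damped
    integral is the Poisson kernel. *)
Lemma damped_fourier d : 0 < d ->
  leb.-integrable setT (fun xi => (expw d (rowt xi) * normsq (fourier f (rowt xi)))%:E) /\
  \int[leb]_xi (expw d (rowt xi) * normsq (fourier f (rowt xi))) =
  \int[leb]_x \int[leb]_y (cc x y * poissonw d (rowt x - rowt y)).
Proof.
move=> d0; have [i1 e1] := integral_square mp mq (iwd d0) (fun xi => expw_ge0 d (rowt xi)) ig pg qg.
split. by move: i1; apply: eq_integrable => // xi _; rewrite fourierE.
transitivity (\int[leb]_xi (expw d (rowt xi) * ((\int[leb]_x p xi x) ^+ 2 + (\int[leb]_x q xi x) ^+ 2))).
  by apply: eq_Rintegral => xi _; rewrite fourierE.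
rewrite e1; apply: eq_Rintegral => x _; apply: eq_Rintegral => y _.
pose z i := (rowt x - rowt y) 0 i.
(* The phase -pi/2 writes the sine part as a cosine; its integral carries the factor cos(-pi/2) = 0
   and drops out. *)
pose h e (xi : T) := expw d (rowt xi) * cos (\sum_i z i * rowt xi 0 i + e).
pose s := b (rowt x) * a (rowt y) - a (rowt x) * b (rowt y).
transitivity (\int[leb]_xi (cc x y * h 0 xi + s * h (- (pi / 2)) xi)). apply: eq_Rintegral => xi _; rewrite /h.
  have -> : \sum_i z i * rowt xi 0 i = th xi x - th xi y. rewrite /th !dotrowE -sumrB; apply: eq_bigr => i _.
    by rewrite /z [(rowt x - rowt y) 0 i]mxE [X in _ + X]mxE mulrBl.
  rewrite addr0 cosBpihalf cosB sinB /p /q /cc /s; ring.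
have ih e : leb.-integrable setT (EFin \o h e) by exact: intg_expw_cos.
have iZ c e : leb.-integrable setT (EFin \o (fun xi => c * h e xi)).
  by have := integrableZl measurableT c (ih e); apply: eq_integrable => // xi _ /=; rewrite EFinM.
rewrite RintegralD//.
rewrite !RintegralZl//.
rewrite /Rintegral !fourier_expw//= cosN cos_pihalf mul0r mulr0 addr0 cos0 mul1r.
by [].
Qed.

Let S (x : T) : R := a (rowt x) ^+ 2 + b (rowt x) ^+ 2.
Let E (x y : T) : R := (a (rowt x) - a (rowt y)) ^+ 2 + (b (rowt x) - b (rowt y)) ^+ 2.

Let S_ge0 x : 0 <= S x. Proof. by rewrite addr_ge0 ?sqr_ge0. Qed.
Let E_ge0 x y : 0 <= E x y. Proof. by rewrite addr_ge0 ?sqr_ge0. Qed.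

Let mS : mfunT S.
Proof. by apply: mfunD; apply: measurable_funX. Qed.

Let ma1 : mfunT (fun z : T * T => a (rowt z.1)).
Proof. by apply: mcompT ma _; exact: measurable_fst. Qed.
Let mb1 : mfunT (fun z : T * T => b (rowt z.1)).
Proof. by apply: mcompT mb _; exact: measurable_fst. Qed.

Let mE : mfunT (fun z : T * T => E z.1 z.2).
Proof. by apply: mfunD; apply: measurable_funX; apply: measurable_funB. Qed.

Let iS : leb.-integrable setT (fun x => (S x)%:E).
Proof.
have [_ Ha Hb _ _] := HC.
apply: (@intg_supp R n y0 r (C ^+ 2 + C ^+ 2)) => //.
- by move=> x; rewrite ger0_norm// lerD// -[leLHS]real_normK ?num_real// lerXn2r ?nnegrE ?(ltW C0).
- by move=> x h; rewrite /S za// zb// expr0n addr0.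
Qed.

(** Lipschitz continuity near the diagonal, boundedness away from it; the indicators record that [E]
    vanishes unless one of the two points lies in [D]. *)
Let E_le x y : E x y <= 8 * C ^+ 2 * (\1_D x + \1_D y) * \sum_i Num.min 1 ((rowt x - rowt y) 0 i ^+ 2).
Proof.
have [_ Ha Hb La Lb] := HC; set m := \sum_i _.
have m0 : 0 <= m by rewrite sumr_ge0// => i _; rewrite le_min ler01 sqr_ge0.
have C2 : 0 <= C ^+ 2 by exact: sqr_ge0.
have i0 z : 0 <= \1_D z :> R by rewrite indicE.
have [xy|xy] := boolP ((x \in D) || (y \in D)); last first.
  move: xy; rewrite negb_or => /andP[]; rewrite !notin_setE /D /= => /negP + /negP; rewrite -!ltNge => hx hy.
  by rewrite /E !za// !zb// subr0 expr0n addr0; exact: mulr_ge0 (mulr_ge0 (mulr_ge0 (ler0n _ _) C2) (addr_ge0 (i0 x) (i0 y))) m0.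
apply: (@le_trans _ _ (8 * C ^+ 2 * m)); last first.
  rewrite ler_wpM2r// -[leLHS]mulr1 ler_wpM2l//; first exact: mulr_ge0.
  by move: xy; rewrite !indicE; case: (x \in D); case: (y \in D) => //= _; rewrite ?addr0 ?add0r// lerDl.
have E4 : E x y <= 8 * C ^+ 2. have ha u v : `|u| <= C -> `|v| <= C -> (u - v) ^+ 2 <= 4 * C ^+ 2.
    move=> hu hv; rewrite -[leLHS]real_normK ?num_real// (_ : 4 * C ^+ 2 = (C + C) ^+ 2); last by ring.
    rewrite lerXn2r ?nnegrE ?addr_ge0 ?(ltW C0)//. by apply: le_trans (ler_normB _ _) _; exact: lerD.
  have := ha _ _ (Ha (rowt x)) (Ha (rowt y)); have := ha _ _ (Hb (rowt x)) (Hb (rowt y)). by rewrite /E; lra.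
have E2 : E x y <= 8 * C ^+ 2 * `|rowt x - rowt y| ^+ 2.
  have hl u v : `|u - v| <= C * `|rowt x - rowt y| -> (u - v) ^+ 2 <= C ^+ 2 * `|rowt x - rowt y| ^+ 2.
    by move=> h; rewrite -[leLHS]real_normK ?num_real// -exprMn lerXn2r ?nnegrE ?mulr_ge0 ?(ltW C0).
  have := hl _ _ (La (rowt x) (rowt y)); have := hl _ _ (Lb (rowt x) (rowt y)).
  have : 0 <= C ^+ 2 * `|rowt x - rowt y| ^+ 2 by rewrite mulr_ge0 ?sqr_ge0. by rewrite /E; lra.
have C8 : 0 < 8 * C ^+ 2 by rewrite mulr_gt0// exprn_gt0.
rewrite -ler_pdivrMl// mulrC; apply: min1_sum.
- by rewrite divr_ge0// ltW.
- by rewrite ler_pdivrMr// mul1r.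
- by rewrite ler_pdivrMr// mulrC.
Qed.

Let lD : (leb D < +oo)%E.
Proof.
have [r0|r0] := ltP r 0. rewrite (_ : D = set0) ?measure0//; apply/seteqP; split => // t; rewrite /D /= => h.
  by have := le_lt_trans h r0; rewrite normr_lt0.
have := leb_closed_ball y0 r0; rewrite (_ : [set t | _] = D); first by move=> ->; rewrite ltry.
by apply/seteqP; split => t; rewrite /D /= distrC.
Qed.

Let mI (h : T * T -> T) : mfunT h -> mfunT (fun z : T * T => \1_D (h z) : R).
Proof.
by move=> mh; apply: (@mcompT _ _ _ _ _ _ (\1_D : T -> R)).
Qed.

(** By [E_le] and [spread_le] the integrand is controlled by [spread], of total mass O(d). *)
Let error d : 0 < d -> d <= 1 -> (\int[leb]_x \int[leb]_y (E x y * poissonw d (rowt x - rowt y))%:E <=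
   (32 * C ^+ 2 * fine (leb D) * n%:R * (2 * pi) ^+ n * d)%:E)%E.
Proof.
move=> d0 d1; pose B x y := (\1_D x + \1_D y) * spread d (rowt x - rowt y).
have B0 x y : 0 <= B x y by rewrite mulr_ge0 ?spread_ge0// addr_ge0// indicE.
have mB : mfunT (fun z : T * T => B z.1 z.2). apply: mfunM; last exact: mspread.
  by apply: mfunD; apply: mI; [exact: measurable_fst|exact: measurable_snd].
pose c := n%:R * (2 * d * (2 * pi) ^+ n).
have ic x : (\int[leb]_y (spread d (x - rowt y))%:E = c%:E)%E by exact: integral_spread.
have ic' y : (\int[leb]_x (spread d (rowt x - y))%:E = c%:E)%E. by under eq_integral do rewrite spreadC; exact: ic.
have iD : (\int[leb]_y (\1_D y : R)%:E = leb D)%E by rewrite integral_indic// setIT.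
have e1 : (\int[leb]_x \int[leb]_y (\1_D y * spread d (rowt x - rowt y))%:E = leb D * c%:E)%E.
  rewrite (@tonelli_convolution R n (\1_D) (spread d) c) ?iD//; [exact: mspread|by move=> x; exact: spread_ge0].
have c0 : 0 <= c by rewrite !mulr_ge0 ?exprn_ge0 ?mulr_ge0 ?pi_ge0 ?(ltW d0).
have ms1 x : mfunT (fun y : T => spread d (rowt x - rowt y)).
  rewrite (_ : (fun y : T => _) = (fun z : T * T => spread d (rowt z.1 - rowt z.2)) \o pair x)//.
  by apply: mcompT (mspread d0) _; exact: measurable_pair1.
have e2 : (\int[leb]_x \int[leb]_y (\1_D x * spread d (rowt x - rowt y))%:E = leb D * c%:E)%E.
  rewrite -iD -ge0_integralZr//; last by apply/mEFinP.
  apply: eq_integral => x _; under eq_integral do rewrite EFinM. rewrite ge0_integralZl ?ic// ?lee_fin ?indicE//.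
  - exact/mEFinP.
  - by move=> y _; rewrite lee_fin spread_ge0.
have mm (h : T -> R) (pr : T * T -> T) : mfunT h -> mfunT pr ->
    mfunT (fun z : T * T => (h (pr z) * spread d (rowt z.1 - rowt z.2))%:E).
  move=> mh mpr; apply/mEFinP; apply: mfunM; last exact: mspread.
  exact: mcompT mh mpr.
have p0 (i : T -> R) (pr : T * T -> T) z : (forall t, 0 <= i t) ->
    (0 <= (i (pr z) * spread d (rowt z.1 - rowt z.2))%:E)%E. by move=> i0; rewrite lee_fin mulr_ge0 ?spread_ge0.
have eB : (\int[leb]_x \int[leb]_y (B x y)%:E = (2 * fine (leb D) * c)%:E)%E.
  transitivity (\int[leb]_x (\int[leb]_y (\1_D x * spread d (rowt x - rowt y))%:E +
      \int[leb]_y (\1_D y * spread d (rowt x - rowt y))%:E))%E. apply: eq_integral => x _; rewrite -ge0_integralD//.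
    - by apply: eq_integral => y _; rewrite -EFinD -mulrDl.
    - by move=> y _; rewrite lee_fin mulr_ge0 ?spread_ge0// indicE.
    - by apply/mEFinP; apply: mfunM => //.
    - by move=> y _; rewrite lee_fin mulr_ge0 ?spread_ge0// indicE.
    - by apply/mEFinP; apply: mfunM => //. have i0 t : 0 <= \1_D t :> R by rewrite indicE.
  have m1D : mfunT (\1_D : T -> R) by []. rewrite ge0_integralD//.
  - rewrite e1 e2 -(@fineK _ (leb D)) ?ge0_fin_numE//. by rewrite -!EFinM -EFinD; congr EFin; ring.
  - by move=> x _; apply: integral_ge0 => y _; rewrite lee_fin mulr_ge0 ?spread_ge0.
  - exact: (@mfubini_F _ _ T T R leb _ (mm _ _ m1D (@measurable_fst _ _ T T)) (fun z => p0 _ (@fst T T) z i0)).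
  - by move=> x _; apply: integral_ge0 => y _; rewrite lee_fin mulr_ge0 ?spread_ge0.
  - exact: (@mfubini_F _ _ T T R leb _ (mm _ _ m1D (@measurable_snd _ _ T T)) (fun z => p0 _ (@snd T T) z i0)).
have C8 : 0 <= 8 * C ^+ 2 by rewrite mulr_ge0// sqr_ge0.
apply: (@le_trans _ _ (\int[leb]_x \int[leb]_y (8 * C ^+ 2 * B x y)%:E)%E); last first.
  rewrite (_ : integral _ _ _ = (8 * C ^+ 2)%:E * \int[leb]_x \int[leb]_y (B x y)%:E)%E.
    by rewrite eB -EFinM lee_fin /c le_eqVlt; apply/orP; left; apply/eqP; ring. rewrite -ge0_integralZl//.
  - apply: eq_integral => x _; under eq_integral do rewrite EFinM. rewrite ge0_integralZl//.
    + apply/mEFinP; rewrite (_ : B x = (fun z : T * T => B z.1 z.2) \o pair x)//.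
      by apply: mcompT mB _; exact: measurable_pair1.
    + by move=> y _; rewrite lee_fin.
  - have mB' : mfunT (fun z : T * T => (B z.1 z.2)%:E) by exact/mEFinP.
    by apply: (@mfubini_F _ _ T T R leb _ mB') => z; rewrite lee_fin.
  - by move=> x _; apply: integral_ge0 => y _; rewrite lee_fin.
have mEP : mfunT (fun z : T * T => (E z.1 z.2 * poissonw d (rowt z.1 - rowt z.2))%:E).
  by apply/mEFinP; apply: mfunM => //; exact: mpoissonw.
have mBP : mfunT (fun z : T * T => (8 * C ^+ 2 * B z.1 z.2)%:E).
  by apply/mEFinP; apply: mfunM.
have EP0 z : (0 <= (E z.1 z.2 * poissonw d (rowt z.1 - rowt z.2))%:E)%E. by rewrite lee_fin mulr_ge0// poissonw_ge0.
have BP0 z : (0 <= (8 * C ^+ 2 * B z.1 z.2)%:E)%E by rewrite lee_fin mulr_ge0.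
apply: ge0_le_integral => //.
- by move=> x _; apply: integral_ge0 => y _; exact: (EP0 (x, y)).
- exact: (@mfubini_F _ _ T T R leb _ mEP EP0).
- exact: (@mfubini_F _ _ T T R leb _ mBP BP0).
move=> x _; apply: ge0_le_integral => //.
- by move=> y _; exact: (EP0 (x, y)).
- rewrite (_ : (fun y : T => _) = (fun z : T * T => (E z.1 z.2 * poissonw d (rowt z.1 - rowt z.2))%:E) \o pair x)//.
  by apply: mcompT mEP _; exact: measurable_pair1.
- rewrite (_ : (fun y : T => _) = (fun z : T * T => (8 * C ^+ 2 * B z.1 z.2)%:E) \o pair x)//.
  by apply: mcompT mBP _; exact: measurable_pair1.
move=> y _; rewrite lee_fin; apply: le_trans (ler_wpM2r (poissonw_ge0 _ d0) (E_le x y)) _.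
rewrite -[leLHS]mulrA -[leLHS]mulrA ler_wpM2l// ler_wpM2l ?spread_le//.
Qed.

Let mcc : mfunT (fun z : T * T => cc z.1 z.2).
Proof. by apply: mfunD; apply: mfunM. Qed.

Let ccP d (z : T * T) := cc z.1 z.2 * poissonw d (rowt z.1 - rowt z.2).

Let ccg x y : `|cc x y| <= g x * g y.
Proof.
apply: (@le_trans _ _ ((`|a (rowt x)| + `|b (rowt x)|) * (`|a (rowt y)| + `|b (rowt y)|))).
  apply: le_trans (ler_normD _ _) _; rewrite !normrM mulrDl !mulrDr.
  have : 0 <= `|a (rowt x)| * `|b (rowt y)| by rewrite mulr_ge0.
  have : 0 <= `|b (rowt x)| * `|a (rowt y)| by rewrite mulr_ge0. by lra.
by apply: ler_pM; rewrite ?addr_ge0// ag.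
Qed.

Let iccP d : 0 < d -> leb.-integrable setT (fun x => (\int[leb]_y ccP d (x, y))%:E).
Proof.
move=> d0; apply: (@intg_inner1 _ _ _ _ R leb leb (ccP d) g (fun y => (2 / d) ^+ n * g y)) => //.
- by apply: mfunM => //; exact: mpoissonw.
- by have := integrableZl measurableT ((2 / d) ^+ n) ig.
move=> x y; rewrite normrM mulrCA mulrC ler_pM//; first by rewrite ger0_norm ?poissonw_max ?poissonw_ge0.
Qed.

Let ibP d (x : X) (h : T -> R) (K : R) : 0 < d -> mfunT h -> (forall y, `|h y| <= K) ->
  leb.-integrable setT (fun y => (h y * poissonw d (x - rowt y))%:E).
Proof.
move=> d0 mh hK; have mP : mfunT (fun y : T => poissonw d (x - rowt y)).
  rewrite (_ : (fun y : T => _) = (fun z : T * T => poissonw d (rowt z.1 - rowt z.2)) \o pair (tupr x)).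
    by apply: mcompT (mpoissonw d0) _; exact: measurable_pair1.
  by apply/funext => y /=; rewrite tuprK.
have iP : leb.-integrable setT (fun y => (poissonw d (x - rowt y))%:E).
  apply/integrableP; split; first exact/mEFinP. under eq_integral do rewrite /= ger0_norm ?poissonw_ge0//.
  by rewrite integral_poissonw// ltry.
have := integrableZl measurableT K iP; apply: le_integrable => //. by apply/mEFinP; apply: mfunM.
move=> y _; rewrite -EFinM /= lee_fin normrM [leRHS]normrM ler_wpM2r//.
exact: le_trans (hK y) (ler_norm _).
Qed.

(** Polarization: twice the real part of f(x) times the conjugate of f(y) is |f(x)|^2 + |f(y)|^2 -
    |f(x) - f(y)|^2. The first two terms see only the mass (2 pi)^n of the kernel, the last one is
    the error. *)
Lemma damped_integral d : 0 < d -> d <= 1 -> `|\int[leb]_xi (expw d (rowt xi) * normsq (fourier f (rowt xi))) -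
    (2 * pi) ^+ n * \int[leb]_x normsq (f (rowt x))| <= 32 * C ^+ 2 * fine (leb D) * n%:R * (2 * pi) ^+ n * d.
Proof.
move=> d0 d1; rewrite (damped_fourier d0).2.
have -> : \int[leb]_x normsq (f (rowt x)) = \int[leb]_x S x by apply: eq_Rintegral.
have Cge : 0 <= C ^+ 2 by exact: sqr_ge0.
pose c1 x := \int[leb]_y ccP d (x, y).
pose e2 x := (\int[leb]_y (S y * poissonw d (rowt x - rowt y))%:E)%E.
pose e3 x := (\int[leb]_y (E x y * poissonw d (rowt x - rowt y))%:E)%E.
have [_ Ha Hb _ _] := HC.
have SC x : `|S x| <= C ^+ 2 + C ^+ 2.
  by rewrite ger0_norm// lerD// -[leLHS]real_normK ?num_real// lerXn2r ?nnegrE ?(ltW C0).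
have gC x : g x <= 2 * C. by rewrite /g indicE ler_piMr ?mulr_ge0 ?(ltW C0)// lern1 leq_b1.
have g0 x : 0 <= g x by rewrite (le_trans _ (ag x))// addr_ge0.
have ccC x y : `|cc x y| <= 4 * C ^+ 2.
  apply: le_trans (ccg x y) _; rewrite (_ : 4 * C ^+ 2 = (2 * C) * (2 * C)); last by ring. by apply: ler_pM.
have sec (h : T * T -> R) x : mfunT h -> mfunT (fun y => h (x, y)).
  by move=> mh; apply: mcompT mh _; exact: measurable_pair1.
have key x : ((2 * c1 x)%:E + e3 x = ((2 * pi) ^+ n * S x)%:E + e2 x)%E.
  have i1 : leb.-integrable setT (fun y => (2 * ccP d (x, y))%:E).
    have /(integrableZl measurableT 2) := ibP (rowt x) d0 (sec _ x mcc) (ccC x).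
    by apply: eq_integrable => // y _; rewrite -EFinM.
  have i3 : leb.-integrable setT (fun y => (E x y * poissonw d (rowt x - rowt y))%:E).
    have -> : (fun y => (E x y * poissonw d (rowt x - rowt y))%:E) =
        (fun y => (S x * poissonw d (rowt x - rowt y))%:E + (S y * poissonw d (rowt x - rowt y))%:E -
        (2 * ccP d (x, y))%:E)%E. by apply/funext => y; rewrite -!EFinD; congr EFin; rewrite /E /S /ccP /cc /=; ring.
    apply: integrableB => //; apply: integrableD => //; first exact: (@ibP d (rowt x) (fun=> S x) _ d0 (measurable_cst _) (fun=> SC x)).
    exact: (ibP (rowt x) d0 mS SC). have -> : (2 * c1 x)%:E = (\int[leb]_y (2 * ccP d (x, y))%:E)%E.
    rewrite /c1 EFinM /Rintegral fineK.
      by under [RHS]eq_integral do rewrite EFinM; rewrite integralZl//; exact: (ibP (rowt x) d0 (sec _ x mcc) (ccC x)).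
    by apply: integrable_fin_num => //; exact: (ibP (rowt x) d0 (sec _ x mcc) (ccC x)).
  have -> : ((2 * pi) ^+ n * S x)%:E = (\int[leb]_y (S x * poissonw d (rowt x - rowt y))%:E)%E.
    rewrite mulrC EFinM -(integral_poissonw (rowt x) d0) -ge0_integralZl//.
    - by apply/mEFinP; exact: (sec (fun z => poissonw d (rowt z.1 - rowt z.2)) x (mpoissonw d0)).
    - by move=> y _; rewrite lee_fin poissonw_ge0.
    - by rewrite lee_fin. rewrite /e3 /e2 -!integralD//.
  - by apply: eq_integral => y _; rewrite -!EFinD; congr EFin; rewrite /E /S /ccP /cc /=; ring.
  - exact: (@ibP d (rowt x) (fun=> S x) _ d0 (measurable_cst _) (fun=> SC x)).
  - exact: (ibP (rowt x) d0 mS SC).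
have e3le := error d0 d1.
have P0 (u : T * T -> R) : (forall z, 0 <= u z) -> forall z : T * T, (0 <= (u z * poissonw d (rowt z.1 - rowt z.2))%:E)%E.
  by move=> u0 z; rewrite lee_fin mulr_ge0// poissonw_ge0.
have mP (u : T * T -> R) : mfunT u ->
    mfunT (fun z : T * T => (u z * poissonw d (rowt z.1 - rowt z.2))%:E).
  by move=> mu; apply/mEFinP; apply: mfunM => //; exact: mpoissonw.
have mS2 : mfunT (fun z : T * T => S z.2). by apply: mcompT mS _; exact: measurable_snd.
have int2 : (\int[leb]_x e2 x = \int[leb]_x (S x)%:E * ((2 * pi) ^+ n)%:E)%E.
  apply: (@tonelli_convolution R n S (poissonw d)) => //.
  - exact: mpoissonw.
  - by move=> x; exact: poissonw_ge0.
  - by move=> y; under eq_integral do rewrite poissonwC; exact: integral_poissonw.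
have e2ge x : (0 <= e2 x)%E by apply: integral_ge0 => y _; rewrite lee_fin mulr_ge0// poissonw_ge0.
have e3ge x : (0 <= e3 x)%E by apply: integral_ge0 => y _; rewrite lee_fin mulr_ge0// poissonw_ge0.
have NE : (\int[leb]_x (S x)%:E = (\int[leb]_x S x)%:E)%E. by rewrite /Rintegral fineK//; exact: integrable_fin_num iS.
have ii2 : leb.-integrable setT e2. apply/integrableP; split.
    exact: (@mfubini_F _ _ T T R leb _ (mP _ mS2) (P0 (fun z => S z.2) (fun z => S_ge0 z.2))).
  by under eq_integral do rewrite gee0_abs//; rewrite int2 NE -EFinM ltry.
have ii3 : leb.-integrable setT e3. apply/integrableP; split.
    exact: (@mfubini_F _ _ T T R leb _ (mP _ mE) (P0 (fun z => E z.1 z.2) (fun z => E_ge0 z.1 z.2))).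
  by under eq_integral do rewrite gee0_abs//; rewrite (le_lt_trans e3le)// ltry.
have iic : leb.-integrable setT (fun x => (2 * c1 x)%:E). have := integrableZl measurableT 2 (iccP d0).
  by apply: eq_integrable => // x _; rewrite -EFinM.
have iis : leb.-integrable setT (fun x => ((2 * pi) ^+ n * S x)%:E).
  have := integrableZl measurableT ((2 * pi) ^+ n) iS. by apply: eq_integrable => // x _; rewrite -EFinM.
have : (\int[leb]_x ((2 * c1 x)%:E + e3 x) = \int[leb]_x (((2 * pi) ^+ n * S x)%:E + e2 x))%E.
  by apply: eq_integral => x _; exact: key.
rewrite (integralD measurableT iic ii3) (integralD measurableT iis ii2) int2 NE.
have -> : (\int[leb]_x (2 * c1 x)%:E = (2 * \int[leb]_x c1 x)%:E)%E. under eq_integral do rewrite EFinM.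
  by rewrite integralZl//; [rewrite EFinM /Rintegral fineK//; exact: integrable_fin_num (iccP d0)|exact: iccP].
have -> : (\int[leb]_x ((2 * pi) ^+ n * S x)%:E = ((2 * pi) ^+ n * \int[leb]_x S x)%:E)%E.
  under eq_integral do rewrite EFinM. by rewrite integralZl// NE.
have i3fin : (\int[leb]_x e3 x)%E \is a fin_num by exact: integrable_fin_num ii3.
have e3pos : 0 <= fine (\int[leb]_x e3 x)%E by apply: fine_ge0; exact: integral_ge0.
move: e3le; rewrite -/(e3 _) -(fineK i3fin) lee_fin; set K := (X in _ <= X).
move=> e3le; rewrite -EFinM -!EFinD => -[] H.
have -> : \int[leb]_x \int[leb]_y (cc x y * poissonw d (rowt x - rowt y)) =
  (2 * pi) ^+ n * \int[leb]_x S x - fine (\int[leb]_x e3 x)%E / 2.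
  have -> : \int[leb]_x \int[leb]_y (cc x y * poissonw d (rowt x - rowt y)) = \int[leb]_x c1 x by []. by lra.
rewrite -/K; move: K e3le e3pos => K; move: (fine _) ((2 * pi) ^+ n * _) => u v uK u0.
by rewrite ler_norml; apply/andP; split; lra.
Qed.

(** The damped transform is integrable, hence measurable, and the factor [expw (- 1)] undoes the
    damping. *)
Lemma measurable_fourier : mfunT (fun xi : T => normsq (fourier f (rowt xi))).
Proof.
have -> : (fun xi : T => normsq (fourier f (rowt xi))) =
    (fun xi => expw (- 1) (rowt xi) * (expw 1 (rowt xi) * normsq (fourier f (rowt xi)))).
  apply/funext => xi; rewrite mulrA /expw -big_split/= big1 ?mul1r// => i _.
  by rewrite -expRD mulN1r opprK mul1r subrr expR0.
apply: mfunM; first exact: measurable_expw.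
by apply/mEFinP; case/integrableP: (damped_fourier (@ltr01 R)).1.
Qed.

(** Monotone convergence as the damping d = 1/(k+1) decreases to 0; [damped_integral] gives the
    limit of the integrals. *)
Lemma plancherel : (\int[leb]_xi (normsq (fourier f (rowt xi)))%:E =
  ((2 * pi) ^+ n)%:E * \int[leb]_x (normsq (f (rowt x)))%:E)%E.
Proof.
pose d k : R := k.+1%:R^-1.
have d0 k : 0 < d k by rewrite invr_gt0.
have d1 k : d k <= 1 by rewrite invf_le1// ler1n.
pose F := fun xi : T => normsq (fourier f (rowt xi)).
have F0 xi : 0 <= F xi by rewrite addr_ge0// sqr_ge0.
have mF : mfunT F by exact: measurable_fourier.
have mdF k : mfunT (fun xi : T => expw (d k) (rowt xi) * F xi).
  by apply: mfunM => //; exact: measurable_expw.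
have NE : (\int[leb]_x (normsq (f (rowt x)))%:E = (\int[leb]_x normsq (f (rowt x)))%:E)%E.
  by rewrite /Rintegral fineK//; exact: integrable_fin_num iS.
rewrite NE -EFinM.
have expE k xi : expw (d k) xi = expR (- (d k * \sum_i `|xi 0 i|)). by rewrite mulr_sumr -sumrN expR_sum.
have cvg_d : d @ \oo --> (0 : R). by have := @cvg_harmonic R.
have mono : forall xi : T, nondecreasing_seq (fun k => (expw (d k) (rowt xi) * F xi)%:E).
  move=> xi k l kl; rewrite lee_fin ler_wpM2r// !expE ler_expR lerN2 ler_wpM2r//. by rewrite sumr_ge0.
  by rewrite /d lef_pV2 ?posrE// ler_nat.
have mdFE k : mfunT (fun xi : T => (expw (d k) (rowt xi) * F xi)%:E). exact/mEFinP.
have dF0 k (xi : T) : setT xi -> (0 <= (expw (d k) (rowt xi) * F xi)%:E)%E.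
  by move=> _; rewrite lee_fin mulr_ge0// expw_ge0.
have lim1 := @cvg_monotone_convergence _ T R leb setT measurableT (fun k xi => (expw (d k) (rowt xi) * F xi)%:E)
  mdFE dF0 (fun xi _ => mono xi).
have limF xi : limn (fun k => (expw (d k) (rowt xi) * F xi)%:E) = (F xi)%:E.
  apply/cvg_lim => //; apply: cvg_EFin; first by near=> k.
  rewrite -[X in _ --> X]mul1r; apply: cvgM; last exact: cvg_cst. under eq_fun do rewrite expE.
  set s := \sum_i _; have H : (fun k => - (d k * s)) @ \oo --> (0 : R).
    rewrite -[X in _ --> X]oppr0; apply: cvgN; rewrite -[X in _ --> X](mul0r s). by apply: cvgM => //; exact: cvg_cst.
  rewrite -expR0; exact: (cvg_comp _ _ H (@continuous_expR R 0)).
have eqF : (\int[leb]_xi (F xi)%:E = \int[leb]_xi limn (fun k => (expw (d k) (rowt xi) * F xi)%:E))%E.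
  by apply: eq_integral => xi _; rewrite limF.
rewrite -/(F _) eqF; apply: (cvg_unique _ lim1). by [].
have -> : (fun k => \int[leb]_xi (expw (d k) (rowt xi) * F xi)%:E)%E =
    (fun k => (\int[leb]_xi (expw (d k) (rowt xi) * F xi))%:E).
  by apply/funext => k; rewrite /Rintegral fineK//; exact: integrable_fin_num (damped_fourier (d0 k)).1.
apply: cvg_EFin; first by near=> k.
set N := (X in _ --> X); apply/cvgrPdist_le => e e0.
set K := 32 * C ^+ 2 * fine (leb D) * n%:R * (2 * pi) ^+ n.
have : (fun k => K * d k) @ \oo --> (0 : R). by rewrite -(mulr0 K); apply: cvgM => //; exact: cvg_cst.
move=> /cvgrPdist_le/(_ e e0); apply: filterS => k; rewrite sub0r normrN => h.
rewrite distrC; apply: le_trans (damped_integral (d0 k) (d1 k)) _.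
exact: le_trans (ler_norm _) h.
Unshelve. all: by end_near.
Qed.

End plancherel_identity.

Local Open Scope complex_scope.

(** * Complex calculus and Sobolev norms *)
Section mixed_partials.
Context (R : realType) (n : nat).
Notation X := 'rV[R]_n.
Notation ev i := (delta_mx 0 i : X).

(** The mean value theorem is applied to the increment of [f] in direction j, along direction i,
    then to the partial derivative along direction j. *)
Lemma mixed_difference (f : X -> R) (i j : 'I_n) (x : X) (a : R) : smooth setT f ->
  exists c d, [/\ `|c| <= `|a|, `|d| <= `|a| &
    f (a *: ev i + (a *: ev j + x)) - f (a *: ev i + x) - f (a *: ev j + x) + f x =
    a * (a * partial j (partial i f) (d *: ev j + (c *: ev i + x)))].
Proof.
(* The translation is written [1 *: (y - z)] to fit [smooth_affine]. *)
move=> Hf; pose z := - (a *: ev j).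
have zE y : 1 *: (y - z) = a *: ev j + y by rewrite scale1r opprK addrC.
have Hg : smooth setT (fun y => f (1 *: (y - z)) - f y).
  by apply: smoothB => //; [exact: openT|exact: smooth_affine openT Hf].
have dg (y : X) : 'D_(ev i) (fun y => f (1 *: (y - z)) - f y) y = partial i f (a *: ev j + y) - partial i f y.
  rewrite (@deriveB _ _ _ (fun y => f (1 *: (y - z))) f).
  - by rewrite -[X in X - _]/(partial i (fun y => f (1 *: (y - z))) y) partial_affine// mul1r zE.
  - exact: smooth_der (smooth_affine _ _ openT Hf) I.
  - exact: smooth_der Hf I.
have [c ca Ec] := @line_MVT R _ _ x (ev i) a (fun s _ => @smooth_der _ _ setT _ _ i Hg I).
have [d da Ed] := @line_MVT R _ (partial i f) (c *: ev i + x) (ev j) a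
  (fun s _ => @smooth_der _ _ setT _ _ j (smooth_partial i Hf) I).
exists c, d; split => //; move: Ec; rewrite dg Ed !zE => <-.
by rewrite [a *: ev i + (a *: _ + _)]addrCA opprB [RHS]addrA [RHS]addrAC.
Qed.

(** The second difference is symmetric in i and j, and divided by a^2 it is a value near x of either
    mixed derivative. *)
Lemma partialC (f : X -> R) i j x : smooth setT f -> partial i (partial j f) x = partial j (partial i f) x.
Proof.
move=> Hf; apply/eqP; rewrite eq_sym -subr_eq0 -normr_le0; apply/ler_addgt0Pl => e e0; rewrite addr0.
have close2 (w p q : R) : `|w - p| <= e / 2 -> `|w - q| <= e / 2 -> `|p - q| <= e.
  move=> hp hq; rewrite (_ : p - q = (w - q) - (w - p)); last by ring. by apply: le_trans (ler_normB _ _) _; lra.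
have cij (k l : 'I_n) : exists2 s : R, 0 < s & forall c d, `|c| <= s -> `|d| <= s ->
    `|partial l (partial k f) (d *: ev l + (c *: ev k + x)) - partial l (partial k f) x| <= e / 2.
  have e2 : 0 < e / 2 by rewrite divr_gt0.
  have := smooth_cont (smooth_partial l (smooth_partial k Hf)) (I : setT x).
  move=> /cvgrPdist_le/(_ _ e2)/nbhs_ballP[s /= s0 Hs]; exists (s / 4); first by rewrite divr_gt0.
  move=> c d hc hd; rewrite distrC; apply: Hs; rewrite -ball_normE /= addrA opprD addrCA subrr addr0 normrN.
  apply: le_lt_trans (ler_normD _ _) _; rewrite !normrZ. have ev1 (m : 'I_n) : `|ev m| <= 1.
    by apply: norm_row_le => // o; rewrite mxE eqxx/= normr_nat lern1 leq_b1.
  have : `|d| * `|ev l| <= s / 4 * 1 by rewrite ler_pM. have : `|c| * `|ev k| <= s / 4 * 1 by rewrite ler_pM. lra.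
have [s1 s10 H1] := cij i j; have [s2 s20 H2] := cij j i.
pose a := Num.min s1 s2; have a0 : 0 < a by rewrite lt_min s10.
have [c [d [ca da E1]]] := mixed_difference i j x a Hf.
have [c' [d' [c'a d'a E2]]] := mixed_difference j i x a Hf.
have aE : `|a| = a by rewrite gtr0_norm.
rewrite !aE in ca da c'a d'a.
have as1 : a <= s1 by rewrite ge_min lexx. have as2 : a <= s2 by rewrite ge_min lexx orbT.
have := H1 _ _ (le_trans ca as1) (le_trans da as1).
have := H2 _ _ (le_trans c'a as2) (le_trans d'a as2).
have aN : a != 0 by rewrite gt_eqF.
have <- : partial j (partial i f) (d *: ev j + (c *: ev i + x)) =
    partial i (partial j f) (d' *: ev i + (c' *: ev j + x)).
  have E12 : f (a *: ev i + (a *: ev j + x)) - f (a *: ev i + x) - f (a *: ev j + x) + f x =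
      f (a *: ev j + (a *: ev i + x)) - f (a *: ev j + x) - f (a *: ev i + x) + f x.
    by rewrite [a *: ev i + (a *: _ + _)]addrCA; congr (_ + _); rewrite addrAC.
  exact: (mulfI aN (mulfI aN (etrans (esym E1) (etrans E12 E2)))).
set u := partial j _ (_ + _); move=> h2 h1.
exact: (close2 u).
Qed.

End mixed_partials.

(** * Partial derivatives and supports of complex functions *)

Section complex_calculus.
Context (R : realType) (n : nat).
Notation X := 'rV[R]_n.
Notation C := R[i].
Implicit Types f g : X -> C.

Definition smoothC f := smooth setT (fun x => complex.Re (f x)) /\ smooth setT (fun x => complex.Im (f x)).

Definition cpart i f (x : X) : C := partial i (fun x => complex.Re (f x)) x +i* partial i (fun x => complex.Im (f x)) x.

Definition suppC (y0 : X) (r : R) f := forall x, r < `|x - y0| -> f x = 0.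

Lemma RecM (z w : C) : complex.Re (z * w) = complex.Re z * complex.Re w - complex.Im z * complex.Im w.
Proof. by case: z; case: w. Qed.
Lemma ImcM (z w : C) : complex.Im (z * w) = complex.Re z * complex.Im w + complex.Im z * complex.Re w.
Proof. by case: z; case: w. Qed.
Lemma ReD (z w : C) : complex.Re (z + w) = complex.Re z + complex.Re w.
Proof. by case: z; case: w. Qed.
Lemma ImD (z w : C) : complex.Im (z + w) = complex.Im z + complex.Im w.
Proof. by case: z; case: w. Qed.
Lemma ReN (z : C) : complex.Re (- z) = - complex.Re z. Proof. by case: z. Qed.
Lemma ImN (z : C) : complex.Im (- z) = - complex.Im z. Proof. by case: z. Qed.

Lemma smoothC_ext f g : f =1 g -> smoothC f -> smoothC g.
Proof. by move=> /funext ->. Qed.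

Lemma smoothC_cst c : smoothC (fun=> c).
Proof. by split; exact: smooth_cst. Qed.

Lemma smoothCD f g : smoothC f -> smoothC g -> smoothC (fun x => f x + g x).
Proof.
move=> [f1 f2] [g1 g2]; split. by under eq_fun do rewrite ReD; apply: smoothD => //; exact: openT.
by under eq_fun do rewrite ImD; apply: smoothD => //; exact: openT.
Qed.

Lemma smoothCM f g : smoothC f -> smoothC g -> smoothC (fun x => f x * g x).
Proof.
move=> [f1 f2] [g1 g2]; split.
  by under eq_fun do rewrite RecM; apply: smoothB; try exact: openT; apply: smoothM => //; exact: openT.
by under eq_fun do rewrite ImcM; apply: smoothD; try exact: openT; apply: smoothM => //; exact: openT.
Qed.

Lemma smoothCZ c f : smoothC f -> smoothC (fun x => c * f x).
Proof. by move=> Hf; apply: smoothCM => //; exact: smoothC_cst. Qed.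

Lemma smoothCN f : smoothC f -> smoothC (fun x => - f x).
Proof. by move=> /(smoothCZ (-1)); apply: smoothC_ext => x; rewrite mulN1r. Qed.

Lemma smoothCB f g : smoothC f -> smoothC g -> smoothC (fun x => f x - g x).
Proof. by move=> Hf Hg; apply: smoothCD => //; exact: smoothCN. Qed.

Lemma smoothC_sum (I : Type) (r : seq I) (P : pred I) (F : I -> X -> C) :
  (forall i, P i -> smoothC (F i)) -> smoothC (fun x => \sum_(i <- r | P i) F i x).
Proof.
move=> H; elim: r => [|i r IH]. by apply: smoothC_ext (smoothC_cst 0) => x; rewrite big_nil.
have [Pi|nPi] := boolP (P i); last first. by apply: smoothC_ext IH => x; rewrite big_cons (negbTE nPi).
by apply: smoothC_ext (smoothCD (H i Pi) IH) => x; rewrite big_cons Pi.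
Qed.

Lemma smoothC_cpart i f : smoothC f -> smoothC (cpart i f).
Proof. by move=> [f1 f2]; split; exact: smooth_partial. Qed.

Lemma smoothC_cont f : smoothC f ->
  continuous (fun x => complex.Re (f x)) /\ continuous (fun x => complex.Im (f x)).
Proof. by move=> [f1 f2]; split => x; [exact: smooth_cont f1 I|exact: smooth_cont f2 I]. Qed.

Lemma cpart_cst i c x : cpart i (fun=> c) x = 0.
Proof. by rewrite /cpart /partial !derive_cst. Qed.

Lemma cpartD i f g x : smoothC f -> smoothC g -> cpart i (fun x => f x + g x) x = cpart i f x + cpart i g x.
Proof.
move=> [f1 f2] [g1 g2]; rewrite /cpart.
under [X in partial i X]eq_fun do rewrite ReD.
under [X in _ +i* partial i X x = _]eq_fun do rewrite ImD.
by rewrite !partialD//; exact: smooth_der I.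
Qed.

Lemma cpartM i f g x : smoothC f -> smoothC g -> cpart i (fun x => f x * g x) x = cpart i f x * g x + f x * cpart i g x.
Proof.
move=> [f1 f2] [g1 g2].
have E h k h' k' : smooth setT h -> smooth setT k -> smooth setT h' -> smooth setT k' ->
    partial i (fun x => h x * k x + h' x * k' x) x =
    partial i h x * k x + h x * partial i k x + (partial i h' x * k' x + h' x * partial i k' x).
  move=> Hh Hk Hh' Hk'; rewrite partialD ?partialM//; try exact: smooth_der I.
  - by apply: (@smooth_der _ _ setT) I; apply: smoothM => //; exact: openT.
  - by apply: (@smooth_der _ _ setT) I; apply: smoothM => //; exact: openT.
have N h : smooth setT h -> smooth setT (fun x => - h x) /\ partial i (fun x => - h x) x = - partial i h x.
  move=> Hh; split; first by apply: smoothN => //; exact: openT.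
  by rewrite -[LHS]/('D_(delta_mx 0 i) (- h) x) deriveN//; exact: smooth_der Hh I.
rewrite /cpart.
under [X in partial i X]eq_fun do rewrite RecM -mulNr.
under [X in _ +i* partial i X x = _]eq_fun do rewrite ImcM.
have [N1 N2] := N _ f2; rewrite !E// N2; apply/eqP; rewrite eq_complex /=.
by case: (f x) => p q; case: (g x) => p' q' /=; apply/andP; split; apply/eqP; ring.
Qed.

Lemma cpartZ i c f x : smoothC f -> cpart i (fun x => c * f x) x = c * cpart i f x.
Proof. by move=> Hf; rewrite (@cpartM i (fun=> c))//; [rewrite cpart_cst mul0r add0r|exact: smoothC_cst]. Qed.

Lemma cpartN i f x : smoothC f -> cpart i (fun x => - f x) x = - cpart i f x.
Proof. by move=> Hf; rewrite -mulN1r -cpartZ//; under [in RHS]eq_fun do rewrite mulN1r. Qed.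

Lemma cpartB i f g x : smoothC f -> smoothC g -> cpart i (fun x => f x - g x) x = cpart i f x - cpart i g x.
Proof. by move=> Hf Hg; rewrite (@cpartD i f (fun x => - g x)) ?cpartN//; exact: smoothCN. Qed.

Lemma cpart_sum i (I : Type) (r : seq I) (P : pred I) (F : I -> X -> C) x : (forall i, P i -> smoothC (F i)) ->
  cpart i (fun x => \sum_(j <- r | P j) F j x) x = \sum_(j <- r | P j) cpart i (F j) x.
Proof.
move=> H; elim: r => [|j r IH]. by rewrite big_nil; under [X in cpart _ X]eq_fun do rewrite big_nil; exact: cpart_cst.
rewrite big_cons; under [X in cpart _ X]eq_fun do rewrite big_cons.
by case: ifP => Pj //; rewrite cpartD ?IH//; [exact: H|exact: smoothC_sum].
Qed.

Lemma cpartC i j f x : smoothC f -> cpart i (cpart j f) x = cpart j (cpart i f) x.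
Proof. by move=> [f1 f2]; rewrite /cpart/= (partialC i j x f1) (partialC i j x f2). Qed.

Lemma suppC_Re y0 r f : suppC y0 r f -> supp_in y0 r (fun x => complex.Re (f x)).
Proof. by move=> H x /H ->. Qed.
Lemma suppC_Im y0 r f : suppC y0 r f -> supp_in y0 r (fun x => complex.Im (f x)).
Proof. by move=> H x /H ->. Qed.

Lemma suppC_cpart i y0 r f : suppC y0 r f -> suppC y0 r (cpart i f).
Proof.
move=> H x xr; rewrite /cpart (supp_in_partial _ (suppC_Re H))//.
by rewrite (supp_in_partial _ (suppC_Im H)).
Qed.

Lemma suppC_le y0 r s f : r <= s -> suppC y0 r f -> suppC y0 s f.
Proof. by move=> rs H x /(le_lt_trans rs); exact: H. Qed.

Lemma suppCD y0 r f g : suppC y0 r f -> suppC y0 r g -> suppC y0 r (fun x => f x + g x).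
Proof. by move=> Hf Hg x xr; rewrite Hf// Hg// addr0. Qed.
Lemma suppCMl y0 r f g : suppC y0 r f -> suppC y0 r (fun x => f x * g x).
Proof. by move=> Hf x /Hf ->; rewrite mul0r. Qed.
Lemma suppCMr y0 r f g : suppC y0 r g -> suppC y0 r (fun x => f x * g x).
Proof. by move=> Hf x /Hf ->; rewrite mulr0. Qed.

Lemma normsqM (z w : C) : normsq (z * w) = normsq z * normsq w.
Proof. by case: z => a b; case: w => c d; rewrite /normsq /=; ring. Qed.
Lemma normsq_ge0 (z : C) : 0 <= normsq z. Proof. by rewrite addr_ge0 ?sqr_ge0. Qed.
Lemma normsqD (z w : C) : normsq (z + w) <= 2 * normsq z + 2 * normsq w.
Proof.
case: z => a b; case: w => c d; rewrite /normsq /=.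
have : 0 <= (a - c) ^+ 2 by exact: sqr_ge0.
have : 0 <= (b - d) ^+ 2 by exact: sqr_ge0.
nra.
Qed.
Lemma normsqN (z : C) : normsq (- z) = normsq z.
Proof. by case: z => a b; rewrite /normsq /= !sqrrN. Qed.

End complex_calculus.

(** * Fourier transform of derivatives; interpolation *)

Section fourier_partial.
Context (R : realType) (n : nat).
Notation X := 'rV[R]_n.
Notation T := (n.-tuple R).
Notation leb := (leb R n).

(** Cosine and sine form one family indexed by quarter turns: a derivative in the i-th coordinate
    raises [k] by one and multiplies by the i-th frequency. *)
Let wave (xi : X) (k : nat) (x : X) : R := cos (dotrow x xi + k%:R * (pi / 2)).

Let smooth_dot (xi : X) : smooth setT (fun x => dotrow x xi).
Proof.
have -> : (fun x => dotrow x xi) = (fun x => \sum_j x 0 j * xi 0 j) by apply/funext => x; rewrite dotrowE.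
by apply: smooth_sum => [|j _]; [exact: openT|apply: smoothM => //; [exact: openT|exact: smooth_coord|exact: smooth_cst]].
Qed.

Let is_derive_wave k s : is_derive s (1 : R) (fun s => cos (s + k%:R * (pi / 2))) (cos (s + k.+1%:R * (pi / 2))).
Proof.
have h : is_derive s (1 : R) (fun s : R => s + k%:R * (pi / 2)) (1 + 0). exact: is_deriveD.
have := @is_derive1_comp R cos (fun s : R => s + k%:R * (pi / 2)) s _ _ (is_derive_cos _) h.
suff -> : cos (s + k.+1%:R * (pi / 2)) = - sin (s + k%:R * (pi / 2)) * (1 + 0) by [].
rewrite addr0 mulr1 -cosDpihalf; congr cos.
by rewrite -[k.+1%:R]natr1 [(_ + 1) * _]mulrDl mul1r addrA.
Qed.

Let smooth_wave xi k : smooth setT (wave xi k).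
Proof.
exact: (@smooth1_comp R n setT setT _ (fun k s => cos (s + k%:R * (pi / 2))) k openT (fun _ _ => I)
  (fun k s _ => is_derive_wave k s) (smooth_dot xi)).
Qed.

Let partial_dot i (xi x : X) : partial i (fun x => dotrow x xi) x = xi 0 i.
Proof.
have -> : (fun x : X => dotrow x xi) = (fun x => \sum_j x 0 j * xi 0 j) by apply/funext => y; rewrite dotrowE.
have H j : is_derive x (delta_mx 0 i : X) (fun x : X => x 0 j * xi 0 j) ((i == j)%:R * xi 0 j).
  have H0 := is_derive_coord i j x; apply: is_derive_eq. by rewrite scaler0 add0r -[_ *: _]/(_ * _) mulrC.
have := @is_derive_sum R _ _ n (fun j (x : X) => x 0 j * xi 0 j) x (delta_mx 0 i) _ H.
move=> [_]; rewrite /partial (_ : \sum_(j < n) (fun x : X => x 0 j * xi 0 j) = (fun x => \sum_j x 0 j * xi 0 j)); last first.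
  by apply/funext => y; rewrite fct_sumE.
move=> ->; rewrite (bigD1 i)//= eqxx mul1r big1 ?addr0// => j /negbTE ji.
by rewrite eq_sym ji mul0r.
Qed.

Let partial_wave i xi k x : partial i (wave xi k) x = xi 0 i * wave xi k.+1 x.
Proof.
have [_ ->] := partial1_comp i openT (smooth_dot xi 1%N) (I : setT x) (is_derive_wave k (dotrow x xi)).
by rewrite partial_dot mulrC.
Qed.

Let byparts i xi k (y0 : X) (r : R) (a : X -> R) : smooth setT a -> supp_in y0 r a ->
  \int[leb]_t (wave xi k (rowt t) * partial i a (rowt t)) =
  - xi 0 i * \int[leb]_t (wave xi k.+1 (rowt t) * a (rowt t)).
Proof.
move=> sa za; have sw := smooth_wave xi.
have swa : smooth setT (fun x => wave xi k x * a x) by apply: smoothM => //; exact: openT.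
have := @integral_partial R n y0 r _ i (swa 1%N) (supp_inMr _ za).
have E x : partial i (fun x => wave xi k x * a x) x = xi 0 i * (wave xi k.+1 x * a x) + wave xi k x * partial i a x.
  rewrite partialM ?partial_wave ?mulrA//; [exact: smooth_der (sw k) I|exact: smooth_der sa I].
have sM f g : smooth setT f -> smooth setT g -> continuous (fun x : X => f x * g x).
  by move=> Hf Hg x; apply: (@smooth_cont _ _ setT) I; apply: smoothM => //; exact: openT.
have i1 : leb.-integrable setT (fun t => (wave xi k.+1 (rowt t) * a (rowt t))%:E).
  exact: (intg_ccont (sM _ _ (sw k.+1) sa) (supp_inMr _ za)).
have i2 : leb.-integrable setT (fun t => (wave xi k (rowt t) * partial i a (rowt t))%:E).
  exact: (intg_ccont (sM _ _ (sw k) (smooth_partial i sa)) (supp_inMr _ (supp_in_partial _ za))).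
move=> H0; have : \int[leb]_t (xi 0 i * (wave xi k.+1 (rowt t) * a (rowt t)) +
    wave xi k (rowt t) * partial i a (rowt t)) = 0. rewrite /Rintegral -[RHS]/(fine 0%E) -H0; congr fine.
  by apply: eq_integral => t _; rewrite E.
rewrite RintegralD//; last by have := integrableZl measurableT (xi 0 i) i1.
by rewrite RintegralZl// => /eqP; rewrite addrC addr_eq0 mulNr => /eqP.
Qed.

(** Integration by parts moves the derivative to the wave; the quarter turn thus produced disappears
    in the squared modulus. *)
Lemma fourier_cpart i (y0 : X) (r : R) (f : X -> R[i]) (xi : T) : smoothC f -> suppC y0 r f ->
  normsq (fourier (cpart i f) (rowt xi)) = rowt xi 0 i ^+ 2 * normsq (fourier f (rowt xi)).
Proof.
move=> [sa sb] zf; have za := suppC_Re zf; have zb := suppC_Im zf.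
have sw := smooth_wave (rowt xi).
have cosE x : cos (dotrow x (rowt xi)) = wave (rowt xi) 0 x by rewrite /wave mul0r addr0.
have sinE x : sin (dotrow x (rowt xi)) = - wave (rowt xi) 1 x. by rewrite /wave mul1r cosDpihalf opprK.
have wave2 x : wave (rowt xi) 2 x = - wave (rowt xi) 0 x.
  by rewrite -cosE /wave (_ : 2%:R * (pi / 2) = pi) ?cosDpi//; field.
have iw k g : smooth setT g -> supp_in y0 r g ->
    leb.-integrable setT (fun t => (wave (rowt xi) k (rowt t) * g (rowt t))%:E).
  move=> sg zg; apply: (@intg_ccont R n y0 r (fun x => wave (rowt xi) k x * g x)).
    by move=> x; apply: (@smooth_cont _ _ setT) I; apply: smoothM => //; exact: openT. exact: supp_inMr.
have FE g : smoothC g -> suppC y0 r g -> normsq (fourier g (rowt xi)) =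
    (\int[leb]_t (wave (rowt xi) 0 (rowt t) * complex.Re (g (rowt t))) -
     \int[leb]_t (wave (rowt xi) 1 (rowt t) * complex.Im (g (rowt t)))) ^+ 2 +
    (\int[leb]_t (wave (rowt xi) 0 (rowt t) * complex.Im (g (rowt t))) +
     \int[leb]_t (wave (rowt xi) 1 (rowt t) * complex.Re (g (rowt t)))) ^+ 2. move=> [ga gb] zg; rewrite fourierE.
  have i1 := iw 0%N _ ga (suppC_Re zg); have i2 := iw 0%N _ gb (suppC_Im zg).
  have i3 := iw 1%N _ ga (suppC_Re zg); have i4 := iw 1%N _ gb (suppC_Im zg). rewrite -RintegralB// -RintegralD//.
  by congr (_ ^+ 2 + _ ^+ 2); apply: eq_Rintegral => t _; rewrite cosE sinE; ring.
have sf : smoothC f by [].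
rewrite (FE _ (smoothC_cpart i sf) (suppC_cpart i zf)) (FE _ sf zf) /=.
rewrite !(byparts i _ _ sa za) !(byparts i _ _ sb zb).
have E2 (g : X -> R) : smooth setT g -> supp_in y0 r g -> \int[leb]_t (wave (rowt xi) 2 (rowt t) * g (rowt t)) =
   - \int[leb]_t (wave (rowt xi) 0 (rowt t) * g (rowt t)). move=> sg zg; rewrite -mulN1r -RintegralZl//; last exact: iw.
  by apply: eq_Rintegral => t _; rewrite wave2 mulN1r mulNr.
rewrite (E2 _ sa za) (E2 _ sb zb); ring.
Qed.

End fourier_partial.

Section interpolation.
Context (R : realType) (n : nat).
Notation X := 'rV[R]_n.
Notation T := (n.-tuple R).
Notation leb := (leb R n).

Definition l2n (f : X -> R[i]) : \bar R := (\int[leb]_t (normsq (f (rowt t)))%:E)%E.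

(** If h |x| >= 1 the last term dominates alone. Otherwise x^2 <= h^-2, and x^2 is split into its
    powers of exponent 1 - e and e. *)
Lemma interpolation_symbol (e eps h x N : R) : 0 <= e -> e <= 1 -> e <= eps -> 0 < h -> x ^+ 2 <= N ->
  x ^+ 2 <= h `^ (2 * e - 2) * (1 + N) `^ eps + h ^+ 2 * x ^+ 4.
Proof.
move=> e0 e1 eeps h0 xN; have N1 : 1 <= 1 + N by rewrite lerDl (le_trans _ xN)// sqr_ge0.
have p0 : 0 <= h `^ (2 * e - 2) * (1 + N) `^ eps by rewrite mulr_ge0 ?powR_ge0.
have [xh|xh] := leP 1 (h ^+ 2 * x ^+ 2).
  apply: ler_wpDl => //; rewrite (_ : h ^+ 2 * x ^+ 4 = (h ^+ 2 * x ^+ 2) * x ^+ 2); last by ring.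
  by rewrite -[leLHS]mul1r ler_wpM2r ?sqr_ge0.
apply: ler_wpDr; first by rewrite mulr_ge0 ?sqr_ge0 ?exprn_even_ge0.
have [->|x0] := eqVneq x 0; first by rewrite expr0n.
have x2 : 0 < x ^+ 2 by rewrite exprn_even_gt0.
have xhV : x ^+ 2 <= (h ^+ 2)^-1 by rewrite -[leRHS]mul1r ler_pdivlMr ?exprn_gt0// mulrC ltW.
have -> : x ^+ 2 = (x ^+ 2) `^ (1 - e) * (x ^+ 2) `^ e.
  by rewrite -powRD ?subrK ?powRr1 ?(ltW x2)//; rewrite (gt_eqF x2) implybT.
apply: ler_pM; rewrite ?powR_ge0//. have -> : h `^ (2 * e - 2) = ((h ^+ 2)^-1) `^ (1 - e).
    rewrite -powR_mulrn ?(ltW h0)// -powRN -powRrM; congr (_ `^ _); ring.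
  by apply: ge0_ler_powR; rewrite ?subr_ge0// nnegrE ?(ltW x2)// invr_ge0 sqr_ge0.
apply: (@le_trans _ _ ((1 + N) `^ e)); last exact: ler_powR.
by apply: ge0_ler_powR; rewrite ?nnegrE ?(ltW x2) ?(le_trans ler01 N1)// (le_trans xN)// lerDr.
Qed.

(** By Plancherel this is [interpolation_symbol] at each frequency, with x its i-th coordinate and N
    its squared length. *)
Lemma interpolation (w : X -> R[i]) (y0 : X) (r e eps h : R) i : smoothC w -> suppC y0 r w ->
  0 <= e -> e <= 1 -> e <= eps -> 0 < h -> (l2n (cpart i w) <= (h `^ (2 * e - 2))%:E * sobolev_sq eps w +
     (h ^+ 2)%:E * l2n (cpart i (cpart i w)))%E.
Proof.
move=> sw zw e0 e1 eeps h0; pose N (t : T) := normsq (fourier w (rowt t)).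
have N0 t : 0 <= N t by exact: normsq_ge0.
have mN : mfunT N. by have [sa sb] := sw; exact: measurable_fourier sa sb (suppC_Re zw) (suppC_Im zw).
have si := smoothC_cpart i sw; have zi := suppC_cpart i zw.
have pl f : smoothC f -> suppC y0 r f -> (l2n f = ((2 * pi) ^- n)%:E * \int[leb]_t (normsq (fourier f (rowt t)))%:E)%E.
  move=> [fa fb] zf; rewrite (plancherel fa fb (suppC_Re zf) (suppC_Im zf)) muleA -EFinM mulVf ?mul1e//.
  by rewrite expf_neq0// mulf_neq0 ?pnatr_eq0// gt_eqF// pi_gt0.
have P0 : 0 <= (2 * pi : R) ^- n by rewrite invr_ge0 exprn_ge0// mulr_ge0// pi_ge0.
have E1 t : normsq (fourier (cpart i w) (rowt t)) = rowt t 0 i ^+ 2 * N t. exact: fourier_cpart sw zw.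
have E2 t : normsq (fourier (cpart i (cpart i w)) (rowt t)) = rowt t 0 i ^+ 4 * N t.
  by rewrite (fourier_cpart i t si zi) E1 mulrA -exprD.
rewrite (pl _ si zi) (pl _ (smoothC_cpart i si) (suppC_cpart i zi)) /sobolev_sq.
rewrite [((h `^ _)%:E * _)%E]muleCA [((h ^+ 2)%:E * _)%E]muleCA -muleDr//; last first.
  by apply: ge0_adde_def; rewrite inE mule_ge0 ?lee_fin ?powR_ge0 ?sqr_ge0//;
    apply: integral_ge0 => t _; rewrite lee_fin ?mulr_ge0 ?powR_ge0 ?normsq_ge0.
rewrite lee_wpmul2l ?lee_fin//.
have mx : mfunT (fun t : T => rowt t 0 i) by exact: mcoord.
have md : mfunT (fun t : T => (1 + dotrow (rowt t) (rowt t)) `^ eps).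
  apply: (@mcompT _ _ _ _ _ _ (fun x : R => x `^ eps)); first exact: measurable_powR.
  apply: mfunD => //; under eq_fun do rewrite dotrowE.
  by apply: measurable_sum => j; apply: mfunM; exact: mcoord.
rewrite -!ge0_integralZl//; last 6 first.
- by apply/mEFinP; under eq_fun do rewrite E2; apply: mfunM => //; exact: measurable_funX.
- by move=> t _; rewrite lee_fin normsq_ge0.
- by rewrite lee_fin sqr_ge0.
- by apply/mEFinP; apply: mfunM.
- by move=> t _; rewrite lee_fin mulr_ge0 ?powR_ge0 ?normsq_ge0.
- by rewrite lee_fin powR_ge0.
rewrite -ge0_integralD//; last 4 first.
- by move=> t _; rewrite -EFinM lee_fin !mulr_ge0 ?powR_ge0 ?normsq_ge0.
- by apply/mEFinP; do 2!apply: mfunM => //.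
- by move=> t _; rewrite -EFinM lee_fin mulr_ge0 ?sqr_ge0 ?normsq_ge0.
- apply/mEFinP; apply: mfunM => //.
  by under eq_fun do rewrite E2; apply: mfunM => //; exact: measurable_funX.
apply: ge0_le_integral => //.
- by move=> t _; rewrite lee_fin normsq_ge0.
- by apply/mEFinP; under eq_fun do rewrite E1; apply: mfunM => //; exact: measurable_funX.
- apply/mEFinP; apply: mfunD; first by do 2!apply: mfunM => //.
  apply: mfunM => //. by under eq_fun do rewrite E2; apply: mfunM => //; exact: measurable_funX.
move=> t _; have xN : rowt t 0 i ^+ 2 <= dotrow (rowt t) (rowt t). rewrite dotrowE (bigD1 i)//= -expr2 lerDl.
  by rewrite sumr_ge0// => j _; rewrite -expr2 sqr_ge0.
have H := ler_wpM2r (N0 t) (interpolation_symbol e0 e1 eeps h0 xN).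
suff conclude (A B : R) : A = rowt t 0 i ^+ 2 * N t -> B = rowt t 0 i ^+ 4 * N t ->
    (A%:E <= (h `^ (2 * e - 2))%:E * ((1 + dotrow (rowt t) (rowt t)) `^ eps * N t)%:E +
      (h ^+ 2)%:E * B%:E)%E by exact: (conclude _ _ (E1 t) (E2 t)).
by move=> -> ->; rewrite -!EFinM -EFinD lee_fin; apply: le_trans H _; rewrite mulrDl !mulrA.
Qed.

End interpolation.

Local Notation nc := (@Normc.normc _).

(** * Kernels *)
Section modulus.
Context (R : realType).
Notation C := R[i].
Implicit Types z w : C.

Lemma ncE z : nc z = Num.sqrt (normsq z). Proof. by case: z. Qed.
Lemma nc_ge0 z : 0 <= nc z. Proof. by rewrite ncE sqrtr_ge0. Qed.
Lemma nc_sqr z : nc z ^+ 2 = normsq z. Proof. by rewrite ncE sqr_sqrtr// normsq_ge0. Qed.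
Lemma nc0 : nc (0 : C) = 0. Proof. exact: Normc.normc0. Qed.
Lemma ncM z w : nc (z * w) = nc z * nc w. Proof. exact: Normc.normcM. Qed.
Lemma ncD z w : nc (z + w) <= nc z + nc w. Proof. exact: le_normcD. Qed.
Lemma ncR (r : R) : nc r%:C = `|r|. Proof. by rewrite ncE /normsq /= expr0n addr0 sqrtr_sqr. Qed.
Lemma ncRe z : `|complex.Re z| <= nc z.
Proof. by rewrite ncE -sqrtr_sqr ler_wsqrtr// lerDl sqr_ge0. Qed.
Lemma ncIm z : `|complex.Im z| <= nc z.
Proof. by rewrite ncE -sqrtr_sqr ler_wsqrtr// lerDr sqr_ge0. Qed.
Lemma nc_le z (a b : R) : `|complex.Re z| <= a -> `|complex.Im z| <= b -> nc z <= a + b.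
Proof.
move=> ha hb; have a0 := le_trans (normr_ge0 _) ha; have b0 := le_trans (normr_ge0 _) hb.
rewrite -(ger0_norm (addr_ge0 a0 b0)) -sqrtr_sqr ncE ler_wsqrtr//.
have : complex.Re z ^+ 2 <= a ^+ 2 by rewrite -real_normK ?num_real// lerXn2r ?nnegrE.
have : complex.Im z ^+ 2 <= b ^+ 2 by rewrite -real_normK ?num_real// lerXn2r ?nnegrE.
by have : 0 <= a * b by [exact: mulr_ge0]; rewrite /normsq; lra.
Qed.
Lemma nc_sum (I : Type) (r : seq I) (P : pred I) (F : I -> C) :
  nc (\sum_(i <- r | P i) F i) <= \sum_(i <- r | P i) nc (F i).
Proof.
elim/big_rec2: _ => [|i y1 y2 _ h]; first by rewrite nc0.
by apply: le_trans (ncD _ _) _; rewrite lerD2l.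
Qed.

End modulus.

(** * Integrals of complex functions *)

Section complex_integral.
Context d (T : measurableType d) (R : realType) (mu : {measure set T -> \bar R}).
Notation C := R[i].
Implicit Types f g : T -> C.

Definition cmeas f := mfunT (fun t => complex.Re (f t)) /\
  mfunT (fun t => complex.Im (f t)).

Definition cintg f := mu.-integrable setT (fun t => (complex.Re (f t))%:E) /\
  mu.-integrable setT (fun t => (complex.Im (f t))%:E).

Lemma cmeasM f g : cmeas f -> cmeas g -> cmeas (fun t => f t * g t).
Proof.
move=> [f1 f2] [g1 g2]; split. by under eq_fun do rewrite RecM; apply: measurable_funB; exact: mfunM.
by under eq_fun do rewrite ImcM; apply: mfunD; exact: mfunM.
Qed.

Lemma cmeas_nc f : cmeas f -> mfunT (fun t => nc (f t)).
Proof.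
move=> [f1 f2]; under eq_fun do rewrite ncE.
apply: (@mcompT _ _ _ _ _ _ (@Num.sqrt R)). by apply: cont_mfun; exact: sqrt_continuous.
by apply: mfunD; exact: measurable_funX.
Qed.

Lemma cmeas_normsq f : cmeas f -> mfunT (fun t => normsq (f t)).
Proof. by move=> [f1 f2]; apply: mfunD; exact: measurable_funX. Qed.

Lemma cintg_meas f : cintg f -> cmeas f.
Proof. by move=> [/integrableP[/mEFinP f1 _] /integrableP[/mEFinP f2 _]]. Qed.

Lemma cintg_bound f (g : T -> R) : cmeas f -> mu.-integrable setT (EFin \o g) ->
  (forall t, nc (f t) <= g t) -> cintg f.
Proof.
move=> [f1 f2] ig fg; split; apply: le_integrable ig => //; try exact/mEFinP.
  by move=> t _; rewrite lee_fin (le_trans (ncRe _))// (le_trans (fg t))// ler_norm.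
by move=> t _; rewrite lee_fin (le_trans (ncIm _))// (le_trans (fg t))// ler_norm.
Qed.

Lemma cintg_nc f : cintg f -> mu.-integrable setT (fun t => (nc (f t))%:E).
Proof.
move=> fi; have mf := cintg_meas fi; have [f1 f2] := fi.
have := integrableD measurableT (integrable_abse f1) (integrable_abse f2).
apply: le_integrable => //; first by apply/mEFinP; exact: cmeas_nc.
move=> t _; rewrite lee_fin ger0_norm ?nc_ge0// ger0_norm ?addr_ge0//.
exact: nc_le.
Qed.

Lemma cintgD f g : cintg f -> cintg g -> cintg (fun t => f t + g t).
Proof.
move=> [f1 f2] [g1 g2]; split. by under eq_fun do rewrite ReD EFinD; exact: integrableD.
by under eq_fun do rewrite ImD EFinD; exact: integrableD.
Qed.

Lemma cintgZ c f : cintg f -> cintg (fun t => c * f t).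
Proof.
move=> fi; have mf := cintg_meas fi.
apply: (@cintg_bound _ (fun t => nc c * nc (f t))).
- by apply: cmeasM => //; split; exact: measurable_cst.
- by have := integrableZl measurableT (nc c) (cintg_nc fi).
- by move=> t; rewrite ncM.
Qed.

Lemma cintegralD f g : cintg f -> cintg g ->
  cintegral mu (fun t => f t + g t) = cintegral mu f + cintegral mu g.
Proof.
move=> [f1 f2] [g1 g2]; rewrite /cintegral.
have -> : \int[mu]_x complex.Re (f x + g x) = \int[mu]_x (complex.Re (f x) + complex.Re (g x)).
  by apply: eq_Rintegral => t _; rewrite ReD.
have -> : \int[mu]_x complex.Im (f x + g x) = \int[mu]_x (complex.Im (f x) + complex.Im (g x)).
  by apply: eq_Rintegral => t _; rewrite ImD.
by rewrite !RintegralD.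
Qed.

Lemma cintegralZ c f : cintg f -> cintegral mu (fun t => c * f t) = c * cintegral mu f.
Proof.
move=> [f1 f2]; rewrite /cintegral; case: c => a b.
have Z (k : R) (h : T -> R) : mu.-integrable setT (fun t => (h t)%:E) -> mu.-integrable setT (fun t => (k * h t)%:E).
  by move=> hi; have := integrableZl measurableT k hi.
have -> : \int[mu]_x complex.Re ((a +i* b) * f x) = \int[mu]_x (a * complex.Re (f x) - b * complex.Im (f x)).
  by apply: eq_Rintegral => t _; rewrite RecM.
have -> : \int[mu]_x complex.Im ((a +i* b) * f x) = \int[mu]_x (a * complex.Im (f x) + b * complex.Re (f x)).
  by apply: eq_Rintegral => t _; rewrite ImcM.
rewrite RintegralB ?RintegralD ?RintegralZl//; exact: Z.
Qed.

Lemma cintg_sum (I : Type) (r : seq I) (P : pred I) (F : I -> T -> C) :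
  (forall i, P i -> cintg (F i)) -> cintg (fun t => \sum_(i <- r | P i) F i t).
Proof.
move=> H; elim: r => [|i r IH]. by split; under eq_fun do rewrite big_nil; exact: integrable0.
rewrite (_ : (fun t => _) = (fun t => (if P i then F i t else 0) + \sum_(i <- r | P i) F i t)).
  by apply: cintgD => //; case: (boolP (P i)) => [/H//|_]; split; exact: integrable0.
by apply/funext => t; rewrite big_cons; case: ifP => // _; rewrite add0r.
Qed.

Lemma eq_cintegral f g : f =1 g -> cintegral mu f = cintegral mu g.
Proof. by move=> /funext ->. Qed.

Lemma cintegral0 : cintegral mu (fun=> 0) = 0.
Proof. by rewrite /cintegral /= /Rintegral integral0. Qed.

Lemma cintegral_sum (I : Type) (r : seq I) (P : pred I) (F : I -> T -> C) : (forall i, P i -> cintg (F i)) ->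
  cintegral mu (fun t => \sum_(i <- r | P i) F i t) = \sum_(i <- r | P i) cintegral mu (F i).
Proof.
move=> H; elim: r => [|i r IH]. by rewrite big_nil -[RHS]cintegral0; apply: eq_cintegral => t; rewrite big_nil.
rewrite big_cons; case: ifP => Pi. rewrite -IH -cintegralD//; [|exact: H|exact: cintg_sum].
  by apply: eq_cintegral => t; rewrite big_cons Pi.
by rewrite -IH; apply: eq_cintegral => t; rewrite big_cons Pi.
Qed.

(** The factor 2 comes from estimating real and imaginary parts separately. *)
Lemma nc_cintegral f (g : T -> R) : cmeas f -> mu.-integrable setT (EFin \o g) ->
  (forall t, nc (f t) <= g t) -> nc (cintegral mu f) <= 2 * \int[mu]_t g t.
Proof.
move=> mf ig fg; have [f1 f2] := cintg_bound mf ig fg.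
have H (h : T -> R) : mu.-integrable setT (fun t => (h t)%:E) -> (forall t, `|h t| <= g t) ->
    `|\int[mu]_t h t| <= \int[mu]_t g t. move=> hi hg; apply: le_trans (le_normr_Rintegral measurableT hi) _.
  apply: le_Rintegral => //; first exact: (integrable_abse hi).
rewrite mulrDl mul1r; apply: nc_le; apply: H => // t. exact: le_trans (ncRe _) (fg t).
exact: le_trans (ncIm _) (fg t).
Qed.

End complex_integral.

Section test_functions.
Context (R : realType) (n : nat).
Notation X := 'rV[R]_n.
Notation T := (n.-tuple R).
Notation C := R[i].
Implicit Types f g : X -> C.

(** The strict inequality leaves room for a cutoff that is 1 on the support and still supported
    inside the ball of radius [rho]. *)
Definition test_in (y0 : X) (rho : R) f := smoothC f /\ exists2 s, s < rho & suppC y0 s f.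

Definition test f := smoothC f /\ exists r, suppC 0 r f.

Lemma test_inW y0 rho f : test_in y0 rho f -> test f.
Proof.
move=> [sf [s _ zf]]; split => //; exists (s + `|y0|) => x xs; apply: zf.
move: xs; rewrite subr0 -ltrBrDr => /lt_le_trans; apply; rewrite lerBlDr.
by apply: le_trans (ler_normD _ _); rewrite subrK.
Qed.

Lemma testD f g : test f -> test g -> test (fun x => f x + g x).
Proof.
move=> [sf [r zf]] [sg [s zg]]; split; first exact: smoothCD.
exists (Num.max r s); apply: suppCD; [apply: suppC_le zf|apply: suppC_le zg]; by rewrite le_max lexx ?orbT.
Qed.

Lemma testM f g : test f -> smoothC g -> test (fun x => f x * g x).
Proof. by move=> [sf [r zf]] sg; split; [exact: smoothCM|exists r; exact: suppCMl]. Qed.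

Lemma testMr f g : smoothC f -> test g -> test (fun x => f x * g x).
Proof. by move=> sf [sg [r zg]]; split; [exact: smoothCM|exists r; exact: suppCMr]. Qed.

Lemma test_cpart i f : test f -> test (cpart i f).
Proof. by move=> [sf [r zf]]; split; [exact: smoothC_cpart|exists r; exact: suppC_cpart]. Qed.

Lemma test0 : test (fun=> 0).
Proof. by split; [exact: smoothC_cst|exists 0]. Qed.

Lemma test_sum (I : Type) (r : seq I) (P : pred I) (F : I -> X -> C) :
  (forall i, P i -> test (F i)) -> test (fun x => \sum_(i <- r | P i) F i x).
Proof.
move=> H; elim: r => [|i r IH].
  by rewrite (_ : (fun x => _) = fun=> 0); [exact: test0|apply/funext => x; rewrite big_nil].
rewrite (_ : (fun x => _) = (fun x => (if P i then F i x else 0) + \sum_(i <- r | P i) F i x)).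
  by apply: testD => //; case: (boolP (P i)) => [/H//|_]; exact: test0.
by apply/funext => x; rewrite big_cons; case: ifP => // _; rewrite add0r.
Qed.

Lemma test_inM y0 rho f g : test_in y0 rho f -> smoothC g -> test_in y0 rho (fun x => f x * g x).
Proof. by move=> [sf [s sr zf]] sg; split; [exact: smoothCM|exists s => //; exact: suppCMl]. Qed.

Lemma test_in_cpart i y0 rho f : test_in y0 rho f -> test_in y0 rho (cpart i f).
Proof. by move=> [sf [s sr zf]]; split; [exact: smoothC_cpart|exists s => //; exact: suppC_cpart]. Qed.

Lemma test_bounded f : test f -> exists2 B, 0 < B & forall x, nc (f x) <= B.
Proof.
move=> [sf [r zf]]; have [c1 c2] := smoothC_cont sf.
have [A A0 HA] := supp_bounded c1 (suppC_Re zf); have [B B0 HB] := supp_bounded c2 (suppC_Im zf).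
by exists (A + B); [exact: addr_gt0|move=> x; exact: nc_le].
Qed.

Lemma test_lipschitz f : test f -> exists2 B, 0 < B & forall x y, nc (f x - f y) <= B * `|x - y|.
Proof.
move=> [[s1 s2] [r zf]].
have [A A0 HA] := supp_lipschitz s1 (suppC_Re zf); have [B B0 HB] := supp_lipschitz s2 (suppC_Im zf).
exists (A + B); [exact: addr_gt0|move=> x y]; rewrite mulrDl; apply: nc_le. by rewrite ReD ReN.
by rewrite ImD ImN.
Qed.

Lemma cmeas_rowt f : smoothC f -> cmeas (fun t : T => f (rowt t)).
Proof.
by move=> /smoothC_cont[c1 c2]; split; [exact: (mrowt_cont c1)|exact: (mrowt_cont c2)].
Qed.

Lemma smoothC_affine (s : R) (y : X) f : smoothC f -> smoothC (fun x => f (s *: (x - y))).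
Proof. by move=> [f1 f2]; split; [exact: smooth_affine openT f1|exact: smooth_affine openT f2]. Qed.

Lemma cpart_affine (s : R) (y : X) f x i : smoothC f ->
  cpart i (fun x => f (s *: (x - y))) x = s%:C * cpart i f (s *: (x - y)).
Proof.
move=> [f1 f2]; rewrite /cpart (partial_affine s y x i f1) (partial_affine s y x i f2).
by apply/eqP; rewrite eq_complex /= !mul0r subr0 addr0 !eqxx.
Qed.

End test_functions.

(** * Kernels concentrated near the diagonal and their commutation with vector fields *)

Section kernels.
Context (R : realType) (n : nat) (y0 : 'rV[R]_n) (rho : R).
Notation X := 'rV[R]_n.
Notation C := R[i].

Definition dilate (chi : X -> C) (t : R) (x y : X) : C := (t^-1 ^+ n)%:C * chi (t^-1 *: (x - y)).

(* Kernels concentrated in |x - y| <= t, of size t^-n; the difference quotients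
   are what commutators with differential operators produce. *)
Inductive ker : (R -> X -> X -> C) -> Prop :=
| ker_base b c chi : test b -> test_in y0 rho c -> smoothC chi -> suppC 0 1 chi ->
    ker (fun t x y => b x * (c y * dilate chi t x y))
| ker_dq a K : test a -> ker K -> ker (fun t x y => (t^-1)%:C * (a x - a y) * K t x y)
| ker_add K L : ker K -> ker L -> ker (fun t x y => K t x y + L t x y).

Lemma ker_ext K L : (forall t x y, K t x y = L t x y) -> ker K -> ker L.
Proof.
move=> KL; rewrite (_ : L = K)//; apply/funext => t; apply/funext => x; apply/funext => y.
by rewrite KL.
Qed.

Lemma ker0 : ker (fun _ _ _ => 0).
Proof.
apply: (@ker_ext (fun t x y => (fun=> 0 : C) x * ((fun=> 0 : C) y * dilate (fun=> 0) t x y))).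
  by move=> t x y; rewrite mul0r.
apply: ker_base; [exact: test0| |exact: smoothC_cst|by []].
by split; [exact: smoothC_cst|exists (rho - 1) => //; rewrite ltrBlDr ltrDl].
Qed.

Lemma ker_sum (I : finType) (F : I -> R -> X -> X -> C) : (forall i, ker (F i)) -> ker (fun t x y => \sum_i F i t x y).
Proof.
move=> H; elim: (index_enum I) => [|i r IH]. by apply: ker_ext ker0 => t x y; rewrite big_nil.
by apply: ker_ext (ker_add (H i) IH) => t x y; rewrite big_cons.
Qed.

Lemma smoothC_dilate1 chi t y : smoothC chi -> smoothC (fun x => dilate chi t x y).
Proof. by move=> sc; apply: smoothCZ; exact: smoothC_affine. Qed.

Lemma dilateE chi t x y : dilate chi t x y = (t^-1 ^+ n)%:C * chi ((- t^-1) *: (y - x)).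
Proof. by rewrite /dilate scaleNr -scalerN opprB. Qed.

Lemma smoothC_dilate2 chi t x : smoothC chi -> smoothC (dilate chi t x).
Proof.
move=> sc; apply: (@smoothC_ext _ _ (fun y => (t^-1 ^+ n)%:C * chi ((- t^-1) *: (y - x)))).
  by move=> y; rewrite dilateE.
by apply: smoothCZ; exact: smoothC_affine.
Qed.

Lemma cpart_dilate1 i chi t x y : smoothC chi ->
  cpart i (fun x => dilate chi t x y) x = (t^-1)%:C * dilate (cpart i chi) t x y.
Proof.
move=> sc; rewrite cpartZ; last exact: smoothC_affine.
by rewrite cpart_affine// /dilate mulrCA.
Qed.

Lemma cpart_dilate2 i chi t x y : smoothC chi ->
  cpart i (dilate chi t x) y = - ((t^-1)%:C * dilate (cpart i chi) t x y).
Proof.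
move=> sc; rewrite (_ : dilate chi t x = fun y => (t^-1 ^+ n)%:C * chi ((- t^-1) *: (y - x))); last first.
  by apply/funext => z; rewrite dilateE.
rewrite cpartZ; last exact: smoothC_affine.
by rewrite cpart_affine// dilateE mulrCA rmorphN mulNr.
Qed.

Lemma ker_smooth1 K t y : ker K -> smoothC (fun x => K t x y).
Proof.
elim=> {K} [b c chi [sb _] _ sc _|a K [sa _] _ IH|K L _ IHK _ IHL].
- by apply: smoothCM => //; apply: smoothCZ; exact: smoothC_dilate1.
- by apply: smoothCM => //; apply: smoothCZ; apply: smoothCB => //; exact: smoothC_cst.
- exact: smoothCD.
Qed.

Lemma ker_smooth2 K t x : ker K -> smoothC (K t x).
Proof.
elim=> {K} [b c chi _ [sc _] schi _|a K [sa _] _ IH|K L _ IHK _ IHL].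
- by apply: smoothCZ; apply: smoothCM => //; exact: smoothC_dilate2.
- by apply: smoothCM => //; apply: smoothCZ; apply: smoothCB => //; exact: smoothC_cst.
- exact: smoothCD.
Qed.

Lemma ker_supp K : ker K -> exists2 s, s < rho & forall t x, suppC y0 s (K t x).
Proof.
elim=> {K} [b c chi _ [_ [s sr zc]] _ _|a K _ _ [s sr H]|K L _ [s sr HK] _ [r rr HL]].
- by exists s => // t x; apply: suppCMr; exact: suppCMl.
- by exists s => // t x; exact: suppCMr.
- exists (Num.max s r) => [|t x]; first by rewrite gt_max sr.
  by apply: suppCD; [apply: suppC_le (HK t x)|apply: suppC_le (HL t x)]; rewrite le_max lexx ?orbT.
Qed.

Lemma ker_near K t x y : ker K -> 0 < t -> t < `|x - y| -> K t x y = 0.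
Proof.
move=> HK t0 xy; elim: HK => {K} [b c chi _ _ _ zc|a K _ _ ->|K L _ -> _ ->]; rewrite ?mulr0 ?addr0//.
rewrite /dilate zc ?mulr0// subr0 normrZ ger0_norm ?invr_ge0 ?(ltW t0)//.
by rewrite mulrC ltr_pdivlMr// mul1r.
Qed.

(** A difference quotient costs nothing: where the kernel is nonzero |x - y| <= t, so (a(x) -
    a(y))/t is bounded by a Lipschitz constant. *)
Lemma ker_bound K : ker K -> exists2 B, 0 <= B & forall t x y, 0 < t -> t <= 1 -> nc (K t x y) <= B * t^-1 ^+ n.
Proof.
move=> HK; elim: (HK) => {K HK} [b c chi tb tc sc zc|a K ta HK [B B0 HB]|K L _ [B B0 HB] _ [D D0 HD]].
- have [A A0 HA] := test_bounded tb; have [B B0 HB] := test_bounded (test_inW tc).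
  have [D D0 HD] := test_bounded (conj sc (ex_intro _ 1 zc)).
  exists (A * (B * D)); first by rewrite !mulr_ge0 ?(ltW A0) ?(ltW B0) ?(ltW D0).
  move=> t x y t0 t1; have tn : 0 <= t^-1 ^+ n by rewrite exprn_ge0// invr_ge0 ltW.
  rewrite /dilate !ncM ncR ger0_norm// (_ : _ * _ ^+ n = A * (B * (t^-1 ^+ n * D))); last by ring.
  by do 2![apply: ler_pM; rewrite ?nc_ge0 ?mulr_ge0 ?nc_ge0//]; rewrite ler_wpM2l.
- have [D D0 HD] := test_lipschitz ta; exists (D * B); first by rewrite mulr_ge0 ?(ltW D0).
  move=> t x y t0 t1; have [xy|xy] := ltP t `|x - y|.
    by rewrite (ker_near HK t0 xy) mulr0 nc0 !mulr_ge0 ?(ltW D0) ?exprn_ge0 ?invr_ge0 ?(ltW t0).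
  rewrite !ncM ncR -[leRHS]mulrA; apply: ler_pM; rewrite ?mulr_ge0 ?nc_ge0//; last exact: HB.
  rewrite ger0_norm ?invr_ge0 ?(ltW t0)// mulrC ler_pdivrMr//.
  by apply: le_trans (HD x y) _; rewrite ler_wpM2l// (ltW D0).
- exists (B + D); first exact: addr_ge0. move=> t x y t0 t1; apply: le_trans (ncD _ _) _; rewrite mulrDl.
  by apply: lerD; [exact: HB|exact: HD].
Qed.

Lemma ker_mul1 a K : test a -> ker K -> ker (fun t x y => a x * K t x y).
Proof.
move=> ta; elim=> {K} [b c chi tb tc sc zc|a' K ta' HK IH|K L HK IHK HL IHL].
- apply: ker_ext (ker_base (testM ta (proj1 tb)) tc sc zc) => t x y; by rewrite /= -mulrA.
- by apply: ker_ext (ker_dq ta' IH) => t x y; rewrite mulrCA.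
- by apply: ker_ext (ker_add IHK IHL) => t x y; rewrite mulrDr.
Qed.

Lemma ker_mul2 a K : smoothC a -> ker K -> ker (fun t x y => a y * K t x y).
Proof.
move=> ta; elim=> {K} [b c chi tb tc sc zc|a' K ta' HK IH|K L HK IHK HL IHL].
- by apply: ker_ext (ker_base tb (test_inM tc ta) sc zc) => t x y; ring.
- by apply: ker_ext (ker_dq ta' IH) => t x y; rewrite mulrCA.
- by apply: ker_ext (ker_add IHK IHL) => t x y; rewrite mulrDr.
Qed.

Lemma ker_cpart i K : ker K -> exists K1 K2, [/\ ker K1, ker K2 &
  forall t x y, cpart i (fun x => K t x y) x = K1 t x y + (t^-1)%:C * K2 t x y].
Proof.
elim=> {K} [b c chi tb tc sc zc|a K ta HK [K1 [K2 [H1 H2 E]]]|K L HK [K1 [K2 [H1 H2 E]]] HL [L1 [L2 [H3 H4 F]]]].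
- exists (fun t x y => cpart i b x * (c y * dilate chi t x y)),
    (fun t x y => b x * (c y * dilate (cpart i chi) t x y)); split.
  + by apply: ker_base => //; exact: test_cpart.
  + by apply: ker_base => //; [exact: smoothC_cpart|exact: suppC_cpart].
  + move=> t x y; have sd := smoothC_dilate1 t y sc.
    rewrite (cpartM _ _ (proj1 tb) (smoothCZ (c y) sd)) (cpartZ _ _ _ sd) cpart_dilate1//; ring.
- exists (fun t x y => (t^-1)%:C * (a x - a y) * K1 t x y),
    (fun t x y => cpart i a x * K t x y + (t^-1)%:C * (a x - a y) * K2 t x y); split.
  + exact: ker_dq.
  + by apply: ker_add; [exact: ker_mul1 (test_cpart i ta) HK|exact: ker_dq].
  + move=> t x y; have sa := proj1 ta.
    have sb : smoothC (fun x => a x - a y) by apply: smoothCB => //; exact: smoothC_cst.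
    rewrite cpartM ?cpartZ ?cpartB ?cpart_cst ?E//; [ring|exact: smoothC_cst|exact: smoothCZ|exact: ker_smooth1].
- exists (fun t x y => K1 t x y + L1 t x y), (fun t x y => K2 t x y + L2 t x y); split.
  + exact: ker_add.
  + exact: ker_add.
  + move=> t x y; rewrite cpartD ?E ?F; [ring|exact: ker_smooth1|exact: ker_smooth1].
Qed.

Variable alpha : 'I_n -> X -> C.
Hypothesis talpha : forall i, test (alpha i).

Definition lieD (f : X -> C) (x : X) : C := \sum_i alpha i x * cpart i f x.

Lemma lieM f g x : smoothC f -> smoothC g -> lieD (fun x => f x * g x) x = lieD f x * g x + f x * lieD g x.
Proof.
move=> sf sg; rewrite /lieD mulr_suml mulr_sumr -big_split; apply: eq_bigr => i _.
by rewrite cpartM//=; ring.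
Qed.

Lemma lieDD f g x : smoothC f -> smoothC g -> lieD (fun x => f x + g x) x = lieD f x + lieD g x.
Proof.
by move=> sf sg; rewrite /lieD -big_split; apply: eq_bigr => i _; rewrite cpartD//= mulrDr.
Qed.

Lemma lie_cst c x : lieD (fun=> c) x = 0.
Proof. by rewrite /lieD big1// => i _; rewrite cpart_cst mulr0. Qed.

Lemma lieZ c f x : smoothC f -> lieD (fun x => c * f x) x = c * lieD f x.
Proof. by move=> sf; rewrite (@lieM (fun=> c)) ?lie_cst ?mul0r ?add0r//; exact: smoothC_cst. Qed.

Lemma lieN f x : smoothC f -> lieD (fun x => - f x) x = - lieD f x.
Proof. by move=> sf; rewrite -mulN1r -lieZ//; under [in RHS]eq_fun do rewrite mulN1r. Qed.

Lemma test_lie f : smoothC f -> test (lieD f).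
Proof.
move=> sf; apply: test_sum => i _; apply: testM => //; exact: smoothC_cpart.
Qed.

(** L in both variables at once. Up to the divergence of the coefficients this is the kernel of the
    commutator with L, since L in the variable y is moved to [v] by parts. *)
Definition transport (K : R -> X -> X -> C) t x y : C := lieD (fun x => K t x y) x + lieD (K t x) y.

(** On a function of x - y the two derivatives are opposite, so the coefficients enter only through
    (alpha(x) - alpha(y))/t times a dilated derivative. The clause [ker_dq] absorbs the factor 1/t,
    and the class does not lose a power of t. *)
Lemma ker_transport K : ker K -> ker (transport K).
Proof.
move=> HK; elim: (HK) => {K HK} [b c chi tb tc sc zc|a K ta HK IH|K L HK IHK HL IHL].
- have := @ker_sum 'I_n (fun i t x y => (t^-1)%:C * (alpha i x - alpha i y) * (b x * (c y * dilate (cpart i chi) t x y)))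
    (fun i => ker_dq (talpha i) (ker_base tb tc (smoothC_cpart i sc) (suppC_cpart i zc))).
  have tLc : test_in y0 rho (lieD c). have [scc [s sr zcc]] := tc; split; first exact: (proj1 (test_lie scc)).
    by exists s => // x xs; rewrite /lieD big1// => i _; rewrite (suppC_cpart i zcc xs) mulr0.
  move=> /(ker_add (ker_base tb tLc sc zc))/(ker_add (ker_base (test_lie (proj1 tb)) tc sc zc)).
  apply: ker_ext => t x y; rewrite /transport. have s1 := smoothC_dilate1 t y sc; have s2 := smoothC_dilate2 t x sc.
  rewrite lieM; [|exact: (proj1 tb)|exact: smoothCZ].
  rewrite lieZ// [in X in _ = _ + X]lieZ; last exact: (smoothCM (proj1 tc)). rewrite lieM//; last exact: (proj1 tc).
  rewrite -[RHS]addrA; congr (_ + _); rewrite mulrDr addrCA; congr (_ + _).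
  rewrite /lieD !mulr_sumr -big_split; apply: eq_bigr => i _. by rewrite cpart_dilate1// cpart_dilate2//=; ring.
- have tL := ker_dq (test_lie (proj1 ta)) HK. apply: ker_ext (ker_add tL (ker_dq ta IH)) => t x y; rewrite /transport.
  have sa := proj1 ta; have sc c : smoothC (fun _ : X => c) by exact: smoothC_cst.
  have s1 := ker_smooth1 t y HK; have s2 := ker_smooth2 t x HK. have sN := smoothCN sa.
  rewrite lieM//; last by apply: smoothCZ; exact: smoothCB. rewrite lieZ; last exact: smoothCB.
  rewrite (@lieDD a (fun=> - a y))// lie_cst addr0.
  rewrite [in X in _ = _ + X]lieM//; last by apply: smoothCZ; exact: smoothCB.
  rewrite [in X in _ = _ + X]lieZ; last exact: smoothCB.
  rewrite (@lieDD (fun=> a x) (fun y => - a y))// lie_cst add0r lieN//; ring.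
- apply: ker_ext (ker_add IHK IHL) => t x y; rewrite /transport.
  rewrite (lieDD _ (ker_smooth1 t y HK) (ker_smooth1 t y HL)).
  by rewrite (lieDD _ (ker_smooth2 t x HK) (ker_smooth2 t x HL)) addrACA.
Qed.

End kernels.

(** * Taylor remainders; differentiation of integral operators *)

Section taylor.
Context (R : realType) (n : nat).
Notation X := 'rV[R]_n.
Notation ev i := (delta_mx 0 i : X).

Lemma taylor_quadratic (V : normedModType R) (f f1 f2 : V -> R) (v x : V) (h M : R) :
  (forall s, `|s| <= `|h| -> is_derive (s *: v + x) v f (f1 (s *: v + x))) ->
  (forall s, `|s| <= `|h| -> is_derive (s *: v + x) v f1 (f2 (s *: v + x))) ->
  (forall s, `|s| <= `|h| -> `|f2 (s *: v + x)| <= M) -> `|f (h *: v + x) - f x - h * f1 x| <= M * h ^+ 2.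
Proof.
move=> df df1 HM.
have [|c ch ->] := @line_MVT R _ f x v h; first by move=> s /df[].
have [|d dc E] := @line_MVT R _ f1 x v c. by move=> s hs; have [] := df1 s (le_trans hs ch).
have [_ ->] := df c ch; rewrite -mulrBr E; have [_ ->] := df1 d (le_trans dc ch).
rewrite !normrM [M * _]mulrC -[h ^+ 2]real_normK ?num_real// expr2 -mulrA ler_wpM2l//.
by apply: ler_pM => //; apply: HM; exact: le_trans dc ch.
Qed.

Lemma taylor2 (f : X -> R) (U : set X) i (x : X) (h M : R) : smooth U f ->
  (forall s, `|s| <= `|h| -> U (s *: ev i + x)) -> (forall z, U z -> `|partial i (partial i f) z| <= M) ->
  `|f (h *: ev i + x) - f x - h * partial i f x| <= M * h ^+ 2.
Proof.
move=> sf Uh HM; apply: (@taylor_quadratic _ f (partial i f) (partial i (partial i f))) => s hs.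
- exact: (derivableP (@smooth_der _ _ U f _ i sf (Uh s hs))).
- exact: (derivableP (@smooth_der _ _ U _ _ i (smooth_partial i sf) (Uh s hs))).
- exact: HM (Uh s hs).
Qed.

(** Converse of Taylor's formula. It reduces differentiation under an integral sign to the
    integration of a uniform remainder. *)
Lemma quadratic_derive (V : normedModType R) (g : V -> R) (x v : V) (d C r : R) : 0 < r ->
  (forall h, `|h| < r -> `|g (h *: v + x) - g x - h * d| <= C * h ^+ 2) -> is_derive x v g d.
Proof.
move=> r0 H.
have cv : (fun h => h^-1 *: (g (h *: v + x) - g x)) @ 0^' --> d. apply/cvgrPdist_le => e e0; pose K := `|C| + 1.
  have K0 : 0 < K by rewrite ltr_wpDl. have : \forall h \near 0^', 0 < `|h : R| < Num.min r (e / K).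
    apply/nbhs_ballP; exists (Num.min r (e / K)); first by rewrite /= lt_min r0 divr_gt0.
    by move=> h; rewrite -ball_normE/= sub0r normrN => -> /=; rewrite andbT normr_gt0.
  apply: filterS => h /andP[h0]; rewrite lt_min => /andP[hr he]. have hn : h != 0 by rewrite -normr_gt0.
  rewrite (_ : d - _ = - (h^-1 * (g (h *: v + x) - g x - h * d))); last first. by rewrite -![_ *: _]/(_ * _); field.
  rewrite normrN normrM normfV ler_pdivrMl//; apply: le_trans (H h hr) _.
  rewrite -[h ^+ 2]real_normK ?num_real// expr2 mulrA [leLHS]mulrC ler_wpM2l//.
  apply: (@le_trans _ _ (K * `|h|)); last by rewrite mulrC -ler_pdivlMr// ltW.
  by rewrite ler_wpM2r// (le_trans (ler_norm _))// lerDl.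
by apply: DeriveDef; [apply/cvg_ex; exists d|exact: cvg_lim cv].
Qed.

Lemma lipschitz_continuous (V : normedModType R) (g : V -> R) (K : R) : 0 <= K ->
  (forall x y, `|g x - g y| <= K * `|x - y|) -> continuous g.
Proof.
move=> K0 Hg x; apply/cvgrPdist_le => e e0.
have K1 : 0 < K + 1 by rewrite ltr_wpDl.
apply/nbhs_ballP; exists (e / (K + 1)) => [|y]; first by rewrite /= divr_gt0.
rewrite -ball_normE /= => xy; apply: le_trans (Hg _ _) _.
apply: (@le_trans _ _ ((K + 1) * `|x - y|)); first by rewrite ler_wpM2r// lerDl.
by rewrite mulrC -ler_pdivlMr// ltW.
Qed.

End taylor.

Section operators.
Context (R : realType) (n : nat) (y0 : 'rV[R]_n) (rho : R).
Notation X := 'rV[R]_n.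
Notation T := (n.-tuple R).
Notation leb := (leb R n).
Notation C := R[i].
Notation ev i := (delta_mx 0 i : X).
Notation ker := (ker y0 rho).

Definition op (K : R -> X -> X -> C) (v : T -> C) (t : R) (x : X) : C := cintegral leb (fun s => K t x (rowt s) * v s).

Definition dker i (K : R -> X -> X -> C) t x y : C := cpart i (fun x => K t x y) x.

Lemma dker_bound i K t : ker K -> 0 < t -> t <= 1 -> exists2 M, 0 <= M & forall x y, nc (dker i K t x y) <= M.
Proof.
move=> HK t0 t1; have [K1 [K2 [H1 H2 E]]] := ker_cpart i HK.
have [A A0 HA] := ker_bound H1; have [B B0 HB] := ker_bound H2.
have ti : 0 <= t^-1 by rewrite invr_ge0 ltW.
exists (A * t^-1 ^+ n + t^-1 * (B * t^-1 ^+ n)). by rewrite addr_ge0 ?mulr_ge0 ?exprn_ge0.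
move=> x y; rewrite /dker E; apply: le_trans (ncD _ _) _; apply: lerD; first exact: HA.
by rewrite ncM ncR ger0_norm// ler_wpM2l// HB.
Qed.

Lemma ddker_bound i K t : ker K -> 0 < t -> t <= 1 ->
  exists2 M, 0 <= M & forall x y, nc (cpart i (fun x => dker i K t x y) x) <= M.
Proof.
move=> HK t0 t1; have [K1 [K2 [H1 H2 E]]] := ker_cpart i HK.
have [A A0 HA] := dker_bound i H1 t0 t1; have [B B0 HB] := dker_bound i H2 t0 t1.
have ti : 0 <= t^-1 by rewrite invr_ge0 ltW.
exists (A + t^-1 * B); first by rewrite addr_ge0 ?mulr_ge0.
move=> x y; rewrite (_ : (fun x => dker i K t x y) = fun x => K1 t x y + (t^-1)%:C * K2 t x y); last first.
  by apply/funext => z; exact: E.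
have s1 := ker_smooth1 t y H1; have s2 := ker_smooth1 t y H2.
rewrite (cpartD _ _ s1 (smoothCZ _ s2)) (cpartZ _ _ _ s2).
apply: le_trans (ncD _ _) _; apply: lerD; first exact: HA.
by rewrite ncM ncR ger0_norm// ler_wpM2l//; exact: HB.
Qed.

Variable v : T -> C.
Hypothesis iv : cintg leb v.

Let mv := cintg_meas iv.

Lemma op_integrable (k : X -> C) (M : R) : cmeas (fun s : T => k (rowt s)) ->
  (forall y, nc (k y) <= M) -> cintg leb (fun s => k (rowt s) * v s).
Proof.
move=> sk kM; apply: (@cintg_bound _ _ _ _ _ (fun s => M * nc (v s))).
- exact: cmeasM.
- by have := integrableZl measurableT M (cintg_nc iv).
- by move=> s; rewrite ncM ler_wpM2r// nc_ge0.
Qed.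

Lemma ker_op_intg K t x : ker K -> 0 < t -> t <= 1 -> cintg leb (fun s => K t x (rowt s) * v s).
Proof.
move=> HK t0 t1; have [B B0 HB] := ker_bound HK.
by apply: (op_integrable (cmeas_rowt (ker_smooth2 t x HK))) => y; exact: HB.
Qed.

Lemma opZ c K t x : ker K -> 0 < t -> t <= 1 -> op (fun t x y => c t x * K t x y) v t x = c t x * op K v t x.
Proof.
move=> HK t0 t1; rewrite /op -cintegralZ; last exact: ker_op_intg.
by apply: eq_cintegral => s; rewrite mulrA.
Qed.

Lemma dker_op_intg i K t x : ker K -> 0 < t -> t <= 1 -> cintg leb (fun s => dker i K t x (rowt s) * v s).
Proof.
move=> HK t0 t1; have [K1 [K2 [H1 H2 E]]] := ker_cpart i HK.
under eq_fun do rewrite /dker E mulrDl -mulrA.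
by apply: cintgD; [exact: ker_op_intg|apply: cintgZ; exact: ker_op_intg].
Qed.

(** At fixed t the second derivative of the kernel is bounded uniformly in y, so the Taylor
    remainder can be integrated against |v| and [quadratic_derive] applies. *)
Lemma op_derive i K t x : ker K -> 0 < t -> t <= 1 ->
  is_derive x (ev i) (fun x => complex.Re (op K v t x)) (complex.Re (op (dker i K) v t x)) /\
  is_derive x (ev i) (fun x => complex.Im (op K v t x)) (complex.Im (op (dker i K) v t x)).
Proof.
move=> HK t0 t1; have [M M0 HM] := ddker_bound i HK t0 t1.
have key h : nc (op K v t (h *: ev i + x) - op K v t x - h%:C * op (dker i K) v t x) <=
    2 * (2 * M * \int[leb]_s nc (v s)) * h ^+ 2.
  rewrite (_ : op K v t (h *: ev i + x) - op K v t x - h%:C * op (dker i K) v t x =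
    cintegral leb (fun s => (K t (h *: ev i + x) (rowt s) - K t x (rowt s) - h%:C * dker i K t x (rowt s)) * v s)); last first.
    transitivity (cintegral leb (fun s => K t (h *: ev i + x) (rowt s) * v s) +
       (-1) * cintegral leb (fun s => K t x (rowt s) * v s) + (- h%:C) * cintegral leb (fun s => dker i K t x (rowt s) * v s)).
      by rewrite mulN1r mulNr. have i1 := ker_op_intg (h *: ev i + x) HK t0 t1.
    have i2 := ker_op_intg x HK t0 t1. have i3 := dker_op_intg i x HK t0 t1.
    have j2 := cintgZ (-1) i2; have j3 := cintgZ (- h%:C) i3.
    rewrite -(cintegralZ _ i2) -(cintegralZ _ i3) -(cintegralD i1 j2) -(cintegralD (cintgD i1 j2) j3).
    by apply: eq_cintegral => s; ring.
  rewrite (_ : 2 * _ * _ = 2 * (2 * M * h ^+ 2 * \int[leb]_s nc (v s))); last by ring.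
  rewrite -RintegralZl//; last exact: cintg_nc. apply: nc_cintegral => [||s].
  - apply: cmeasM => //. have [m1 m2] : cmeas (fun s : T => K t (h *: ev i + x) (rowt s)) /\
        cmeas (fun s : T => K t x (rowt s)). by split; apply: cmeas_rowt; exact: (ker_smooth2 _ _ HK).
    have m3 : cmeas (fun s : T => dker i K t x (rowt s)). have [K1 [K2 [H1 H2 E]]] := ker_cpart i HK.
      rewrite (_ : (fun s : T => _) = (fun s : T => (fun y => K1 t x y + (t^-1)%:C * K2 t x y) (rowt s))).
        exact: (cmeas_rowt (smoothCD (ker_smooth2 t x H1) (smoothCZ _ (ker_smooth2 t x H2)))).
      by apply/funext => s; exact: E. case: m1 => a1 b1; case: m2 => a2 b2; case: m3 => a3 b3; split.
      under eq_fun do rewrite !ReD !ReN RecM /= mul0r subr0.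
      by apply: measurable_funB; [exact: measurable_funB|apply: mfunM].
    under eq_fun do rewrite !ImD !ImN ImcM /= mul0r addr0.
    by apply: measurable_funB; [exact: measurable_funB|apply: mfunM].
  - by have := integrableZl measurableT (2 * M * h ^+ 2) (cintg_nc iv).
  - rewrite ncM ler_wpM2r ?nc_ge0//. have [s1 s2] := ker_smooth1 t (rowt s) HK.
    rewrite (_ : 2 * M * h ^+ 2 = M * h ^+ 2 + M * h ^+ 2); last by ring. apply: nc_le.
      rewrite !ReD !ReN RecM /= mul0r subr0; apply: (@taylor2 _ _ _ setT) => // z _.
      exact: le_trans (ncRe _) (HM z (rowt s)).
    rewrite !ImD !ImN ImcM /= mul0r addr0; apply: (@taylor2 _ _ _ setT) => // z _.
    exact: le_trans (ncIm _) (HM z (rowt s)).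
split; apply: (@quadratic_derive _ _ _ _ _ _ _ 1 ltr01) => h _; apply: le_trans (key h).
  by apply: le_trans (ncRe _); rewrite !ReD !ReN RecM /= mul0r subr0.
by apply: le_trans (ncIm _); rewrite !ImD !ImN ImcM /= mul0r addr0.
Qed.

Lemma op_cpart i K t x : ker K -> 0 < t -> t <= 1 -> cpart i (op K v t) x = op (dker i K) v t x.
Proof.
move=> HK t0 t1; have [d1 d2] := op_derive i x HK t0 t1.
rewrite /cpart /partial (@derive_val _ _ _ _ _ _ _ d1) (@derive_val _ _ _ _ _ _ _ d2).
by case: (op _ _ _ _).
Qed.

Lemma op_dker i K K1 K2 t x : ker K1 -> ker K2 -> 0 < t -> t <= 1 ->
  (forall t x y, cpart i (fun x => K t x y) x = K1 t x y + (t^-1)%:C * K2 t x y) ->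
  op (dker i K) v t x = op K1 v t x + (t^-1)%:C * op K2 v t x.
Proof.
move=> H1 H2 t0 t1 E; rewrite /op -cintegralZ; last exact: ker_op_intg.
rewrite -cintegralD; [|exact: ker_op_intg|by apply: cintgZ; exact: ker_op_intg].
by apply: eq_cintegral => s; rewrite /dker E mulrDl mulrA.
Qed.

(** The induction runs over all kernels at once, since a derivative of [op K] combines operators
    with two other kernels. Continuity comes from a Lipschitz bound at fixed t. *)
Lemma smoothC_op K t : ker K -> 0 < t -> t <= 1 -> smoothC (op K v t).
Proof.
move=> HK t0 t1; suff H k : forall K, ker K -> Ck k setT (fun x => complex.Re (op K v t x)) /\
    Ck k setT (fun x => complex.Im (op K v t x)) by split => k; have [] := H k K HK.
have cont L : ker L -> continuous (fun x => complex.Re (op L v t x)) /\ continuous (fun x => complex.Im (op L v t x)).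
  move=> HL. have /choice[M HM] i : exists M, 0 <= M /\ forall x y, nc (dker i L t x y) <= M.
    by have [M M0 H] := dker_bound i HL t0 t1; exists M. pose B := \sum_i M i.
  have MB i : M i <= B by rewrite /B (bigD1 i)//= lerDl sumr_ge0// => j _; have [] := HM j.
  have B0 : 0 <= B by rewrite sumr_ge0// => i _; have [] := HM i.
  have lip x x' : nc (op L v t x - op L v t x') <= 2 * (2 * (n%:R * B * `|x - x'|) * \int[leb]_s nc (v s)).
    have i1 := ker_op_intg x HL t0 t1; have i2 := ker_op_intg x' HL t0 t1. have j2 := cintgZ (-1) i2.
    rewrite -[- op _ _ _ _]mulN1r -(cintegralZ _ i2) -(cintegralD i1 j2).
    rewrite -RintegralZl//; last exact: cintg_nc. apply: nc_cintegral => [||s].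
    - exact: cintg_meas (cintgD i1 j2).
    - by have := integrableZl measurableT (2 * (n%:R * B * `|x - x'|)) (cintg_nc iv).
    - rewrite mulN1r -mulrBl ncM ler_wpM2r ?nc_ge0// mulrDl mul1r. have [s1 s2] := ker_smooth1 t (rowt s) HL.
      apply: nc_le; rewrite ?ReD ?ReN ?ImD ?ImN.
        apply: (@C1_lipschitz _ _ setT (fun z => complex.Re (L t z (rowt s)))) => //; [exact: openT|move=> i z _].
        by apply: le_trans (ncRe (dker i L t z (rowt s))) _; have [_ h] := HM i; exact: le_trans (h _ _) (MB i).
      apply: (@C1_lipschitz _ _ setT (fun z => complex.Im (L t z (rowt s)))) => //; [exact: openT|move=> i z _].
      by apply: le_trans (ncIm (dker i L t z (rowt s))) _; have [_ h] := HM i; exact: le_trans (h _ _) (MB i).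
  pose K' := 2 * (2 * (n%:R * B) * \int[leb]_s nc (v s)). have K'0 : 0 <= K'.
    by rewrite /K' !mulr_ge0//; apply: Rintegral_ge0 => s _; exact: nc_ge0.
  have lipE x x' : 2 * (2 * (n%:R * B * `|x - x'|) * \int[leb]_s nc (v s)) = K' * `|x - x'|. by rewrite /K'; ring.
  split; apply: (@lipschitz_continuous _ _ _ K') => // x x'; rewrite -lipE; apply: le_trans (lip x x').
    by rewrite -ReN -ReD; exact: ncRe. by rewrite -ImN -ImD; exact: ncIm.
elim: k => [|k IH] L HL. have [c1 c2] := cont L HL; split; split=> // x _; [exact: c1|exact: c2].
have [c1 c2] := cont L HL.
have dP i : Ck k setT (partial i (fun x => complex.Re (op L v t x))) /\
    Ck k setT (partial i (fun x => complex.Im (op L v t x))). have [K1 [K2 [H1 H2 E]]] := ker_cpart i HL.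
  have [a1 b1] := IH K1 H1; have [a2 b2] := IH K2 H2.
  have Eo x : op (dker i L) v t x = op K1 v t x + (t^-1)%:C * op K2 v t x by exact: op_dker. split.
    rewrite (_ : partial i _ = fun x => complex.Re (op K1 v t x) + t^-1 * complex.Re (op K2 v t x)).
      by apply: CkD; [exact: openT|by []|apply: CkZ; [exact: openT|by []]].
    apply/funext => x; have [d1 _] := op_derive i x HL t0 t1.
    by rewrite /partial (@derive_val _ _ _ _ _ _ _ d1) Eo ReD RecM /= mul0r subr0.
  rewrite (_ : partial i _ = fun x => complex.Im (op K1 v t x) + t^-1 * complex.Im (op K2 v t x)).
    by apply: CkD; [exact: openT|by []|apply: CkZ; [exact: openT|by []]].
  apply/funext => x; have [_ d1] := op_derive i x HL t0 t1.
  by rewrite /partial (@derive_val _ _ _ _ _ _ _ d1) Eo ImD ImcM /= mul0r addr0.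
split; split.
- by move=> x _; exact: c1.
- move=> i; split; last by have [] := dP i. by move=> x _; have [[]] := op_derive i x HL t0 t1.
- by move=> x _; exact: c2.
- move=> i; split; last by have [] := dP i. by move=> x _; have [_ []] := op_derive i x HL t0 t1.
Qed.

End operators.

(** * Gain of regularity *)
(** Weighted Cauchy-Schwarz, from 2 I <= l J + m/l for all l > 0. *)
Lemma sq_integral_le d (T : measurableType d) (R : realType) (mu : {measure set T -> \bar R})
    (w f : T -> R) : (forall t, 0 <= w t) -> (forall t, 0 <= f t) ->
  mu.-integrable setT (EFin \o w) -> mu.-integrable setT (fun t => (w t * f t)%:E) ->
  mu.-integrable setT (fun t => (w t * f t ^+ 2)%:E) ->
  (\int[mu]_t (w t * f t)) ^+ 2 <= (\int[mu]_t w t) * \int[mu]_t (w t * f t ^+ 2).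
Proof.
move=> w0 f0 iw iwf iwf2; set m := \int[mu]_t w t; set J := \int[mu]_t (w t * f t ^+ 2).
set I := \int[mu]_t _.
have m0 : 0 <= m by apply: Rintegral_ge0.
have J0 : 0 <= J by apply: Rintegral_ge0 => t _; rewrite mulr_ge0// sqr_ge0.
have I0 : 0 <= I by apply: Rintegral_ge0 => t _; rewrite mulr_ge0.
have key l : 0 < l -> 2 * I <= l * J + l^-1 * m. move=> l0; rewrite -!RintegralZl// -RintegralD//; last 2 first.
  - by have := integrableZl measurableT l iwf2.
  - by have := integrableZl measurableT l^-1 iw.
  apply: le_Rintegral => //; first by have := integrableZl measurableT 2 iwf.
    have := integrableD measurableT (integrableZl measurableT l iwf2) (integrableZl measurableT l^-1 iw).
    by apply: eq_integrable => // t _. move=> t _; rewrite (_ : l * _ + _ = w t * (l * f t ^+ 2 + l^-1)); last by ring.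
  rewrite mulrCA ler_wpM2l// -subr_ge0.
  rewrite (_ : _ - _ = l^-1 * (l * f t - 1) ^+ 2); first by rewrite mulr_ge0 ?sqr_ge0// invr_ge0 ltW.
  by field; rewrite gt_eqF.
have [I1|I1] := ltP 0 I; last first. by have -> : I = 0 by [apply/eqP; rewrite eq_le I1]; rewrite expr0n mulr_ge0.
(* If m were 0, this choice of l would give 2 I <= I J/(J + 1), against I > 0. *)
have mp : 0 < m. rewrite lt_neqAle m0 andbT; apply/eqP => mE. have J1 : 0 < J + 1 by rewrite ltr_wpDl.
  have := key (I / (J + 1)) (divr_gt0 I1 J1); rewrite -mE mulr0 addr0 mulrAC ler_pdivlMr//.
  rewrite -mulrA [2 * _]mulrC -mulrA ler_pM2l//; lra.
(* This l makes the second term equal to I, which cancels half of the left side. *)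
have := key (m / I) (divr_gt0 mp I1).
have -> : (m / I)^-1 * m = I by field; rewrite !gt_eqF.
by rewrite mulrAC -lerBlDr (_ : 2 * I - I = I) ?ler_pdivlMr//; ring.
Qed.

(** * Uniform L^2 bounds for the operators *)

Section schur.
Context (R : realType) (n : nat) (y0 : 'rV[R]_n) (rho : R).
Notation X := 'rV[R]_n.
Notation T := (n.-tuple R).
Notation leb := (leb R n).
Notation C := R[i].

(** Indicator of a ball of the maximum norm, hence a product of indicators of intervals. *)
Definition cube (t : R) (z : X) : R := (`|z| <= t)%R%:R.

Lemma cube_ge0 t z : 0 <= cube t z. Proof. by []. Qed.

Lemma cubeE t (z : X) : 0 <= t -> cube t z = \prod_i \1_`[(- t), t]%classic (z 0 i).
Proof.
move=> t0; have [zt|zt] := leP `|z| t. rewrite /cube zt big1// => i _; rewrite indicE mem_set//= in_itv/= -ler_norml.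
  exact: le_trans (coord_le_norm z i) zt.
rewrite /cube leNgt zt; have [i Hi] : exists i, t < `|z 0 i|.
  apply: contrapT => H; move: zt; rewrite ltNge => /negP; apply; apply: norm_row_le => // i.
  by rewrite leNgt; apply/negP => h; apply: H; exists i.
rewrite (bigD1 i)//= indicE memNset ?mul0r//= in_itv/= -ler_norml => /(lt_le_trans Hi).
by rewrite ltxx.
Qed.

Lemma cubeC t (x y : X) : cube t (x - y) = cube t (y - x).
Proof. by rewrite /cube distrC. Qed.

Lemma cube_indic t (x : X) : (fun s : T => cube t (x - rowt s)) = \1_[set s : T | `|x - rowt s| <= t].
Proof.
apply/funext => s; rewrite /cube indicE.
by have [h|h] := boolP (`|x - rowt s| <= t); [rewrite mem_set|rewrite memNset//=; exact/negP].
Qed.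

Lemma measurable_cball t (x : X) : measurable [set s : T | `|x - rowt s| <= t].
Proof.
have := @mnorm_le R n x t; congr measurable; apply/seteqP.
by split => s /=; rewrite distrC.
Qed.

Lemma integral_cube t (x : X) : 0 <= t -> (\int[leb]_s (cube t (x - rowt s))%:E = ((2 * t) ^+ n)%:E)%E.
Proof.
move=> t0; rewrite -(leb_closed_ball x t0) -[X in leb X]setIT.
rewrite -(integral_indic leb measurableT (measurable_cball t x)).
by apply: eq_integral => s _; rewrite -cube_indic.
Qed.

Lemma measurable_cube2 t : 0 <= t -> mfunT (fun z : T * T => cube t (rowt z.1 - rowt z.2)).
Proof.
move=> t0; under eq_fun do rewrite cubeE//; apply: measurable_prod => i _.
have mI : mfunT (\1_`[(- t), t]%classic : R -> R) by exact: measurable_indic.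
apply: (mcompT mI); under eq_fun do rewrite mxE [X in _ + X]mxE.
apply: measurable_funB. by apply: mcompT (mcoord i) _; exact: measurable_fst.
by apply: mcompT (mcoord i) _; exact: measurable_snd.
Qed.

(** Integrability is asked along with square integrability; in the application all functions live on
    a bounded set. *)
Definition L2 (v : T -> C) := cintg leb v /\ leb.-integrable setT (fun s => (normsq (v s))%:E).

(** Cauchy-Schwarz on the cube |x - y| <= t, then Tonelli: each step gives a factor (2t)^n, and
    together they cancel the square of the size t^-n of the kernel. The leading 4 is the square of
    the 2 in [nc_cintegral]. *)
Lemma schur K : ker y0 rho K -> exists2 B, 0 <= B & forall v t, L2 v -> 0 < t -> t <= 1 ->
  (l2n (op K v t) <= (B * \int[leb]_s normsq (v s))%:E)%E.
Proof.
move=> HK; have [B B0 HB] := ker_bound HK.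
exists (4 * B ^+ 2 * 4 ^+ n); first by rewrite !mulr_ge0 ?sqr_ge0 ?exprn_ge0.
move=> v t [iv iv2] t0 t1; have tw := ltW t0; have mv := cintg_meas iv.
have mcube (x : X) : mfunT (fun s : T => cube t (x - rowt s)).
  rewrite cube_indic; exact: measurable_indic (measurable_cball t x).
have cube1 (x : X) : cube t x <= 1 by rewrite /cube lern1 leq_b1.
have icube x (h : T -> R) : (forall s, 0 <= h s) -> leb.-integrable setT (EFin \o h) ->
    leb.-integrable setT (fun s => (cube t (x - rowt s) * h s)%:E). move=> h0 ih; apply: (le_integrable _ _ _ ih) => //.
    have [/mEFinP mh _] := integrableP _ _ _ ih. by apply/mEFinP; exact: mfunM.
  by move=> s _; rewrite lee_fin !ger0_norm ?mulr_ge0// ler_piMl.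
have icst x : leb.-integrable setT (EFin \o (fun s : T => cube t (x - rowt s))).
  apply/integrableP; split; first exact/mEFinP.
  by under eq_integral do rewrite /= ger0_norm//; rewrite integral_cube// ltry.
have tn : 0 <= t^-1 ^+ n by rewrite exprn_ge0// invr_ge0.
have i1 x : leb.-integrable setT (fun s => (cube t (x - rowt s) * nc (v s))%:E).
  by apply: icube; [move=> s; exact: nc_ge0|exact: cintg_nc].
have i2 x : leb.-integrable setT (fun s => (cube t (x - rowt s) * normsq (v s))%:E).
  by apply: icube => // s; exact: normsq_ge0.
have pt x : normsq (op K v t x) <= 4 * B ^+ 2 * (t^-1 ^+ n) ^+ 2 * (2 * t) ^+ n *
    \int[leb]_s (cube t (x - rowt s) * normsq (v s)).
  have h1 : nc (op K v t x) <= 2 * (B * t^-1 ^+ n * \int[leb]_s (cube t (x - rowt s) * nc (v s))).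
    rewrite -RintegralZl//; last exact: i1. apply: nc_cintegral => [||s].
    - exact: cintg_meas (ker_op_intg iv x HK t0 t1).
    - by have := integrableZl measurableT (B * t^-1 ^+ n) (i1 x).
    - rewrite ncM mulrA ler_wpM2r ?nc_ge0//; have [xs|xs] := leP `|x - rowt s| t. by rewrite /cube xs mulr1 HB.
      by rewrite (ker_near HK t0 xs) nc0 !mulr_ge0.
  have h2 := @sq_integral_le _ _ R leb (fun s => cube t (x - rowt s)) (fun s => nc (v s))
    (fun s => cube_ge0 _ _) (fun s => nc_ge0 _) (icst x) (i1 x).
  have e2 : (fun s => (cube t (x - rowt s) * nc (v s) ^+ 2)%:E) = (fun s => (cube t (x - rowt s) * normsq (v s))%:E).
    by apply/funext => s; rewrite nc_sqr. have {}h2 := h2 (eq_ind_r (fun f => leb.-integrable setT f) (i2 x) e2).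
  rewrite -nc_sqr; apply: (@le_trans _ _ ((2 * (B * t^-1 ^+ n * \int[leb]_s (cube t (x - rowt s) * nc (v s)))) ^+ 2)).
    rewrite lerXn2r ?nnegrE ?nc_ge0// !mulr_ge0//; apply: Rintegral_ge0 => s _. by rewrite mulr_ge0 ?nc_ge0.
  rewrite (_ : (2 * _) ^+ 2 = 4 * B ^+ 2 * (t^-1 ^+ n) ^+ 2 * (\int[leb]_s (cube t (x - rowt s) * nc (v s))) ^+ 2); last by ring.
  rewrite -[leRHS]mulrA ler_wpM2l ?mulr_ge0 ?sqr_ge0//; apply: le_trans h2 _.
  have -> : \int[leb]_s cube t (x - rowt s) = (2 * t) ^+ n by rewrite /Rintegral integral_cube.
  by rewrite le_eqVlt; apply/orP; left; apply/eqP; congr (_ * _); apply: eq_Rintegral => s _; rewrite nc_sqr.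
set c := 4 * B ^+ 2 * (t^-1 ^+ n) ^+ 2 * (2 * t) ^+ n in pt.
have t20 : 0 <= 2 * t by rewrite mulr_ge0.
have c0 : 0 <= c. by apply: mulr_ge0; [rewrite !mulr_ge0 ?sqr_ge0|exact: exprn_ge0].
have conv := @tonelli_convolution R n (fun s => normsq (v s)) (cube t) ((2 * t) ^+ n)
  (cmeas_normsq mv) (fun s => normsq_ge0 _) (measurable_cube2 tw) (fun z => cube_ge0 t z).
have {}conv := conv (fun y => etrans (eq_integral _ _ (fun x _ => congr1 EFin (cubeC t (rowt x) y))) (integral_cube y tw)).
have NE : (\int[leb]_s (normsq (v s))%:E = (\int[leb]_s normsq (v s))%:E)%E.
  by rewrite /Rintegral fineK//; exact: integrable_fin_num iv2.
have innerE x : (\int[leb]_s (cube t (x - rowt s) * normsq (v s)))%:E =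
    (\int[leb]_s (normsq (v s) * cube t (x - rowt s))%:E)%E.
  rewrite /Rintegral fineK; last exact: integrable_fin_num (i2 x). by apply: eq_integral => s _; rewrite mulrC.
have mF : mfunT (fun z : T * T => (normsq (v z.2) * cube t (rowt z.1 - rowt z.2))%:E).
  apply/mEFinP; apply: mfunM; last exact: measurable_cube2.
  by apply: mcompT (cmeas_normsq mv) _; exact: measurable_snd.
have F0 (z : T * T) : (0 <= (normsq (v z.2) * cube t (rowt z.1 - rowt z.2))%:E)%E.
  by rewrite lee_fin mulr_ge0 ?normsq_ge0.
have mI := @mfubini_F _ _ T T R leb _ mF F0.
apply: (@le_trans _ _ (\int[leb]_x (c%:E * \int[leb]_y (normsq (v y) * cube t (rowt x - rowt y))%:E))%E).
  apply: ge0_le_integral => //.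
  - by move=> x _; rewrite lee_fin normsq_ge0.
  - apply/mEFinP; apply: (@cmeas_normsq _ _ _ (fun s => op K v t (rowt s))).
    exact: cmeas_rowt (smoothC_op iv HK t0 t1).
  - exact: measurable_funeM.
  - by move=> x _; rewrite -innerE -EFinM lee_fin; exact: pt.
rewrite ge0_integralZl//; last by move=> x _; apply: integral_ge0 => y _; rewrite lee_fin mulr_ge0 ?normsq_ge0.
rewrite conv NE -!EFinM lee_fin le_eqVlt; apply/orP; left; apply/eqP.
rewrite /c (_ : 4 ^+ n = 2 ^+ n * 2 ^+ n :> R); last by rewrite -exprMn; congr (_ ^+ _); ring.
rewrite !exprMn exprVn; field; rewrite expf_neq0// gt_eqF//.
Qed.

End schur.

Section power_bounds.
Context (R : realType) (n : nat).
Notation X := 'rV[R]_n.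
Notation T := (n.-tuple R).
Notation C := R[i].
Implicit Types F G : R -> X -> C.

Lemma l2n_ge0 (f : X -> C) : (0 <= l2n f)%E.
Proof. by apply: integral_ge0 => t _; rewrite lee_fin normsq_ge0. Qed.

Lemma l2nD (f g : X -> C) : smoothC f -> smoothC g -> (l2n (fun x => (f x + g x)%R) <= 2%:E * l2n f + 2%:E * l2n g)%E.
Proof.
move=> sf sg; have mm h : smoothC h -> mfunT (fun t : T => (normsq (h (rowt t)))%:E).
  by move=> sh; apply/mEFinP; exact: cmeas_normsq (cmeas_rowt sh).
have p0 h (t : T) : setT t -> (0 <= (normsq (h (rowt t) : C))%:E)%E. by move=> _; rewrite lee_fin normsq_ge0.
rewrite /l2n -!ge0_integralZl//; try exact: mm; try exact: p0.
rewrite -ge0_integralD//; last 4 first.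
- by move=> t _; rewrite -EFinM lee_fin mulr_ge0 ?normsq_ge0.
- by apply: emeasurable_funM => //; exact: mm.
- by move=> t _; rewrite -EFinM lee_fin mulr_ge0 ?normsq_ge0.
- by apply: emeasurable_funM => //; exact: mm.
apply: ge0_le_integral => //; first by move=> s _; rewrite lee_fin normsq_ge0.
- exact: (mm _ (smoothCD sf sg)).
- by apply: emeasurable_funD; apply: emeasurable_funM => //; exact: mm.
by move=> t _; rewrite -!EFinM -EFinD lee_fin normsqD.
Qed.

Lemma l2nM (a f : X -> C) (A : R) : smoothC a -> smoothC f -> (forall x, nc (a x) <= A) ->
  (l2n (fun x => (a x * f x)%R) <= (A ^+ 2)%:E * l2n f)%E.
Proof.
move=> sa sf aA; have A0 : 0 <= A := le_trans (nc_ge0 _) (aA 0).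
have mm h : smoothC h -> mfunT (fun t : T => (normsq (h (rowt t)))%:E).
  by move=> sh; apply/mEFinP; exact: cmeas_normsq (cmeas_rowt sh).
rewrite /l2n -ge0_integralZl//; last 3 first.
- exact: mm.
- by move=> t _; rewrite lee_fin normsq_ge0.
- by rewrite lee_fin sqr_ge0.
apply: ge0_le_integral => //.
- by move=> t _; rewrite lee_fin normsq_ge0.
- exact: (mm _ (smoothCM sa sf)).
- by apply: emeasurable_funM => //; exact: mm.
move=> t _; rewrite -EFinM lee_fin normsqM ler_wpM2r ?normsq_ge0// -nc_sqr.
by rewrite lerXn2r ?nnegrE ?nc_ge0.
Qed.

Definition smooth_family F := forall t, 0 < t -> t <= 1 -> smoothC (F t).

(** [l2n] is a squared norm, so the exponent 2 s stands for a norm of size t^s. *)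
Definition le_pow F (a : R) := exists2 B, 0 <= B & forall t, 0 < t -> t <= 1 -> (l2n (F t) <= (B * t `^ a)%:E)%E.

Lemma le_pow_ext F G a : (forall t, 0 < t -> t <= 1 -> F t =1 G t) -> le_pow F a -> le_pow G a.
Proof.
move=> FG [B B0 HB]; exists B => // t t0 t1; rewrite (_ : G t = F t); first exact: HB.
by apply/funext => x; rewrite FG.
Qed.

Lemma le_pow_weak F a b : b <= a -> le_pow F a -> le_pow F b.
Proof.
move=> ba [B B0 HB]; exists B => // t t0 t1; apply: le_trans (HB t t0 t1) _.
by rewrite lee_fin ler_wpM2l//; apply: ger_powR; rewrite ?t0.
Qed.

Lemma le_powD F G a : smooth_family F -> smooth_family G -> le_pow F a -> le_pow G a ->
  le_pow (fun t x => F t x + G t x) a.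
Proof.
move=> sF sG [B B0 HB] [D D0 HD]; exists (2 * B + 2 * D); first by rewrite addr_ge0 ?mulr_ge0.
move=> t t0 t1; apply: le_trans (l2nD (sF _ t0 t1) (sG _ t0 t1)) _.
apply: (@le_trans _ _ (2%:E * (B * t `^ a)%:E + 2%:E * (D * t `^ a)%:E)%E).
  by apply: leeD; apply: lee_wpmul2l; rewrite ?lee_fin//; [exact: HB|exact: HD].
rewrite -!EFinM -EFinD lee_fin le_eqVlt; apply/orP; left; apply/eqP; ring.
Qed.

Lemma le_powM (z : X -> C) F a : test z -> smooth_family F -> le_pow F a -> le_pow (fun t x => z x * F t x) a.
Proof.
move=> tz sF [B B0 HB]; have [A A0 HA] := test_bounded tz.
exists (A ^+ 2 * B); first by rewrite mulr_ge0 ?sqr_ge0.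
move=> t t0 t1; apply: le_trans (l2nM (proj1 tz) (sF _ t0 t1) HA) _.
apply: (@le_trans _ _ ((A ^+ 2)%:E * (B * t `^ a)%:E)%E); last by rewrite -EFinM mulrA.
by apply: lee_wpmul2l; [rewrite lee_fin sqr_ge0|exact: HB].
Qed.

Lemma le_powN F a : le_pow F a -> le_pow (fun t x => - F t x) a.
Proof.
move=> [B B0 HB]; exists B => // t t0 t1; rewrite (_ : l2n _ = l2n (F t)); first exact: HB.
by apply: eq_integral => s _; rewrite normsqN.
Qed.

End power_bounds.

Section hypotheses.
Context (R : realType) (n m : nat) (y0 : 'rV[R]_n) (rho : R) (alpha : 'I_m -> 'I_n -> 'rV[R]_n -> R[i]).

(** The left side pairs [v] with the transpose of L_j applied to [phi]: v' is L_j v in the sense of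
    distributions on the ball, and it belongs to [V] again. *)
Definition lie_stable (V : (n.-tuple R -> R[i]) -> Prop) :=
  forall v j, V v -> exists2 v', V v' & forall phi, test_in y0 rho phi ->
  cintegral (leb R n) (fun s => (- \sum_i cpart i (fun x => alpha j i x * phi x) (rowt s)) * v s) =
  cintegral (leb R n) (fun s => phi (rowt s) * v' s).

Definition subell_est (eps K : R) := forall w, test_in y0 rho w ->
  (sobolev_sq eps w <= K%:E * (l2n w + \sum_j l2n (lieD (alpha j) w)))%E.

End hypotheses.

(** * Families of operators at scale t and the improvement of their bounds *)

Section families.
Context (R : realType) (n m : nat) (y0 : 'rV[R]_n) (rho : R).
Notation X := 'rV[R]_n.
Notation T := (n.-tuple R).
Notation leb := (leb R n).
Notation C := R[i].
Notation ker := (ker y0 rho).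

Variable alpha : 'I_m -> 'I_n -> X -> C.
Hypothesis talpha : forall j i, test (alpha j i).

Variable V : (T -> C) -> Prop.
Hypothesis VL2 : forall v, V v -> L2 v.
Hypothesis Vlie : lie_stable y0 rho alpha V.

(** The index bounds the number of derivatives. Stability under the L_j is not a clause: it is
    proved in [fam_lie]. *)
Inductive fam : nat -> (R -> X -> C) -> Prop :=
| fam_op K v : ker K -> V v -> fam 0 (op K v)
| fam_mul b a F : test a -> fam b F -> fam b (fun t x => a x * F t x)
| fam_add b F G : fam b F -> fam b G -> fam b (fun t x => F t x + G t x)
| fam_part b i F : fam b F -> fam b.+1 (fun t => cpart i (F t))
| fam_succ b F : fam b F -> fam b.+1 F.

(** Normal form with all derivatives carried out in the kernels: at most [b] factors 1/t in front of
    operators without derivatives. *)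
Inductive rep : nat -> (R -> X -> C) -> Prop :=
| rep_op b j K v : (j <= b)%N -> ker K -> V v -> rep b (fun t x => (t^-1 ^+ j)%:C * op K v t x)
| rep_add b F G : rep b F -> rep b G -> rep b (fun t x => F t x + G t x).

Lemma rep_succ b F : rep b F -> rep b.+1 F.
Proof.
elim=> {b F} [b j K v jb HK Hv|b F G _ HF _ HG]; last exact: rep_add.
by apply: rep_op => //; exact: leqW.
Qed.

Lemma rep_mul b a F : test a -> rep b F -> exists2 F', rep b F' & forall t x, 0 < t -> t <= 1 -> a x * F t x = F' t x.
Proof.
move=> ta; elim=> {b F} [b j K v jb HK Hv|b F G _ [F' rF EF] _ [G' rG EG]].
  exists (fun t x => (t^-1 ^+ j)%:C * op (fun t x y => a x * K t x y) v t x). by apply: rep_op => //; exact: ker_mul1.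
  by move=> t x t0 t1; rewrite (opZ (proj1 (VL2 Hv)) (fun=> a) x HK t0 t1) mulrCA.
exists (fun t x => F' t x + G' t x); first exact: rep_add.
by move=> t x t0 t1; rewrite mulrDr EF ?EG.
Qed.

Lemma rep_smooth b F : rep b F -> smooth_family F.
Proof.
elim=> {b F} [b j K v jb HK Hv|b F G _ sF _ sG] t t0 t1.
  by apply: smoothCZ; exact: (smoothC_op (proj1 (VL2 Hv)) HK t0 t1).
by apply: smoothCD; [exact: sF|exact: sG].
Qed.

Lemma rep_part b i F : rep b F -> exists2 F', rep b.+1 F' & forall t x, 0 < t -> t <= 1 -> cpart i (F t) x = F' t x.
Proof.
elim=> {b F} [b j K v jb HK Hv|b F G rF [F' rF' EF] rG [G' rG' EG]]. have [K1 [K2 [H1 H2 E]]] := ker_cpart i HK.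
  exists (fun t x => (t^-1 ^+ j)%:C * op K1 v t x + (t^-1 ^+ j.+1)%:C * op K2 v t x).
    by apply: rep_add; apply: rep_op => //; exact: leqW. move=> t x t0 t1; have iv := proj1 (VL2 Hv).
  rewrite (cpartZ _ _ _ (smoothC_op iv HK t0 t1)) (op_cpart iv i x HK t0 t1).
  by rewrite (op_dker iv x H1 H2 t0 t1 E) mulrDr mulrA exprSr rmorphM.
exists (fun t x => F' t x + G' t x); first exact: rep_add.
move=> t x t0 t1; rewrite (cpartD _ _ (rep_smooth rF t0 t1) (rep_smooth rG t0 t1)).
by rewrite EF ?EG.
Qed.

Lemma fam_rep b F : fam b F -> exists2 F', rep b F' & forall t, 0 < t -> t <= 1 -> F t = F' t.
Proof.
elim=> {b F} [K v HK Hv|b a F ta _ [F' rF EF]|b F G _ [F' rF EF] _ [G' rG EG]|b i F _ [F' rF EF]|b F _ [F' rF EF]].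
- exists (fun t x => (t^-1 ^+ 0)%:C * op K v t x); first exact: rep_op.
  by move=> t _ _; apply/funext => x; rewrite expr0 mul1r.
- have [F'' rF' EF'] := rep_mul ta rF; exists F'' => // t t0 t1; apply/funext => x. by rewrite EF ?EF'.
- exists (fun t x => F' t x + G' t x); first exact: rep_add. by move=> t t0 t1; apply/funext => x; rewrite EF ?EG.
- have [F'' rF' EF'] := rep_part i rF; exists F'' => // t t0 t1; apply/funext => x. by rewrite EF ?EF'.
- by exists F' => //; exact: rep_succ.
Qed.

Lemma fam_smooth b F : fam b F -> smooth_family F.
Proof. by move=> /fam_rep[F' rF EF] t t0 t1; rewrite EF//; exact: (rep_smooth rF t0 t1). Qed.

(** The trivial bound: each derivative costs at most 1/t, and Schur's estimate controls the
    operators that remain. *)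
Lemma fam_bound b F : fam b F -> le_pow F (- (2 * b%:R)).
Proof.
move=> /fam_rep[F' rF EF]; apply: (@le_pow_ext _ _ F'); first by move=> t t0 t1; rewrite EF.
elim: rF => {F F' EF b} [b j K v jb HK Hv|b F G rF IHF rG IHG]; last first.
  by apply: le_powD => //; [exact: rep_smooth rF|exact: rep_smooth rG].
apply: (@le_pow_weak _ _ _ (- (2 * j%:R))); first by rewrite lerN2 ler_wpM2l ?ler_nat.
have [B B0 HB] := schur HK; exists (B * \int[leb]_s normsq (v s)).
  by rewrite mulr_ge0//; apply: Rintegral_ge0 => s _; exact: normsq_ge0.
move=> t t0 t1; have iv := VL2 Hv.
have nct (x : X) : nc ((fun=> (t^-1 ^+ j)%:C) x) <= t^-1 ^+ j. by rewrite ncR ger0_norm// exprn_ge0// invr_ge0 ltW.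
apply: le_trans (l2nM (@smoothC_cst R n _) (smoothC_op (proj1 iv) HK t0 t1) nct) _.
apply: (@le_trans _ _ (((t^-1 ^+ j) ^+ 2)%:E * (B * \int[leb]_s normsq (v s))%:E)%E).
  by apply: lee_wpmul2l; [rewrite lee_fin sqr_ge0|exact: HB].
rewrite -EFinM mulrC lee_fin le_eqVlt; apply/orP; left; apply/eqP; congr (_ * _).
rewrite powRN -natrM powR_mulrn ?(ltW t0)// -exprVn -exprM mulnC//.
Qed.

Lemma fam_sum b F0 (I : finType) (F : I -> R -> X -> C) : fam b F0 -> (forall i, fam b (F i)) ->
  fam b (fun t x => \sum_i F i t x).
Proof.
move=> H0 H; elim: (index_enum I) => [|i r IH].
  rewrite (_ : (fun t x => _) = (fun t x => (fun=> 0 : C) x * F0 t x)); first exact: (fam_mul (@test0 R n) H0).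
  by apply/funext => t; apply/funext => x; rewrite big_nil mul0r.
rewrite (_ : (fun t x => _) = (fun t x => F i t x + \sum_(i <- r) F i t x)); first exact: fam_add.
by apply/funext => t; apply/funext => x; rewrite big_cons.
Qed.

(** For an operator, L in x is the transport of the kernel minus L in y; by parts the latter falls
    on [v], giving v' and a divergence term. For a derivative, its commutator with L_j is again of
    first order, so the index does not grow. *)
Lemma fam_lie j b F : fam b F -> exists2 F', fam b F' & forall t x, 0 < t -> t <= 1 -> lieD (alpha j) (F t) x = F' t x.
Proof.
elim=> {b F} [K v HK Hv|b a F ta fF [F' rF EF]|b F G fF [F' rF EF] fG [G' rG EG]|b i F fF [F' rF EF]|b F fF [F' rF EF]].
- have [v' Hv' Ev'] := Vlie j Hv; pose div y := \sum_i cpart i (alpha j i) y.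
  have sdiv : smoothC div by apply: smoothC_sum => i _; apply: smoothC_cpart; exact: (proj1 (talpha j i)).
  pose K' t x y := transport (alpha j) K t x y + div y * K t x y.
  have kT := ker_transport (talpha j) HK; have kD := ker_mul2 sdiv HK. have HK' : ker K' by exact: ker_add.
  exists (fun t x => op K' v t x + op K v' t x); first by apply: fam_add; exact: fam_op.
  move=> t x t0 t1; have iv := proj1 (VL2 Hv); have iv' := proj1 (VL2 Hv'). have tK : test_in y0 rho (K t x).
    split; first exact: ker_smooth2 HK. by have [s sr Hs] := ker_supp HK; exists s.
  rewrite [X in _ = _ + X](_ : _ = cintegral leb (fun s => K t x (rowt s) * v' s))// -Ev'//.
  have E1 y : - \sum_i cpart i (fun z => alpha j i z * K t x z) y =
      - (div y * K t x y + lieD (alpha j) (K t x) y).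
    congr (- _); rewrite /div /lieD mulr_suml -big_split; apply: eq_bigr => i _.
    by rewrite cpartM//; [exact: (proj1 (talpha j i))|exact: ker_smooth2 HK].
  have -> : lieD (alpha j) (op K v t) x = cintegral leb (fun s => lieD (alpha j) (fun x => K t x (rowt s)) x * v s).
    rewrite /lieD; transitivity (\sum_i cintegral leb (fun s => alpha j i x * (dker i K t x (rowt s) * v s))).
      apply: eq_bigr => i _; rewrite cintegralZ; last exact: (dker_op_intg iv i x HK t0 t1).
      by rewrite (op_cpart iv i x HK t0 t1). rewrite -cintegral_sum; last first.
      by move=> i _; apply: cintgZ; exact: (dker_op_intg iv i x HK t0 t1).
    by apply: eq_cintegral => s; rewrite mulr_suml; apply: eq_bigr => i _; rewrite mulrA.
  have i1 := ker_op_intg iv x HK' t0 t1.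
  have i2 : cintg leb (fun s => (- \sum_i cpart i (fun z => alpha j i z * K t x z) (rowt s)) * v s).
    pose k y := - \sum_i cpart i (fun z => alpha j i z * K t x z) y. have tk : test k.
      rewrite (_ : k = fun y => (-1) * \sum_i cpart i (fun z => alpha j i z * K t x z) y); last first.
        by apply/funext => y; rewrite mulN1r. apply: testMr; first exact: smoothC_cst.
      apply: test_sum => i _; apply: test_cpart; apply: testMr; first exact: (proj1 (talpha j i)). exact: test_inW tK.
    have [A A0 HA] := test_bounded tk. exact: (op_integrable iv (cmeas_rowt (proj1 tk)) HA).
  rewrite /op -cintegralD//; apply: eq_cintegral => s. by rewrite E1 -mulrDl /K' /transport; congr (_ * _); ring.
- exists (fun t x => lieD (alpha j) a x * F t x + a x * F' t x).
    by apply: fam_add; apply: fam_mul => //; exact: (test_lie (talpha j) (proj1 ta)).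
  move=> t x t0 t1; rewrite lieM; [|exact: (proj1 ta)|exact: (fam_smooth fF t0 t1)]. by rewrite EF.
- exists (fun t x => F' t x + G' t x); first exact: fam_add.
  move=> t x t0 t1; rewrite (lieDD _ _ (fam_smooth fF t0 t1) (fam_smooth fG t0 t1)). by rewrite EF ?EG.
- exists (fun t x => cpart i (F' t) x + \sum_k (- cpart i (alpha j k) x) * cpart k (F t) x).
    apply: fam_add; first exact: fam_part. apply: (fam_sum (fam_part i fF)) => k; apply: fam_mul; last exact: fam_part.
    rewrite (_ : (fun x => _) = fun x => (-1) * cpart i (alpha j k) x); last by apply/funext => x; rewrite mulN1r.
    by apply: testMr; [exact: smoothC_cst|exact: test_cpart]. move=> t x t0 t1; have sF := fam_smooth fF t0 t1.
  rewrite (_ : F' t = lieD (alpha j) (F t)); last by apply/funext => y; rewrite EF. rewrite /lieD cpart_sum; last first.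
    by move=> k _; apply: smoothCM; [exact: (proj1 (talpha j k))|exact: smoothC_cpart].
  rewrite -big_split; apply: eq_bigr => k _ /=. rewrite cpartM; [|exact: (proj1 (talpha j k))|exact: smoothC_cpart].
  by rewrite (cpartC k i x sF); ring.
- by exists F' => //; exact: fam_succ.
Qed.

Variables (eps Kc : R).
Hypotheses (eps0 : 0 < eps) (Kc0 : 0 <= Kc).
Hypothesis subell : subell_est y0 rho alpha eps Kc.

Let e := Num.min eps 1.
(** With h = t^(1 + sigma) in [interpolation], the exponents of the two terms exceed the trivial one
    by 2 sigma + 4 sigma^2 and by 2 sigma. The minimum with 1 in [e] is imposed by
    [interpolation_symbol]. *)
Definition sigma := e / 2.

Let e0 : 0 < e. Proof. by rewrite lt_min eps0 ltr01. Qed.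
Let e1 : e <= 1. Proof. by rewrite ge_min lexx orbT. Qed.
Let eeps : e <= eps. Proof. by rewrite ge_min lexx. Qed.

Lemma sigma_gt0 : 0 < sigma. Proof. by rewrite divr_gt0. Qed.
Lemma sigma_le1 : sigma <= 1. Proof. by rewrite /sigma; have := e1; have := e0; lra. Qed.

(** [s] is the improvement over [fam_bound], as a power of t in the norm. The factor [z] brings the
    support into the ball where the subelliptic estimate holds. *)
Definition gain b (s : R) := forall F z, fam b F -> test_in y0 rho z ->
  le_pow (fun t x => z x * F t x) (2 * (s - b%:R)).

Lemma gain0 b : gain b 0.
Proof.
move=> F z fF tz; apply: le_powM; [exact: test_inW tz|exact: fam_smooth fF|].
by rewrite sub0r mulrN; exact: fam_bound fF.
Qed.

(** For w = z F, each L_j w is bounded like w by [fam_lie], so the estimate bounds the Sobolev norm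
    of w with no loss in t. The assumptions at orders b+1 and b+2 serve to bound the second
    derivative of w, the other term of the interpolation. *)
Lemma gain_part b s i F z : gain b s -> gain b.+1 s -> gain b.+2 s -> fam b F -> test_in y0 rho z ->
  le_pow (fun t x => z x * cpart i (F t) x) (2 * (s + sigma - b.+1%:R)).
Proof.
move=> g0 g1 g2 fF tz; pose a := s - b%:R.
have s01 := sigma_gt0; have s1 := sigma_le1.
have bS : b.+1%:R = b%:R + 1 :> R by rewrite natr1.
have bSS : b.+2%:R = b%:R + 2 :> R by rewrite -[b.+2%:R]natr1 bS -addrA.
have sF := fam_smooth fF; have sz := proj1 tz.
pose w t x := z x * F t x.
have sw t : 0 < t -> t <= 1 -> smoothC (w t) by move=> t0 t1; apply: smoothCM => //; exact: sF.
have tw t : 0 < t -> t <= 1 -> test_in y0 rho (w t) by move=> t0 t1; apply: test_inM => //; exact: sF.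
have [B1 B10 HB1] : le_pow w (2 * a) by exact: g0.
have Dw k t x : 0 < t -> t <= 1 -> cpart k (w t) x = cpart k z x * F t x + z x * cpart k (F t) x.
  by move=> t0 t1; rewrite cpartM//; exact: sF.
have sM u G t : smoothC u -> smooth_family G -> 0 < t -> t <= 1 -> smoothC (fun x => u x * G t x).
  by move=> su sG t0 t1; apply: smoothCM => //; exact: sG.
have [B2 B20 HB2] : le_pow (fun t => cpart i (cpart i (w t))) (2 * (a - 2)).
  apply: (@le_pow_ext _ _ (fun t x => (cpart i (cpart i z) x * F t x + cpart i z x * cpart i (F t) x) +
      (cpart i z x * cpart i (F t) x + z x * cpart i (cpart i (F t)) x))). move=> t t0 t1 x; have sFt := sF _ t0 t1.
    rewrite (_ : cpart i (w t) = fun x => cpart i z x * F t x + z x * cpart i (F t) x); last first.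
      by apply/funext => y; exact: Dw. have sz1 := smoothC_cpart i sz; have sF1 := smoothC_cpart i sFt.
    rewrite (cpartD _ _ (smoothCM sz1 sFt) (smoothCM sz sF1)). by rewrite (cpartM _ _ sz1 sFt) (cpartM _ _ sz sF1).
  have tz1 := test_in_cpart i tz; have tz2 := test_in_cpart i tz1.
  have p0 : le_pow (fun t x => cpart i (cpart i z) x * F t x) (2 * (a - 2)).
    by apply: le_pow_weak (g0 _ _ fF tz2); rewrite ler_wpM2l// /a; lra.
  have p1 : le_pow (fun t x => cpart i z x * cpart i (F t) x) (2 * (a - 2)).
    by apply: le_pow_weak (g1 _ _ (fam_part i fF) tz1); rewrite ler_wpM2l// /a bS; lra.
  have p2 : le_pow (fun t x => z x * cpart i (cpart i (F t)) x) (2 * (a - 2)).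
    by apply: le_pow_weak (g2 _ _ (fam_part i (fam_part i fF)) tz); rewrite ler_wpM2l// /a bSS; lra.
  have s0 : smooth_family (fun t x => cpart i (cpart i z) x * F t x). by move=> t; exact: sM (proj1 tz2) sF.
  have s1' : smooth_family (fun t x => cpart i z x * cpart i (F t) x).
    by move=> t t0 t1; apply: smoothCM (proj1 tz1) _; apply: smoothC_cpart; exact: sF.
  have s2 : smooth_family (fun t x => z x * cpart i (cpart i (F t)) x).
    by move=> t t0 t1; apply: smoothCM sz _; do 2!apply: smoothC_cpart; exact: sF.
  apply: le_powD; [| |exact: le_powD|exact: le_powD] => t t0 t1; apply: smoothCD.
  - exact: s0. - exact: s1'. - exact: s1'. - exact: s2.
have /choice[B3 HB3] j : exists B, 0 <= B /\ forall t, 0 < t -> t <= 1 ->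
    (l2n (lieD (alpha j) (w t)) <= (B * t `^ (2 * a))%:E)%E. have [F' fF' EF'] := fam_lie j fF.
  have tLz : test_in y0 rho (lieD (alpha j) z).
    have [_ [r rr zr]] := tz; split; first exact: (proj1 (test_lie (talpha j) sz)).
    by exists r => // x xr; rewrite /lieD big1// => k _; rewrite (suppC_cpart k zr xr) mulr0.
  suff [B B0 HB] : le_pow (fun t => lieD (alpha j) (w t)) (2 * a) by exists B.
  apply: (@le_pow_ext _ _ (fun t x => lieD (alpha j) z x * F t x + z x * F' t x)).
    by move=> t t0 t1 x; rewrite lieM ?EF'//; exact: sF. apply: le_powD.
  - by move=> t; exact: sM (proj1 tLz) sF.
  - by move=> t; exact: sM sz (fam_smooth fF').
  - exact: g0. - exact: g0.
have [_ [r _ zr]] := tz.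
have pD : le_pow (fun t => cpart i (w t)) (2 * (s + sigma - b.+1%:R)). pose B := B1 + \sum_j B3 j.
  have BB : 0 <= B by rewrite addr_ge0// sumr_ge0// => j _; have [] := HB3 j.
  exists (Kc * B + B2); first by rewrite addr_ge0 ?mulr_ge0. move=> t t0 t1; have tN : t != 0 by rewrite gt_eqF.
  (* This power makes the second-derivative term exactly of the announced order; the Sobolev term is
     then smaller because e = 2 sigma. *)
  pose h := t `^ (1 + sigma); have h0 : 0 < h by rewrite powR_gt0. have zw : suppC y0 r (w t) by exact: suppCMl.
  apply: le_trans (interpolation i (sw t t0 t1) zw (ltW e0) e1 eeps h0) _.
  have sob : (sobolev_sq eps (w t) <= (Kc * B * t `^ (2 * a))%:E)%E.
    apply: le_trans (subell (tw t t0 t1)) _; rewrite -mulrA EFinM lee_wpmul2l ?lee_fin//.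
    rewrite /B mulrDl EFinD; apply: leeD; first exact: HB1.
    by rewrite mulr_suml -sumEFin; apply: lee_sum => j _; have [_] := HB3 j; exact.
  apply: (@le_trans _ _ ((h `^ (2 * e - 2))%:E * (Kc * B * t `^ (2 * a))%:E +
     (h ^+ 2)%:E * (B2 * t `^ (2 * (a - 2)))%:E)%E).
    by apply: leeD; apply: lee_wpmul2l; rewrite ?lee_fin ?powR_ge0 ?sqr_ge0//; exact: HB2.
  rewrite -!EFinM -EFinD lee_fin [leRHS]mulrDl; apply: lerD.
    rewrite mulrCA ler_wpM2l ?mulr_ge0// /h -powRrM -powRD; last by rewrite tN implybT.
    apply: ger_powR; first by rewrite t0 t1.
    rewrite /a bS /sigma; have := e0; have : 0 <= e * e by rewrite mulr_ge0// ltW. by lra.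
  rewrite mulrCA ler_wpM2l// -powR_mulrn ?powR_ge0// /h -powRrM -powRD; last by rewrite tN implybT.
  apply: ger_powR; first by rewrite t0 t1. by rewrite /a bS; lra.
apply: (@le_pow_ext _ _ (fun t x => cpart i (w t) x + - (cpart i z x * F t x))).
  by move=> t t0 t1 x; rewrite Dw// addrAC subrr add0r.
have tz1 := test_in_cpart i tz.
apply: le_powD => //.
- by move=> t t0 t1; apply: smoothC_cpart; exact: sw.
- by move=> t t0 t1; apply: smoothCN; exact: sM (proj1 tz1) sF t0 t1.
- apply: le_powN; apply: le_pow_weak (g0 _ _ fF tz1). by rewrite ler_wpM2l// bS; lra.
Qed.

(** Improving a derivative of order b uses orders b-1, b and b+1, so the lowest admissible order
    rises by one at each step. *)
Lemma gain_step k s : (forall b, (k <= b)%N -> gain b s) -> forall b, (k < b)%N -> gain b (s + sigma).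
Proof.
move=> Hg b kb F z fF; elim: fF z kb => {b F} [K v HK Hv|b a F ta fF IH|b F G fF IHF fG IHG|b i F fF IH|b F fF IH] z kb tz //.
- have := IH _ kb (test_inM tz (proj1 ta)); apply: le_pow_ext => t t0 t1 x. by rewrite -mulrA.
- apply: (@le_pow_ext _ _ (fun t x => z x * F t x + z x * G t x)). by move=> t t0 t1 x; rewrite mulrDr.
  apply: le_powD; [| |exact: IHF|exact: IHG] => t t0 t1; apply: smoothCM (proj1 tz) _. exact: (fam_smooth fF).
  exact: (fam_smooth fG).
- by apply: gain_part => //; apply: Hg; rewrite // ltnW// leqW.
(* Counting a member of order b as one of order b+1 gives away a full power of t, at least
   [sigma]. *)
- apply: le_pow_weak (Hg b kb _ _ fF tz); rewrite ler_wpM2l// -[b.+1%:R]natr1. have := sigma_le1; lra.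
Qed.

(** At k = b this says that a derivative of order b costs only t^(-b (1 - sigma)). *)
Lemma gain_all k b : (k <= b)%N -> gain b (k%:R * sigma).
Proof.
elim: k b => [|k IH] b kb; first by rewrite mul0r; exact: gain0.
by rewrite -[k.+1%:R]natr1 mulrDl mul1r; exact: gain_step kb.
Qed.

End families.

(** * Smooth limits *)
Section sup_bound.
Context (R : realType).
Notation C := R[i].
Notation mu := (@lebesgue_measure R).

Lemma abs_le_integral_derive (f F : R -> R) (r a : R) : continuous f ->
  (forall x, is_derive x (1 : R) F (f x)) -> (forall x, r < `|x| -> F x = 0) -> (`|F a|%:E <= \int[mu]_x `|f x|%:E)%E.
Proof.
move=> cf dF F0; pose s := `|r| + `|a| + 1.
have s0 : 0 < s by rewrite ltr_wpDl ?addr_ge0.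
have rs : r < s by have := ler_norm r; have := normr_ge0 a; rewrite /s; lra.
have sa : - s < a by have := ler_norm (- a); rewrite normrN; have := normr_ge0 r; rewrite /s; lra.
have cF : continuous F. by move=> x; apply/differentiable_continuous/derivable1_diffP; have [] := dF x.
have E : (\int[mu]_(x in `[(- s)%R, a]) (f x)%:E = (F a)%:E)%E. rewrite (@continuous_FTC2 _ f F)//.
  - by rewrite [F (- s)]F0 ?sube0// normrN ger0_norm// ltW.
  - exact: continuous_subspaceT.
  - split; first by move=> x _; have [] := dF x. by apply: cvg_at_right_filter; exact: cF.
    by apply: cvg_at_left_filter; exact: cF.
  - by move=> x _; rewrite derive1E; have [_] := dF x.
have mf : mfunT f by exact: cont_mfun.
rewrite (_ : `|F a|%:E = `|(F a)%:E|)%E// -E.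
apply: le_trans (le_abse_integral _ _ _) _ => //. by apply/mEFinP; exact: measurable_funTS.
apply: ge0_subset_integral => //.
by apply/mEFinP; apply: mcompT.
Qed.

Definition partials n (w : seq 'I_n) (f : 'rV[R]_n -> R) : 'rV[R]_n -> R := foldl (fun g i => partial i g) f w.

Lemma smooth_partials n (w : seq 'I_n) (f : 'rV[R]_n -> R) : smooth setT f -> smooth setT (partials w f).
Proof. by elim: w f => [|i w IH] f sf //=; apply: IH; exact: smooth_partial. Qed.

Lemma partials_mxcons n (w : seq 'I_n) (f : 'rV[R]_n.+1 -> R) a (x : 'rV[R]_n) : smooth setT f ->
  partials w (fun x => f (mxcons a x)) x = partials (map (lift ord0) w) f (mxcons a x).
Proof.
elim: w f => [|i w IH] f sf //=; rewrite -IH; last exact: smooth_partial.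
congr (partials w _ x); apply/funext => z.
by have [] := partial_mxcons (@smooth_der _ _ setT f (mxcons a z) (lift ord0 i) sf I).
Qed.

(** The fundamental theorem in each variable in turn; the resulting mixed derivative contains every
    coordinate exactly once. *)
Lemma abs_le_integral_partials n (f : 'rV[R]_n -> R) y r x : smooth setT f -> supp_in y r f ->
  (`|f x|%:E <= \int[leb R n]_t `|partials (enum 'I_n) f (rowt t)|%:E)%E.
Proof.
elim: n f y x => [|n IH] f y x sf zf. rewrite (_ : enum 'I_0 = [::]); last by apply: size0nil; rewrite size_enum_ord.
  rewrite [leRHS](_ : _ = `|f x|%:E)//= integral_dirac//=.
    by rewrite diracT mul1e; congr ((`|f _|)%:E); apply/rowP => -[].
  by apply/mEFinP; apply: mcompT => //; apply: mrowt_cont => z;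
    exact: smooth_cont sf I.
have sD := smooth_partial ord0 sf; have zD := supp_in_partial ord0 zf.
pose x' : 'rV[R]_n := \row_j x 0 (lift ord0 j).
have -> : x = mxcons (x 0 ord0) x'. by apply/rowP => k; have [->|[j ->]] := ord_liftP k; rewrite ?mxcons0 ?mxconsS ?mxE.
have cD : continuous (partial ord0 f) by move=> z; exact: smooth_cont sD I.
have cD1 : continuous (fun a => partial ord0 f (mxcons a x')).
  move=> a; apply: (@continuous_comp _ _ _ (fun a => mxcons a x') (partial ord0 f)). exact: continuous_mxcons1.
  exact: cD.
apply: le_trans (abs_le_integral_derive (x 0 ord0) cD1
  (fun a => is_derive_mxcons0 x' a (sf 1%N)) (fun a => @supp_in_mxcons0 _ _ y r f x' a zf)) _.
set g := partials _ f.
have sg : smooth setT g by exact: smooth_partials.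
have cg : continuous g by move=> z; exact: smooth_cont sg I.
have mg : mfunT (fun t : n.+1.-tuple R => `|g (rowt t)|%:E).
  apply/mEFinP; apply: mcompT => //. exact: mrowt_cont.
rewrite ge0_integral_leb_cons//.
have mF : mfunT (fun z : measurableTypeR R * n.-tuple R => `|g (rowt (tuple_cons z))|%:E).
  by apply: (mcompT mg); exact: measurable_tuple_cons.
have F0 (z : measurableTypeR R * n.-tuple R) : (0 <= `|g (rowt (tuple_cons z))|%:E)%E by rewrite lee_fin.
apply: ge0_le_integral => //.
- apply/mEFinP; apply: mcompT => //; exact: cont_mfun.
- exact: (@mfubini_F _ _ _ _ R (leb R n) _ mF F0).
move=> a _; have sa : smooth setT (fun x => partial ord0 f (mxcons a x)). by move=> k; exact: Ck_mxcons (sD k).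
apply: le_trans (IH _ _ x' sa (supp_in_mxconsS a zD)) _.
rewrite le_eqVlt; apply/orP; left; apply/eqP; apply: eq_integral => t _.
by rewrite partials_mxcons// rowt_mxcons /g enum_ordSl.
Qed.

Definition cparts n (w : seq 'I_n) (f : 'rV[R]_n -> C) : 'rV[R]_n -> C := foldl (fun g i => cpart i g) f w.

Lemma smoothC_cparts n (w : seq 'I_n) (f : 'rV[R]_n -> C) : smoothC f -> smoothC (cparts w f).
Proof. by elim: w f => [|i w IH] f sf //=; apply: IH; exact: smoothC_cpart. Qed.

Lemma suppC_cparts n (w : seq 'I_n) y r (f : 'rV[R]_n -> C) : suppC y r f -> suppC y r (cparts w f).
Proof. by elim: w f => [|i w IH] f sf //=; apply: IH; exact: suppC_cpart. Qed.

Lemma cparts_partials n (w : seq 'I_n) (f : 'rV[R]_n -> C) :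
  (fun x => complex.Re (cparts w f x)) = partials w (fun x => complex.Re (f x)) /\
  (fun x => complex.Im (cparts w f x)) = partials w (fun x => complex.Im (f x)).
Proof. by elim: w f => [|i w IH] f //=; have [-> ->] := IH (cpart i f). Qed.

(** The L^1 bound by the full mixed derivative, then Cauchy-Schwarz on the cube that carries the
    support. The n derivatives spent here are recovered in [growth_one]. *)
Lemma sup_bound n (y : 'rV[R]_n) (r : R) (w : 'rV[R]_n -> C) x : 0 <= r -> smoothC w -> suppC y r w ->
  ((normsq (w x))%:E <= ((2 * r) ^+ n)%:E * l2n (cparts (enum 'I_n) w))%E.
Proof.
move=> r0 sw zw; set D := cparts _ w.
have sD : smoothC D by exact: smoothC_cparts.
have zD : suppC y r D by exact: suppC_cparts.
have key (f F : 'rV[R]_n -> R) : smooth setT f -> supp_in y r f -> smooth setT F -> supp_in y r F ->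
    F = partials (enum 'I_n) f -> (leb R n).-integrable setT (fun t => (F (rowt t) ^+ 2)%:E) /\
    f x ^+ 2 <= (2 * r) ^+ n * \int[leb R n]_t (F (rowt t) ^+ 2). move=> sf zf sF zF FE.
  have cF : continuous F by move=> z; exact: smooth_cont sF I.
  have cF2 : continuous (fun z => F z ^+ 2) by move=> z; exact: (@smooth_cont _ _ setT (fun z => F z * F z)) (smoothM openT sF sF) I.
  have iF := intg_ccont cF zF. have iF2 : (leb R n).-integrable setT (fun t => (F (rowt t) ^+ 2)%:E).
    by apply: (@intg_ccont _ _ y r _ cF2) => z hz; rewrite zF// expr0n. split=> //.
  have E (h : 'rV[R]_n -> R) t : supp_in y r h -> cube r (y - rowt t) * h (rowt t) = h (rowt t).
    move=> zh; rewrite cubeC /cube; have [_|yt] := leP `|rowt t - y| r; first by rewrite mul1r. by rewrite zh// mulr0.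
  have iaF : (leb R n).-integrable setT (fun t => `|F (rowt t)|%:E) by exact: (integrable_abse iF).
  have zaF : supp_in y r (fun z => `|F z|) by move=> z hz; rewrite zF// normr0.
  have zF2 : supp_in y r (fun z => `|F z| ^+ 2) by move=> z hz; rewrite zF// normr0 expr0n.
  have icube : (leb R n).-integrable setT (EFin \o (fun s : n.-tuple R => cube r (y - rowt s))).
    apply/integrableP; split.
      by apply/mEFinP; rewrite cube_indic; exact: measurable_indic (measurable_cball r y).
    by under eq_integral do rewrite /= ger0_norm//; rewrite integral_cube// ltry.
  have := @sq_integral_le _ _ R (leb R n) (fun t => cube r (y - rowt t)) (fun t => `|F (rowt t)|)
    (fun t => cube_ge0 _ _) (fun t => normr_ge0 _) icube.
  have -> : (fun t : n.-tuple R => (cube r (y - rowt t) * `|F (rowt t)|)%:E) = (fun t => `|F (rowt t)|%:E).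
    by apply/funext => t; rewrite (E (fun z => `|F z|)).
  have -> : (fun t : n.-tuple R => (cube r (y - rowt t) * `|F (rowt t)| ^+ 2)%:E) = (fun t => (F (rowt t) ^+ 2)%:E).
    by apply/funext => t; rewrite (E (fun z => `|F z| ^+ 2))// real_normK// num_real. move=> /(_ iaF iF2).
  have -> : \int[leb R n]_t cube r (y - rowt t) = (2 * r) ^+ n by rewrite /Rintegral integral_cube.
  have -> : \int[leb R n]_t (cube r (y - rowt t) * `|F (rowt t)|) = \int[leb R n]_t `|F (rowt t)|.
    by apply: eq_Rintegral => t _; rewrite (E (fun z => `|F z|)).
  have -> : \int[leb R n]_t (cube r (y - rowt t) * `|F (rowt t)| ^+ 2) = \int[leb R n]_t (F (rowt t) ^+ 2).
    by apply: eq_Rintegral => t _; rewrite (E (fun z => `|F z| ^+ 2))// real_normK// num_real.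
  apply: le_trans; rewrite -[leLHS]real_normK ?num_real//.
  have I0 : 0 <= \int[leb R n]_t `|F (rowt t)| by exact: Rintegral_ge0.
  have h : (`|f x|%:E <= (\int[leb R n]_t `|F (rowt t)|)%:E)%E.
    rewrite /Rintegral fineK; last exact: integrable_fin_num iaF. by rewrite FE; exact: abs_le_integral_partials sf zf.
  by rewrite lee_fin in h; rewrite lerXn2r ?nnegrE.
have [D1 D2] := cparts_partials (enum 'I_n) w; have [sw1 sw2] := sw; have [sD1 sD2] := sD.
have [i1 k1] := key _ _ sw1 (suppC_Re zw) sD1 (suppC_Re zD) D1.
have [i2 k2] := key _ _ sw2 (suppC_Im zw) sD2 (suppC_Im zD) D2.
have -> : l2n D = (\int[leb R n]_t (complex.Re (D (rowt t)) ^+ 2) + \int[leb R n]_t (complex.Im (D (rowt t)) ^+ 2))%:E.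
  rewrite EFinD /Rintegral !fineK; try exact: integrable_fin_num.
  by rewrite -integralD//; apply: eq_integral => t _; rewrite -EFinD.
by rewrite -EFinM lee_fin mulrDr; exact: lerD.
Qed.

End sup_bound.

(** * Derivatives of dilated functions with respect to the scale *)

Section dilation_derivative.
Context (R : realType) (n : nat).
Notation X := 'rV[R]_n.
Notation C := R[i].

Lemma radial_derive (f : X -> R) (z : X) k (t : R) : smooth setT f -> 0 < t ->
  is_derive t (1 : R) (fun t => t^-1 ^+ k * f (t^-1 *: z))
    (- (t^-1 ^+ k.+1 * (k%:R * f (t^-1 *: z) + \sum_i (t^-1 *: z) 0 i * partial i f (t^-1 *: z)))).
Proof.
move=> sf t0; have tN : t != 0 by rewrite gt_eqF.
have dV : is_derive t (1 : R) (fun t : R => t^-1) (- t^-1 ^+ 2).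
  have := @is_deriveV R id t (1 : R) 1 tN (is_derive_id _ _). by rewrite exprVn scaler1 => H; apply: is_derive_eq.
have [df dE] := C1_diff openT (sf 1%N) (I : setT (t^-1 *: z)).
have dray : is_derive t^-1 (1 : R) (fun s : R => f (s *: z)) (\sum_i z 0 i * partial i f (t^-1 *: z)).
  have := @is_derive_line _ _ f 0 z t^-1; rewrite addr0 => H; have {H} := H (diff_derivable df).
  by rewrite deriveE// dE; under [X in is_derive _ _ X]eq_fun do rewrite addr0.
have dc := @is_derive1_comp R (fun s : R => f (s *: z)) (fun t : R => t^-1) t _ _ dray dV.
have dX : is_derive t (1 : R) ((fun t : R => t^-1) ^+ k) (k%:R * t^-1 ^+ k.-1 * - t^-1 ^+ 2) := @is_deriveX _ _ (fun t : R => t^-1) k t (1 : R) _ dV.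
have dM := is_deriveM dX dc.
rewrite (_ : (fun t : R => _) = (fun t : R => t^-1) ^+ k * ((fun s : R => f (s *: z)) \o (fun t : R => t^-1))); last first.
  by apply/funext => s; rewrite fctE exprfctE.
case: dM => dM1 dM2; apply: DeriveDef; first exact: dM1.
rewrite dM2 exprfctE /=; rewrite -![_ *: _]/(_ * _).
have -> : \sum_i (t^-1 *: z) 0 i * partial i f (t^-1 *: z) = t^-1 * \sum_i z 0 i * partial i f (t^-1 *: z).
  by rewrite mulr_sumr; apply: eq_bigr => i _; rewrite mxE mulrA.
set S := \sum_i _; set g := f _; rewrite -[g *: _]/(g * _).
case: k {dX dM1 dM2} => [|k]; first by rewrite !expr0 expr1 /=; ring.
by rewrite /= -[in RHS]natr1 !exprS; ring.
Qed.

(** Euler operator: up to sign and a factor 1/t it is the t-derivative of t^-k psi(x/t). *)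
Definition euler k (psi : X -> C) (x : X) : C := k%:R%:C * psi x + \sum_i (x 0 i)%:C * cpart i psi x.

Definition mollifier (psi : X -> C) := smoothC psi /\ suppC 0 1 psi.

Lemma smoothC_coord i : smoothC (fun x : X => (x 0 i)%:C).
Proof. by split; [exact: smooth_coord|exact: smooth_cst]. Qed.

Lemma mollifier_cpart i psi : mollifier psi -> mollifier (cpart i psi).
Proof. by move=> [sp zp]; split; [exact: smoothC_cpart|exact: suppC_cpart]. Qed.

Lemma mollifier_coord i psi : mollifier psi -> mollifier (fun x => (x 0 i)%:C * psi x).
Proof. by move=> [sp zp]; split; [apply: smoothCM => //; exact: smoothC_coord|exact: suppCMr]. Qed.

Lemma mollifier_euler k psi : mollifier psi -> mollifier (euler k psi).
Proof.
move=> mp; have [sp zp] := mp; split. apply: smoothCD; first exact: smoothCZ.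
  by apply: smoothC_sum => i _; apply: smoothCM; [exact: smoothC_coord|exact: smoothC_cpart].
by move=> x xr; rewrite /euler zp// mulr0 big1 ?addr0// => i _; rewrite (suppC_cpart i zp xr) mulr0.
Qed.

Lemma mollifier_test psi : mollifier psi -> test psi.
Proof. by move=> [sp zp]; split=> //; exists 1. Qed.

Lemma mollifier_cparts w psi : mollifier psi -> mollifier (cparts w psi).
Proof. by move=> [sp zp]; split; [exact: smoothC_cparts|exact: suppC_cparts]. Qed.

Definition scaled k psi (t : R) (x y : X) : C := (t^-1 ^+ k)%:C * psi (t^-1 *: (x - y)).

Lemma RecZ (r : R) (z : C) : complex.Re (r%:C * z) = r * complex.Re z.
Proof. by case: z => a b /=; rewrite mul0r subr0. Qed.
Lemma ImcZ (r : R) (z : C) : complex.Im (r%:C * z) = r * complex.Im z.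
Proof. by case: z => a b /=; rewrite mul0r addr0. Qed.
Lemma Re_comb (a b d : C) (h : R) : complex.Re (a - b + h%:C * d) = complex.Re a - complex.Re b + h * complex.Re d.
Proof. by rewrite !ReD ReN RecZ. Qed.
Lemma Im_comb (a b d : C) (h : R) : complex.Im (a - b + h%:C * d) = complex.Im a - complex.Im b + h * complex.Im d.
Proof. by rewrite !ImD ImN ImcZ. Qed.
Lemma Rec_sum (I : Type) (r : seq I) (F : I -> C) : complex.Re (\sum_(i <- r) F i) = \sum_(i <- r) complex.Re (F i).
Proof. by elim/big_rec2: _ => // i a b _ <-; rewrite ReD. Qed.
Lemma Imc_sum (I : Type) (r : seq I) (F : I -> C) : complex.Im (\sum_(i <- r) F i) = \sum_(i <- r) complex.Im (F i).
Proof. by elim/big_rec2: _ => // i a b _ <-; rewrite ImD. Qed.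

Lemma scaled_derive k (psi : X -> C) (t : R) (x y : X) : smoothC psi -> 0 < t ->
  is_derive t (1 : R) (fun t => complex.Re (scaled k psi t x y)) (- complex.Re (scaled k.+1 (euler k psi) t x y)) /\
  is_derive t (1 : R) (fun t => complex.Im (scaled k psi t x y)) (- complex.Im (scaled k.+1 (euler k psi) t x y)).
Proof.
move=> [s1 s2] t0; have d1 := radial_derive (x - y) k s1 t0; have d2 := radial_derive (x - y) k s2 t0.
split. under eq_fun do rewrite /scaled RecZ. rewrite /scaled RecZ /euler ReD RecZ Rec_sum.
  by under [in X in is_derive _ _ _ X]eq_bigr do rewrite RecZ.
under eq_fun do rewrite /scaled ImcZ.
rewrite /scaled ImcZ /euler ImD ImcZ Imc_sum.
by under [in X in is_derive _ _ _ X]eq_bigr do rewrite ImcZ.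
Qed.

Lemma cpart_coord i j x : cpart i (fun x : X => (x 0 j)%:C) x = (i == j)%:R.
Proof.
have [_ E] := is_derive_coord i j x.
rewrite /cpart /= (_ : partial i (fun x : X => x 0 j) x = (i == j)%:R)//.
rewrite /partial derive_cst; case: (i == j) => //.
Qed.

Lemma euler_cpart k i psi x : smoothC psi -> cpart i (euler k psi) x = euler k.+1 (cpart i psi) x.
Proof.
move=> sp; have sc j : smoothC (fun x : X => (x 0 j)%:C * cpart j psi x).
  by apply: smoothCM; [exact: smoothC_coord|exact: smoothC_cpart].
rewrite /euler cpartD; [|exact: smoothCZ|exact: smoothC_sum].
rewrite cpartZ// cpart_sum// -natr1 [(k%:R + 1)%:C]rmorphD mulrDl -addrA; congr (_ + _).
rewrite (eq_bigr (fun j => (i == j)%:R * cpart j psi x + (x 0 j)%:C * cpart j (cpart i psi) x)); last first.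
  move=> j _; rewrite (cpartM _ _ (smoothC_coord j) (smoothC_cpart j sp)) cpart_coord. by rewrite (cpartC i j x sp).
rewrite big_split/=; congr (_ + _); rewrite (bigD1 i)//= eqxx mul1r big1 ?addr0 ?mul1r// => j /negbTE.
by rewrite eq_sym => ->; rewrite mul0r.
Qed.

Lemma euler_cparts k w psi x : smoothC psi -> cparts w (euler k psi) x = euler (k + size w) (cparts w psi) x.
Proof.
elim: w k psi => [|i w IH] k psi sp /=; first by rewrite addn0.
rewrite (_ : cpart i (euler k psi) = euler k.+1 (cpart i psi)); last first. by apply/funext => z; exact: euler_cpart.
by rewrite IH ?addSnnS//; exact: smoothC_cpart.
Qed.

(** At k = n the Euler operator is the divergence of x psi: the n derivatives of the coordinates
    supply the term n psi. *)
Lemma euler_div psi x : smoothC psi -> euler n psi x = \sum_i cpart i (fun x => (x 0 i)%:C * psi x) x.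
Proof.
move=> sp; rewrite /euler; under [RHS]eq_bigr => i _ do
  rewrite (cpartM _ _ (smoothC_coord i) sp) cpart_coord eqxx mul1r.
by rewrite big_split/= sumr_const card_ord rmorph_nat [in LHS]mulr_natl.
Qed.

Lemma cparts_sum w (I : Type) (r : seq I) (F : I -> X -> C) x : (forall i, smoothC (F i)) ->
  cparts w (fun x => \sum_(i <- r) F i x) x = \sum_(i <- r) cparts w (F i) x.
Proof.
elim: w F => [|i w IH] F sF //=; rewrite -IH; last by move=> j; exact: smoothC_cpart.
by congr (cparts w _ x); apply/funext => z; rewrite cpart_sum.
Qed.

(** Passing the Euler operator through [w] raises its index to n + |w|. Hence the t-derivative of an
    order |w| derivative of a mollification consists of derivatives of order |w| + 1 of
    mollifications with the profiles x_i psi. *)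
Lemma euler_div_cparts w psi x : smoothC psi ->
  euler (n + size w) (cparts w psi) x = \sum_i cparts (i :: w) (fun x => (x 0 i)%:C * psi x) x.
Proof.
move=> sp; rewrite -euler_cparts//.
rewrite (_ : euler n psi = fun x => \sum_i cpart i (fun x => (x 0 i)%:C * psi x) x); last first.
  by apply/funext => z; exact: euler_div.
by rewrite cparts_sum// => i; apply: smoothC_cpart; apply: smoothCM => //; exact: smoothC_coord.
Qed.

End dilation_derivative.

(** * Functions of the radius with controlled derivative *)

Section radius.
Context (R : realType).
Variables (G G' : R -> R).
Hypothesis dG : forall r : R, 0 < r -> r <= 1 -> is_derive r (1 : R) G (G' r).

Lemma radius_MVT (H H' : R -> R) (a b : R) : 0 < a -> a < b -> b <= 1 ->
  (forall r : R, 0 < r -> is_derive r (1 : R) H (H' r)) ->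
  exists2 c, a < c < b & G b + H b - (G a + H a) = (G' c + H' c) * (b - a).
Proof.
move=> a0 ab b1 dH.
have dS (r : R) : a <= r -> r <= b -> is_derive r (1 : R) (G + H) (G' r + H' r).
  move=> ar rb; have r0 := lt_le_trans a0 ar. by have := is_deriveD (dG r0 (le_trans rb b1)) (dH r r0).
have [||c cab E] := @MVT R (G + H) (fun r => G' r + H' r) a b ab.
- by move=> r; rewrite in_itv/= => /andP[/ltW ar /ltW rb]; exact: dS.
- apply: derivable_within_continuous => r; rewrite in_itv/= => /andP[ar rb]. by have [] := dS r ar rb.
by exists c; [move: cab; rewrite in_itv|exact: E].
Qed.

(** G + C r^-(k+1) decreases and G - C r^-(k+1) increases on (0, 1]; each is compared with its value
    at 1. *)
Lemma radius_bound (C : R) k : 0 <= C -> (forall r : R, 0 < r -> r <= 1 -> `|G' r| <= C * r^-1 ^+ k.+2) ->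
  forall r : R, 0 < r -> r <= 1 -> `|G r| <= `|G 1| + C * r^-1 ^+ k.+1.
Proof.
move=> C0 HG r r0 r1; have [->|rN] := eqVneq r 1; first by rewrite lerDl invr1 expr1n mulr1.
have {rN}r1' : r < 1 by rewrite lt_neqAle rN.
have dV (s : R) : 0 < s -> is_derive s (1 : R) (fun s : R => s^-1) (- s^-1 ^+ 2).
  move=> s0; have sN : s != 0 by rewrite gt_eqF. have := @is_deriveV R id s (1 : R) 1 sN (is_derive_id _ _).
  by rewrite exprVn scaler1 => H; apply: is_derive_eq.
have dH (s : R) : 0 < s -> is_derive s (1 : R) (fun s : R => C * s^-1 ^+ k.+1) (C * (k.+1%:R * s^-1 ^+ k * - s^-1 ^+ 2)).
  move=> s0; have := @is_deriveX _ _ (fun t : R => t^-1) k.+1 s (1 : R) _ (dV s s0).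
  rewrite (_ : (fun t : R => t^-1) ^+ k.+1 = fun t : R => t^-1 ^+ k.+1); last by apply/funext => u; rewrite exprfctE.
  by move=> D0; exact: (@is_deriveZ _ _ _ _ C _ _ _ D0).
have dH' (s : R) : 0 < s -> is_derive s (1 : R) (fun s : R => - (C * s^-1 ^+ k.+1)) (- (C * (k.+1%:R * s^-1 ^+ k * - s^-1 ^+ 2))).
  by move=> s0; exact: is_deriveN (dH s s0).
have dom (c : R) : r < c < 1 -> `|G' c| <= - (C * (k.+1%:R * c^-1 ^+ k * - c^-1 ^+ 2)).
  move=> /andP[rc c1]; have c0 := lt_trans r0 rc.
  apply: le_trans (HG c c0 (ltW c1)) _; rewrite -[k.+2]addn2 exprD !mulrN opprK -mulrA.
  rewrite ler_wpM2l// ler_peMl ?ler1n// mulr_ge0 ?exprn_ge0 ?invr_ge0 ?(ltW c0)//.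
have rr : 0 <= 1 - r by rewrite subr_ge0.
have H1 : 0 <= C * 1^-1 ^+ k.+1 by rewrite invr1 expr1n mulr1.
have [c crl E1] := radius_MVT r0 r1' (lexx 1) dH.
have [d drl E2] := radius_MVT r0 r1' (lexx 1) dH'.
have le1 : (G' c + C * (k.+1%:R * c^-1 ^+ k * - c^-1 ^+ 2)) * (1 - r) <= 0.
  by apply: mulr_le0_ge0 => //; have := dom c crl; have := ler_norm (G' c); lra.
have le2 : 0 <= (G' d + - (C * (k.+1%:R * d^-1 ^+ k * - d^-1 ^+ 2))) * (1 - r).
  by apply: mulr_ge0 => //; have := dom d drl; have := ler_norm (- G' d); rewrite normrN; lra.
rewrite -E1 in le1; rewrite -E2 in le2.
have := ler_norm (G 1); have := ler_norm (- G 1); rewrite normrN => n1 n2.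
rewrite ler_norml; apply/andP; split; lra.
Qed.

Lemma radius_lipschitz (C : R) : (forall r : R, 0 < r -> r <= 1 -> `|G' r| <= C) ->
  forall r s : R, 0 < r -> r <= 1 -> 0 < s -> s <= 1 -> `|G r - G s| <= C * `|r - s|.
Proof.
move=> HG r s r0 r1 s0 s1; wlog rs : r s r0 r1 s0 s1 / r <= s. move=> W; have [rs|/ltW sr] := leP r s; first exact: W.
  by rewrite distrC [`|r - s|]distrC; exact: W.
move: rs; rewrite le_eqVlt => /orP[/eqP ->|rs]; first by rewrite !subrr !normr0 mulr0.
have d0 (u : R) : 0 < u -> is_derive u (1 : R) (fun=> 0 : R) 0 by move=> _; exact: is_derive_cst.
have [c /andP[rc cs] E] := radius_MVT r0 rs s1 d0.
rewrite !addr0 in E; rewrite distrC E normrM [`|r - s|]distrC ler_wpM2r//.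
by apply: HG; [exact: lt_trans r0 rc|exact: le_trans (ltW cs) s1].
Qed.

End radius.

(** * Mollifications as functions of the scale *)

Section regularization.
Context (R : realType) (n : nat) (y0 : 'rV[R]_n) (rho : R).
Notation X := 'rV[R]_n.
Notation T := (n.-tuple R).
Notation leb := (leb R n).
Notation C := R[i].

Implicit Types (psi : X -> C) (t : R) (x y : X).

Variables (v : T -> C) (c : X -> C).
Hypotheses (iv : cintg leb v) (tc : test_in y0 rho c).

(** The power [k] is left free: it is n for a mollification and n + |w| for its derivative along
    [w]. *)
Definition reg k (psi : X -> C) (t : R) (x : X) : C :=
  cintegral leb (fun s => c (rowt s) * scaled k psi t x (rowt s) * v s).

Lemma scaled_bound k psi : mollifier psi -> exists2 B, 0 <= B &
  forall t x y, 0 < t -> nc (scaled k psi t x y) <= t^-1 ^+ k * B.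
Proof.
move=> mp; have [B B0 HB] := test_bounded (mollifier_test mp); exists B; first exact: ltW.
move=> t x y t0; rewrite ncM ncR ger0_norm ?exprn_ge0 ?invr_ge0 ?(ltW t0)//.
by rewrite ler_wpM2l// exprn_ge0// invr_ge0 ltW.
Qed.

Lemma scaledE k (psi : X -> C) t (x y : X) : scaled k psi t x y = (t^-1 ^+ k)%:C * psi ((- t^-1) *: (y - x)).
Proof. by rewrite /scaled scaleNr -scalerN opprB. Qed.

Lemma smoothC_scaled k psi t x : mollifier psi -> smoothC (scaled k psi t x).
Proof.
move=> [sp _]; rewrite (_ : scaled k psi t x = fun y => (t^-1 ^+ k)%:C * psi ((- t^-1) *: (y - x))).
  by apply: smoothCZ; exact: smoothC_affine.
by apply/funext => y; rewrite scaledE.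
Qed.

Lemma reg_intg k psi t x : mollifier psi -> 0 < t ->
  cintg leb (fun s => c (rowt s) * scaled k psi t x (rowt s) * v s).
Proof.
move=> mp t0; have [A A0 HA] := test_bounded (test_inW tc); have [B B0 HB] := scaled_bound k mp.
apply: (@op_integrable _ _ v iv (fun y => c y * scaled k psi t x y) (A * (t^-1 ^+ k * B))).
  by apply: (@cmeas_rowt _ _ (fun y => c y * scaled k psi t x y)); apply: smoothCM; [exact: (proj1 tc)|exact: smoothC_scaled].
by move=> y; rewrite ncM ler_pM ?nc_ge0// HB.
Qed.

Lemma reg_sum k (I : Type) (r : seq I) (F : I -> X -> C) t x : (forall i, mollifier (F i)) -> 0 < t ->
  reg k (fun x => \sum_(i <- r) F i x) t x = \sum_(i <- r) reg k (F i) t x.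
Proof.
move=> mF t0; rewrite /reg -cintegral_sum; last by move=> i _; exact: reg_intg.
by apply: eq_cintegral => s; rewrite /scaled -mulr_suml -!mulr_sumr.
Qed.

Lemma reg_derive k psi t x : mollifier psi -> 0 < t ->
  is_derive t (1 : R) (fun t => complex.Re (reg k psi t x)) (- complex.Re (reg k.+1 (euler k psi) t x)) /\
  is_derive t (1 : R) (fun t => complex.Im (reg k psi t x)) (- complex.Im (reg k.+1 (euler k psi) t x)).
Proof.
move=> mp t0; have m1 := mollifier_euler k mp; have m2 := mollifier_euler k.+1 m1.
have [B B0 HB] := scaled_bound k.+2 m2; have [A A0 HA] := test_bounded (test_inW tc).
(* Increments below t/2 keep the scale above t/2, where [M] bounds the second derivative in the
   scale. *)
pose M := (t / 2)^-1 ^+ k.+2 * B.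
have t2 : 0 < t / 2 by rewrite divr_gt0.
have M0 : 0 <= M by rewrite mulr_ge0// exprn_ge0// invr_ge0 ltW.
have pt h y : `|h| < t / 2 ->
    nc (scaled k psi (h + t) x y - scaled k psi t x y + h%:C * scaled k.+1 (euler k psi) t x y) <= 2 * M * h ^+ 2.
  move=> ht; have pos s : `|s| <= `|h| -> t / 2 < s + t. by move=> hs; have := ler_norm (- s); rewrite normrN; lra.
  have pos0 s : `|s| <= `|h| -> 0 < s + t by move=> /pos; apply: lt_trans.
  have bnd s : `|s| <= `|h| -> nc (scaled k.+2 (euler k.+1 (euler k psi)) (s + t) x y) <= M.
    move=> hs; apply: le_trans (HB _ _ _ (pos0 s hs)) _; rewrite ler_wpM2r// lerXn2r ?nnegrE ?invr_ge0 ?(ltW (pos0 s hs)) ?(ltW t2)//.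
    by rewrite lef_pV2 ?posrE ?(pos0 s hs)// ltW// pos.
  have sE (s : R) : s *: (1 : R) + t = s + t by rewrite -[s *: _]/(s * _) mulr1.
  rewrite (_ : 2 * M * h ^+ 2 = M * h ^+ 2 + M * h ^+ 2); last by ring. apply: nc_le. rewrite Re_comb.
    have := @taylor_quadratic R _ (fun t => complex.Re (scaled k psi t x y))
      (fun t => - complex.Re (scaled k.+1 (euler k psi) t x y))
      (fun t => complex.Re (scaled k.+2 (euler k.+1 (euler k psi)) t x y)) 1 t h M.
    rewrite sE mulrN opprK; apply => s hs; rewrite sE.
    - by have [H _] := @scaled_derive R n k psi (s + t) x y (proj1 mp) (pos0 s hs); exact: H.
    - have [H _] := @scaled_derive R n k.+1 (euler k psi) (s + t) x y (proj1 m1) (pos0 s hs).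
      by have := is_deriveN H; rewrite opprK.
    - exact: le_trans (ncRe _) (bnd s hs). rewrite Im_comb.
  have := @taylor_quadratic R _ (fun t => complex.Im (scaled k psi t x y))
    (fun t => - complex.Im (scaled k.+1 (euler k psi) t x y))
    (fun t => complex.Im (scaled k.+2 (euler k.+1 (euler k psi)) t x y)) 1 t h M.
  rewrite sE mulrN opprK; apply => s hs; rewrite sE.
  - by have [_ H] := @scaled_derive R n k psi (s + t) x y (proj1 mp) (pos0 s hs); exact: H.
  - have [_ H] := @scaled_derive R n k.+1 (euler k psi) (s + t) x y (proj1 m1) (pos0 s hs).
    by have := is_deriveN H; rewrite opprK.
  - exact: le_trans (ncIm _) (bnd s hs).
have key h : `|h| < t / 2 -> nc (reg k psi (h + t) x - reg k psi t x + h%:C * reg k.+1 (euler k psi) t x) <=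
    2 * (A * (2 * M) * \int[leb]_s nc (v s)) * h ^+ 2.
  move=> ht; have th : 0 < h + t by have := ler_norm (- h); rewrite normrN; lra.
  have i1 := reg_intg k x mp th; have i2 := reg_intg k x mp t0. have i3 := reg_intg k.+1 x m1 t0.
  have j2 := cintgZ (-1) i2; have j3 := cintgZ h%:C i3. have j12 := cintgD i1 j2.
  rewrite -[- reg _ _ _ _]mulN1r /reg -(cintegralZ _ i2) -(cintegralZ _ i3) -(cintegralD i1 j2) -(cintegralD j12 j3).
  rewrite (_ : 2 * _ * _ = 2 * (A * (2 * M) * h ^+ 2 * \int[leb]_s nc (v s))); last by ring.
  rewrite -RintegralZl//; last exact: cintg_nc. apply: nc_cintegral => [||s].
  - exact: cintg_meas (cintgD j12 j3).
  - by have := integrableZl measurableT (A * (2 * M) * h ^+ 2) (cintg_nc iv).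
  - rewrite (_ : _ + _ = c (rowt s) * (scaled k psi (h + t) x (rowt s) - scaled k psi t x (rowt s) +
      h%:C * scaled k.+1 (euler k psi) t x (rowt s)) * v s); last by ring.
    rewrite !ncM ler_wpM2r ?nc_ge0// -mulrA ler_pM ?nc_ge0//. exact: pt.
have sE (s : R) : s *: (1 : R) + t = s + t by rewrite -[s *: _]/(s * _) mulr1.
split; apply: (@quadratic_derive _ _ _ _ _ _ _ _ t2) => h ht; rewrite sE mulrN opprK; apply: le_trans (key h ht).
  by apply: le_trans (ncRe _); rewrite Re_comb.
by apply: le_trans (ncIm _); rewrite Im_comb.
Qed.

Lemma reg_bound1 k psi : mollifier psi -> exists2 B, 0 <= B & forall x, nc (reg k psi 1 x) <= B.
Proof.
move=> mp; have [B B0 HB] := scaled_bound k mp; have [A A0 HA] := test_bounded (test_inW tc).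
exists (2 * (A * B * \int[leb]_s nc (v s))).
  by rewrite !mulr_ge0 ?(ltW A0)//; apply: Rintegral_ge0 => s _; exact: nc_ge0.
move=> x; rewrite -RintegralZl//; last exact: cintg_nc.
apply: nc_cintegral => [||s].
- exact: cintg_meas (reg_intg k x mp ltr01).
- by have := integrableZl measurableT (A * B) (cintg_nc iv).
- rewrite ncM ler_wpM2r ?nc_ge0// ncM ler_pM ?nc_ge0//. by have := HB 1 x (rowt s) ltr01; rewrite invr1 expr1n mul1r.
Qed.

Variable rho1 : R.

(** The scale is r^2, so that the bound t^(-1/2) has the integer exponent p = 1. All profiles are
    included because differentiating in the scale replaces psi by the x_i psi. *)
Definition growth k p := forall psi w, mollifier psi -> size w = k -> exists2 B, 0 <= B &
  forall (r : R) x, 0 < r -> r <= 1 -> `|x - y0| <= rho1 -> nc (reg (n + k) (cparts w psi) (r ^+ 2) x) <= B * r^-1 ^+ p.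

Lemma reg_radius_derive k psi x (r : R) : mollifier psi -> 0 < r ->
  is_derive r (1 : R) (fun r => complex.Re (reg k psi (r ^+ 2) x)) (- complex.Re (reg k.+1 (euler k psi) (r ^+ 2) x) * (2 * r)) /\
  is_derive r (1 : R) (fun r => complex.Im (reg k psi (r ^+ 2) x)) (- complex.Im (reg k.+1 (euler k psi) (r ^+ 2) x) * (2 * r)).
Proof.
move=> mp r0; have r2 : 0 < r ^+ 2 by exact: exprn_gt0.
have d2 : is_derive r (1 : R) (fun r : R => r ^+ 2) (2 * r).
  have := @is_deriveX _ _ (id : R -> R) 2 r (1 : R) _ (is_derive_id _ _).
  rewrite (_ : (id : R -> R) ^+ 2 = fun r : R => r ^+ 2); last by apply/funext => u; rewrite exprfctE.
  by move=> H; apply: is_derive_eq; rewrite -[_ *: _]/(_ * _) mulr1 expr1.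
have [h1 h2] := reg_derive k x mp r2.
split; first exact: (@is_derive1_comp R (fun t => complex.Re (reg k psi t x)) (fun r : R => r ^+ 2) r _ _ h1 d2).
exact: (@is_derive1_comp R (fun t => complex.Im (reg k psi t x)) (fun r : R => r ^+ 2) r _ _ h2 d2).
Qed.

(** The factor 2 r is the derivative of the scale r^2, and lowers the exponent by one. *)
Lemma growth_derive k p psi w : growth k.+1 p.+1 -> mollifier psi -> size w = k ->
  exists2 B, 0 <= B & forall (r : R) x, 0 < r -> r <= 1 -> `|x - y0| <= rho1 ->
    nc (reg (n + k).+1 (euler (n + k) (cparts w psi)) (r ^+ 2) x) * (2 * r) <= B * r^-1 ^+ p.
Proof.
move=> g mp wk.
have /choice[B HB] i : exists B, 0 <= B /\ forall (r : R) x, 0 < r -> r <= 1 -> `|x - y0| <= rho1 ->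
    nc (reg (n + k.+1) (cparts (i :: w) (fun x => (x 0 i)%:C * psi x)) (r ^+ 2) x) <= B * r^-1 ^+ p.+1.
  have [|B B0 HB] := g _ (i :: w) (mollifier_coord i mp); first by rewrite /= wk. by exists B.
exists (2 * \sum_i B i); first by rewrite mulr_ge0// sumr_ge0// => i _; have [] := HB i.
move=> r x r0 r1 xr; have r2 : 0 < r ^+ 2 by exact: exprn_gt0.
rewrite (_ : euler (n + k) (cparts w psi) = fun x => \sum_i cparts (i :: w) (fun x => (x 0 i)%:C * psi x) x); last first.
  by apply/funext => z; rewrite -wk; exact: euler_div_cparts (proj1 mp).
rewrite reg_sum//; last by move=> i; exact: mollifier_cparts (mollifier_coord i mp).
rewrite -addnS; apply: (@le_trans _ _ ((\sum_i B i * r^-1 ^+ p.+1) * (2 * r))).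
  rewrite ler_wpM2r ?mulr_ge0 ?(ltW r0)//; apply: le_trans (nc_sum _ _ _) _.
  by apply: ler_sum => i _; have [_] := HB i; exact.
rewrite -mulr_suml exprS le_eqVlt; apply/orP; left; apply/eqP.
have rN : r != 0 by rewrite gt_eqF.
by move: (\sum_i _) (r^-1 ^+ p) => S P; rewrite -[RHS]mul1r -(mulVf rN); ring.
Qed.

(** The factor 2 r and the integration from r to 1 gain one power of r each: one order less is worth
    r^2, that is one power of t. *)
Lemma growth_step k p : growth k.+1 p.+3 -> growth k p.+1.
Proof.
move=> g psi w mp wk; have [B B0 HB] := growth_derive g mp wk.
have mw := mollifier_cparts w mp; have [D D0 HD] := reg_bound1 (n + k) mw.
exists (2 * D + 2 * B); first by rewrite addr_ge0 ?mulr_ge0.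
move=> r x r0 r1 xr.
have H (G G' : R -> R) : (forall r : R, 0 < r -> is_derive r (1 : R) G (- G' r * (2 * r))) ->
    (forall r : R, 0 < r -> r <= 1 -> `|G' r| <= nc (reg (n + k).+1 (euler (n + k) (cparts w psi)) (r ^+ 2) x)) ->
    `|G 1| <= D -> `|G r| <= D + B * r^-1 ^+ p.+1.
  move=> dG HG G1; apply: le_trans (@radius_bound R G _ (fun r h _ => dG r h) B p B0 _ r r0 r1) _.
    move=> s s0 s1; apply: le_trans (HB s x s0 s1 xr); rewrite normrM normrN.
    by rewrite [`|2 * s|]ger0_norm ?mulr_ge0 ?(ltW s0)// ler_wpM2r ?mulr_ge0 ?(ltW s0)// HG. by rewrite lerD2r.
have hr : 1 <= r^-1 ^+ p.+1 by rewrite exprn_ege1// invf_ge1.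
apply: (@le_trans _ _ ((D + B * r^-1 ^+ p.+1) + (D + B * r^-1 ^+ p.+1))); last first.
  have : D <= D * r^-1 ^+ p.+1 by rewrite ler_peMr. by rewrite mulrDl -!mulrA; lra.
apply: nc_le. apply: (H (fun r => complex.Re (reg (n + k) (cparts w psi) (r ^+ 2) x))
    (fun r => complex.Re (reg (n + k).+1 (euler (n + k) (cparts w psi)) (r ^+ 2) x))).
  - by move=> s s0; have [h _] := reg_radius_derive (n + k) x mw s0; exact: h.
  - by move=> s s0 s1; exact: ncRe.
  - by rewrite expr1n; exact: le_trans (ncRe _) (HD x).
apply: (H (fun r => complex.Im (reg (n + k) (cparts w psi) (r ^+ 2) x))
  (fun r => complex.Im (reg (n + k).+1 (euler (n + k) (cparts w psi)) (r ^+ 2) x))).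
- by move=> s s0; have [_ h] := reg_radius_derive (n + k) x mw s0; exact: h.
- by move=> s s0 s1; exact: ncIm.
- by rewrite expr1n; exact: le_trans (ncIm _) (HD x).
Qed.

(** An exponent 1 at the next order is cancelled by the factor 2 r, so the derivative in r is
    bounded. *)
Lemma growth_lipschitz k psi w : growth k.+1 1 -> mollifier psi -> size w = k ->
  exists2 B, 0 <= B & forall (r s : R) x, 0 < r -> r <= 1 -> 0 < s -> s <= 1 -> `|x - y0| <= rho1 ->
    nc (reg (n + k) (cparts w psi) (r ^+ 2) x - reg (n + k) (cparts w psi) (s ^+ 2) x) <= B * `|r - s|.
Proof.
move=> g mp wk; have [B B0 HB] := growth_derive g mp wk; have mw := mollifier_cparts w mp.
exists (2 * B); first by rewrite mulr_ge0.
move=> r s x r0 r1 s0 s1 xr; rewrite -mulrA mulrDl mul1r.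
have H (G G' : R -> R) : (forall r : R, 0 < r -> is_derive r (1 : R) G (- G' r * (2 * r))) ->
    (forall r : R, 0 < r -> r <= 1 -> `|G' r| <= nc (reg (n + k).+1 (euler (n + k) (cparts w psi)) (r ^+ 2) x)) ->
    `|G r - G s| <= B * `|r - s|. move=> dG HG; apply: (@radius_lipschitz R G _ (fun r h _ => dG r h)) => // u u0 u1.
  have := HB u x u0 u1 xr; rewrite expr0 mulr1; apply: le_trans; rewrite normrM normrN.
  by rewrite [`|2 * u|]ger0_norm ?mulr_ge0 ?(ltW u0)// ler_wpM2r ?mulr_ge0 ?(ltW u0)// HG.
apply: nc_le; rewrite ?ReD ?ReN ?ImD ?ImN. apply: (H (fun r => complex.Re (reg (n + k) (cparts w psi) (r ^+ 2) x))
    (fun r => complex.Re (reg (n + k).+1 (euler (n + k) (cparts w psi)) (r ^+ 2) x))).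
  - by move=> u u0; have [h _] := reg_radius_derive (n + k) x mw u0; exact: h.
  - by move=> u u0 u1; exact: ncRe.
apply: (H (fun r => complex.Im (reg (n + k) (cparts w psi) (r ^+ 2) x))
  (fun r => complex.Im (reg (n + k).+1 (euler (n + k) (cparts w psi)) (r ^+ 2) x))).
- by move=> u u0; have [_ h] := reg_radius_derive (n + k) x mw u0; exact: h.
- by move=> u u0 u1; exact: ncIm.
Qed.

End regularization.

(** * Sup bounds on derivatives of mollifications, and the descent *)

Section growth.
Context (R : realType) (n m : nat) (y0 : 'rV[R]_n) (rho : R).
Notation X := 'rV[R]_n.
Notation T := (n.-tuple R).
Notation leb := (leb R n).
Notation C := R[i].
Notation ker := (ker y0 rho).
Hypothesis rho0 : 0 < rho.
Variable alpha : 'I_m -> 'I_n -> X -> C.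
Hypothesis talpha : forall j i, test (alpha j i).
Variable V : (T -> C) -> Prop.
Hypothesis VL2 : forall v, V v -> L2 v.
Hypothesis Vlie : lie_stable y0 rho alpha V.
Variables (eps Kc : R).
Hypotheses (eps0 : 0 < eps) (Kc0 : 0 <= Kc).
Hypothesis subell : subell_est y0 rho alpha eps Kc.
Notation fam := (fam y0 rho V).
Notation sigma := (sigma eps).

Lemma fam_cparts w b F : fam b F -> fam (b + size w) (fun t => cparts w (F t)).
Proof.
elim: w b F => [|i w IH] b F fF /=; first by rewrite addn0.
by rewrite -addSnnS; apply: (IH b.+1 (fun t => cpart i (F t))); exact: fam_part.
Qed.

Lemma smooth_cutoffC y (a b : R) : smoothC (fun x : X => (cutoff y a b x)%:C).
Proof. by split; [exact: smooth_cutoff openT|exact: smooth_cst]. Qed.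

(** The sup norm is bought with n derivatives. The second cutoff z' is 1 on the support of [z],
    which puts the full mixed derivative of z F in the form to which [gain_all] applies. *)
Lemma fam_sup b F z : fam b F -> test_in y0 rho z -> exists2 B, 0 <= B &
  forall (t : R) x, 0 < t -> t <= 1 -> normsq (z x * F t x) <= B * t `^ (2 * ((b + n)%:R * sigma - (b + n)%:R)).
Proof.
move=> fF tz; have [sz [s0 s0r zs0]] := tz.
(* The inner radius of a cutoff has to be nonnegative. *)
pose s := Num.max s0 0; have s_ge0 : 0 <= s by rewrite le_max lexx orbT.
have sr : s < rho by rewrite gt_max s0r.
have zs : suppC y0 s z by move=> x xs; apply: zs0; apply: le_lt_trans xs; rewrite le_max lexx.
have ss : s < (s + rho) / 2 by lra.
pose z' x : C := (cutoff y0 s ((s + rho) / 2) x)%:C.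
have tz' : test_in y0 rho z'. split; first exact: smooth_cutoffC.
  by exists ((s + rho) / 2); [lra|move=> x xs; rewrite /z' (cutoff_supp s_ge0 ss xs)].
have fG := fam_mul (test_inW tz) fF.
have fH := fam_cparts (enum 'I_n) fG; rewrite size_enum_ord in fH.
have [B B0 HB] := gain_all talpha VL2 Vlie eps0 Kc0 subell (leqnn (b + n)) fH tz'.
exists ((2 * s) ^+ n * B); first by rewrite mulr_ge0 ?exprn_ge0 ?mulr_ge0.
move=> t x t0 t1; rewrite -lee_fin.
have zG : suppC y0 s (fun x => z x * F t x) by exact: suppCMl.
have sG : smoothC (fun x => z x * F t x) := fam_smooth VL2 fG t0 t1.
apply: le_trans (sup_bound x s_ge0 sG zG) _; rewrite -mulrA EFinM.
apply: lee_wpmul2l; first by rewrite lee_fin exprn_ge0 ?mulr_ge0.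
apply: le_trans (HB t t0 t1); rewrite le_eqVlt; apply/orP; left; apply/eqP.
congr (l2n _); apply/funext => y.
have [ys|ys] := leP `|y - y0| s; first by rewrite /z' (cutoff1 s_ge0 ss ys) mul1r.
by rewrite (suppC_cparts _ zG ys) mulr0.
Qed.

Variables (v : T -> C) (c : X -> C).
Hypotheses (Vv : V v) (tc : test_in y0 rho c).
Let iv := proj1 (VL2 Vv).

(** [ker_base] asks for a compactly supported factor in x. This one is 1 on all x within distance 1
    of the ball of radius [rho], so for t <= 1 it does not alter the mollification. *)
Definition window (x : X) : C := (cutoff y0 (rho + 1) (rho + 2) x)%:C.

Definition mol_ker (psi : X -> C) (t : R) (x y : X) : C := window x * (c y * dilate psi t x y).

Lemma test_window : test window.
Proof.
split; first exact: smooth_cutoffC.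
have r1 : 0 <= rho + 1 by rewrite addr_ge0// ltW.
have r2 : rho + 1 < rho + 2 by lra.
exists (rho + 2 + `|y0|) => x; rewrite subr0 => h.
rewrite /window (cutoff_supp (y0 := y0) r1 r2)//.
have : `|x| <= `|x - y0| + `|y0| by apply: le_trans (ler_normD _ _); rewrite subrK.
by move: h; lra.
Qed.

Lemma ker_mol psi : mollifier psi -> ker (mol_ker psi).
Proof. by move=> [sp zp]; apply: ker_base => //; exact: test_window. Qed.

Lemma mol_kerE psi t y : mollifier psi -> 0 < t -> t <= 1 ->
  (fun x => mol_ker psi t x y) = (fun x => c y * dilate psi t x y).
Proof.
move=> [sp zp] t0 t1; apply/funext => x; rewrite /mol_ker.
have r1 : 0 <= rho + 1 by rewrite addr_ge0// ltW.
have r2 : rho + 1 < rho + 2 by lra.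
have [xs|xs] := leP `|x - y0| (rho + 1); first by rewrite /window (cutoff1 r1 r2 xs) mul1r.
have [_ [s sr zc]] := tc.
have [ys|ys] := ltP s `|y - y0|; first by rewrite zc// mul0r mulr0.
rewrite /dilate zp ?mulr0//; rewrite subr0 normrZ ger0_norm ?invr_ge0 ?(ltW t0)// mulrC ltr_pdivlMr// mul1r.
apply: le_lt_trans t1 _; have : `|x - y0| <= `|x - y| + `|y - y0| by apply: le_trans (ler_normD _ _); rewrite addrA subrK.
lra.
Qed.

Lemma op_mol psi t : mollifier psi -> 0 < t -> t <= 1 -> op (mol_ker psi) v t = reg v c n psi t.
Proof.
move=> mp t0 t1; apply/funext => x; apply: eq_cintegral => s.
by have /(congr1 (fun f => f x)) -> := mol_kerE (rowt s) mp t0 t1.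
Qed.

Lemma smoothC_reg psi t k : mollifier psi -> 0 < t -> t <= 1 -> smoothC (reg v c (n + k) psi t).
Proof.
move=> mp t0 t1; rewrite (_ : reg v c (n + k) psi t = fun x => (t^-1 ^+ k)%:C * op (mol_ker psi) v t x).
  by apply: smoothCZ; apply: (smoothC_op iv (ker_mol mp)).
apply/funext => x; rewrite op_mol// /reg -cintegralZ; last exact: (reg_intg iv tc).
by apply: eq_cintegral => s; rewrite /scaled exprD rmorphM/=; ring.
Qed.

Lemma cpart_reg psi t k i x : mollifier psi -> 0 < t -> t <= 1 ->
  cpart i (reg v c (n + k) psi t) x = reg v c (n + k.+1) (cpart i psi) t x.
Proof.
move=> mp t0 t1; rewrite (_ : reg v c (n + k) psi t = fun x => (t^-1 ^+ k)%:C * op (mol_ker psi) v t x); last first.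
  apply/funext => z; rewrite op_mol// /reg -cintegralZ; last exact: (reg_intg iv tc).
  by apply: eq_cintegral => s; rewrite /scaled exprD rmorphM/=; ring.
rewrite cpartZ; last exact: (smoothC_op iv (ker_mol mp)).
have mi := mollifier_cpart i mp; rewrite (op_cpart iv i x (ker_mol mp) t0 t1).
have ri := reg_intg iv tc n x mi t0.
rewrite (_ : op _ _ _ _ = (t^-1)%:C * reg v c n (cpart i psi) t x); last first.
  rewrite /reg -cintegralZ//; apply: eq_cintegral => s.
  rewrite /dker (mol_kerE (rowt s) mp t0 t1) cpartZ; last by apply: smoothCZ; exact: smoothC_affine (proj1 mp).
  rewrite cpart_dilate1; last exact: (proj1 mp). by rewrite /dilate /scaled; ring.
rewrite mulrA -rmorphM /= /reg -cintegralZ//; apply: eq_cintegral => s.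
by rewrite /scaled addnS exprS exprD !rmorphM/=; ring.
Qed.

Lemma cparts_reg psi t k w x : mollifier psi -> 0 < t -> t <= 1 ->
  cparts w (reg v c (n + k) psi t) x = reg v c (n + (k + size w)) (cparts w psi) t x.
Proof.
elim: w k psi => [|i w IH] k psi mp t0 t1 /=; first by rewrite addn0.
rewrite -addSnnS -IH//; last exact: mollifier_cpart.
by congr (cparts w _ x); apply/funext => z; rewrite cpart_reg.
Qed.

(** The bound of [fam_sup] at order k + n; the exponent (k + n)(1 - sigma) in t doubles because t =
    r^2. *)
Lemma growth_large rho1 k p : rho1 < rho -> 2 * ((k + n)%:R * (1 - sigma)) <= p%:R :> R -> growth y0 v c rho1 k p.
Proof.
move=> r1r Hp psi w mp wk.
pose s := Num.max rho1 0; have s_ge0 : 0 <= s by rewrite le_max lexx orbT.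
have sr : s < rho by rewrite gt_max r1r.
have ss : s < (s + rho) / 2 by lra.
pose z x : C := (cutoff y0 s ((s + rho) / 2) x)%:C.
have tz : test_in y0 rho z. split; first exact: smooth_cutoffC.
  by exists ((s + rho) / 2); [lra|move=> x xs; rewrite /z (cutoff_supp s_ge0 ss xs)].
have fF := fam_cparts w (fam_op (ker_mol mp) Vv).
have [B B0 HB] := fam_sup fF tz; exists (Num.sqrt B); first exact: sqrtr_ge0.
move=> r x r0 r1 xr; have r20 : 0 < r ^+ 2 by exact: exprn_gt0.
have r21 : r ^+ 2 <= 1 by rewrite exprn_ile1// ltW.
have := HB (r ^+ 2) x r20 r21; rewrite op_mol//.
rewrite -[n in reg _ _ n]addn0 cparts_reg// !add0n wk.
rewrite /z (cutoff1 s_ge0 ss) ?mul1r; last by apply: le_trans xr _; rewrite le_max lexx.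
rewrite -nc_sqr => H; rewrite -ler_sqr ?nnegrE ?nc_ge0//; last first.
  by rewrite mulr_ge0 ?sqrtr_ge0 ?exprn_ge0 ?invr_ge0 ?(ltW r0).
apply: le_trans H _; rewrite exprMn sqr_sqrtr// ler_wpM2l//.
rewrite -(powR_mulrn 2 (ltW r0)) -powRrM -exprM exprVn -[r ^+ _](powR_mulrn _ (ltW r0)) -powRN.
apply: ger_powR; first by rewrite r0.
by rewrite natrM; move: Hp; move: (sigma) => S; lra.
Qed.

(** Started l orders higher, the descent needs 2 (k + l + n)(1 - sigma) <= 2 l + 1. The surplus (k +
    l + n) sigma exceeds k + n as soon as l > (k + n)/sigma, which is more than enough. *)
Lemma growth_one rho1 k : rho1 < rho -> growth y0 v c rho1 k 1.
Proof.
move=> r1r.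
have down l p j : growth y0 v c rho1 (j + l) (2 * l + p.+1) -> growth y0 v c rho1 j p.+1.
  elim: l p j => [|l IH] p j; first by rewrite addn0. move=> H; apply: (growth_step iv tc); apply: IH.
  by move: H; rewrite addSnnS mulnS -addnA addnC -!addnA; congr growth; lia.
have s0 := sigma_gt0 eps0.
pose l := Num.truncn ((k + n)%:R / sigma); have Hl := Num.Theory.truncnS_gt ((k + n)%:R / sigma : R).
apply: (down l.+1 0); apply: growth_large => //.
move: Hl; rewrite ltr_pdivrMr// -/l => Hl.
have := @sigma_le1 R eps; move: s0 Hl; move: (sigma) => S S0 Hl S1.
rewrite addn1 -[(2 * _).+1%:R]natr1 natrM addnAC natrD.
have : 0 <= (k + n)%:R * S :> R by rewrite mulr_ge0 ?ler0n ?ltW.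
by nra.
Qed.

End growth.

(** * Limits with a rate *)

Section real_limit.
Context (R : realType).

(** The limit is the supremum of the lower bounds G r - B r, all of which lie below every G s + B
    s. *)
Lemma cauchy_limit (G : R -> R) (B : R) :
  (forall r s : R, 0 < r -> r <= 1 -> 0 < s -> s <= 1 -> `|G r - G s| <= B * `|r - s|) ->
  exists l, forall r : R, 0 < r -> r <= 1 -> `|G r - l| <= B * r.
Proof.
move=> HG; pose A := [set G r - B * r | r in [set r : R | 0 < r /\ r <= 1]].
have B0 : 0 <= B. have := le_trans (normr_ge0 _) (HG 1 (2^-1) ltr01 (lexx 1) _ _).
  rewrite invr_gt0 ltr0n invf_le1 ?ler1n ?ltr0n// => /(_ isT isT).
  by rewrite [`|1 - _|]ger0_norm ?subr_ge0 ?invf_le1 ?ler1n ?ltr0n//; lra.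
have key (r s : R) : 0 < r -> r <= 1 -> 0 < s -> s <= 1 -> G s - B * s <= G r + B * r.
  move=> r0 r1 s0 s1; have := HG s r s0 s1 r0 r1; rewrite ler_norml => /andP[_]. have : B * `|s - r| <= B * (s + r).
    by apply: ler_wpM2l => //; apply: le_trans (ler_normB _ _) _; rewrite !ger0_norm// ltW. lra.
have A0 : A !=set0 by exists (G 1 - B * 1), 1.
exists (sup A) => r r0 r1.
have ub : ubound A (G r + B * r) by move=> _ [s [s0 s1] <-]; exact: key.
have u1 : sup A <= G r + B * r by exact: ge_sup.
have u2 : G r - B * r <= sup A by apply: ub_le_sup; [exists (G r + B * r)|exists r].
by rewrite ler_norml; apply/andP; split; lra.
Qed.

Lemma le_limit (a b K : R) : 0 <= K -> (forall r : R, 0 < r -> r <= 1 -> a <= b + K * r) -> a <= b.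
Proof.
move=> K0 H; apply/ler_addgt0Pr => e e0; have K1 : 0 < K + 1 by rewrite ltr_wpDl.
have r0 : 0 < Num.min 1 (e / (K + 1)) by rewrite lt_min ltr01 divr_gt0.
apply: le_trans (H _ r0 _) _; first by rewrite ge_min lexx.
rewrite lerD2l; apply: (@le_trans _ _ ((K + 1) * Num.min 1 (e / (K + 1)))). by rewrite ler_wpM2r ?(ltW r0)// lerDl.
by rewrite mulrC -ler_pdivlMr// ge_min lexx orbT.
Qed.

Lemma uniform_limit_continuous (V : normedModType R) (W : set V) (F : R -> V -> R) (u : V -> R) (B : R) (x : V) :
  open W -> 0 <= B -> (forall r : R, 0 < r -> r <= 1 -> continuous (F r)) ->
  (forall y, W y -> forall r : R, 0 < r -> r <= 1 -> `|F r y - u y| <= B * r) -> W x -> {for x, continuous u}.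
Proof.
move=> oW B0 cF Hu Wx; apply/cvgrPdist_le => e e0.
pose r := Num.min 1 (e / (3 * (B + 1))); have Bp : 0 < B + 1 by rewrite ltr_wpDl.
have r0 : 0 < r by rewrite lt_min ltr01 divr_gt0// mulr_gt0.
have r1 : r <= 1 by rewrite ge_min lexx.
have Br : B * r <= e / 3. have re : r <= e / (3 * (B + 1)) by rewrite ge_min lexx orbT.
  move: re; rewrite ler_pdivlMr ?mulr_gt0// => re. by rewrite ler_pdivlMr//; move: (ltW r0); nra.
have /cvgrPdist_le/(_ (e / 3)) := cF r r0 r1 x; rewrite divr_gt0// => /(_ isT) near1.
have near2 : \forall y \near x, W y by exact: (open_nbhs_nbhs (conj oW Wx)).
near=> y.
have h1 : `|F r x - F r y| <= e / 3 by near: y.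
have Wy : W y by near: y.
have h2 := Hu x Wx r r0 r1; have h3 := Hu y Wy r r0 r1.
move: h1 h2 h3; rewrite /= !ler_norml => /andP[? ?] /andP[? ?] /andP[? ?].
by apply/andP; split; lra.
Unshelve. all: by end_near.
Qed.

End real_limit.

Section smooth_limit.
Context (R : realType) (n : nat) (y0 : 'rV[R]_n) (rho : R).
Notation X := 'rV[R]_n.
Notation ev i := (delta_mx 0 i : X).

Let W := [set x : X | `|x - y0| < rho].

Lemma open_W : open W.
Proof.
rewrite (_ : W = ball y0 rho); first exact: ball_open.
by rewrite -ball_normE; apply/seteqP; split=> x /=; rewrite distrC.
Qed.

Variable F : seq 'I_n -> R -> X -> R.
Hypothesis cF : forall w (r : R), 0 < r -> r <= 1 -> continuous (F w r).
Hypothesis dF : forall w i (r : R) x, 0 < r -> r <= 1 -> is_derive x (ev i) (F w r) (F (rcons w i) r x).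
Hypothesis lF : forall w, exists2 B, 0 <= B & forall (r s : R) x, 0 < r -> r <= 1 -> 0 < s -> s <= 1 -> W x ->
  `|F w r x - F w s x| <= B * `|r - s|.
Hypothesis bF : forall w, exists2 M, 0 <= M & forall (r : R) x, 0 < r -> r <= 1 -> W x -> `|F w r x| <= M.

(** The limits of all derivatives are chosen together. The Taylor remainder, bounded uniformly in r
    by [bF], passes to the limit and identifies the limit along [rcons w i] as the i-th derivative
    of the limit along [w]. *)
Lemma smooth_limit : exists u, smooth W u /\
  exists2 B, 0 <= B & forall (r : R) x, 0 < r -> r <= 1 -> W x -> `|F [::] r x - u x| <= B * r.
Proof.
have /choice[B HB] w : exists B, 0 <= B /\ forall (r s : R) x, 0 < r -> r <= 1 -> 0 < s -> s <= 1 -> W x ->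
    `|F w r x - F w s x| <= B * `|r - s| by have [B ? ?] := lF w; exists B.
have B0 w : 0 <= B w by have [] := HB w.
have /choice[M HM] w : exists M, 0 <= M /\ forall (r : R) x, 0 < r -> r <= 1 -> W x -> `|F w r x| <= M.
  by have [M ? ?] := bF w; exists M.
have /choice[u Hu] (wx : seq 'I_n * X) : exists l, W wx.2 ->
    forall r : R, 0 < r -> r <= 1 -> `|F wx.1 r wx.2 - l| <= B wx.1 * r.
  have [Wx|nW] := pselect (W wx.2); last by exists 0.
  have [|l Hl] := @cauchy_limit R (fun r => F wx.1 r wx.2) (B wx.1); last by exists l.
  by move=> r s r0 r1 s0 s1; have [_] := HB wx.1; apply.
have cu w x : W x -> {for x, continuous (fun x : X => u (w, x) : R)}.
  by move=> Wx; apply: (uniform_limit_continuous (F := F w) open_W (B0 w)) => // y Wy r r0 r1; [exact: cF|exact: (Hu (w, y))].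
have du w i x : W x -> is_derive x (ev i) (fun x => u (w, x)) (u (rcons w i, x)).
  move=> Wx; have d0 : 0 < rho - `|x - y0| by rewrite subr_gt0. pose w2 := rcons (rcons w i) i; have [M0 HM2] := HM w2.
  apply: (@quadratic_derive _ _ _ _ _ _ (M w2) _ d0) => h hd. have Wh (s : R) : `|s| <= `|h| -> W (s *: ev i + x).
    move=> sh; rewrite /W /= -addrA; apply: le_lt_trans (ler_normD _ _) _.
    rewrite normrZ; have : `|s| * `|ev i| <= `|s| by rewrite ler_piMr// norm_row_le// => j; rewrite mxE eqxx/= normr_nat lern1 leq_b1.
    by move: hd; lra. have Whh := Wh h (lexx _). apply: (@le_limit _ _ _ (B w + B w + `|h| * B (rcons w i))).
    by rewrite !addr_ge0 ?mulr_ge0. move=> r r0 r1.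
  have T : `|F w r (h *: ev i + x) - F w r x - h * F (rcons w i) r x| <= M w2 * h ^+ 2.
    apply: (@taylor_quadratic _ _ (F w r) (F (rcons w i) r) (F w2 r)) => s sh; try exact: dF.
    by apply: HM2 => //; exact: Wh. have h1 := Hu (w, _) Whh r r0 r1; have h2 := Hu (w, x) Wx r r0 r1.
  have h3 := Hu (rcons w i, x) Wx r r0 r1; rewrite /= in h1 h2 h3.
  have h4 : `|h * (F (rcons w i) r x - u (rcons w i, x))| <= `|h| * (B (rcons w i) * r). by rewrite normrM ler_wpM2l.
  move: T h1 h2 h4.
  move: (F w r _) (F w r x) (F (rcons w i) r x) (u (w, x)) (u (w, _)) (u (rcons w i, x)) => a b c a' b' c'.
  rewrite mulrBr !mulrDl -mulrA. move: (M w2 * _) (h * c) (h * c') (B w * r) (`|h| * _) => m p q z y.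
  rewrite !ler_norml => /andP[? ?] /andP[? ?] /andP[? ?] /andP[? ?]. by apply/andP; split; lra.
exists (fun x => u ([::], x)); split; last first.
  by exists (B [::]) => // r x r0 r1 Wx; exact: (Hu ([::], x) Wx r r0 r1).
suff H k w : Ck k W (fun x => u (w, x)) by move=> k; exact: H.
elim: k w => [|k IH] w; first by split=> // x; exact: cu.
split; first by move=> x; exact: cu.
move=> i; split; first by move=> x Wx; have [] := du w i x Wx.
apply: (@Ck_ext _ _ _ _ (fun x => u (rcons w i, x))) => //; first exact: open_W.
by move=> x; rewrite inE => Wx; have [_ <-] := du w i x Wx.
Unshelve. all: by end_near.
Qed.

End smooth_limit.

(** * A mollifier of unit mass *)

Section unit_mass.
Context (R : realType).
Notation mu := (@lebesgue_measure R).

(** The derivative of [step], which rises from 0 to 1; its integral is therefore 1 without any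
    normalizing constant. *)
Definition dstep (x : R) : R :=
  (flatD 1 x * flatD 0 (1 - x) + flatD 0 x * flatD 1 (1 - x)) / (flatD 0 x + flatD 0 (1 - x)) ^+ 2.

Lemma flatD_le0 k (x : R) : x <= 0 -> flatD k x = 0.
Proof. by move=> x0; rewrite /flatD /flat ltNge x0. Qed.

Lemma flatD1_ge0 (x : R) : 0 <= flatD 1 x.
Proof.
rewrite /flatD /flat/=; case: ltP => // x0.
by rewrite derivC subr0 mulr1 hornerXn mulr_ge0 ?expR_ge0 ?exprn_ge0 ?invr_ge0 ?(ltW x0).
Qed.

Lemma dstep_ge0 x : 0 <= dstep x.
Proof.
have f0 y : 0 <= flatD 0 y :> R by rewrite flatD0; case: ltP => // _; exact: expR_ge0.
by rewrite /dstep mulr_ge0 ?invr_ge0 ?sqr_ge0// addr_ge0// mulr_ge0// flatD1_ge0.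
Qed.

Lemma dstep_lt0 x : x <= 0 -> dstep x = 0.
Proof. by move=> x0; rewrite /dstep !(flatD_le0 _ x0) !mul0r addr0 mul0r. Qed.

Lemma dstep_gt1 x : 1 <= x -> dstep x = 0.
Proof.
move=> x1; have x0 : 1 - x <= 0 by rewrite subr_le0.
by rewrite /dstep !(flatD_le0 _ x0) !mulr0 addr0 mul0r.
Qed.

Lemma smooth_dstep n (U : set 'rV[R]_n) f : open U -> smooth U f -> smooth U (fun x => dstep (f x)).
Proof.
move=> oU sf; have s1 : smooth U (fun x => 1 - f x) by apply: smoothB => //; exact: smooth_cst.
have sF k g : smooth U g -> smooth U (fun x => flatD k (g x)).
  by move=> sg; apply: (@smooth1_comp _ _ U setT g _ k) => // j s _; exact: flatD_derive.
apply: smoothM => //. by apply: smoothD => //; apply: smoothM => //; exact: sF.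
apply: smoothV => //; first by move=> x _; rewrite expf_neq0// gt_eqF// step_den.
have sD : smooth U (fun x => flatD 0 (f x) + flatD 0 (1 - f x)) by apply: smoothD => //; exact: sF.
by apply: (@smooth_ext _ _ U (fun x => (flatD 0 (f x) + flatD 0 (1 - f x)) * (flatD 0 (f x) + flatD 0 (1 - f x)))) => //; exact: smoothM.
Qed.

Lemma is_derive_step (x : R) : is_derive x (1 : R) (@step R) (dstep x).
Proof.
have d1 y : is_derive y (1 : R) (@flatD R 0) (flatD 1 y) by exact: flatD_derive.
have db : is_derive x (1 : R) (fun x : R => 1 - x) (- 1).
  by have := is_deriveB (is_derive_cst (1 : R) x 1) (is_derive_id x (1 : R)); rewrite sub0r.
have d2 : is_derive x (1 : R) (fun x : R => flatD 0 (1 - x)) (flatD 1 (1 - x) * -1).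
  exact: (@is_derive1_comp R (@flatD R 0) (fun x : R => 1 - x) x _ _ (d1 _) db).
have dd := is_deriveD (d1 x) d2.
have d0 : ((@flatD R 0 : R -> R) + (fun x : R => flatD 0 (1 - x))) x != 0.
  by rewrite -[X in X != _]/(flatD 0 x + flatD 0 (1 - x)) gt_eqF// step_den.
have dV := @is_deriveV _ _ _ _ _ d0 dd.
have := is_deriveM (d1 x) dV; move=> [H1 H2]; apply: DeriveDef; first exact: H1.
have {}H2 : 'D_1 (@step R) x = _ := H2; rewrite H2.
rewrite -![_ *: _]/(_ * _) /dstep -[((@flatD R 0 : R -> R) + _) x]/(flatD 0 x + flatD 0 (1 - x)).
rewrite -[((@flatD R 0 : R -> R) + _) x]/(flatD 0 x + flatD 0 (1 - x)) in d0.
by move: (flatD 0 x) (flatD 0 (1 - x)) (flatD 1 x) (flatD 1 (1 - x)) d0 => a b c d d0; field.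
Qed.

Lemma continuous_dstep : continuous dstep.
Proof.
have c k : continuous (@flatD R k).
  by move=> x; apply/differentiable_continuous/derivable1_diffP; have [] := flatD_derive k x.
have c1 k : continuous (fun x : R => flatD k (1 - x)).
  move=> x; apply: (@continuous_comp _ _ _ (fun x : R => 1 - x) (@flatD R k)); last exact: c.
  by apply: cvgB; [exact: cvg_cst|exact: cvg_id].
move=> x; apply: cvgM. by apply: cvgD; apply: cvgM; first [exact: c|exact: c1].
apply: cvgV; first by rewrite expf_neq0// gt_eqF// step_den.
by apply: cvgM; apply: cvgD; first [exact: c|exact: c1].
Qed.

Lemma integral_dstep (t a : R) : 0 < t -> (\int[mu]_s (t^-1 * dstep (t^-1 * (s - a)))%:E = 1)%E.
Proof.
move=> t0; pose f s := t^-1 * dstep (t^-1 * (s - a)); pose F s := step (t^-1 * (s - a)).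
pose S := `|a| + t + 1; have S0 : 0 < S by rewrite ltr_wpDl// addr_ge0// ltW.
have t1 : 0 < t^-1 by rewrite invr_gt0.
have lo s : s <= - S -> t^-1 * (s - a) <= 0.
  move=> sS; rewrite pmulr_rle0// subr_le0; have := ler_norm (- a); rewrite normrN. by move: sS; rewrite /S; lra.
have hi s : S <= s -> 1 <= t^-1 * (s - a). move=> sS; rewrite mulrC ler_pdivlMr// mul1r; have := ler_norm a.
  by move: sS; rewrite /S; lra.
have cl : continuous (fun s : R => t^-1 * (s - a)).
  by move=> x; apply: cvgM; [exact: cvg_cst|apply: cvgB; [exact: cvg_id|exact: cvg_cst]].
have cf : continuous f. move=> x; apply: cvgM; first exact: cvg_cst.
  by apply: (@continuous_comp _ _ _ (fun s : R => t^-1 * (s - a)) dstep); [exact: cl|exact: continuous_dstep].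
have dF x : is_derive x (1 : R) F (f x). have dl : is_derive x (1 : R) (fun s : R => t^-1 * (s - a)) t^-1.
    have := is_deriveZ t^-1 (is_deriveB (is_derive_id x (1 : R)) (is_derive_cst a x (1 : R))).
    by rewrite subr0 -[_ *: 1]/(_ * 1) mulr1.
  have := @is_derive1_comp R (@step R) (fun s : R => t^-1 * (s - a)) x _ _ (is_derive_step _) dl. by rewrite mulrC.
have -> : (\int[mu]_x (f x)%:E = \int[mu]_(x in `[(- S)%R, S]) (f x)%:E)%E.
  rewrite [RHS]integral_mkcond; apply: eq_integral => x _; rewrite patchE.
  case: ifPn => //; rewrite notin_setE/= in_itv/= => /negP; rewrite negb_and -!ltNge => /orP[/ltW h|/ltW h].
    by rewrite /f dstep_lt0 ?mulr0//; exact: lo. by rewrite /f dstep_gt1 ?mulr0//; exact: hi.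
rewrite (@continuous_FTC2 _ f F).
- by rewrite /F step1 ?step0 ?sube0//; [exact: lo|exact: hi].
- by rewrite gtrN.
- exact: continuous_subspaceT.
- have dd x : derivable F x 1 by have [] := dF x.
  have cF : continuous F by move=> x; apply/differentiable_continuous/derivable1_diffP. split; first by move=> x _.
    by apply: cvg_at_right_filter; exact: cF. by apply: cvg_at_left_filter; exact: cF.
- by move=> x _; rewrite derive1E; have [_] := dF x.
Qed.

Context {n : nat}.

(** Supported in the cube [0, 1]^n, which lies in the unit ball of the maximum norm. *)
Definition hat (x : 'rV[R]_n) : R := \prod_i dstep (x 0 i).

Lemma hat_ge0 x : 0 <= hat x. Proof. by apply: prodr_ge0 => i _; exact: dstep_ge0. Qed.

Lemma smooth_hat : smooth setT hat.
Proof.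
apply: smooth_prod; first exact: openT.
by move=> i _; apply: smooth_dstep; [exact: openT|exact: smooth_coord].
Qed.

Lemma hat_supp : supp_in 0 1 hat.
Proof.
move=> x; rewrite subr0 => x1; apply/eqP; apply: contraTT x1 => /prodf_neq0 H; rewrite -leNgt.
apply: norm_row_le => // i; have := H i isT.
have [x0|x0] := leP (x 0 i) 0; first by rewrite dstep_lt0// eqxx.
have [x1|x1] := leP 1 (x 0 i); first by rewrite dstep_gt1// eqxx.
by move=> _; rewrite ger0_norm ltW.
Qed.

Lemma integral_hat (t : R) (y : 'rV[R]_n) : 0 < t ->
  (\int[leb R n]_s (t^-1 ^+ n * hat (t^-1 *: (rowt s - y)))%:E = 1)%E.
Proof.
move=> t0; under eq_integral => s _.
  rewrite (_ : t^-1 ^+ n * hat _ = \prod_i (fun i s => t^-1 * dstep (t^-1 * (s - y 0 i))) i (rowt s 0 i)); last first.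
    rewrite big_split /= prodr_const card_ord; congr (_ * _). by apply: eq_bigr => i _; rewrite !mxE. over.
rewrite (@integral_leb_prod R n (fun i s => t^-1 * dstep (t^-1 * (s - y 0 i)))); last 2 first.
- move=> i; apply: cont_mfun => x; apply: cvgM; first exact: cvg_cst.
  apply: (@continuous_comp _ _ _ (fun s : R => t^-1 * (s - y 0 i)) dstep); last exact: continuous_dstep.
  by apply: cvgM; [exact: cvg_cst|apply: cvgB; [exact: cvg_id|exact: cvg_cst]].
- by move=> i x; rewrite mulr_ge0 ?dstep_ge0// invr_ge0 ltW.
by rewrite big1// => i _; exact: integral_dstep.
Qed.

End unit_mass.

(** * Local regularity of weakly Lie-stable families *)
Section weak_mollification.
Context (R : realType) (n : nat).
Notation X := 'rV[R]_n.
Notation T := (n.-tuple R).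
Notation leb := (leb R n).

Definition mker (t : R) (x y : X) : R := t^-1 ^+ n * hat (t^-1 *: (x - y)).

Lemma mker_ge0 (t : R) x y : 0 < t -> 0 <= mker t x y.
Proof. by move=> t0; rewrite mulr_ge0 ?hat_ge0// exprn_ge0// invr_ge0 ltW. Qed.

Lemma mker_far (t : R) x y : 0 < t -> t < `|x - y| -> mker t x y = 0.
Proof.
move=> t0 h; rewrite /mker hat_supp ?mulr0//.
by rewrite subr0 normrZ gtr0_norm ?invr_gt0// mulrC ltr_pdivlMr// mul1r.
Qed.

Lemma measurable_mker (t : R) : mfunT (fun z : T * T => mker t (rowt z.1) (rowt z.2)).
Proof.
apply: mfunM; first exact: measurable_cst.
apply: measurable_prod => i _; under eq_fun do rewrite !mxE.
have md : mfunT (@dstep R) by apply: cont_mfun; exact: continuous_dstep.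
apply: (mcompT md); apply: mfunM; first exact: measurable_cst.
apply: measurable_funB. by apply: mcompT (measurable_tnth i) _; exact: measurable_fst.
by apply: mcompT (measurable_tnth i) _; exact: measurable_snd.
Qed.

Lemma mker_bound (t : R) : exists2 M, 0 <= M & forall x y, `|mker t x y| <= M.
Proof.
have cb : continuous (@hat R n) by move=> x; exact: (smooth_cont (@smooth_hat R n)).
have [M M0 HM] := supp_bounded cb (@hat_supp R n).
exists (`|t^-1 ^+ n| * M); first by rewrite mulr_ge0// ltW.
by move=> x y; rewrite normrM ler_wpM2l.
Qed.

Lemma integrable_mker (t : R) y : 0 < t -> leb.-integrable setT (fun s => (mker t (rowt s) y)%:E).
Proof.
move=> t0; have [M M0 HM] := mker_bound t.
apply: (@intg_supp R n y t M (fun s => mker t (rowt s) y)) => //; last by move=> s; exact: mker_far.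
have ma := measurable_mker t.
rewrite (_ : (fun s => _) = (fun z : T * T => mker t (rowt z.1) (rowt z.2)) \o (fun s => (s, tupr y))).
  by apply: mcompT ma _; apply: measurable_pair2.
by apply/funext => s /=; rewrite tuprK.
Qed.

Lemma Rintegral_mker (t : R) y : 0 < t -> \int[leb]_s mker t (rowt s) y = 1.
Proof. by move=> t0; rewrite /Rintegral integral_hat. Qed.

Variables (phi cc : X -> R) (y0 : X) (s0 A : R) (q : T -> R).
Hypotheses (sphi : smooth setT phi) (zphi : supp_in y0 s0 phi) (ccc : continuous cc)
  (ccA : forall x, `|cc x| <= A) (ccphi : forall x, cc x * phi x = phi x) (iq : leb.-integrable setT (EFin \o q)).

Lemma mollify_near : exists2 L, 0 <= L & forall (t : R) y, 0 < t ->
  `|\int[leb]_s (phi (rowt s) * mker t (rowt s) y) - phi y| <= L * t.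
Proof.
have [L L0 HL] := supp_lipschitz sphi zphi; exists L; first exact: ltW.
move=> t y t0; have ia := integrable_mker y t0.
have cphi : continuous phi by move=> x; exact: (smooth_cont sphi).
have [D _ HD] := supp_bounded cphi zphi.
have mphi := mrowt_cont cphi.
have ma : mfunT (fun s : T => mker t (rowt s) y). by have /integrableP[/mEFinP] := ia.
have ipa : leb.-integrable setT (fun s => (phi (rowt s) * mker t (rowt s) y)%:E).
  apply: (@le_integrable _ _ _ _ _ _ _ (fun s => (D * mker t (rowt s) y)%:E)) => //.
  - by apply/mEFinP; exact: mfunM.
  - by move=> s _; rewrite lee_fin !normrM ler_wpM2r// (le_trans (HD _))// ler_norm.
  - by have := integrableZl measurableT D ia.
have iya : leb.-integrable setT (fun s => (phi y * mker t (rowt s) y)%:E).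
  by have := integrableZl measurableT (phi y) ia.
rewrite -[X in _ - X]mulr1 -(Rintegral_mker y t0) -RintegralZl// -RintegralB//.
apply: le_trans (le_normr_Rintegral measurableT _) _. by have := integrableB measurableT ipa iya.
rewrite -[leRHS]mulr1 -(Rintegral_mker y t0) -RintegralZl//.
apply: le_Rintegral => //.
- by apply: integrable_norm; have := integrableB measurableT ipa iya.
- by have := integrableZl measurableT (L * t) ia.
- move=> s _; rewrite -mulrBl normrM (ger0_norm (mker_ge0 _ _ t0)).
  have [far|near] := ltP t `|rowt s - y|; first by rewrite mker_far// !mulr0.
  rewrite ler_wpM2r ?mker_ge0//; apply: le_trans (HL _ _) _. by rewrite ler_wpM2l// ltW.
Qed.

(** Fubini moves the mollification to the test function [phi], which is Lipschitz. This gives the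
    rate O(t) although [q] is merely integrable. *)
Lemma weak_mollification : exists2 L, 0 <= L & forall t : R, 0 < t ->
  leb.-integrable setT (fun x => (phi (rowt x) * \int[leb]_y (cc (rowt y) * mker t (rowt x) (rowt y) * q y))%:E) /\
  `|\int[leb]_x (phi (rowt x) * \int[leb]_y (cc (rowt y) * mker t (rowt x) (rowt y) * q y))
    - \int[leb]_y (phi (rowt y) * q y)| <= L * t.
Proof.
have A0 : 0 <= A := le_trans (normr_ge0 _) (ccA 0).
have [L L0 HL] := mollify_near.
have iaq : leb.-integrable setT (fun y => (`|q y|)%:E) by exact: integrable_norm.
have I0 : 0 <= \int[leb]_y `|q y| by apply: Rintegral_ge0.
exists (A * L * \int[leb]_y `|q y|); first by rewrite !mulr_ge0.
move=> t t0; have [M M0 HM] := mker_bound t.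
have cphi : continuous phi by move=> x; exact: (smooth_cont sphi).
have mphi := mrowt_cont cphi; have mcc := mrowt_cont ccc.
have mq : mfunT q by have /integrableP[/mEFinP] := iq.
pose k (z : T * T) := phi (rowt z.1) * (cc (rowt z.2) * mker t (rowt z.1) (rowt z.2) * q z.2).
have mk : mfunT k. apply: mfunM; first exact: (mcompT mphi measurable_fst).
  apply: mfunM; last exact: (mcompT mq measurable_snd).
  apply: mfunM; last exact: measurable_mker. exact: (mcompT mcc measurable_snd).
have ip : leb.-integrable setT (fun x => (`|phi (rowt x)|)%:E).
  by apply: integrable_norm; exact: intg_ccont cphi zphi.
have iv : leb.-integrable setT (fun y => (A * M * `|q y|)%:E) by have := integrableZl measurableT (A * M) iaq.
have kb x y : `|k (x, y)| <= `|phi (rowt x)| * (A * M * `|q y|).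
  rewrite /k /= !normrM; apply: ler_wpM2l => //; apply: ler_wpM2r => //.
  by apply: ler_pM => //; rewrite -normrM; exact: HM.
have inner x : leb.-integrable setT (fun y => (cc (rowt y) * mker t (rowt x) (rowt y) * q y)%:E).
  apply: (@le_integrable _ _ _ _ _ _ _ (fun y => (A * M * `|q y|)%:E)) => //.
    apply/mEFinP; apply: mfunM => //; apply: mfunM => //.
    rewrite (_ : (fun y => _) = (fun z : T * T => mker t (rowt z.1) (rowt z.2)) \o pair x)//.
    by apply: mcompT (measurable_mker t) _; exact: measurable_pair1.
  move=> y _; rewrite lee_fin !normrM normr_id ler_wpM2r// (ger0_norm A0) (ger0_norm M0).
  by apply: ler_pM => //; rewrite -normrM; exact: HM.
have E1 x : phi (rowt x) * \int[leb]_y (cc (rowt y) * mker t (rowt x) (rowt y) * q y) = \int[leb]_y k (x, y).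
  by rewrite -RintegralZl//; exact: inner.
split. under eq_fun do rewrite E1; exact: (intg_inner1 mk ip iv kb).
under [X in `|X - _|]eq_Rintegral do rewrite E1.
rewrite (Rintegral_Fubini mk ip iv kb).
have E2 y : \int[leb]_x k (x, y) = cc (rowt y) * q y * \int[leb]_x (phi (rowt x) * mker t (rowt x) (rowt y)).
  rewrite -RintegralZl//. by apply: eq_Rintegral => x _; rewrite /k; ring. have [D _ HD] := supp_bounded cphi zphi.
  have ia := integrable_mker (rowt y) t0.
  apply: (@le_integrable _ _ _ _ _ _ _ (fun x => (D * mker t (rowt x) (rowt y))%:E)) => //.
  - apply/mEFinP; apply: mfunM => //. by have /integrableP[/mEFinP] := ia.
  - by move=> x _; rewrite lee_fin !normrM ler_wpM2r// (le_trans (HD _))// ler_norm.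
  - by have := integrableZl measurableT D ia.
have E3 y : phi (rowt y) * q y = cc (rowt y) * q y * phi (rowt y) by rewrite -[in LHS]ccphi; ring.
have i2 : leb.-integrable setT (fun y => (\int[leb]_x k (x, y))%:E).
  have mk' : mfunT (fun z : T * T => k (z.2, z.1)).
    by apply: (mcompT mk); exact: measurable_swap.
  apply: (intg_inner1 (f := fun z => k (z.2, z.1)) mk' iv ip) => y x. by rewrite mulrC; exact: kb.
have i3 : leb.-integrable setT (fun y => (phi (rowt y) * q y)%:E). have [D _ HD] := supp_bounded cphi zphi.
  apply: (@le_integrable _ _ _ _ _ _ _ (fun y => (D * `|q y|)%:E)) => //.
  - by apply/mEFinP; exact: mfunM.
  - by move=> y _; rewrite lee_fin !normrM normr_id ler_wpM2r// (le_trans (HD _))// ler_norm.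
  - by have := integrableZl measurableT D iaq.
rewrite -RintegralB//; apply: le_trans (le_normr_Rintegral measurableT _) _. by have := integrableB measurableT i2 i3.
rewrite [A * L * _ * t]mulrAC -RintegralZl//; apply: le_Rintegral => //.
- by apply: integrable_norm; have := integrableB measurableT i2 i3.
- by have := integrableZl measurableT (A * L * t) iaq.
- move=> y _; rewrite E2 E3 -mulrBr !normrM [leRHS]mulrC [`|cc _| * _]mulrC -mulrA ler_wpM2l// -mulrA.
  by apply: ler_pM => //; exact: HL.
Qed.

End weak_mollification.

Lemma measurable_continuous_on (R : realType) n (O : set 'rV[R]_n) (f : 'rV[R]_n -> R) : open O ->
  (forall x, O x -> {for x, continuous f}) -> measurable_fun [set t : n.-tuple R | O (rowt t)] (fun t => f (rowt t)).
Proof.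
move=> oO cf; apply: (measurability _ (RGenOpens.measurableE R)) => //.
move=> _ [_ [a [b ->]] <-].
rewrite (_ : _ `&` _ = [set t | (O `&` f @^-1` `]a, b[%classic) (rowt t)]); last by apply/seteqP; split.
apply: mrowt_open; rewrite openE => x [Ox fx].
have nO : nbhs x O by exact: open_nbhs_nbhs.
have nf : nbhs x (f @^-1` `]a, b[%classic).
  by apply: (cf x Ox); apply: open_nbhs_nbhs; split => //; exact: interval_open.
exact: filterI nO nf.
Qed.

(** * Identification of the smooth limit with the given function *)

Section local_regularity.
Context (R : realType) (n m : nat) (y0 : 'rV[R]_n) (rho : R).
Notation X := 'rV[R]_n.
Notation T := (n.-tuple R).
Notation leb := (leb R n).
Notation C := R[i].
Hypothesis rho0 : 0 < rho.
Variable alpha : 'I_m -> 'I_n -> X -> C.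
Hypothesis talpha : forall j i, test (alpha j i).
Variable V : (T -> C) -> Prop.
Hypothesis VL2 : forall v, V v -> L2 v.
Hypothesis Vlie : lie_stable y0 rho alpha V.
Variables (eps Kc : R).
Hypotheses (eps0 : 0 < eps) (Kc0 : 0 <= Kc).
Hypothesis subell : subell_est y0 rho alpha eps Kc.
Variable rho1 : R.
Hypotheses (rho10 : 0 < rho1) (rho1r : rho1 < rho).
Variable v : T -> C.
Hypothesis Vv : V v.

Let iv := proj1 (VL2 Vv).
Let rho2 := (rho1 + rho) / 2.
Let rho12 : rho1 < rho2. Proof. exact: (midf_lt rho1r).1. Qed.
Let cc : X -> R := cutoff y0 rho1 rho2.
Let c (x : X) : C := (cc x)%:C.
Let psi (x : X) : C := (hat x)%:C.

Let tc : test_in y0 rho c.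
Proof.
split; first exact: smooth_cutoffC.
exists rho2; first exact: (midf_lt rho1r).2.
by move=> x h; rewrite /c /cc (cutoff_supp (ltW rho10) rho12 h).
Qed.

Let mpsi : mollifier psi.
Proof.
split; first by split; [exact: smooth_hat|exact: smooth_cst].
by move=> x h; rewrite /psi (hat_supp h).
Qed.

(** [p] stands for the real or the imaginary part; the hypotheses that follow are what the argument
    uses of either. *)
Variable p : C -> R.
Hypotheses (pn : forall z, `|p z| <= nc z) (pB : forall a b, p (a - b) = p a - p b)
  (pZ : forall (r : R) z, p (r%:C * z) = r * p z) (pI : forall f, p (cintegral leb f) = \int[leb]_s p (f s))
  (pS : forall f : X -> C, smoothC f -> smooth setT (fun x => p (f x)))
  (pP : forall (f : X -> C) i x, p (cpart i f x) = partial i (fun x => p (f x)) x)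
  (pi : leb.-integrable setT (fun s => (p (v s))%:E)).

Local Notation d w r x := (reg v c (n + size w) (cparts w psi) (r ^+ 2) x).
Let W := [set x : X | `|x - y0| < rho1].

Lemma part_regular : exists u, smooth W u /\ {ae leb, forall s, `|rowt s - y0| < rho1 -> p (v s) = u (rowt s)}.
Proof.
have G k : growth y0 v c rho1 k 1. by apply: (growth_one rho0 talpha VL2 Vlie eps0 Kc0 subell Vv tc).
have r2 (r : R) : 0 < r -> r <= 1 -> 0 < r ^+ 2 /\ r ^+ 2 <= 1. by move=> r0 r1; rewrite exprn_gt0// exprn_ile1// ltW.
have mw w : mollifier (cparts w psi) by exact: mollifier_cparts.
have sd w (r : R) : 0 < r -> r <= 1 -> smoothC (fun x => d w r x).
  by move=> r0 r1; have [a b] := r2 r r0 r1; exact: (smoothC_reg rho0 VL2 Vv tc (size w) (mw w)).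
have lip w : exists2 B, 0 <= B & forall (r s : R) x, 0 < r -> r <= 1 -> 0 < s -> s <= 1 -> W x ->
    `|p (d w r x) - p (d w s x)| <= B * `|r - s|.
  have [B B0 HB] := growth_lipschitz iv tc (G (size w).+1) mpsi (erefl (size w)).
  exists B => // r s x r0 r1 s0 s1 Wx; rewrite -pB; apply: le_trans (pn _) _. by apply: HB => //; exact: ltW.
have [u [su [B B0 HB]]] : exists u : X -> R, smooth W u /\ exists2 B, 0 <= B &
    forall (r : R) x, 0 < r -> r <= 1 -> W x -> `|p (d (@nil 'I_n) r x) - u x| <= B * r.
  apply: (@smooth_limit R n y0 rho1 (fun w r x => p (d w r x))) => //.
  - by move=> w r r0 r1 x; have := smooth_cont (pS (sd w r r0 r1)); exact.
  - move=> w i r x r0 r1; have [a b] := r2 r r0 r1; apply: DeriveDef. exact: smooth_der (pS (sd w r r0 r1)) _.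
    rewrite -[LHS]/(partial i (fun x => p (d w r x)) x) -pP.
    rewrite (cpart_reg rho0 VL2 Vv tc (size w) i x (mw w) a b) size_rcons. by rewrite /cparts -cats1 foldl_cat.
  - move=> w; have [B B0 HB] := lip w; have [D D0 HD] := reg_bound1 iv tc (n + size w) (mw w).
    exists (D + B); first exact: addr_ge0. move=> r x r0 r1 Wx; have := HB r 1 x r0 r1 ltr01 (lexx 1) Wx.
    have := le_trans (pn _) (HD x); rewrite expr1n => h1 h2. have h3 : B * `|r - 1| <= B.
      by rewrite ler_piMr// ler_norml; apply/andP; split; move: (ltW r0); lra.
    move: h1 h2 h3; move: (p (d w r x)) (p _) (B * _) => p1 p2 q.
    by rewrite !ler_norml => /andP[? ?] /andP[? ?] ?; apply/andP; split; lra.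
exists u; split=> //.
(* [u] is controlled only in the open ball; extended by 0 it is bounded and integrable, as du
   Bois-Reymond requires. *)
pose u0 (t : T) := if `|rowt t - y0| < rho1 then u (rowt t) else 0.
have oW : open W := @open_W R n y0 rho1.
have mW : measurable [set t : T | W (rowt t)] by exact: mrowt_open.
have mu0 : mfunT u0. have := measurable_continuous_on oW (fun x Wx => smooth_cont su Wx).
  move=> /(measurable_restrictT _ mW); congr (measurable_fun _ _).
  apply/funext => t; rewrite patchE /u0; case: ifPn => [|/negP nW]; rewrite ?inE. by rewrite /W /= => ->.
  by rewrite ifF//; apply/negP => h; apply: nW; rewrite inE.
have [D D0 HD] := reg_bound1 iv tc (n + size (@nil 'I_n)) (mw [::]).
have u0b t : `|u0 t| <= D + B. rewrite /u0; case: ifPn => [Wt|_]; last by rewrite normr0 addr_ge0.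
  have := HB 1 _ ltr01 (lexx 1) Wt; have := le_trans (pn _) (HD (rowt t)).
  rewrite expr1n mulr1 !ler_norml => /andP[? ?] /andP[? ?]. by apply/andP; split; lra.
have iu0 : leb.-integrable setT (EFin \o u0). apply: (@intg_supp R n y0 rho1 (D + B)) => // t h.
  by rewrite /u0 ifF//; apply/negbTE; rewrite -leNgt ltW.
have iq : leb.-integrable setT (EFin \o (fun s => p (v s))) by [].
have if0 : leb.-integrable setT (EFin \o (fun t => p (v t) - u0 t)). by have := integrableB measurableT iq iu0.
have ccc : continuous cc by move=> x; apply: (smooth_cont (smooth_cutoff y0 rho1 rho2 openT)).
have [A A0 HA] := supp_bounded ccc (cutoff_supp (ltW rho10) rho12).
suff weak phi s : s < rho1 -> smooth setT phi -> supp_in y0 s phi ->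
    (\int[leb]_t ((p (v t) - u0 t) * phi (rowt t))%:E = 0)%E.
  have := du_bois_reymond rho10 if0 weak; apply: filterS => t H Wt.
  by apply/eqP; rewrite -subr_eq0; have := H Wt; rewrite /u0 Wt => ->.
move=> sr sphi zphi.
have ccphi x : cc x * phi x = phi x.
  have [h|h] := leP `|x - y0| rho1; first by rewrite /cc (cutoff1 (ltW rho10) rho12 h) mul1r.
  by rewrite zphi ?mulr0//; exact: lt_trans h.
have [L L0 HL] := weak_mollification sphi zphi ccc HA ccphi iq.
have cphi : continuous phi by move=> x; exact: (smooth_cont sphi).
have iphi : leb.-integrable setT (fun x => (`|phi (rowt x)|)%:E).
  by apply: integrable_norm; exact: intg_ccont cphi zphi.
have [E _ HE] := supp_bounded cphi zphi.
have mphi := mrowt_cont cphi.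
have imul f : leb.-integrable setT (EFin \o f) -> leb.-integrable setT (fun t => (f t * phi (rowt t))%:E).
  move=> fi; have mf : mfunT f by have /integrableP[/mEFinP] := fi.
  apply: (@le_integrable _ _ _ _ _ _ _ (fun t => (E * `|f t|)%:E)) => //.
  - by apply/mEFinP; exact: mfunM.
  - move=> t _; rewrite lee_fin !normrM normr_id mulrC ler_wpM2r//. exact: le_trans (HE _) (ler_norm _).
  - by have := integrableZl measurableT E (integrable_norm fi).
rewrite -(fineK (integrable_fin_num measurableT (imul _ if0))); congr (_%:E).
rewrite -[LHS]/(\int[leb]_t ((p (v t) - u0 t) * phi (rowt t))).
have Ip := imul _ iq; have Iu := imul _ iu0.
have I0 : 0 <= \int[leb]_x `|phi (rowt x)| by apply: Rintegral_ge0.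
apply/eqP; rewrite -normr_le0.
apply: (@le_limit R _ _ (L + B * \int[leb]_x `|phi (rowt x)|)); first by rewrite addr_ge0// mulr_ge0.
move=> r r0 r1; rewrite add0r; have [a b] := r2 r r0 r1.
have [Ig Hg] := HL (r ^+ 2) a.
pose g x := \int[leb]_y (cc (rowt y) * mker (r ^+ 2) x (rowt y) * p (v y)).
have gE x : p (d (@nil 'I_n) r x) = g x. rewrite /reg pI addn0; apply: eq_Rintegral => y _.
  by rewrite /c /scaled /psi -!rmorphM pZ.
under eq_Rintegral do rewrite mulrBl.
rewrite RintegralB//.
have Igu : leb.-integrable setT (fun x => (phi (rowt x) * g (rowt x) - u0 x * phi (rowt x))%:E).
  by have := integrableB measurableT Ig Iu.
have h1 : `|\int[leb]_x (phi (rowt x) * g (rowt x)) - \int[leb]_x (u0 x * phi (rowt x))| <=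
    B * (\int[leb]_x `|phi (rowt x)|) * r.
  rewrite -RintegralB//; apply: le_trans (le_normr_Rintegral measurableT _) _ => //.
  rewrite mulrAC -RintegralZl//; apply: le_Rintegral => //; first exact: integrable_norm.
    by have := integrableZl measurableT (B * r) iphi. move=> x _; rewrite [u0 x * _]mulrC -mulrBr normrM mulrC.
  have [Wx|nW] := ltP `|rowt x - y0| rho1. by rewrite ler_wpM2r// /u0 Wx -gE; exact: HB.
  by rewrite zphi ?normr0 ?mulr0//; exact: lt_le_trans nW.
have h2 : `|\int[leb]_x (phi (rowt x) * g (rowt x)) - \int[leb]_y (p (v y) * phi (rowt y))| <= L * r.
  under [X in _ - X]eq_Rintegral do rewrite mulrC. by apply: le_trans Hg _; rewrite ler_wpM2l// expr2 ler_piMl// ltW.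
move: h1 h2; rewrite mulrDl !ler_norml => /andP[? ?] /andP[? ?].
by apply/andP; split; lra.
Qed.

End local_regularity.

(** The interface between analysis and geometry: only coefficients on R^n, a weakly stable family
    and the estimate remain of the original problem. *)
Theorem local_regularity (R : realType) (n m : nat) (y0 : 'rV[R]_n) (rho : R)
    (alpha : 'I_m -> 'I_n -> 'rV[R]_n -> R[i]) (V : (n.-tuple R -> R[i]) -> Prop) (eps Kc rho1 : R) :
  0 < rho -> (forall j i, test (alpha j i)) -> (forall v, V v -> L2 v) ->
  lie_stable y0 rho alpha V -> 0 < eps -> 0 <= Kc -> subell_est y0 rho alpha eps Kc ->
  0 < rho1 -> rho1 < rho -> forall v, V v ->
  exists u1 u2, [/\ smooth [set x | `|x - y0| < rho1] u1, smooth [set x | `|x - y0| < rho1] u2 &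
    {ae leb R n, forall s, `|rowt s - y0| < rho1 -> v s = u1 (rowt s) +i* u2 (rowt s)}].
Proof.
move=> rho0 ta VL2 Vl e0 K0 sub r10 r1r v Vv.
have [[iv1 iv2] _] := VL2 v Vv.
have [|||||||u1 [s1 a1]] := part_regular rho0 ta VL2 Vl e0 K0 sub r10 r1r Vv (p := @complex.Re R).
- exact: ncRe.
- by move=> a b; rewrite ReD ReN.
- exact: RecZ.
- by [].
- by move=> f [].
- by [].
- by [].
have [|||||||u2 [s2 a2]] := part_regular rho0 ta VL2 Vl e0 K0 sub r10 r1r Vv (p := @complex.Im R).
- exact: ncIm.
- by move=> a b; rewrite ImD ImN.
- exact: ImcZ.
- by [].
- by move=> f [].
- by [].
- by [].
exists u1, u2; split=> //; apply: filterS2 a1 a2 => s h1 h2 hs.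
by rewrite -h1// -h2//; case: (v s).
Qed.

(** * Manifolds *)
Section weighted_transfer.
Context d1 d2 (X1 : measurableType d1) (X2 : measurableType d2) (R : realType).
Variables (mu : {measure set X1 -> \bar R}) (nu : {measure set X2 -> \bar R}).
Variables (phi : X2 -> X1) (mphi : mfunT phi) (w : X2 -> R) (mw : mfunT w).
Hypothesis w0 : forall x, 0 <= w x.
Variable B : set X1.
Hypothesis mB : measurable B.
Hypothesis muE : forall A, measurable A -> A `<=` B -> mu A = (\int[nu]_(x in phi @^-1` A) (w x)%:E)%E.

Import HBNNSimple.

Let mpre A : measurable A -> measurable (phi @^-1` A).
Proof. by move=> mA; rewrite -[_ @^-1` _]setTI; exact: mphi. Qed.

(** On [B] the measure [mu] is the image of the weighted measure w nu; simple functions and monotone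
    convergence carry this over to integrals. *)
Lemma ge0_weighted_transfer (f : X1 -> \bar R) : measurable_fun B f -> (forall x, B x -> 0 <= f x)%E ->
  (\int[mu]_(x in B) f x = \int[nu]_(x in phi @^-1` B) (f (phi x) * (w x)%:E))%E.
Proof.
move=> mf f0; have mP := mpre mB; have mwP : measurable_fun (phi @^-1` B) w by exact: measurable_funTS.
pose f_ := nnsfun_approx mB mf.
have mfn n : measurable_fun (phi @^-1` B) (fun x => f_ n (phi x)).
  by apply: measurable_funTS; apply: mcompT mphi.
transitivity (limn (fun n => \int[mu]_(x in B) (f_ n x)%:E))%E. rewrite -monotone_convergence//.
  - apply: eq_integral => y /[!inE] yD; apply/esym/cvg_lim => //. exact: cvg_nnsfun_approx.
  - by move=> n; exact/mEFinP/measurable_funP.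
  - by move=> n y _; rewrite lee_fin.
  - by move=> y _ m n mn; rewrite lee_fin; exact/lefP/nd_nnsfun_approx.
rewrite [X in limn X](_ : _ = (fun n => \int[nu]_(x in phi @^-1` B) (f_ n (phi x) * w x)%:E)%E).
  rewrite -monotone_convergence//; last 3 first.
    - by move=> n /=; apply/mEFinP; exact: mfunM.
    - by move=> n x _ /=; rewrite lee_fin mulr_ge0.
    - by move=> x _ m n mn; rewrite lee_fin ler_wpM2r//; exact/lefP/nd_nnsfun_approx.
  apply: eq_integral => x /[!inE] Px; apply/cvg_lim => //. under eq_fun do rewrite EFinM; apply: cvgeZr => //.
  exact: cvg_nnsfun_approx.
apply/funext => n.
transitivity (\sum_(k \in range (f_ n)) \int[nu]_(x in phi @^-1` B) (k * \1_(f_ n @^-1` [set k]) (phi x) * w x)%:E)%E.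
  under eq_integral do rewrite fimfunE -fsumEFin//. rewrite ge0_integral_fsum//; last 2 first.
  - by move=> y; exact/mEFinP/mfunM.
  - by move=> y x _; rewrite nnfun_muleindic_ge0. apply: eq_fsbigr => r _. have [r0|r0] := ltP r 0.
    rewrite preimage_nnfun0//. by rewrite !integral0_eq// => x _; rewrite indicE in_set0 mulr0 ?mul0r.
  have mE : measurable (f_ n @^-1` [set r]) by [].
  rewrite integralZl_indic_nnsfun// integral_indic// muE//; last exact: measurableI.
  under [RHS]eq_integral do rewrite -mulrA EFinM. rewrite ge0_integralZl_EFin//; last 2 first.
  - by move=> x _; rewrite lee_fin mulr_ge0.
  - apply/mEFinP; apply: mfunM => //; apply: measurable_funTS.
    by apply: mcompT mphi; exact: measurable_indic.
  congr (_ * _)%E; rewrite preimage_setI setIC integral_mkcondr. apply: eq_integral => x _; rewrite patchE indicE.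
  have -> : (phi x \in f_ n @^-1` [set r]) = (x \in phi @^-1` (f_ n @^-1` [set r])) by apply/idP/idP; rewrite !inE.
  by case: (x \in _); rewrite ?mul1r ?mul0r.
rewrite -ge0_integral_fsum//.
- by apply: eq_integral => x _; rewrite fsumEFin// -mulr_fsuml -fimfunE.
- move=> r; apply/mEFinP; apply: mfunM => //; apply: mfunM => //; apply: measurable_funTS.
  by apply: mcompT mphi; exact: measurable_indic.
- move=> r x _; rewrite EFinM mule_ge0 ?lee_fin//. by have := nnfun_muleindic_ge0 (f_ n) r (phi x).
Qed.

Lemma weighted_transfer (f : X1 -> R) : measurable_fun B f ->
  \int[mu]_(x in B) f x = \int[nu]_(x in phi @^-1` B) (f (phi x) * w x).
Proof.
move=> mf; rewrite /Rintegral; congr fine; rewrite [LHS]integralE [RHS]integralE.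
have mfe : measurable_fun B (EFin \o f) by exact/mEFinP.
rewrite (ge0_weighted_transfer (measurable_funepos mfe) (fun x _ => funepos_ge0 _ _)).
rewrite (ge0_weighted_transfer (measurable_funeneg mfe) (fun x _ => funeneg_ge0 _ _)).
have H (a b : R) : 0 <= b -> (maxe a%:E 0 * b%:E = maxe (a * b)%:E 0)%E.
  by move=> b0; rewrite -!EFin_max -EFinM maxr_pMl// mul0r.
congr (_ - _)%E; apply: eq_integral => x _; rewrite ?funeposE ?funenegE/= -?EFinN H//.
by rewrite mulNr.
Qed.

End weighted_transfer.

(** * Smooth functions on the manifold *)

Section smooth_functions.
Context (R : realType) (n : nat) (M : manifold R n).
Notation X := 'rV[R]_n.
Notation C := R[i].
Implicit Types (W O : set M) (f g : M -> R).

Lemma open_chart_image (c : chart R M n) O : open O -> open (cmap c @` (cdom c `&` O)).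
Proof.
move=> oO; rewrite openE => y [x [cx Ox] <-].
have h1 : nbhs (cmap c x) (cmap c @` cdom c) by apply: open_nbhs_nbhs; split; [exact: cim_open|exists x].
have h2 : nbhs (cmap c x) (cinv c @^-1` O). apply: (@cinv_continuous _ _ _ c); first by exists x.
  by rewrite cmapK//; exact: open_nbhs_nbhs.
by apply: filterS2 h1 h2 => z [x' cx' <-]; rewrite /= cmapK// => Ox'; exists x'.
Qed.

Lemma smooth_on_sub W O f : O `<=` W -> smooth_on W f -> smooth_on O f.
Proof.
by move=> OW sf c ac; apply: smooth_sub (sf c ac) => y [x [cx Ox] <-]; exists x => //; split=> //; exact: OW.
Qed.

Lemma smooth_on_local W f : (forall x, W x -> exists O, [/\ open O, O x & smooth_on O f]) -> smooth_on W f.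
Proof.
move=> H c ac; apply: smooth_local => y [x [cx Wx] <-]; have [N [hN Nx sN]] := H x Wx.
by exists (cmap c @` (cdom c `&` N)); [exists x|exact: sN].
Qed.

Lemma smooth_on_ext W f g : open W -> (forall x, W x -> f x = g x) -> smooth_on W f -> smooth_on W g.
Proof.
move=> oW fg sf c ac; apply: smooth_ext (sf c ac); first exact: open_chart_image.
by move=> y; rewrite inE => -[x [cx Wx] <-]; rewrite /= cmapK// fg.
Qed.

(** One chart suffices, since any other one differs from it by a smooth change of coordinates. *)
Lemma smooth_on_chart (c : chart R M n) O f : atlas c -> open O -> O `<=` cdom c ->
  smooth (cmap c @` O) (fun y => f (cinv c y)) -> smooth_on O f.
Proof.
move=> ac oO Oc sf c' ac'; have oO' := open_chart_image (c := c') oO.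
have O'E : cmap c @` O = cmap c @` (cdom c `&` O).
  by apply/seteqP; split=> y [x]; [move=> Ox <-; exists x => //; split => //; exact: Oc|move=> [_ Ox] <-; exists x].
apply: (@smooth_ext _ _ _ (fun y => f (cinv c (cmap c (cinv c' y))))) => //.
  by move=> y; rewrite inE => -[x [c'x Ox] <-]; rewrite /= !cmapK//; exact: Oc.
move=> k; apply: (@Ck_comp _ _ _ k _ (cmap c @` O) (fun y => cmap c (cinv c' y)) (fun y => f (cinv c y))) => //.
- by rewrite O'E; exact: open_chart_image.
- by move=> y [x [c'x Ox] <-]; rewrite cmapK//; exists x.
- move=> j; apply: Ck_sub (atlas_compatible ac' ac j k) => y [x [c'x Ox] <-]. by exists x => //; split => //; exact: Oc.
Qed.

Lemma smooth_on_cst W (a : R) : smooth_on W (fun=> a).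
Proof. by move=> c ac; exact: smooth_cst. Qed.
Lemma smooth_onD W f g : open W -> smooth_on W f -> smooth_on W g -> smooth_on W (fun x => f x + g x).
Proof. by move=> oW sf sg c ac; apply: smoothD; [exact: open_chart_image|exact: sf|exact: sg]. Qed.
Lemma smooth_onM W f g : open W -> smooth_on W f -> smooth_on W g -> smooth_on W (fun x => f x * g x).
Proof. by move=> oW sf sg c ac; apply: smoothM; [exact: open_chart_image|exact: sf|exact: sg]. Qed.
Lemma smooth_onN W f : open W -> smooth_on W f -> smooth_on W (fun x => - f x).
Proof. by move=> oW sf c ac; apply: smoothN; [exact: open_chart_image|exact: sf]. Qed.

Implicit Types (F G : M -> C).

Lemma csm_on_sub W O F : O `<=` W -> csmooth_on W F -> csmooth_on O F.
Proof. by move=> OW [s1 s2]; split; exact: smooth_on_sub OW _. Qed.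
Lemma csm_on_local W F : (forall x, W x -> exists O, [/\ open O, O x & csmooth_on O F]) -> csmooth_on W F.
Proof. by move=> H; split; apply: smooth_on_local => x /H[N [hN Nx [s1 s2]]]; exists N. Qed.
Lemma csm_on_ext W F G : open W -> (forall x, W x -> F x = G x) -> csmooth_on W F -> csmooth_on W G.
Proof. by move=> oW FG [s1 s2]; split; [apply: smooth_on_ext s1|apply: smooth_on_ext s2] => // x Wx; rewrite FG. Qed.
Lemma csm_on_cst W (a : C) : csmooth_on W (fun=> a).
Proof. by split; exact: smooth_on_cst. Qed.
Lemma csmooth_onD W F G : open W -> csmooth_on W F -> csmooth_on W G -> csmooth_on W (fun x => F x + G x).
Proof.
move=> oW [f1 f2] [g1 g2]; split. by apply: (smooth_on_ext oW _ (smooth_onD oW f1 g1)) => x _; rewrite ReD.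
by apply: (smooth_on_ext oW _ (smooth_onD oW f2 g2)) => x _; rewrite ImD.
Qed.
Lemma csmooth_onM W F G : open W -> csmooth_on W F -> csmooth_on W G -> csmooth_on W (fun x => F x * G x).
Proof.
move=> oW [f1 f2] [g1 g2]; split.
  apply: (smooth_on_ext oW _ (smooth_onD oW (smooth_onM oW f1 g1) (smooth_onN oW (smooth_onM oW f2 g2)))) => x _.
  by rewrite RecM.
by apply: (smooth_on_ext oW _ (smooth_onD oW (smooth_onM oW f1 g2) (smooth_onM oW f2 g1))) => x _; rewrite ImcM.
Qed.
Lemma csm_on_conj W F : open W -> csmooth_on W F -> csmooth_on W (fun x => (F x)^*%C).
Proof.
move=> oW [f1 f2]; split. by apply: (smooth_on_ext oW _ f1) => x _; case: (F x).
by apply: (smooth_on_ext oW _ (smooth_onN oW f2)) => x _; case: (F x).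
Qed.
Lemma csm_on_sum W (I : Type) (r : seq I) (F : I -> M -> C) : open W -> (forall i, csmooth_on W (F i)) ->
  csmooth_on W (fun x => \sum_(i <- r) F i x).
Proof.
move=> oW H; elim: r => [|i r IH]. by apply: (csm_on_ext oW _ (csm_on_cst W 0)) => x _; rewrite big_nil.
by apply: (csm_on_ext oW _ (csmooth_onD oW (H i) IH)) => x _; rewrite big_cons.
Qed.

Lemma compact_chart_ball (c : chart R M n) (y : X) (r : R) :
  [set z | `|z - y| <= r] `<=` cmap c @` cdom c -> compact (cinv c @` [set z | `|z - y| <= r]).
Proof.
move=> H; apply: continuous_compact; last exact: compact_norm_le.
by apply: continuous_in_subspaceT => z; rewrite inE => /H; exact: cinv_continuous.
Qed.

Lemma open_far (c : chart R M n) (y : X) (r : R) :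
  [set z | `|z - y| <= r] `<=` cmap c @` cdom c -> open (~` (cinv c @` [set z | `|z - y| <= r])).
Proof.
move=> H; apply: closed_openC; apply: compact_closed; first exact: manifold_hausdorff.
exact: compact_chart_ball.
Qed.

Definition transplant (c : chart R M n) (phi : X -> C) (x : M) : C := if `[< cdom c x >] then phi (cmap c x) else 0.

Lemma transplantE (c : chart R M n) phi x : cdom c x -> transplant c phi x = phi (cmap c x).
Proof. by move=> cx; rewrite /transplant asboolT. Qed.

Lemma transplant_far (c : chart R M n) phi y r x : suppC y r phi ->
  ~ (cinv c @` [set z | `|z - y| <= r]) x -> transplant c phi x = 0.
Proof.
move=> zphi nx; rewrite /transplant; case: asboolP => // cx; apply: zphi.
by rewrite ltNge; apply/negP => h; apply: nx; exists (cmap c x) => //; exact: cmapK.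
Qed.

Lemma csm_on_chart (c : chart R M n) O (phi : X -> C) F : atlas c -> open O -> O `<=` cdom c -> smoothC phi ->
  (forall x, O x -> F x = phi (cmap c x)) -> csmooth_on O F.
Proof.
move=> ac oO Oc [s1 s2] E; have oO' : open (cmap c @` O).
  by have := open_chart_image (c := c) oO; rewrite (_ : cdom c `&` O = O)//; apply/seteqP; split=> x; [case|split => //; exact: Oc].
have E' y : y \in cmap c @` O -> F (cinv c y) = phi y. by rewrite inE => -[x Ox <-]; rewrite cmapK ?E//; exact: Oc.
split; apply: (smooth_on_chart ac oO Oc). by apply: (smooth_ext oO' _ (smooth_sub (@subsetT _ _) s1)) => y /E' ->.
by apply: (smooth_ext oO' _ (smooth_sub (@subsetT _ _) s2)) => y /E' ->.
Qed.

(** The chart domain and the complement of the coordinate ball cover M; this complement is open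
    because the ball is compact and M is Hausdorff. *)
Lemma csm_transplant (c : chart R M n) phi y r : atlas c -> smoothC phi -> suppC y r phi ->
  [set z | `|z - y| <= r] `<=` cmap c @` cdom c -> csmooth (transplant c phi).
Proof.
move=> ac sphi zphi H; apply: csm_on_local => x _.
have [cx|ncx] := pselect (cdom c x). exists (cdom c); split=> //; first exact: cdom_open.
  by apply: (csm_on_chart ac (cdom_open c) (@subset_refl _ _) sphi) => z; exact: transplantE.
exists (~` (cinv c @` [set z | `|z - y| <= r])); split; first exact: open_far.
  by move=> [z /H[x' cx' <-]]; rewrite cmapK// => xx; apply: ncx; rewrite -xx.
apply: (csm_on_ext (open_far H) _ (csm_on_cst _ 0)) => z nz.
by rewrite (transplant_far zphi nz).
Qed.

Lemma csm_on_coord (c : chart R M n) O F : atlas c -> open O -> O `<=` cdom c -> csmooth_on O F ->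
  smooth (cmap c @` O) (fun y => complex.Re (F (cinv c y))) /\
  smooth (cmap c @` O) (fun y => complex.Im (F (cinv c y))).
Proof.
move=> ac oO Oc [s1 s2]; have E : cdom c `&` O = O by apply/seteqP; split=> x; [case|split => //; exact: Oc].
by have := s1 c ac; have := s2 c ac; rewrite E.
Qed.

End smooth_functions.

(** Every matrix on the segment from the identity to G is positive definite, so the determinant, a
    polynomial in s, has no root on [0, 1] and keeps the sign that it has at the identity. *)
Lemma posdef_det_gt0 (R : realType) n (G : 'M[R]_n) :
  (forall v : 'rV[R]_n, v != 0 -> 0 < (v *m G *m v^T) 0 0) -> 0 < \det G.
Proof.
move=> posG.
pose A : 'M[{poly R}]_n := (1 - 'X)%:M + 'X *: map_mx polyC G; pose p := \det A.
have AE s : map_mx (horner_eval s) A = (1 - s)%:M + s *: G.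
  by apply/matrixP => i j; rewrite !mxE /horner_eval !hornerE hornerMn !hornerE.
have pE s : p.[s] = \det ((1 - s)%:M + s *: G) by rewrite -AE det_map_mx.
have nz s : 0 <= s <= 1 -> p.[s] != 0. move=> /andP[s0 s1]; rewrite pE; apply/det0P => -[v v0 vE].
  have := congr1 (fun z => (z *m v^T) 0 0) vE; rewrite mul0mx [RHS]mxE mulmxDr mulmxDl mxE.
  rewrite mul_mx_scalar -scalemxAr -!scalemxAl [X in X + _]mxE [X in _ + X]mxE => E. have vv : 0 < (v *m v^T) 0 0.
    rewrite mxE; have [i vi] : exists i, v 0 i != 0 by apply/rV0Pn.
    rewrite (bigD1 i)//= mxE -expr2 ltr_pwDl//; first by rewrite exprn_even_gt0.
    by apply: sumr_ge0 => j _; rewrite mxE -expr2 sqr_ge0.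
  have gv := posG v v0; move: E vv gv; move: (_ 0 0) (_ 0 0) => b a E a0 b0.
  have h1 : 0 <= (1 - s) * a by rewrite mulr_ge0 ?subr_ge0// ltW. have h2 : 0 <= s * b by rewrite mulr_ge0// ltW.
  have [s5|s5] := leP s 2^-1. have : 0 < (1 - s) * a by rewrite mulr_gt0//; lra. lra.
  have : 0 < s * b by rewrite mulr_gt0//; lra. lra.
rewrite ltNge; apply/negP => dG.
have [|s s01 /eqP root_s] := @poly_ivt R (- p) 0 1 ler01; last first.
  by have := nz s s01; rewrite -oppr_eq0 -hornerN root_s eqxx.
by rewrite !hornerN !pE subrr scale1r scale0r addr0 subr0 det1 oppr_ge0 oppr_le0 ler01 raddf0 add0r.
Qed.

(** * Change of coordinates for derivatives and vector fields *)

Section chain_rule.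
Context (R : realType) (n : nat) (M : manifold R n).
Notation X := 'rV[R]_n.
Notation C := R[i].

Lemma cmap_open_image (c : chart R M n) (O : set M) : open O -> O `<=` cdom c -> open (cmap c @` O).
Proof.
move=> oO Oc; have := open_chart_image (c := c) oO.
by rewrite (_ : cdom c `&` O = O)//; apply/seteqP; split=> x; [case|split => //; exact: Oc].
Qed.

Lemma jacE (c c' : chart R M n) x i j : atlas c -> atlas c' -> cdom c x -> cdom c' x ->
  jac c c' x i j = partial i (fun y => cmap c' (cinv c y) 0 j) (cmap c x).
Proof.
move=> ac ac' cx c'x; set U := cmap c @` (cdom c `&` cdom c').
have oU : open U by apply: open_chart_image; exact: cdom_open.
have Ux : U (cmap c x) by exists x.
have d k : differentiable (fun y => cmap c' (cinv c y) 0 k : R) (cmap c x).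
  by have [] := C1_diff oU (atlas_compatible ac ac' k 1%N) Ux.
have dF : differentiable (cmap c' \o cinv c) (cmap c x) by exact: differentiable_row.
rewrite /jac /jacobian !mxE -deriveE// derive_mx ?mxE//.
exact: diff_derivable.
Qed.

Lemma partial_chart (c c' : chart R M n) (O : set M) (f : M -> R) x l : atlas c -> atlas c' ->
  cdom c x -> cdom c' x -> open O -> O x -> smooth_on O f -> partial l (fun y => f (cinv c' y)) (cmap c' x) =
  \sum_i jac c' c x l i * partial i (fun y => f (cinv c y)) (cmap c x).
Proof.
move=> ac ac' cx c'x oO Ox sf.
pose W := cdom c `&` O; have oW : open W by apply: openI => //; exact: cdom_open.
pose U := cmap c' @` (cdom c' `&` W); pose V := cmap c @` W.
have oU : open U by exact: open_chart_image.
have oV : open V by apply: cmap_open_image => // z [].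
have Ux : U (cmap c' x) by exists x.
have -> : partial l (fun y => f (cinv c' y)) (cmap c' x) =
    partial l (fun y => f (cinv c (cmap c (cinv c' y)))) (cmap c' x).
  apply: near_eq_derive; apply: (near_open oU _ Ux) => y; rewrite inE => -[z [c'z [cz Oz]] <-]. by rewrite !cmapK.
have E1 : cmap c (cinv c' (cmap c' x)) = cmap c x by rewrite cmapK.
have [] := @partial_comp _ _ _ U V (fun y => cmap c (cinv c' y)) (fun y => f (cinv c y)) (cmap c' x) l oU oV Ux.
- by rewrite E1; exists x.
- move=> j; apply: Ck_sub (atlas_compatible ac' ac j 1%N) => y [z [c'z [cz Oz]] <-]; exists z => //.
- exact: sf c ac 1%N.
- move=> _ ->; rewrite E1; apply: eq_bigr => i _. by rewrite (jacE l i ac' ac c'x cx) mulrC.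
Qed.

Lemma jac_mul (c c' : chart R M n) x : atlas c -> atlas c' -> cdom c x -> cdom c' x -> jac c c' x *m jac c' c x = 1%:M.
Proof.
move=> ac ac' cx c'x; apply/matrixP => l j; rewrite !mxE.
have sc : smooth_on (cdom c) (fun z => cmap c z 0 j). apply: (smooth_on_chart ac (cdom_open c) (@subset_refl _ _)).
  apply: (@smooth_ext _ _ _ (fun y => y 0 j)); [|by move=> y; rewrite inE => -[z cz <-]; rewrite cmapK|exact: smooth_coord].
  by apply: cmap_open_image => //; exact: cdom_open.
have := partial_chart l ac' ac c'x cx (cdom_open c) cx sc.
rewrite (_ : partial l _ _ = (l == j)%:R); last first.
  have [_ <-] := is_derive_coord l j (cmap c x); apply: near_eq_derive.
  apply: (near_open (cmap_open_image (cdom_open c) (@subset_refl _ _))); last by exists x.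
  by move=> y; rewrite inE => -[z cz <-]; rewrite cmapK.
move=> E; apply: etrans (esym E); apply: eq_bigr => i _; congr (_ * _); exact: (jacE i j ac' ac c'x cx).
Qed.

(** The determinant in any chart is that of [g] times the square of a nonzero Jacobian. *)
Lemma metric_det_gt0 (g : M -> 'M[R]_n) (c : chart R M n) x : is_riemannian_metric g -> atlas c -> cdom c x ->
  0 < \det (metric_in c g x).
Proof.
move=> [_ gpos _] ac cx; rewrite /metric_in !det_mulmx det_tr mulrAC -expr2 mulr_gt0//.
  rewrite exprn_even_gt0//=; have := jac_mul ac (chart_at_atlas x) cx (chart_at_dom x).
  move: (jac c _ x) (jac _ c x) => J J' /mulmx1_unit[+ _]. by rewrite unitmxE unitfE.
exact: posdef_det_gt0 (gpos x).
Qed.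

Lemma cpartial_chart (c c' : chart R M n) (O : set M) (F : M -> C) x l : atlas c -> atlas c' ->
  cdom c x -> cdom c' x -> open O -> O x -> csmooth_on O F ->
  cpartial c' l F x = \sum_i (jac c' c x l i)%:C * cpart i (fun y => F (cinv c y)) (cmap c x).
Proof.
move=> ac ac' cx c'x oO Ox [s1 s2]; rewrite /cpartial.
rewrite (partial_chart l ac ac' cx c'x oO Ox s1) (partial_chart l ac ac' cx c'x oO Ox s2).
apply/eqP; rewrite eq_complex /= Rec_sum Imc_sum; apply/andP; split; apply/eqP; apply: eq_bigr => i _. by rewrite RecZ.
by rewrite ImcZ.
Qed.

(** The definition of [vf_apply] uses the chart chosen at each point, which may jump with x; in a
    fixed chart the components of a smooth field are smooth. *)
Lemma vf_applyE (c : chart R M n) (O : set M) (Z : cvfield M) (F : M -> C) x : atlas c ->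
  cdom c x -> open O -> O x -> csmooth_on O F ->
  vf_apply Z F x = \sum_i components c Z x 0 i * cpart i (fun y => F (cinv c y)) (cmap c x).
Proof.
move=> ac cx oO Ox sF; rewrite /vf_apply.
under eq_bigr => i _ do rewrite (cpartial_chart i ac (chart_at_atlas x) cx (chart_at_dom x) oO Ox sF) mulr_sumr.
rewrite exchange_big /=; apply: eq_bigr => i _; rewrite /components mxE mulr_suml.
by apply: eq_bigr => l _; rewrite !mxE mulrA.
Qed.

Lemma components_re (c : chart R M n) (Z : cvfield M) x j :
  components c (fun x => map_mx (real_complex R) (re_vfield Z x)) x 0 j = (complex.Re (components c Z x 0 j))%:C.
Proof.
rewrite /components !mxE Rec_sum rmorph_sum; apply: eq_bigr => i _.
by rewrite !mxE /= mulrC RecM/= mulr0 subr0 -rmorphM /= mulrC.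
Qed.

Lemma components_im (c : chart R M n) (Z : cvfield M) x j :
  components c (fun x => map_mx (real_complex R) (im_vfield Z x)) x 0 j = (complex.Im (components c Z x 0 j))%:C.
Proof.
rewrite /components !mxE Imc_sum rmorph_sum; apply: eq_bigr => i _.
by rewrite !mxE /= ImcM/= mulr0 add0r -rmorphM /=.
Qed.

Lemma smooth_re_vfield (Z : cvfield M) : smooth_cvfield Z -> smooth_rvfield (re_vfield Z).
Proof.
move=> sZ c ac j; have [s1 s2] := sZ c ac j; split.
  by apply: (smooth_on_ext (cdom_open c) _ s1) => x _; rewrite components_re.
by apply: (smooth_on_ext (cdom_open c) _ (smooth_on_cst _ 0)) => x _; rewrite components_re.
Qed.

Lemma smooth_im_vfield (Z : cvfield M) : smooth_cvfield Z -> smooth_rvfield (im_vfield Z).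
Proof.
move=> sZ c ac j; have [s1 s2] := sZ c ac j; split.
  by apply: (smooth_on_ext (cdom_open c) _ s2) => x _; rewrite components_im.
by apply: (smooth_on_ext (cdom_open c) _ (smooth_on_cst _ 0)) => x _; rewrite components_im.
Qed.

Lemma vf_apply_re_im (Z : cvfield M) F x :
  vf_apply Z F x = vf_apply (fun y => map_mx (real_complex R) (re_vfield Z y)) F x +
    (0 +i* 1) * vf_apply (fun y => map_mx (real_complex R) (im_vfield Z y)) F x.
Proof.
rewrite /vf_apply mulr_sumr -big_split /=; apply: eq_bigr => i _; rewrite !mxE mulrA -mulrDl.
by congr (_ * _); case: (Z x 0 i) => a b; apply/eqP; rewrite eq_complex /=; apply/andP; split; apply/eqP; ring.
Qed.

End chain_rule.

(** * Sections of the bundle in a frame *)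

Section bundle.
Context (R : realType) (n : nat) (M : manifold R n) (r : nat) (E : vbundle M r).
Notation X := 'rV[R]_n.
Notation C := R[i].
Implicit Types (t : trivialization r E) (s : section E).

Lemma tfwdD t x (u v : E x) : tdom t x -> tfwd t (u + v) = tfwd t u + tfwd t v.
Proof. by move=> tx; have := tfwd_linear tx 1 u v; rewrite !scale1r. Qed.
Lemma tfwd0 t x : tdom t x -> tfwd t (0 : E x) = 0.
Proof. by move=> tx; have := tfwdD (0 : E x) 0 tx; rewrite addr0 => /esym/eqP; rewrite addrC -subr_eq0 addrK => /eqP. Qed.
Lemma tfwdZ t x (a : C) (u : E x) : tdom t x -> tfwd t (a *: u) = a *: tfwd t u.
Proof. by move=> tx; have := tfwd_linear tx a u 0; rewrite !addr0 tfwd0// addr0. Qed.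
Lemma tfwd_sum t x (I : Type) (q : seq I) (F : I -> E x) : tdom t x ->
  tfwd t (\sum_(i <- q) F i) = \sum_(i <- q) tfwd t (F i).
Proof.
by move=> tx; elim: q => [|i q IH]; rewrite ?big_nil ?tfwd0// !big_cons tfwdD// IH.
Qed.

Definition frame t a (x : M) : E x := tbwd t x (delta_mx 0 a).

Lemma frame_decomp t x (u : E x) : tdom t x -> u = \sum_a tfwd t u 0 a *: frame t a x.
Proof.
move=> tx; apply: (can_inj (tfwdK tx)); rewrite tfwd_sum// [LHS]row_sum_delta.
by apply: eq_bigr => a _; rewrite tfwdZ// /frame tbwdK.
Qed.

Lemma tbwdE t x (w : 'rV[C]_r) : tdom t x -> tbwd t x w = \sum_a w 0 a *: frame t a x.
Proof. by move=> tx; rewrite [LHS](frame_decomp _ tx); apply: eq_bigr => a _; rewrite tbwdK. Qed.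

Lemma smooth_sectionD s1 s2 : smooth_section s1 -> smooth_section s2 -> smooth_section (fun x => s1 x + s2 x).
Proof.
move=> h1 h2 t tt j; apply: (csm_on_ext (tdom_open t) _ (csmooth_onD (tdom_open t) (h1 t tt j) (h2 t tt j))).
by move=> x tx; rewrite tfwdD// mxE.
Qed.

Lemma smooth_sectionZ (f : M -> C) s : csmooth f -> smooth_section s -> smooth_section (fun x => f x *: s x).
Proof.
move=> sf hs t tt j; have sf' := csm_on_sub (@subsetT _ (tdom t)) sf.
apply: (csm_on_ext (tdom_open t) _ (csmooth_onM (tdom_open t) sf' (hs t tt j))).
by move=> x tx; rewrite tfwdZ// mxE.
Qed.

Lemma smooth_cnabla (nabla : connection E) Z s : is_connection nabla -> smooth_cvfield Z -> smooth_section s ->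
  smooth_section (cnabla nabla Z s).
Proof.
move=> [h1 _ _ _ _] sZ ss; apply: smooth_sectionD; first by apply: h1 => //; exact: smooth_re_vfield.
apply: (@smooth_sectionZ (fun=> 0 +i* 1)); first exact: csm_on_cst.
by apply: h1 => //; exact: smooth_im_vfield.
Qed.

Lemma cnabla_leibniz (nabla : connection E) Z (f : M -> C) s x : is_connection nabla -> smooth_cvfield Z ->
  csmooth f -> smooth_section s ->
  cnabla nabla Z (fun y => f y *: s y) x = vf_apply Z f x *: s x + f x *: cnabla nabla Z s x.
Proof.
move=> [_ _ _ _ h] sZ sf ss; rewrite /cnabla (h _ _ _ (smooth_re_vfield sZ) sf ss) (h _ _ _ (smooth_im_vfield sZ) sf ss).
rewrite [vf_apply Z f x]vf_apply_re_im scalerDl !scalerDr !scalerA [f x * (0 +i* 1)]mulrC.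
by rewrite addrACA.
Qed.

Variables (c : chart R M n) (t : trivialization r E).
Hypotheses (ac : atlas c) (tt : trivs t).
Let D := cdom c `&` tdom t.
Let oD : open D. Proof. by apply: openI; [exact: cdom_open|exact: tdom_open]. Qed.

Definition section_of (phi : 'I_r -> X -> C) : section E := fun x =>
  if `[< D x >] then tbwd t x (\row_a phi a (cmap c x)) else 0.

Lemma section_ofE phi x : D x -> tfwd t (section_of phi x) = \row_a phi a (cmap c x).
Proof. by move=> Dx; rewrite /section_of asboolT// tbwdK//; case: Dx. Qed.

Lemma section_of_far phi y rho x : (forall a, suppC y rho (phi a)) ->
  ~ (cinv c @` [set z | `|z - y| <= rho]) x -> section_of phi x = 0.
Proof.
move=> zphi nx; rewrite /section_of; case: asboolP => // -[cx tx].
rewrite (_ : \row_a _ = 0); last first. apply/rowP => a; rewrite !mxE; apply: zphi; rewrite ltNge; apply/negP => h.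
  by apply: nx; exists (cmap c x) => //; exact: cmapK.
by rewrite tbwdE// big1// => a _; rewrite mxE scale0r.
Qed.

Lemma smooth_section_of phi y rho : (forall a, smoothC (phi a)) -> (forall a, suppC y rho (phi a)) ->
  [set z | `|z - y| <= rho] `<=` cmap c @` D -> smooth_section (section_of phi).
Proof.
move=> sphi zphi H t' tt' j.
have H' : [set z | `|z - y| <= rho] `<=` cmap c @` cdom c by move=> z /H[x [cx _] <-]; exists x.
apply: csm_on_local => x t'x.
have [Dx|nDx] := pselect (D x). exists (D `&` tdom t'); split=> //; first by apply: openI => //; exact: tdom_open.
  have oW : open (D `&` tdom t') by apply: openI => //; exact: tdom_open.
  have Wc : D `&` tdom t' `<=` cdom c by move=> z [[]].
  have sP a : csmooth_on (D `&` tdom t') (fun z => phi a (cmap c z)). by apply: (csm_on_chart ac oW Wc (sphi a)).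
  have sT a : csmooth_on (D `&` tdom t') (fun z => tfwd t' (frame t a z) 0 j).
    by apply: csm_on_sub (trivs_compatible tt tt' a j) => z [[_ ?] ?].
  apply: (csm_on_ext oW _ (csm_on_sum (index_enum 'I_r) oW (fun a => csmooth_onM oW (sP a) (sT a)))).
  move=> z [Dz t'z]; rewrite /section_of asboolT// tbwdE; last by case: Dz.
  by rewrite tfwd_sum// summxE; apply: eq_bigr => a _; rewrite tfwdZ// !mxE.
exists (~` (cinv c @` [set z | `|z - y| <= rho]) `&` tdom t'); split.
- by apply: openI; [exact: open_far|exact: tdom_open].
- split=> // -[z /H[x' Dx' <-]]; rewrite cmapK; last by case: Dx'. by move=> xx; apply: nDx; rewrite -xx.
have oW : open (~` (cinv c @` [set z | `|z - y| <= rho]) `&` tdom t').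
  by apply: openI; [exact: open_far|exact: tdom_open].
apply: (csm_on_ext oW _ (csm_on_cst _ 0)) => z [nz t'z].
by rewrite (section_of_far zphi nz) tfwd0// mxE.
Qed.

End bundle.

(** * First order systems *)
Section first_order_systems.
Context (R : realType) (n : nat).
Notation X := 'rV[R]_n.
Notation T := (n.-tuple R).
Notation leb := (leb R n).
Notation C := R[i].

(** Transpose of the field with coefficients [a] for Lebesgue measure, without conjugation. *)
Definition lie_adj (a : 'I_n -> X -> C) (phi : X -> C) (x : X) : C :=
  - \sum_i cpart i (fun x => a i x * phi x) x.

(** Leibniz rule read backwards: a multiplier [A] of the unknown is absorbed into the test
    function. *)
Lemma lie_adjM a phi A x : (forall i, smoothC (a i)) -> smoothC phi -> smoothC A ->
  lie_adj a phi x * A x = lie_adj a (fun x => phi x * A x) x + phi x * lieD a A x.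
Proof.
move=> sa sp sA; rewrite /lie_adj /lieD mulNr mulr_suml mulr_sumr -!sumrN -big_split /=.
apply: eq_bigr => i _.
rewrite (_ : (fun x => a i x * (phi x * A x)) = fun x => (a i x * phi x) * A x); last first.
  by apply/funext => z; rewrite mulrA.
rewrite [cpart i (fun x => a i x * phi x * A x) x]cpartM//; last exact: smoothCM.
by ring.
Qed.

Lemma cintegral_cpart i (f : X -> C) : test f -> cintegral leb (fun s => cpart i f (rowt s)) = 0.
Proof.
move=> [[s1 s2] [rr zf]]; rewrite /cintegral /cpart /= /Rintegral.
rewrite (integral_partial i (s1 1%N) (suppC_Re zf)).
by rewrite (integral_partial i (s2 1%N) (suppC_Im zf)).
Qed.

Lemma test_intg (f : X -> C) : test f -> cintg leb (fun s => f (rowt s)).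
Proof.
move=> [sf [rr zf]]; have [c1 c2] := smoothC_cont sf.
by split; [exact: intg_ccont c1 (suppC_Re zf)|exact: intg_ccont c2 (suppC_Im zf)].
Qed.

Lemma lie_adj_integral a phi : (forall i, smoothC (a i)) -> test phi ->
  cintegral leb (fun s => lie_adj a phi (rowt s)) = 0.
Proof.
move=> sa tp; have ti i : test (cpart i (fun x => a i x * phi x)) by apply: test_cpart; exact: testMr.
rewrite (eq_cintegral _ (g := fun s => (-1) * \sum_i cpart i (fun x => a i x * phi x) (rowt s))); last first.
  by move=> s; rewrite mulN1r.
rewrite cintegralZ; last by apply: cintg_sum => i _; exact: test_intg.
rewrite cintegral_sum; last by move=> i _; exact: test_intg.
by rewrite big1 ?mulr0// => i _; apply: cintegral_cpart; exact: testMr.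
Qed.

Lemma test_mul_intg (f : X -> C) q : test f -> cintg leb q -> cintg leb (fun s => f (rowt s) * q s).
Proof.
move=> tf iq; have [B B0 HB] := test_bounded tf.
exact: (op_integrable iq (cmeas_rowt (proj1 tf)) HB).
Qed.

Lemma L2D (v w : T -> C) : L2 v -> L2 w -> L2 (fun s => v s + w s).
Proof.
move=> [iv nv] [iw nw]; have ivw := cintgD iv iw; split=> //.
apply: (@le_integrable _ _ _ _ _ _ _ (fun s => (2 * normsq (v s) + 2 * normsq (w s))%:E)) => //.
- by apply/mEFinP; apply: cmeas_normsq; exact: cintg_meas ivw.
- by move=> s _; rewrite lee_fin ger0_norm ?normsq_ge0// (le_trans (normsqD _ _))// ler_norm.
- have := integrableD measurableT (integrableZl measurableT 2 nv) (integrableZl measurableT 2 nw). by [].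
Qed.

Lemma L2M (f : X -> C) (v : T -> C) : test f -> L2 v -> L2 (fun s => f (rowt s) * v s).
Proof.
move=> tf [iv nv]; have ifv := test_mul_intg tf iv; split=> //.
have [B B0 HB] := test_bounded tf.
apply: (@le_integrable _ _ _ _ _ _ _ (fun s => (B ^+ 2 * normsq (v s))%:E)) => //.
- by apply/mEFinP; apply: cmeas_normsq; exact: cintg_meas ifv.
- move=> s _; rewrite lee_fin ger0_norm ?normsq_ge0// ger0_norm; last by rewrite mulr_ge0 ?sqr_ge0 ?normsq_ge0.
  rewrite normsqM ler_wpM2r ?normsq_ge0//. by rewrite -nc_sqr lerXn2r ?nnegrE ?nc_ge0// ltW.
- by have := integrableZl measurableT (B ^+ 2) nv.
Qed.

Lemma L2_test (f : X -> C) : test f -> L2 (fun s : T => f (rowt s)).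
Proof.
move=> tf; have it := test_intg tf; split=> //; have [B B0 HB] := test_bounded tf.
have := cintg_nc it; move=> /(integrableZl measurableT B) ib.
apply: (@le_integrable _ _ _ _ _ _ _ (fun s => (B * nc (f (rowt s)))%:E)) => //.
- by apply/mEFinP; apply: cmeas_normsq; exact: cintg_meas it.
- move=> s _; rewrite lee_fin !ger0_norm ?normsq_ge0 ?mulr_ge0 ?nc_ge0 ?(ltW B0)// -nc_sqr expr2.
  by rewrite ler_wpM2r ?nc_ge0.
Qed.

Variables (m r : nat) (y0 : X) (rho : R).
Hypothesis rho0 : 0 < rho.
Variable alpha : 'I_m -> 'I_n -> X -> C.
Hypothesis talpha : forall j i, test (alpha j i).
Variables (q : 'I_r -> T -> C) (Gam : 'I_m -> 'I_r -> 'I_r -> X -> C) (F : 'I_m -> 'I_r -> X -> C).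
Hypotheses (qL2 : forall a, L2 (q a)) (tGam : forall j a b, test (Gam j a b)) (tF : forall j a, test (F j a)).
(** Weak form of the equations L_j q_b + sum_a Gam_ab q_a = F_b on the ball. *)
Hypothesis weak : forall j b phi, test_in y0 rho phi ->
  cintegral leb (fun s => lie_adj (alpha j) phi (rowt s) * q b s) =
  cintegral leb (fun s => phi (rowt s) * (F j b (rowt s) - \sum_a Gam j a b (rowt s) * q a s)).
Variables (eps Kc : R).
Hypotheses (eps0 : 0 < eps) (Kc0 : 0 <= Kc).
Hypothesis subell : subell_est y0 rho alpha eps Kc.

(** Stable under the weak action of the L_j because the system expresses L_j q_b through the
    unknowns themselves. *)
Definition generated (v : T -> C) : Prop := exists (A : 'I_r -> X -> C) (f : X -> C),
  [/\ forall a, test (A a), test f & v = fun s => \sum_a A a (rowt s) * q a s + f (rowt s)].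

Lemma generated_L2 v : generated v -> L2 v.
Proof.
move=> [A [f [tA tf ->]]]; apply: L2D; last exact: L2_test.
elim: (index_enum _) => [|a s IH].
  rewrite (_ : (fun s => _) = fun s : T => (fun=> 0 : C) (rowt s)); first exact: (L2_test (@test0 R n)).
  by apply/funext => s; rewrite big_nil.
rewrite (_ : (fun s => _) = fun t : T => A a (rowt t) * q a t + \sum_(i <- s) A i (rowt t) * q i t).
  by apply: L2D => //; exact: L2M.
by apply/funext => t; rewrite big_cons.
Qed.

(** L_j (A q) = (L_j A) q + A L_j q, where the system replaces L_j q. The coefficients of the
    unknowns are collected in [A'] and the rest in [f']; the weak equations are tested on phi
    A_a. *)
Lemma generated_lie v j : generated v -> exists2 v', generated v' & forall phi, test_in y0 rho phi ->
  cintegral leb (fun s => (- \sum_i cpart i (fun x => alpha j i x * phi x) (rowt s)) * v s) =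
  cintegral leb (fun s => phi (rowt s) * v' s).
Proof.
move=> [A [f [tA tf ->]]]; have sal i : smoothC (alpha j i) by have [] := talpha j i.
have sA a : smoothC (A a) by have [] := tA a.
have tlA a : test (lieD (alpha j) (A a)) by exact: (test_lie (talpha j)).
have tlf : test (lieD (alpha j) f) by apply: (test_lie (talpha j)); exact: (proj1 tf).
pose A' b x := lieD (alpha j) (A b) x + (-1) * \sum_a A a x * Gam j b a x.
pose f' x := \sum_a A a x * F j a x + lieD (alpha j) f x.
exists (fun s => \sum_a A' a (rowt s) * q a s + f' (rowt s)). exists A', f'; split=> //.
  - move=> b; apply: testD => //; apply: testMr; first exact: smoothC_cst.
    by apply: test_sum => a _; apply: testM => //; exact: (proj1 (tGam j b a)).
  - by apply: testD => //; apply: test_sum => a _; apply: testM => //; exact: (proj1 (tF j a)).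
move=> phi tphi; have sphi := proj1 tphi; have tp := test_inW tphi.
have iq a : cintg leb (q a) by have [] := qL2 a.
have tpA a : test_in y0 rho (fun x => phi x * A a x) by exact: test_inM.
have tadj psi : test psi -> test (lie_adj (alpha j) psi).
  move=> tpsi; rewrite (_ : lie_adj _ _ = fun x => (-1) * \sum_i cpart i (fun x => alpha j i x * psi x) x).
    apply: testMr; first exact: smoothC_cst. by apply: test_sum => i _; apply: test_cpart; apply: testMr.
  by apply/funext => x; rewrite /lie_adj mulN1r.
pose I1 a s := lie_adj (alpha j) (fun x => phi x * A a x) (rowt s) * q a s.
pose I2 a s := (phi (rowt s) * lieD (alpha j) (A a) (rowt s)) * q a s.
pose J a s := (phi (rowt s) * A a (rowt s)) * (F j a (rowt s) - \sum_b Gam j b a (rowt s) * q b s).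
have h1 a : cintg leb (I1 a) by apply: test_mul_intg => //; apply: tadj; exact: test_inW (tpA a).
have h2 a : cintg leb (I2 a).
  by apply: (test_mul_intg (f := fun x => phi x * lieD (alpha j) (A a) x)) => //; apply: testM => //; exact: (proj1 (tlA a)).
have hJ a : cintg leb (J a). have tpa := test_inW (tpA a).
  apply: (test_mul_intg (f := fun x => phi x * A a x)) => //.
  rewrite (_ : (fun s => _) = fun s : T => F j a (rowt s) + (-1) * \sum_b Gam j b a (rowt s) * q b s).
    apply: cintgD; first exact: test_intg.
    by apply: cintgZ; apply: cintg_sum => b _; exact: test_mul_intg.
  by apply/funext => s; rewrite mulN1r.
have h3 : cintg leb (fun s => lie_adj (alpha j) (fun x => phi x * f x) (rowt s)).
  by apply: test_intg; apply: tadj; exact: testMr.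
have h4 : cintg leb (fun s => phi (rowt s) * lieD (alpha j) f (rowt s)).
  by apply: (test_intg (f := fun x => phi x * lieD (alpha j) f x)); exact: testMr.
have hs1 : cintg leb (fun s => \sum_a I1 a s) by apply: cintg_sum => a _.
have hs2 : cintg leb (fun s => \sum_a I2 a s) by apply: cintg_sum => a _.
have hsJ : cintg leb (fun s => \sum_a J a s) by apply: cintg_sum => a _.
transitivity (cintegral leb (fun s => (\sum_a I1 a s + \sum_a I2 a s) +
    (lie_adj (alpha j) (fun x => phi x * f x) (rowt s) + phi (rowt s) * lieD (alpha j) f (rowt s)))).
  apply: eq_cintegral => s; rewrite -[- _]/(lie_adj (alpha j) phi (rowt s)) mulrDr (lie_adjM _ sal sphi (proj1 tf)).
  congr (_ + _); rewrite mulr_sumr -big_split /=; apply: eq_bigr => a _.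
  by rewrite mulrA (lie_adjM _ sal sphi (sA a)) mulrDl.
rewrite (cintegralD (cintgD hs1 hs2) (cintgD h3 h4)) (cintegralD hs1 hs2) (cintegralD h3 h4).
rewrite (lie_adj_integral sal (testM tp (proj1 tf))) add0r cintegral_sum//.
rewrite (eq_bigr (fun a => cintegral leb (J a))); last by move=> a _; exact: (@weak j a _ (tpA a)).
rewrite -cintegral_sum// -(cintegralD hsJ hs2) -(cintegralD (cintgD hsJ hs2) h4).
apply: eq_cintegral => s; rewrite /f' /=.
have E1 : \sum_a J a s = phi (rowt s) * (\sum_a A a (rowt s) * F j a (rowt s)) -
    phi (rowt s) * (\sum_b (\sum_a A a (rowt s) * Gam j b a (rowt s)) * q b s).
  under [X in _ - _ * X]eq_bigr => b _ do rewrite mulr_suml.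
  rewrite exchange_big /= -mulrBr -sumrB mulr_sumr; apply: eq_bigr => a _; rewrite /J -mulrA; congr (_ * _).
  by rewrite mulrBr mulr_sumr; congr (_ - _); apply: eq_bigr => b _; rewrite mulrA.
have E2 : \sum_a I2 a s = phi (rowt s) * (\sum_a lieD (alpha j) (A a) (rowt s) * q a s).
  by rewrite mulr_sumr; apply: eq_bigr => a _; rewrite /I2 mulrA.
have E3 : \sum_a A' a (rowt s) * q a s = (\sum_a lieD (alpha j) (A a) (rowt s) * q a s) -
    \sum_b (\sum_a A a (rowt s) * Gam j b a (rowt s)) * q b s.
  by rewrite -sumrB; apply: eq_bigr => b _; rewrite /A' mulN1r mulrBl.
by rewrite E1 E2 E3; ring.
Qed.

Lemma system_regularity rho1 b : 0 < rho1 -> rho1 < rho ->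
  exists u1 u2, [/\ smooth [set x | `|x - y0| < rho1] u1, smooth [set x | `|x - y0| < rho1] u2 &
    {ae leb, forall s, `|rowt s - y0| < rho1 -> q b s = u1 (rowt s) +i* u2 (rowt s)}].
Proof.
(* [k] is 1 on the ball of radius [rho1], and multiplying q_b by it gives a member of the generated
   family. *)
move=> r10 r1r; pose k (x : X) : C := (cutoff y0 rho1 rho x)%:C.
have tk : test k. apply: (@test_inW _ _ y0 (rho + 1)); split; first exact: smooth_cutoffC.
  exists rho; first by rewrite ltrDl. by move=> x h; rewrite /k (cutoff_supp (ltW r10) r1r h).
have gv : generated (fun s => k (rowt s) * q b s). exists (fun a => if a == b then k else fun=> 0), (fun=> 0); split.
  - by move=> a; case: eqP => // _; exact: test0.
  - exact: test0.
  - apply/funext => s; rewrite addr0 (bigD1 b)//= eqxx big1 ?addr0// => a /negbTE ->. by rewrite mul0r.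
have [u1 [u2 [s1 s2 H]]] := local_regularity rho0 talpha generated_L2 generated_lie eps0 Kc0 subell r10 r1r gv.
exists u1, u2; split=> //; apply: filterS H => s H hs; rewrite -H//.
by rewrite /k (cutoff1 (ltW r10) r1r (ltW hs)) mul1r.
Qed.

End first_order_systems.

Lemma csm_on_prod (R : realType) n (M : manifold R n) W (I : Type) (r : seq I) (F : I -> M -> R[i]) :
  open W -> (forall i, csmooth_on W (F i)) -> csmooth_on W (fun x => \prod_(i <- r) F i x).
Proof.
move=> oW H; elim: r => [|i r IH]. by apply: (csm_on_ext oW _ (csm_on_cst W 1)) => x _; rewrite big_nil.
by apply: (csm_on_ext oW _ (csmooth_onM oW (H i) IH)) => x _; rewrite big_cons.
Qed.

Lemma csm_on_det (R : realType) n (M : manifold R n) W r (A : M -> 'M[R[i]]_r) :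
  open W -> (forall i j, csmooth_on W (fun x => A x i j)) -> csmooth_on W (fun x => \det (A x)).
Proof.
move=> oW H; apply: csm_on_sum => // s.
apply: csmooth_onM => //; first exact: csm_on_cst.
exact: csm_on_prod.
Qed.

Lemma smooth_onV (R : realType) n (M : manifold R n) W (f : M -> R) : open W -> (forall x, W x -> f x != 0) ->
  smooth_on W f -> smooth_on W (fun x => (f x)^-1).
Proof.
move=> oW f0 sf c ac; apply: smoothV; [exact: open_chart_image| |exact: sf].
by move=> y [x [cx Wx] <-]; rewrite /= cmapK// f0.
Qed.

Lemma csmooth_onV (R : realType) n (M : manifold R n) W (f : M -> R[i]) : open W -> (forall x, W x -> f x != 0) ->
  csmooth_on W f -> csmooth_on W (fun x => (f x)^-1).
Proof.
move=> oW f0 sf; pose N x := complex.Re (f x) ^+ 2 + complex.Im (f x) ^+ 2.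
have [s1 s2] := sf.
have sN : smooth_on W (fun x => (N x)^-1). apply: smooth_onV => //.
    move=> x Wx; have := f0 x Wx; rewrite /N; case: (f x) => a b; rewrite eq_complex /=; apply: contraNN.
    by rewrite paddr_eq0 ?sqr_ge0// !sqrf_eq0.
  by apply: (smooth_on_ext oW _ (smooth_onD oW (smooth_onM oW s1 s1) (smooth_onM oW s2 s2))) => x _; rewrite -!expr2.
split. by apply: (smooth_on_ext oW _ (smooth_onM oW s1 sN)) => x _; rewrite /N; case: (f x).
apply: (smooth_on_ext oW _ (smooth_onN oW (smooth_onM oW s2 sN))) => x _; by rewrite /N; case: (f x).
Qed.

(** The entries of the inverse are cofactors divided by the determinant. *)
Lemma csm_on_invmx (R : realType) n (M : manifold R n) W r (A : M -> 'M[R[i]]_r) i j :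
  open W -> (forall i j, csmooth_on W (fun x => A x i j)) -> (forall x, W x -> A x \in unitmx) ->
  csmooth_on W (fun x => invmx (A x) i j).
Proof.
move=> oW sA uA; have sd := csm_on_det oW sA.
have sV : csmooth_on W (fun x => (\det (A x))^-1). by apply: csmooth_onV => // x /uA; rewrite unitmxE unitfE.
have sc : csmooth_on W (fun x => cofactor (A x) j i). apply: csmooth_onM => //; first exact: csm_on_cst.
  apply: csm_on_det => // k l. apply: (csm_on_ext oW _ (sA (lift j k) (lift i l))) => x _. by rewrite !mxE.
apply: (csm_on_ext oW _ (csmooth_onM oW sV sc)) => x /uA u.
by rewrite /invmx u !mxE.
Qed.

Lemma measurable_smooth_on (R : realType) n (M : manifold R n) (W : set M) (f : M -> R) : open W -> smooth_on W f ->
  measurable_fun (W : set (borel M)) (f : borel M -> R).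
Proof.
move=> oW sf; apply: (measurability _ (RGenOpens.measurableE R)).
move=> _ [_ [a [b ->]] <-]; apply: sub_sigma_algebra.
rewrite openE => x [Wx fx].
pose c := chart_at x; have cx := chart_at_dom x.
have cf : {for cmap c x, continuous (fun y => f (cinv c y))}.
  by apply: (smooth_cont (sf c (chart_at_atlas x))); exists x.
have h1 : nbhs x W by exact: open_nbhs_nbhs.
have h2 : nbhs x (cdom c) by apply: open_nbhs_nbhs; split=> //; exact: cdom_open.
have h3 : nbhs (cmap c x) ((fun y => f (cinv c y)) @^-1` `]a, b[%classic).
  by apply: cf; rewrite cmapK//; apply: open_nbhs_nbhs; split => //; exact: interval_open.
have h4 := @cmap_continuous _ _ _ c x cx _ h3.
by apply: filterS3 h1 h2 h4 => z Wz cz /=; rewrite cmapK.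
Qed.

(** * Integration over a coordinate ball *)

Section chart_ball.
Context (R : realType) (n : nat) (M : manifold R n).
Notation X := 'rV[R]_n.
Notation T := (n.-tuple R).
Notation leb := (leb R n).
Notation C := R[i].
Variables (g : M -> 'M[R]_n) (lam : {measure set (borel M) -> \bar R}).
Hypotheses (gm : is_riemannian_metric g) (gl : is_riemannian_density g lam).
Variables (c : chart R M n) (y0 : X) (r : R).
Hypotheses (ac : atlas c) (r0 : 0 <= r) (Hb : [set z | `|z - y0| <= r] `<=` cmap c @` cdom c).

Definition chart_ball : set M := cinv c @` [set z | `|z - y0| <= r].
Notation Kb := chart_ball.

Definition volume (x : M) : R := Num.sqrt (\det (metric_in c g x)).

(** Points outside the ball are sent to the centre and get the weight 0 in [ball_volume]: the map is
    then measurable on the whole space, with values in the compact ball. *)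
Definition ball_point (s : T) : M := if `|rowt s - y0| <= r then cinv c (rowt s) else cinv c y0.
Definition ball_volume (s : T) : R := if `|rowt s - y0| <= r then volume (cinv c (rowt s)) else 0.

Lemma volume_gt0 x : cdom c x -> 0 < volume x.
Proof. by move=> cx; rewrite sqrtr_gt0; exact: metric_det_gt0. Qed.

Lemma smooth_volume : smooth_on (cdom c) volume.
Proof.
have oc := cdom_open c; have [_ _ sg] := gm.
have sdet : csmooth_on (cdom c) (fun x => \det (map_mx (real_complex R) (metric_in c g x))).
  apply: csm_on_det => // i j; split.
    by apply: (smooth_on_ext oc _ (sg c ac i j)) => x _; rewrite [X in _ = complex.Re X]mxE.
  by apply: (smooth_on_ext oc _ (smooth_on_cst _ 0)) => x _; rewrite [X in _ = complex.Im X]mxE.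
have sd : smooth_on (cdom c) (fun x => \det (metric_in c g x)).
  by apply: (smooth_on_ext oc _ (proj1 sdet)) => x _; rewrite det_map_mx.
have E : cdom c `&` cdom c = cdom c by rewrite setIid.
apply: (smooth_on_chart ac oc (@subset_refl _ _)).
have oI := cmap_open_image oc (@subset_refl _ (cdom c)).
apply: smooth_sqrt => //; last by have := sd c ac; rewrite E.
by move=> y [x cx <-]; rewrite cmapK//; exact: metric_det_gt0.
Qed.

Lemma chart_ball_dom x : Kb x -> cdom c x /\ `|cmap c x - y0| <= r.
Proof. by move=> [z hz <-]; have [x' cx' E] := Hb hz; rewrite -E cmapK// E. Qed.

Lemma mchart_ball : measurable (Kb : set (borel M)).
Proof.
rewrite -[X in measurable X]setCK; apply: measurableC; apply: sub_sigma_algebra.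
exact: open_far.
Qed.

Lemma ball_pointE s : `|rowt s - y0| <= r -> cmap c (ball_point s) = rowt s.
Proof. by move=> h; rewrite /ball_point h; have [x cx <-] := Hb h; rewrite cmapK. Qed.

Lemma ball_point_in s : Kb (ball_point s).
Proof.
rewrite /ball_point; case: ifPn => h; first by exists (rowt s).
by exists y0 => //=; rewrite subrr normr0.
Qed.

Lemma mnorm_ball : measurable [set s : T | `|rowt s - y0| <= r].
Proof. exact: mnorm_le. Qed.

Lemma mball_point : mfunT (ball_point : T -> borel M).
Proof.
apply: (@measurability _ _ _ (borel M) setT ball_point (@open M) erefl) => _ [Q oQ <-]; rewrite setTI.
have mI : measurable [set s : T | (cmap c @` (cdom c `&` Q)) (rowt s)].
  by apply: mrowt_open; exact: open_chart_image.
have E1 s : `|rowt s - y0| <= r -> Q (ball_point s) <-> (cmap c @` (cdom c `&` Q)) (rowt s).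
  move=> h; rewrite -(ball_pointE h); have [cb _] := chart_ball_dom (ball_point_in s).
  split; first by move=> Qs; exists (ball_point s). by move=> [x [cx Qx] E]; rewrite -(cmapK cb) -E cmapK.
(* Whether the centre lies in [Q] decides if the exterior of the ball belongs to the preimage. *)
have [Qy|nQy] := pselect (Q (cinv c y0)).
  rewrite (_ : _ @^-1` _ = [set s : T | (cmap c @` (cdom c `&` Q)) (rowt s)] `|` ~` [set s : T | `|rowt s - y0| <= r]).
    by apply: measurableU => //; apply: measurableC; exact: mnorm_ball. apply/seteqP; split=> s /=.
    move=> Qs; have [h|h] := pselect (`|rowt s - y0| <= r); [left; exact/E1|by right].
  move=> [h|h]; last by rewrite /ball_point ifN//; exact/negP.
  have [hs|hs] := pselect (`|rowt s - y0| <= r); first exact/(E1 s hs). by rewrite /ball_point ifN//; exact/negP.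
rewrite (_ : _ @^-1` _ = [set s : T | (cmap c @` (cdom c `&` Q)) (rowt s)] `&` [set s : T | `|rowt s - y0| <= r]).
  by apply: measurableI => //; exact: mnorm_ball.
apply/seteqP; split=> s /=. move=> Qs; have [h|h] := pselect (`|rowt s - y0| <= r); first by split => //; exact/E1.
  by exfalso; apply: nQy; move: Qs; rewrite /ball_point ifN//; exact/negP.
by move=> [h1 h2]; exact/(E1 s h2).
Qed.

Lemma ball_volume_ge0 s : 0 <= ball_volume s.
Proof. by rewrite /ball_volume; case: ifP => // _; exact: sqrtr_ge0. Qed.

Lemma mball_volume : mfunT ball_volume.
Proof.
have mv : measurable_fun (cdom c : set (borel M)) (volume : borel M -> R).
  by apply: measurable_smooth_on; [exact: cdom_open|exact: smooth_volume].
have mvb : mfunT (fun s => volume (ball_point s)).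
  apply: (measurable_comp (F := cdom c : set (borel M))) mv mball_point.
    by apply: sub_sigma_algebra; exact: cdom_open. by move=> _ [s _ <-]; have [] := chart_ball_dom (ball_point_in s).
rewrite (_ : ball_volume = fun s => volume (ball_point s) * \1_[set s : T | `|rowt s - y0| <= r] s).
  by apply: mfunM => //; apply: measurable_indic; exact: mnorm_ball.
apply/funext => s; rewrite /ball_volume /ball_point indicE; case: ifPn => h. by rewrite mem_set ?mulr1.
by rewrite memNset ?mulr0//=; exact/negP.
Qed.

Lemma chart_ball_measure (A : set (borel M)) : measurable A -> A `<=` Kb ->
  lam A = (\int[leb]_(s in ball_point @^-1` A) (ball_volume s)%:E)%E.
Proof.
move=> mA AK; rewrite (gl ac mA); last by move=> x /AK/chart_ball_dom[].
rewrite integral_mkcond [RHS]integral_mkcond; apply: eq_integral => s _; rewrite !patchE.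
have [h|h] := boolP (`|rowt s - y0| <= r).
  rewrite (_ : (s \in [set t | (cmap c @` A) (rowt t)]) = (s \in ball_point @^-1` A)). by rewrite /ball_volume h.
  have [cb _] := chart_ball_dom (ball_point_in s). apply/idP/idP; rewrite !inE /=.
    move=> [x Ax E]; have [cx _] := chart_ball_dom (AK _ Ax). by rewrite -(cmapK cb) (ball_pointE h) -E cmapK.
  by move=> Ab; exists (ball_point s) => //; exact: ball_pointE.
rewrite (_ : (s \in _) = false); first by case: ifP => // _; rewrite /ball_volume ifN.
apply/negP; rewrite inE /= => -[x Ax E]; have [_] := chart_ball_dom (AK _ Ax).
by rewrite E; exact/negP.
Qed.

Lemma ge0_chart_integral (f : M -> \bar R) : measurable_fun (Kb : set (borel M)) (f : borel M -> \bar R) ->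
  (forall x, Kb x -> 0 <= f x)%E ->
  (\int[lam]_(x in (Kb : set (borel M))) f x = \int[leb]_s (f (ball_point s) * (ball_volume s)%:E))%E.
Proof.
move=> mf f0.
rewrite (ge0_weighted_transfer mball_point mball_volume ball_volume_ge0 mchart_ball chart_ball_measure mf f0).
by congr (integral _ _ _); apply/seteqP; split=> // s _; exact: ball_point_in.
Qed.

Lemma chart_integral (f : M -> R) : measurable_fun (Kb : set (borel M)) (f : borel M -> R) ->
  (forall x, ~ Kb x -> f x = 0) -> \int[lam]_x f x = \int[leb]_s (f (ball_point s) * ball_volume s).
Proof.
move=> mf f0; transitivity (\int[lam]_(x in (Kb : set (borel M))) f x).
  rewrite [RHS]Rintegral_mkcond; apply: eq_Rintegral => x _; rewrite patchE.
  by case: ifPn => //; rewrite notin_setE => /f0.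
rewrite (weighted_transfer mball_point mball_volume ball_volume_ge0 mchart_ball chart_ball_measure mf).
by congr (Rintegral _ _ _); apply/seteqP; split=> // s _; exact: ball_point_in.
Qed.

Definition cmeas_on (A : set M) (f : M -> C) :=
  measurable_fun (A : set (borel M)) (fun x : borel M => complex.Re (f x)) /\
  measurable_fun (A : set (borel M)) (fun x : borel M => complex.Im (f x)).

Lemma chart_cintegral (f : M -> C) : cmeas_on Kb f -> (forall x, ~ Kb x -> f x = 0) ->
  cintegral lam (f : borel M -> C) = cintegral leb (fun s => (ball_volume s)%:C * f (ball_point s)).
Proof.
move=> [m1 m2] f0; rewrite /cintegral; congr (_ +i* _). rewrite (chart_integral m1); last by move=> x /f0 ->.
  by apply: eq_Rintegral => s _; rewrite RecZ mulrC.
rewrite (chart_integral m2); last by move=> x /f0 ->.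
by apply: eq_Rintegral => s _; rewrite ImcZ mulrC.
Qed.

End chart_ball.

(** * Bundles and adjoints *)
Section conjugation.
Context (R : realType).
Implicit Types a b : R[i].
Lemma conjcD a b : (a + b)^*%C = a^*%C + b^*%C.
Proof. by case: a b => a1 a2 [b1 b2]; rewrite /= opprD. Qed.
Lemma conjcM a b : (a * b)^*%C = a^*%C * b^*%C.
Proof. by case: a b => a1 a2 [b1 b2]; apply/eqP; rewrite eq_complex /= mulrNN !mulrN mulNr opprD !eqxx. Qed.
Lemma conjcN a : (- a)^*%C = - a^*%C. Proof. by case: a => a1 a2. Qed.
Lemma conjcR (x : R) : (x%:C)^*%C = x%:C. Proof. by rewrite /= oppr0. Qed.
End conjugation.

(** * The Hermitian metric in a frame *)

Section hermitian.
Context (R : realType) (n : nat) (M : manifold R n) (r : nat) (E : vbundle M r).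
Notation C := R[i].
Variable h : forall x : M, E x -> E x -> C.
Hypothesis hh : is_hermitian_metric h.
Variable t : trivialization r E.

Lemma herm_conj x (u v : E x) : h v u = (h u v)^*%C. Proof. by have [_ H _ _] := hh; exact: H. Qed.
Lemma hermDl x (u v w : E x) : h (u + v) w = h u w + h v w.
Proof. by have [H _ _ _] := hh; have := H x 1 u v w; rewrite scale1r mul1r. Qed.
Lemma herm0l x (w : E x) : h 0 w = 0.
Proof. by apply: (addrI (h 0 w)); rewrite -hermDl !addr0. Qed.
Lemma hermZl x a (u w : E x) : h (a *: u) w = a * h u w.
Proof. by have [H _ _ _] := hh; have := H x a u 0 w; rewrite !addr0 herm0l addr0. Qed.
Lemma herm_suml x (I : Type) (q : seq I) (F : I -> E x) w : h (\sum_(i <- q) F i) w = \sum_(i <- q) h (F i) w.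
Proof. by elim: q => [|i q IH]; rewrite ?big_nil ?herm0l// !big_cons hermDl IH. Qed.
Lemma hermDr x (u v w : E x) : h w (u + v) = h w u + h w v.
Proof. by rewrite herm_conj hermDl conjcD -!herm_conj. Qed.
Lemma herm0r x (w : E x) : h w 0 = 0. Proof. by rewrite herm_conj herm0l /= oppr0. Qed.
Lemma hermZr x a (u w : E x) : h w (a *: u) = a^*%C * h w u.
Proof. by rewrite herm_conj hermZl conjcM -herm_conj. Qed.
Lemma herm_sumr x (I : Type) (q : seq I) (F : I -> E x) w : h w (\sum_(i <- q) F i) = \sum_(i <- q) h w (F i).
Proof. by elim: q => [|i q IH]; rewrite ?big_nil ?herm0r// !big_cons hermDr IH. Qed.
Lemma herm_gt0 x (u : E x) : u != 0 -> 0 < complex.Re (h u u) /\ complex.Im (h u u) = 0.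
Proof.
by have [_ _ H _] := hh => /H; rewrite ltcE /= => /andP[/eqP -> ->].
Qed.
Lemma herm_ge0 x (u : E x) : 0 <= complex.Re (h u u) /\ complex.Im (h u u) = 0.
Proof.
have [->|/herm_gt0[/ltW]] := eqVneq u 0; first by rewrite herm0l.
by [].
Qed.

Lemma cauchy_schwarz x (u w : E x) : normsq (h u w) <= complex.Re (h u u) * complex.Re (h w w).
Proof.
have [->|w0] := eqVneq w 0; first by rewrite !herm0r /normsq /= expr0n addr0 mulr0.
have [b0 bi] := herm_gt0 w0; set b := complex.Re (h w w) in b0 *.
have bE : h w w = b%:C by rewrite /b; case: (h w w) bi => b1 b2 /= ->.
set z := h u w; have bN : b%:C != 0 :> C by rewrite eq_complex /= eqxx andbT gt_eqF.
(* The vector is u minus its orthogonal projection on w; its squared length is h(u, u) - |z|^2/b. *)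
have [+ _] := herm_ge0 (u + (- (z / b%:C)) *: w).
rewrite hermDl !hermDr !hermZl !hermZr [h w u]herm_conj -/z bE conjcN.
have -> : (z / b%:C)^*%C = z^*%C / b%:C by rewrite -fmorphV/= conjcM conjcR.
rewrite (_ : _ + _ = h u u - z * z^*%C / b%:C); last by field.
rewrite ReD ReN (_ : complex.Re (z * z^*%C / b%:C) = normsq z / b). by rewrite subr_ge0 ler_pdivrMr.
have -> : (b%:C)^-1 = (b^-1)%:C :> C by rewrite fmorphV.
by rewrite mulrC RecZ mulrC; congr (_ * _); case: (z) => p q; rewrite /normsq /=; ring.
Qed.

Definition gram (x : M) : 'M[C]_r := \matrix_(a, b) h (frame t a x) (frame t b x).

(** A row vector killed by the Gram matrix gives a vector of the fiber orthogonal to the whole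
    frame, hence to itself. *)
Lemma gram_unit x : tdom t x -> gram x \in unitmx.
Proof.
move=> tx; rewrite unitmxE unitfE; apply/det0P => -[w w0 wE].
pose u : E x := tbwd t x w.
have u0 : u != 0. apply: contraNneq w0 => u0; have := congr1 (fun v => tfwd t v) u0.
  by rewrite /u tbwdK// tfwd0// => ->.
have [+ _] := herm_gt0 u0; rewrite (_ : h u u = 0) ?ltxx//.
rewrite {2}/u tbwdE// herm_sumr big1// => b _; rewrite hermZr.
rewrite /u tbwdE// herm_suml (_ : \sum_a _ = (w *m gram x) 0 b); first by rewrite wE mxE mulr0.
by rewrite mxE; apply: eq_bigr => a _; rewrite hermZl mxE.
Qed.

(** Dual frame for [h]: pairing on the right with it extracts a coordinate. The conjugates
    compensate the antilinearity in the second argument. *)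
Definition dual_frame b x : E x := \sum_a ((invmx (gram x)) a b)^*%C *: frame t a x.

Lemma dual_frameE b x (u : E x) : tdom t x -> h u (dual_frame b x) = tfwd t u 0 b.
Proof.
move=> tx; rewrite [in LHS](frame_decomp u tx) herm_suml.
under eq_bigr => a _. rewrite hermZl herm_sumr. under eq_bigr => a' _ do rewrite hermZr conjcK mulrC.
  rewrite (_ : \sum_a' _ = (gram x *m invmx (gram x)) a b); last by rewrite mxE; apply: eq_bigr => a' _; rewrite mxE.
  rewrite mulmxV ?gram_unit// mxE. over.
rewrite (bigD1 b)//= eqxx mulr1 big1 ?addr0// => a /negbTE ->.
by rewrite mulr0.
Qed.

Hypothesis tt : trivs t.

Lemma csmooth_gram a b : csmooth_on (tdom t) (fun x => gram x a b).
Proof.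
have [_ _ _ H] := hh; apply: (csm_on_ext (tdom_open t) _ (H t tt a b)) => x _; rewrite mxE//.
Qed.

Lemma csmooth_invgram a b : csmooth_on (tdom t) (fun x => invmx (gram x) a b).
Proof.
apply: csm_on_invmx; [exact: tdom_open|exact: csmooth_gram|exact: gram_unit].
Qed.

Lemma hermE x (u v : E x) : tdom t x -> h u v = \sum_a \sum_b tfwd t u 0 a * (tfwd t v 0 b)^*%C * gram x a b.
Proof.
move=> tx; rewrite [in LHS](frame_decomp u tx) herm_suml; apply: eq_bigr => a _.
rewrite [in LHS](frame_decomp v tx) hermZl herm_sumr mulr_sumr; apply: eq_bigr => b _.
by rewrite hermZr mulrA mxE.
Qed.

Lemma csmooth_herm (W : set M) (s1 s2 : section E) : open W -> W `<=` tdom t ->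
  (forall a, csmooth_on W (fun x => tfwd t (s1 x) 0 a)) -> (forall a, csmooth_on W (fun x => tfwd t (s2 x) 0 a)) ->
  csmooth_on W (fun x => h (s1 x) (s2 x)).
Proof.
move=> oW Wt h1 h2; apply: (@csm_on_ext _ _ _ W (fun x => \sum_a \sum_b tfwd t (s1 x) 0 a * (tfwd t (s2 x) 0 b)^*%C * gram x a b)) => //.
  by move=> x /Wt tx; rewrite -hermE.
apply: csm_on_sum => // a; apply: csm_on_sum => // b; apply: csmooth_onM => //.
  by apply: csmooth_onM => //; exact: csm_on_conj.
by apply: csm_on_sub (csmooth_gram a b).
Qed.

End hermitian.

(** * Cut-off coordinate expressions *)

Section chart_cutoff.
Context (R : realType) (n : nat) (M : manifold R n).
Notation X := 'rV[R]_n.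
Notation C := R[i].
Variables (c : chart R M n) (O : set M) (y0 : X) (rho r : R).
Hypotheses (ac : atlas c) (oO : open O) (Oc : O `<=` cdom c) (rho0 : 0 < rho) (rhor : rho < r)
  (Hb : [set z | `|z - y0| <= r] `<=` cmap c @` O).

(** Turns a function smooth near the ball into a test function on R^n with the same values in the
    ball of radius [rho]. *)
Definition loc (F : M -> C) (y : X) : C := (cutoff y0 rho r y)%:C * F (cinv c y).

Lemma loc_far F y : r < `|y - y0| -> loc F y = 0.
Proof. by move=> h; rewrite /loc (cutoff_supp (ltW rho0) rhor h) mul0r. Qed.

Lemma locE F y : `|y - y0| <= rho -> loc F y = F (cinv c y).
Proof. by move=> h; rewrite /loc (cutoff1 (ltW rho0) rhor h) mul1r. Qed.

Lemma smoothC_loc F : csmooth_on O F -> smoothC (loc F).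
Proof.
move=> sF; have [s1 s2] := csm_on_coord ac oO Oc sF.
have H (f : X -> R) : smooth (cmap c @` O) f -> smooth setT (fun y => cutoff y0 rho r y * f y).
  move=> sf; apply: smooth_local => y _. have oI := cmap_open_image oO Oc. have [Vy|nVy] := pselect ((cmap c @` O) y).
    exists (cmap c @` O) => //; apply: smoothM => //; exact: smooth_cutoff. exists [set z : X | r < `|z - y0|].
    by rewrite /= ltNge; apply/negP => h; apply: nVy; exact: Hb.
  apply: (@smooth_ext _ _ _ (fun=> 0)); [exact: open_norm_gt| |exact: smooth_cst].
  by move=> z; rewrite inE => h; rewrite (cutoff_supp (ltW rho0) rhor h) mul0r.
split. by apply: (smooth_ext openT _ (H _ s1)) => y _; rewrite /loc RecZ.
by apply: (smooth_ext openT _ (H _ s2)) => y _; rewrite /loc ImcZ.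
Qed.

Lemma test_loc F : csmooth_on O F -> test (loc F).
Proof.
move=> sF; apply: (@test_inW _ _ y0 (r + 1)); split; first exact: smoothC_loc.
by exists r; [rewrite ltrDl|exact: loc_far].
Qed.

Lemma chart_ball_sub x : chart_ball c y0 r x -> O x.
Proof. by move=> [z /Hb[x' Ox' <-] <-]; rewrite cmapK//; exact: Oc. Qed.

Lemma Hball_dom : [set z | `|z - y0| <= r] `<=` cmap c @` cdom c.
Proof. by move=> z /Hb[x Ox <-]; exists x => //; exact: Oc. Qed.

Lemma cmeas_on_ball F : csmooth_on O F -> cmeas_on (chart_ball c y0 r) F.
Proof.
move=> [s1 s2]; have mO : measurable (O : set (borel M)) by apply: sub_sigma_algebra.
split; apply: (measurable_funS mO chart_ball_sub); exact: measurable_smooth_on.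
Qed.

End chart_cutoff.

Lemma Rintegral_gt0 (R : realType) n (G : 'rV[R]_n -> R) (y y0 : 'rV[R]_n) (rr : R) :
  continuous G -> supp_in y rr G -> (forall x, 0 <= G x) -> 0 < G y0 -> 0 < \int[leb R n]_z G (rowt z).
Proof.
move=> cG zG G0 Gy0; have iG := intg_ccont cG zG.
have [d d0 Hd] : exists2 d : R, 0 < d & forall y, `|y - y0| <= d -> G y0 / 2 <= G y.
  have := cG y0 [set z | G y0 / 2 < z]; rewrite nbhs_filterE => /(_ _)/nbhs_ballP[|d d0 Hd].
    by apply: open_nbhs_nbhs; split; [exact: open_gt|rewrite /= gtr_pMr// invf_lt1// ltr1n].
  exists (d / 2); first exact: divr_gt0.
  move=> z hy; apply/ltW/Hd; rewrite -ball_normE /= distrC; apply: le_lt_trans hy _.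
  by rewrite gtr_pMr// invf_lt1// ltr1n.
pose B := [set z : n.-tuple R | `|y0 - rowt z| <= d].
have mB : measurable B by exact: measurable_cball.
have : (\int[leb R n]_z (G y0 / 2 * \1_B z)%:E <= \int[leb R n]_z (G (rowt z))%:E)%E. apply: ge0_le_integral => //.
  - by move=> z _; rewrite lee_fin mulr_ge0// divr_ge0// ltW.
  - by apply/mEFinP; apply: mfunM => //; exact: measurable_indic.
  - by apply/mEFinP; exact: mrowt_cont.
  - move=> z _; rewrite lee_fin indicE; case: (boolP (z \in B)); rewrite ?mulr0// inE mulr1 => hz.
    by apply: Hd; rewrite distrC.
under eq_integral do rewrite EFinM.
rewrite ge0_integralZl_EFin//; last 2 first.
- by apply/mEFinP; exact: measurable_indic.
- by rewrite divr_ge0// ltW.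
have -> : (\int[leb R n]_x (\1_B x)%:E = ((2 * d) ^+ n)%:E)%E.
  by rewrite integral_indic// setIT; exact: (leb_closed_ball y0 (ltW d0)).
rewrite -EFinM.
rewrite -(fineK (integrable_fin_num measurableT iG)) lee_fin; apply: lt_le_trans.
by rewrite mulr_gt0 ?divr_gt0// exprn_gt0// mulr_gt0.
Qed.

Lemma vf_apply_near0 (R : realType) n (M : manifold R n) (Z : cvfield M) (f : M -> R[i]) x :
  (\forall y \near x, f y = 0) -> vf_apply Z f x = 0.
Proof.
move=> f0; rewrite /vf_apply big1// => i _; rewrite /cpartial.
have H (p : R[i] -> R) : p 0 = 0 -> partial i (fun y => p (f (cinv (chart_at x) y))) (cmap (chart_at x) x) = 0.
  move=> p0; rewrite /partial (@near_eq_derive _ _ _ _ (cst 0)) ?derive_cst//.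
  have ci : {for cmap (chart_at x) x, continuous (cinv (chart_at x))}.
    by apply: cinv_continuous; exists x => //; exact: chart_at_dom.
  have := ci (fun y => f y = 0); rewrite cmapK; last exact: chart_at_dom. move=> H1; have {}H1 := H1 f0.
  by apply: (@filterS _ (nbhs (cmap (chart_at x) x)) _ _ _ _ H1) => y /= ->.
by rewrite (H (@complex.Re R))// (H (@complex.Im R))// mulr0.
Qed.

(** * Support of the formal adjoint *)

Section adjoint_support.
Context (R : realType) (n : nat) (M : manifold R n) (r : nat) (E : vbundle M r).
Notation C := R[i].
Variables (g : M -> 'M[R]_n) (lam : {measure set (borel M) -> \bar R}) (h : forall x : M, E x -> E x -> C).
Hypotheses (gm : is_riemannian_metric g) (gl : is_riemannian_density g lam) (hh : is_hermitian_metric h).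
Variables (nabla : connection E) (Z : cvfield M) (D' : section E -> section E).
Hypotheses (cn : is_connection nabla) (sZ : smooth_cvfield Z) (adj : is_formal_adjoint h lam (cnabla nabla Z) D').

Lemma chart_radius (c : chart R M n) (O : set M) x : open O -> O `<=` cdom c -> O x ->
  exists2 r : R, 0 < r & [set z | `|z - cmap c x| <= r] `<=` cmap c @` O.
Proof.
move=> oO Oc Ox; have : nbhs (cmap c x) (cmap c @` O).
  by apply: open_nbhs_nbhs; split; [exact: cmap_open_image|exists x].
move=> /nbhs_ballP[e e0 H]; exists (e / 2); first exact: divr_gt0.
move=> z hz; apply: H; rewrite -ball_normE /= distrC; apply: le_lt_trans hz _.
by rewrite gtr_pMr// invf_lt1// ltr1n.
Qed.

(** Locality is not part of the definition of the adjoint. If s = D' v were nonzero at x0, the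
    adjoint identity tested on psi s, with a bump psi near x0 away from the support of v, would make
    the integral of psi h(s, s) vanish. *)
Lemma adjoint_support v x0 : smooth_section v -> compact (supp v) -> ~ supp v x0 -> D' v x0 = 0.
Proof.
move=> sv cv nx; have [sD' adjE] := adj; set s := D' v; have ss : smooth_section s by exact: sD'.
apply/eqP/negPn/negP => s0; have [t tt tx] := trivs_cover E x0.
have [f0 _] := herm_gt0 hh s0.
pose c := chart_at x0; have ac := chart_at_atlas x0; have cx := chart_at_dom x0.
pose f x := complex.Re (h (s x) (s x)).
pose O1 := cdom c `&` ~` supp v `&` tdom t.
have oO1 : open O1. apply: openI; [apply: openI|exact: tdom_open]; first exact: cdom_open.
  by apply: closed_openC; exact: closed_closure.
have Ot : O1 `<=` tdom t by move=> x [].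
have sf1 : csmooth_on O1 (fun x => h (s x) (s x)).
  by apply: (csmooth_herm hh tt oO1 Ot) => a; apply: csm_on_sub Ot (ss t tt a).
have O1c : O1 `<=` cdom c by move=> x [[]].
have O1x : O1 x0 by [].
pose y0 := cmap c x0; pose V := cmap c @` O1.
have oV : open V by exact: cmap_open_image.
have sfV : smooth V (fun y => f (cinv c y)) := proj1 (csm_on_coord ac oO1 O1c sf1).
pose Q := V `&` (fun y => f (cinv c y)) @^-1` [set z | f x0 / 2 < z].
have nQ : nbhs y0 Q. apply: filterI; first by apply: open_nbhs_nbhs; split=> //; exists x0.
  have cf : {for y0, continuous (fun y => f (cinv c y))} by apply: (smooth_cont sfV); exists x0.
  apply: cf; apply: open_nbhs_nbhs; split; first exact: open_gt. by rewrite /= /y0 cmapK// gtr_pMr// invf_lt1// ltr1n.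
have /nbhs_ballP[e e0 He] := nQ.
pose rr := e / 2; have rr0 : 0 < rr by exact: divr_gt0.
have HbQ : [set z | `|z - y0| <= rr] `<=` Q.
  move=> z hz; apply: He; rewrite -ball_normE /= distrC; apply: le_lt_trans hz _. by rewrite gtr_pMr// invf_lt1// ltr1n.
have HbV : [set z | `|z - y0| <= rr] `<=` V by move=> z /HbQ[].
pose r1 := rr / 2; have r10 : 0 < r1 by exact: divr_gt0.
have r1r : r1 < rr by rewrite gtr_pMr// invf_lt1// ltr1n.
pose k y := cutoff y0 r1 rr y; pose psi := transplant c (fun y => (k y)%:C).
have Hbd := Hball_dom O1c HbV.
have zk : suppC y0 rr (fun y => (k y)%:C) by move=> y hy; rewrite /k (cutoff_supp (ltW r10) r1r hy).
have spsi : csmooth psi by apply: (csm_transplant ac (smooth_cutoffC _ _ _) zk).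
have sw : smooth_section (fun x => psi x *: s x) by exact: smooth_sectionZ.
have psi_far x : ~ chart_ball c y0 rr x -> psi x = 0 by move=> nK; exact: (transplant_far zk nK).
have KO x : chart_ball c y0 rr x -> O1 x := @chart_ball_sub _ _ _ _ _ _ _ O1c HbV x.
have psi_near x : supp v x -> \forall y \near x, psi y = 0. move=> vx; have : nbhs x (~` chart_ball c y0 rr).
    apply: open_nbhs_nbhs; split; first exact: open_far. by move=> /KO[[_ +] _]; apply.
  by apply: filterS => y; exact: psi_far.
have vf0 x : supp v x -> vf_apply Z psi x = 0 by move=> /psi_near; exact: vf_apply_near0.
have := adjE v _ sv sw (compact_closedI cv (@closed_closure _ _)).
(* The right side is 0 pointwise: near the support of [v] the bump vanishes, elsewhere [v] does. *)
rewrite -/s /pairing [RHS](_ : _ = 0); last first.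
  rewrite (_ : (fun x => _) = fun=> 0) ?cintegral0//; apply/funext => x. have [vx|nvx] := pselect (supp v x).
    rewrite (cnabla_leibniz x cn sZ spsi ss) (vf0 x vx) scale0r add0r.
    by have /nbhs_singleton -> := psi_near x vx; rewrite scale0r herm0r.
  rewrite (_ : v x = 0) ?herm0l//; apply/eqP/negPn/negP => v0; apply: nvx. exact: subset_closure.
move=> /(congr1 (@complex.Re R)) /=.
pose F x := complex.Re (psi x) * f x.
rewrite (_ : (fun x => complex.Re _) = F); last first. apply/funext => x; rewrite /F (hermZr hh) /psi /transplant.
  by case: ifP => _; rewrite ?conjcR ?RecZ//= oppr0 mul0r mul0r.
have mF : measurable_fun (chart_ball c y0 rr : set (borel M)) (F : borel M -> R).
  have [] := cmeas_on_ball oO1 O1c HbV (F := fun x => psi x * h (s x) (s x)).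
    by apply: csmooth_onM => //; exact: csm_on_sub spsi.
  move=> + _; congr (measurable_fun _ _); apply/funext => x; rewrite /F /psi /transplant.
  by case: ifP => _; rewrite ?RecZ// mul0r mul0r.
have F_far x : ~ chart_ball c y0 rr x -> F x = 0 by move=> /psi_far; rewrite /F => ->; rewrite mul0r.
rewrite (chart_integral gm gl ac (ltW rr0) Hbd mF F_far).
pose G y := k y * (f (cinv c y) * volume g c (cinv c y)).
have sG : smooth setT G. have sfv : csmooth_on O1 (fun x => h (s x) (s x) * (volume g c x)%:C).
    apply: csmooth_onM => //; split; last exact: smooth_on_cst. exact: smooth_on_sub O1c (smooth_volume gm ac).
  have [s1 _] := smoothC_loc ac oO1 O1c r10 r1r HbV sfv.
  apply: (smooth_ext openT _ s1) => y _; rewrite /loc RecZ /G /k; congr (_ * _). by rewrite mulrC RecZ mulrC.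
rewrite (_ : \int[leb R n]_z _ = \int[leb R n]_z G (rowt z)); last first.
  apply: eq_Rintegral => z _; rewrite /ball_volume; case: ifPn => hz; last first.
    by rewrite mulr0 /G /k (cutoff_supp (ltW r10) r1r) ?mul0r// ltNge.
  have bE := ball_pointE Hbd hz; have [cb _] := chart_ball_dom Hbd (ball_point_in c y0 (ltW rr0) z).
  rewrite /F /psi transplantE// bE /G [complex.Re _]/= /ball_point hz. by rewrite mulrA.
have cG : continuous G by move=> y; exact: (smooth_cont sG).
have zG : supp_in y0 rr G by move=> y hy; rewrite /G /k (cutoff_supp (ltW r10) r1r hy) mul0r.
have iG := intg_ccont cG zG.
have G0 y : 0 <= G y. rewrite mulr_ge0 ?cutoff_ge0// mulr_ge0 ?sqrtr_ge0//. by have [] := herm_ge0 hh (s (cinv c y)).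
move=> IG; have Gy0 : 0 < G y0. rewrite /G /k (cutoff1 (ltW r10) r1r) ?subrr ?normr0 ?(ltW r10)// mul1r.
  by rewrite mulr_gt0// /y0 cmapK//; exact: (volume_gt0 gm ac).
by have := Rintegral_gt0 cG zG G0 Gy0; rewrite IG ltxx.
Qed.

End adjoint_support.

Lemma cintegral_conj d (T : measurableType d) (R : realType) (mu : {measure set T -> \bar R}) (f : T -> R[i]) :
  cintg mu f -> cintegral mu (fun x => (f x)^*%C) = (cintegral mu f)^*%C.
Proof.
move=> [f1 f2]; rewrite /cintegral /=; congr (_ +i* _). by apply: eq_Rintegral => x _; case: (f x).
rewrite -mulN1r -RintegralZl//; apply: eq_Rintegral => x _; rewrite mulN1r.
by case: (f x).
Qed.

Lemma lie_adj_by_parts (R : realType) n (a : 'I_n -> 'rV[R]_n -> R[i]) (phi psi : 'rV[R]_n -> R[i]) :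
  (forall i, smoothC (a i)) -> test phi -> test psi ->
  cintegral (leb R n) (fun s => lieD a psi (rowt s) * phi (rowt s)) =
  cintegral (leb R n) (fun s => psi (rowt s) * lie_adj a phi (rowt s)).
Proof.
move=> sa tphi tpsi; have sphi := proj1 tphi; have spsi := proj1 tpsi.
have tpp : test (fun x => phi x * psi x) by exact: testM.
have tadj : test (lie_adj a (fun x => phi x * psi x)).
  rewrite (_ : lie_adj _ _ = fun x => (-1) * \sum_i cpart i (fun x => a i x * (phi x * psi x)) x).
    apply: testMr; first exact: smoothC_cst. by apply: test_sum => i _; apply: test_cpart; apply: testMr.
  by apply/funext => x; rewrite /lie_adj mulN1r.
have tl : test (fun x => phi x * lieD a psi x).
  apply: testM => //; apply: smoothC_sum => i _; apply: smoothCM => //; exact: smoothC_cpart.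
transitivity (cintegral (leb R n) (fun s => lie_adj a (fun x => phi x * psi x) (rowt s) + phi (rowt s) * lieD a psi (rowt s))).
  rewrite (cintegralD (test_intg tadj) (test_intg tl)) lie_adj_integral// add0r.
  by apply: eq_cintegral => s; rewrite mulrC.
by apply: eq_cintegral => s; rewrite -lie_adjM// mulrC.
Qed.

(** * The weak equation in a chart and a trivialization *)

Section local_system.
Context (R : realType) (n : nat) (M : manifold R n) (r : nat) (E : vbundle M r).
Notation X := 'rV[R]_n.
Notation T := (n.-tuple R).
Notation leb := (leb R n).
Notation C := R[i].
Variables (g : M -> 'M[R]_n) (lam : {measure set (borel M) -> \bar R}) (h : forall x : M, E x -> E x -> C).
Hypotheses (gm : is_riemannian_metric g) (gl : is_riemannian_density g lam) (hh : is_hermitian_metric h).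
Variables (nabla : connection E) (Z : cvfield M) (D' : section E -> section E).
Hypotheses (cn : is_connection nabla) (sZ : smooth_cvfield Z) (adj : is_formal_adjoint h lam (cnabla nabla Z) D').
Variables (c : chart R M n) (t : trivialization r E) (O : set M) (y0 : X) (rho R0 : R).
Hypotheses (ac : atlas c) (tt : trivs t) (oO : open O) (OD : O `<=` cdom c `&` tdom t)
  (rho0 : 0 < rho) (rhoR : rho < R0) (Hb : [set z | `|z - y0| <= R0] `<=` cmap c @` O).

Let Oc : O `<=` cdom c. Proof. by move=> x /OD[]. Qed.
Let Ot : O `<=` tdom t. Proof. by move=> x /OD[]. Qed.
Let R00 : 0 <= R0. Proof. exact: ltW (lt_trans rho0 rhoR). Qed.
Notation Kb := (chart_ball c y0 R0).
Notation bp := (ball_point c y0 R0).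
Notation bv := (ball_volume g c y0 R0).
Notation loc := (loc c y0 rho R0).
Local Notation frame a x := (frame t a x).
Let Hbd := Hball_dom Oc Hb.
Let KO x : Kb x -> O x := @chart_ball_sub _ _ _ _ _ _ _ Oc Hb x.
Let bpO s : O (bp s). Proof. exact: KO (ball_point_in c y0 R00 s). Qed.
Let HbD : [set z | `|z - y0| <= R0] `<=` cmap c @` (cdom c `&` tdom t).
Proof. by move=> z /Hb[x Ox <-]; exists x => //; exact: OD. Qed.

(** The connection acts on global sections, so the frame is cut off to global smooth sections that
    agree with it on the ball of radius [rho]. *)
Definition ext_frame (a : 'I_r) : section E :=
  section_of c t (fun b y => if b == a then (cutoff y0 rho R0 y)%:C else 0).

Lemma smooth_ext_frame a : smooth_section (ext_frame a).
Proof.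
apply: (smooth_section_of ac tt (y := y0) (rho := R0)) => // b; case: eqP => _ //.
- exact: smooth_cutoffC.
- exact: smoothC_cst.
- by move=> y hy; rewrite (cutoff_supp (ltW rho0) rhoR hy).
Qed.

Lemma ext_frameE a x : O x -> `|cmap c x - y0| <= rho -> ext_frame a x = frame a x.
Proof.
move=> Ox hx; have [cx tx] := OD Ox; apply: (can_inj (tfwdK tx)).
rewrite (section_ofE _ (OD Ox)) tbwdK//.
apply/rowP => b; rewrite !mxE (cutoff1 (ltW rho0) rhoR hx) eqxx /=.
by case: eqP.
Qed.

Definition lcoef i : X -> C := loc (fun x => components c Z x 0 i).
(** Entries of the connection matrix along [Z], cut off. *)
Definition ccoef a b : X -> C := loc (fun x => tfwd t (cnabla nabla Z (ext_frame a) x) 0 b).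

Lemma csmooth_tfwd s a : smooth_section s -> csmooth_on O (fun x => tfwd t (s x) 0 a).
Proof. by move=> ss; exact: csm_on_sub Ot (ss t tt a). Qed.

Lemma test_lcoef i : test (lcoef i).
Proof. by apply: (test_loc ac oO Oc rho0 rhoR Hb); exact: csm_on_sub Oc (sZ ac i). Qed.

Lemma test_ccoef a b : test (ccoef a b).
Proof.
apply: (test_loc ac oO Oc rho0 rhoR Hb); apply: csmooth_tfwd.
by apply: smooth_cnabla => //; exact: smooth_ext_frame.
Qed.

(** Coefficients of the dual frame before conjugation, divided by the volume density so that the
    latter cancels when [lam] is written in coordinates. *)
Definition dual_coef b' b (x : M) : C := invmx (gram h t x) b' b * ((volume g c x)^-1)%:C.

Lemma csmooth_volumeV : csmooth_on O (fun x => ((volume g c x)^-1)%:C).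
Proof.
split; last exact: smooth_on_cst.
apply: smooth_onV => //; last exact: smooth_on_sub Oc (smooth_volume gm ac).
by move=> x /Oc cx; rewrite gt_eqF// (volume_gt0 gm ac cx).
Qed.

Lemma csmooth_dual_coef b' b : csmooth_on O (dual_coef b' b).
Proof.
apply: csmooth_onM => //; last exact: csmooth_volumeV.
by apply: csm_on_sub Ot _; exact: csmooth_invgram.
Qed.

Section dual_section.
Variables (phi : X -> C) (b : 'I_r).
Hypothesis tphi : test_in y0 rho phi.
Let sphi := proj1 tphi.

(** The test section that turns pairings over M into Lebesgue integrals of [phi] against the b-th
    coordinate. Everything is conjugated because it stands in the second argument of [h]. *)
Definition dual_section : section E := section_of c t (fun b' y => (phi y * loc (dual_coef b' b) y)^*%C).
Notation vphi := dual_section.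

Lemma dual_section_supp : exists2 s, s < rho & suppC y0 s phi /\ forall x, ~ chart_ball c y0 s x -> vphi x = 0.
Proof.
have [_ [s sr zs]] := tphi; exists s => //; split=> // x nx.
apply: (@section_of_far _ _ _ _ _ c t _ y0 s x) nx => a y hy.
by rewrite zs// mul0r /= oppr0.
Qed.

Lemma smooth_dual_section : smooth_section vphi.
Proof.
have [s sr [zs _]] := dual_section_supp.
apply: (smooth_section_of ac tt (y := y0) (rho := R0)) => // b'.
  have [s1 s2] : smoothC (fun y => phi y * loc (dual_coef b' b) y).
    by apply: smoothCM => //; apply: (smoothC_loc ac oO Oc rho0 rhoR Hb); exact: csmooth_dual_coef.
  split; first by apply: (smooth_ext openT _ s1) => y _; case: (_ * _).
  by apply: (smooth_ext openT _ (smoothN openT s2)) => y _; case: (_ * _).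
by move=> y hy; rewrite zs ?mul0r /= ?oppr0//; exact: lt_trans (lt_trans sr rhoR) hy.
Qed.

Lemma dual_section_far s x : suppC y0 s phi -> s < rho -> ~ chart_ball c y0 s x -> vphi x = 0.
Proof.
move=> zs sr nx; apply: (@section_of_far _ _ _ _ _ c t _ y0 s x) nx => a y hy.
by rewrite zs// mul0r /= oppr0.
Qed.

Lemma supp_dual_section s : suppC y0 s phi -> s < rho -> supp vphi `<=` chart_ball c y0 s.
Proof.
move=> zs sr.
have Hs : [set z | `|z - y0| <= s] `<=` cmap c @` cdom c.
  by move=> z hz; apply: Hbd; apply: le_trans hz (ltW (lt_trans sr rhoR)).
have cl : closed (chart_ball c y0 s). by apply: compact_closed; [exact: manifold_hausdorff|exact: compact_chart_ball].
rewrite [X in _ `<=` X]((closure_id _).1 cl); apply: closure_subset => x /= v0; apply: contrapT => nx.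
by move: v0; rewrite (dual_section_far zs sr nx) eqxx.
Qed.

Lemma compact_supp_dual : compact (supp vphi).
Proof.
have [s sr [zs _]] := dual_section_supp.
have Hs : [set z | `|z - y0| <= s] `<=` cmap c @` cdom c.
  by move=> z hz; apply: Hbd; apply: le_trans hz (ltW (lt_trans sr rhoR)).
apply: (subclosed_compact (@closed_closure _ _) (compact_chart_ball Hs)).
exact: supp_dual_section.
Qed.

Lemma herm_dual_section x (w : E x) : O x -> h w (vphi x) = phi (cmap c x) * ((volume g c x)^-1)%:C * tfwd t w 0 b.
Proof.
move=> Ox; have [cx tx] := OD Ox; have [s sr [zs _]] := dual_section_supp.
have [far|near] := ltP s `|cmap c x - y0|.
  rewrite zs// !mul0r (_ : vphi x = 0) ?herm0r//; apply: (dual_section_far zs sr) => -[z hz E1].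
  have [x' cx' E2] := Hbd (le_trans hz (ltW (lt_trans sr rhoR))). by move: far; rewrite -E1 -E2 cmapK// E2 ltNge hz.
rewrite -(dual_frameE hh) // /vphi /section_of asboolT; last exact: OD.
rewrite tbwdE// !(herm_sumr hh) mulr_sumr; apply: eq_bigr => a _.
rewrite mxE !(hermZr hh) !conjcK (@locE R n M c y0 rho R0 rho0 rhoR _ _ (le_trans near (ltW sr))) cmapK// /dual_coef.
by rewrite !mulrA; congr (_ * _); rewrite -!mulrA; congr (_ * _); rewrite mulrC.
Qed.

Lemma ball_point_far s s0 : suppC y0 s phi -> s < rho -> s < `|rowt s0 - y0| -> `|rowt s0 - y0| <= R0 -> vphi (bp s0) = 0.
Proof.
move=> zs sr far hs; apply: (dual_section_far zs sr) => -[z hz E1].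
have [x' cx' E2] := Hbd (le_trans hz (ltW (lt_trans sr rhoR))).
have := ball_pointE Hbd hs; rewrite -E1 -E2 cmapK// E2 => Ez.
by move: far; rewrite -Ez ltNge hz.
Qed.

Lemma lieD_transplant psi x : smoothC psi -> O x -> `|cmap c x - y0| <= rho ->
  vf_apply Z (transplant c psi) x = lieD lcoef psi (cmap c x).
Proof.
move=> spsi Ox hx; have cx := Oc Ox.
have sT : csmooth_on (cdom c) (transplant c psi).
  by apply: (csm_on_chart ac (cdom_open c) (@subset_refl _ _) spsi) => z; exact: transplantE.
rewrite (vf_applyE Z ac cx (cdom_open c) cx sT) /lieD; apply: eq_bigr => i _.
rewrite /lcoef (@locE R n M c y0 rho R0 rho0 rhoR _ _ hx) cmapK//; congr (_ * _).
have oI := cmap_open_image (cdom_open c) (@subset_refl _ (cdom c)).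
have Ix : (cmap c @` cdom c) (cmap c x) by exists x.
rewrite /cpart; congr (_ +i* _); apply: near_eq_derive; apply: (near_open oI _ Ix) => y.
  by rewrite inE => -[z cz <-]; rewrite cmapK// transplantE.
by rewrite inE => -[z cz <-]; rewrite cmapK// transplantE.
Qed.

(** The value to be expected for [herm_vol]: the transpose of the field on [phi] in the diagonal
    case, plus the connection term. *)
Definition adj_coef a y : C := (if a == b then lie_adj lcoef phi y else 0) + ccoef a b y * phi y.

Lemma test_lie_adj : test (lie_adj lcoef phi).
Proof.
rewrite (_ : lie_adj _ _ = fun x => (-1) * \sum_i cpart i (fun x => lcoef i x * phi x) x); last first.
  by apply/funext => x; rewrite /lie_adj mulN1r.
apply: testMr; first exact: smoothC_cst.
by apply: test_sum => i _; apply: test_cpart; apply: testM => //; exact: test_lcoef.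
Qed.

Lemma test_adj_coef a : test (adj_coef a).
Proof.
apply: testD; last by apply: testM => //; exact: test_ccoef.
by case: (a == b); [exact: test_lie_adj|exact: test0].
Qed.

(** Pairing of the a-th frame vector with the adjoint of the test section, density included; these
    numbers determine the adjoint locally. *)
Definition herm_vol a x : C := h (frame a x) (D' vphi x) * (volume g c x)%:C.

Let sD : smooth_section (D' vphi). Proof. by apply: (proj1 adj); exact: smooth_dual_section. Qed.

Lemma csmooth_herm_vol a : csmooth_on O (herm_vol a).
Proof.
apply: csmooth_onM => //; last first. by split; [exact: smooth_on_sub Oc (smooth_volume gm ac)|exact: smooth_on_cst].
apply: (csmooth_herm hh tt oO Ot (s1 := fun x => frame a x)) => b'; last exact: csmooth_tfwd.
apply: (csm_on_ext oO _ (csm_on_cst O ((delta_mx 0 a : 'rV[C]_r) 0 b'))) => x /Ot tx.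
by rewrite tbwdK.
Qed.

(** The adjoint identity is tested on psi times a frame vector; the Leibniz rule and one integration
    by parts bring its right side to [adj_coef]. Both sides come out conjugated, since that section
    stands in the second argument of [h]. *)
Lemma adjoint_weak a (psi : X -> C) : test_in y0 rho psi ->
  cintegral leb (fun s => loc (herm_vol a) (rowt s) * psi (rowt s)) =
  cintegral leb (fun s => adj_coef a (rowt s) * psi (rowt s)).
Proof.
move=> tpsi; have spsi := proj1 tpsi; have tp := test_inW tpsi.
have [_ [s' s'r zpsi]] := tpsi; have [s0 s0r [zphi vfar]] := dual_section_supp.
have Hs' : [set z | `|z - y0| <= s'] `<=` cmap c @` cdom c.
  by move=> z hz; apply: Hbd; apply: le_trans hz (ltW (lt_trans s'r rhoR)).
have sT : csmooth (transplant c psi) by exact: csm_transplant zpsi Hs'.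
pose w x := transplant c psi x *: ext_frame a x.
have sw : smooth_section w by apply: smooth_sectionZ => //; exact: smooth_ext_frame.
have sv := smooth_dual_section.
have sub' s1 x : s1 <= R0 -> chart_ball c y0 s1 x -> Kb x.
  by move=> h1 [z hz <-]; exists z => //=; apply: le_trans hz h1.
have [_ /(_ _ w sv sw (compact_closedI compact_supp_dual (@closed_closure _ _)))] := adj.
have sh1 : csmooth_on O (fun x => h (D' vphi x) (w x)). by apply: (csmooth_herm hh tt oO Ot) => a'; exact: csmooth_tfwd.
have sh2 : csmooth_on O (fun x => h (vphi x) (cnabla nabla Z w x)).
  by apply: (csmooth_herm hh tt oO Ot) => a'; apply: csmooth_tfwd => //; exact: smooth_cnabla.
rewrite /pairing (chart_cintegral gm gl ac R00 Hbd (cmeas_on_ball oO Oc Hb sh1)); last first.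
  move=> x nK; rewrite /w (transplant_far zpsi) ?scale0r ?(herm0r hh)//.
  by move=> /(sub' _ _ (ltW (lt_trans s'r rhoR))).
rewrite (chart_cintegral gm gl ac R00 Hbd (cmeas_on_ball oO Oc Hb sh2)); last first.
  move=> x nK; rewrite vfar ?(herm0l hh)//. by move=> /(sub' _ _ (ltW (lt_trans s0r rhoR))).
pose I1 s := loc (herm_vol a) (rowt s) * psi (rowt s).
pose L y := if a == b then lieD lcoef psi y * phi y else 0.
pose I2 s := L (rowt s) + ccoef a b (rowt s) * phi (rowt s) * psi (rowt s).
have inball s : `|rowt s - y0| <= rho ->
    [/\ cmap c (bp s) = rowt s, bp s = cinv c (rowt s) & (bv s)%:C = (volume g c (bp s))%:C :> C].
  move=> hs; have hR := le_trans hs (ltW rhoR).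
  by split; [exact: ball_pointE|rewrite /ball_point hR|rewrite /ball_volume /ball_point hR].
have E1 s : (bv s)%:C * h (D' vphi (bp s)) (w (bp s)) = (I1 s)^*%C. have [hs|hs] := leP `|rowt s - y0| s'; last first.
    rewrite /I1 zpsi// mulr0 [RHS]/= oppr0; have [hR|hR] := leP `|rowt s - y0| R0; last first.
      by rewrite /ball_volume ifN ?mul0r// -ltNge.
    by rewrite /w transplantE ?(ball_pointE Hbd hR) ?zpsi// ?scale0r ?(herm0r hh) ?mulr0//; exact: Oc.
  have hr := le_trans hs (ltW s'r); have [e1 e2 e3] := inball s hr.
  rewrite e3 /I1 (@locE R n M c y0 rho R0 rho0 rhoR _ _ hr) -e2 /herm_vol /w transplantE; last exact: Oc.
  rewrite e1 ext_frameE ?e1// (hermZr hh) !conjcM conjcR -(herm_conj hh).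
  by move: (h _ _) (_%:C) (_^*%C) => H V p; ring.
have E2 s : (bv s)%:C * h (vphi (bp s)) (cnabla nabla Z w (bp s)) = (I2 s)^*%C.
  have [hs|hs] := leP `|rowt s - y0| s0; last first.
    rewrite /I2 /L zphi// !mulr0 mul0r addr0 (_ : (if a == b then _ else _) = 0); last by case: ifP.
    rewrite [RHS]/= oppr0; have [hR|hR] := leP `|rowt s - y0| R0; last first.
      by rewrite /ball_volume ifN ?mul0r// -ltNge. by rewrite (ball_point_far zphi s0r hs hR) (herm0l hh) mulr0.
  have hr := le_trans hs (ltW s0r); have [e1 e2 e3] := inball s hr.
  have Ob := bpO s; have cb := Oc Ob; have vN : (volume g c (bp s))%:C != 0 :> C.
    by rewrite eq_complex /= eqxx andbT gt_eqF// (volume_gt0 gm ac cb).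
  have vV : (volume g c (bp s))%:C * ((volume g c (bp s))^-1)%:C = 1 :> C.
    by rewrite -rmorphM /= mulfV// gt_eqF// (volume_gt0 gm ac cb).
  rewrite (cnabla_leibniz (bp s) cn sZ sT (smooth_ext_frame a)) (lieD_transplant spsi Ob) ?e1//.
  rewrite transplantE// e1 e3 (hermDr hh) !(hermZr hh).
  rewrite ![h (vphi _) _](herm_conj hh) !herm_dual_section// e1 -!conjcM -conjcD -conjcR -conjcM.
  apply: (congr1 (@conjc R)); rewrite /I2 /L /ccoef (@locE R n M c y0 rho R0 rho0 rhoR _ _ hr) -e2.
  rewrite ext_frameE ?e1// -[frame a (bp s)]/(tbwd t (bp s) (delta_mx 0 a)) tbwdK; last exact: Ot.
  rewrite [delta_mx _ _ _ _]mxE eqxx [b == a]eq_sym.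
  move: (_%:C) ((_^-1)%:C) (tfwd _ _ 0 b) (lieD _ _ _) (phi _) (psi _) vV => V V' N l p q vV.
  rewrite (_ : V * _ = (V * V') * (l * p * (a == b)%:R + N * p * q)); last by rewrite /=; ring.
  by rewrite vV mul1r; case: (a == b); rewrite ?mulr1 ?mulr0.
rewrite (eq_cintegral _ E1) (eq_cintegral _ E2).
have tI1 : test (fun y => loc (herm_vol a) y * psi y).
  by apply: testM => //; apply: (test_loc ac oO Oc rho0 rhoR Hb); exact: csmooth_herm_vol.
have tC : test (fun y => ccoef a b y * phi y * psi y). by apply: testM => //; apply: testM => //; exact: test_ccoef.
have slc i : smoothC (lcoef i) by have [] := test_lcoef i.
have tlp : test (lieD lcoef psi) by exact: (test_lie test_lcoef).
have tL : test L. by rewrite /L; case: (a == b); [apply: testM => //; exact: sphi|exact: test0].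
have iI2 : cintg leb I2. by apply: cintgD; [exact: test_intg|exact: (test_intg tC)].
rewrite (cintegral_conj (test_intg tI1)) (cintegral_conj iI2) => /(congr1 (@conjc R)).
rewrite !conjcK => ->; rewrite (cintegralD (test_intg tL) (test_intg tC)).
rewrite [X in X + _](_ : _ = cintegral leb (fun s => (if a == b then lie_adj lcoef phi (rowt s) else 0) * psi (rowt s))); last first.
  rewrite /L; case: (a == b); last by apply: eq_cintegral => s; rewrite mul0r.
  by rewrite (lie_adj_by_parts slc (test_inW tphi) tp); apply: eq_cintegral => s; rewrite mulrC.
rewrite -cintegralD; last 2 first.
- apply: (test_intg (f := fun y => (if a == b then lie_adj lcoef phi y else 0) * psi y)).
  by apply: testM => //; case: (a == b); [exact: test_lie_adj|exact: test0].
- exact: (test_intg tC).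
by apply: eq_cintegral => s; rewrite /adj_coef mulrDl.
Qed.

(** Du Bois-Reymond for the real and the imaginary part of the difference in [adjoint_weak];
    equality almost everywhere is what the integrals of [local_weak] use. *)
Lemma adjoint_coef a : {ae leb, forall s, `|rowt s - y0| < rho -> loc (herm_vol a) (rowt s) = adj_coef a (rowt s)}.
Proof.
pose D y := loc (herm_vol a) y + (-1) * adj_coef a y.
have tl : test (loc (herm_vol a)) by apply: (test_loc ac oO Oc rho0 rhoR Hb); exact: csmooth_herm_vol.
have ta := test_adj_coef a.
have tD : test D by apply: testD => //; apply: testMr => //; exact: smoothC_cst.
have weak (psi : X -> R) s : s < rho -> smooth setT psi -> supp_in y0 s psi ->
    cintegral leb (fun t0 => D (rowt t0) * (psi (rowt t0))%:C) = 0. move=> sr spsi zpsi; pose p y : C := (psi y)%:C.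
  have tp : test_in y0 rho p. by split; [split => //; exact: smooth_cst|exists s => // y hy; rewrite /p zpsi].
  have sp := proj1 tp.
  rewrite (eq_cintegral _ (g := fun t0 => loc (herm_vol a) (rowt t0) * p (rowt t0) + (-1) * (adj_coef a (rowt t0) * p (rowt t0)))); last first.
    by move=> t0; rewrite /D mulrDl mulrA.
  have i1 : cintg leb (fun t0 => loc (herm_vol a) (rowt t0) * p (rowt t0)).
    by apply: (test_intg (f := fun y => loc (herm_vol a) y * p y)); exact: testM.
  have i2 : cintg leb (fun t0 => adj_coef a (rowt t0) * p (rowt t0)).
    by apply: (test_intg (f := fun y => adj_coef a y * p y)); exact: testM.
  by rewrite (cintegralD i1 (cintgZ (-1) i2)) (cintegralZ _ i2) (adjoint_weak a tp) mulN1r subrr.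
have [iRe iIm] := test_intg tD.
have aeP (q : C -> R) : leb.-integrable setT (EFin \o (fun t0 => q (D (rowt t0)))) ->
    (forall z (x : R), q (z * x%:C) = q z * x) -> (forall f, q (cintegral leb f) = \int[leb]_s q (f s)) ->
    {ae leb, forall t0, `|rowt t0 - y0| < rho -> q (D (rowt t0)) = 0}.
  move=> iq qM qI; apply: du_bois_reymond => // psi s sr spsi zpsi.
  have cpsi : continuous psi by move=> y; exact: (smooth_cont spsi).
  have [B _ HB] := supp_bounded cpsi zpsi; have mpsi := mrowt_cont cpsi.
  have mq : mfunT (fun t0 => q (D (rowt t0))) by have /integrableP[/mEFinP] := iq.
  have ip : leb.-integrable setT (fun t0 => (q (D (rowt t0)) * psi (rowt t0))%:E).
    apply: (@le_integrable _ _ _ _ _ _ _ (fun t0 => (B * `|q (D (rowt t0))|)%:E)) => //.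
    - by apply/mEFinP; exact: mfunM.
    - move=> t0 _; rewrite lee_fin !normrM normr_id mulrC ler_wpM2r//; exact: le_trans (HB _) (ler_norm _).
    - by have := integrableZl measurableT B (integrable_norm iq).
  rewrite -(fineK (integrable_fin_num measurableT ip)); congr (_%:E).
  have := congr1 q (weak psi s sr spsi zpsi); rewrite qI. have -> : q 0 = 0 by have := qM 0 0; rewrite mul0r mulr0.
  by move=> <-; apply: eq_Rintegral => t0 _; rewrite qM.
have a1 := aeP (@complex.Re R) iRe (fun z x => _) (fun f => erefl).
have {}a1 : {ae leb, forall t0, `|rowt t0 - y0| < rho -> complex.Re (D (rowt t0)) = 0}.
  by apply: a1; case=> z1 z2 x /=; rewrite mulr0 subr0.
have a2 : {ae leb, forall t0, `|rowt t0 - y0| < rho -> complex.Im (D (rowt t0)) = 0}.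
  by apply: (aeP (@complex.Im R)) => //; case=> z1 z2 x /=; rewrite mulr0 add0r.
apply: filterS2 a1 a2 => s h1 h2 hs; apply/eqP; rewrite -subr_eq0.
have -> : loc (herm_vol a) (rowt s) - adj_coef a (rowt s) = D (rowt s) by rewrite /D mulN1r.
by rewrite eq_complex /= h1 ?h2// !eqxx.
Qed.

End dual_section.

Section weak_equation.
Variables (u f : section E).
Hypotheses (mu_ : measurable_section u) (sf : smooth_section f).

(** The sharp cutoff at [rho] is invisible to test functions supported inside that ball. *)
Definition qcoef a (s : T) : C := if `|rowt s - y0| <= rho then tfwd t (u (bp s)) 0 a else 0.
Definition fcoef a : X -> C := loc (fun x => tfwd t (f x) 0 a).

Lemma test_fcoef a : test (fcoef a).
Proof. by apply: (test_loc ac oO Oc rho0 rhoR Hb); exact: csmooth_tfwd. Qed.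

Lemma cmeas_onM (f1 f2 : M -> C) : cmeas_on Kb f1 -> cmeas_on Kb f2 ->
  cmeas_on Kb (fun x => f1 x * f2 x).
Proof.
move=> [f11 f12] [f21 f22]; split. by under eq_fun do rewrite RecM; apply: measurable_funB; exact: mfunM.
by under eq_fun do rewrite ImcM; apply: mfunD; exact: mfunM.
Qed.

Lemma cmeas_on_sum (I : Type) (l : seq I) (F : I -> M -> C) : (forall i, cmeas_on Kb (F i)) ->
  cmeas_on Kb (fun x => \sum_(i <- l) F i x).
Proof.
move=> H; elim: l => [|i l [IH1 IH2]]. by split; under eq_fun do rewrite big_nil; exact: measurable_cst.
have [H1 H2] := H i; split; under eq_fun do rewrite big_cons ?ReD ?ImD; exact: mfunD.
Qed.

Lemma cmeas_tfwd a : cmeas_on Kb (fun x => tfwd t (u x) 0 a).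
Proof.
have mt : measurable (tdom t : set (borel M)) by apply: sub_sigma_algebra; exact: tdom_open.
have Kt : Kb `<=` tdom t by move=> x /KO/Ot.
have [m1 m2] := mu_ tt a.
by split; apply: measurable_funS mt Kt _.
Qed.

Lemma cmeas_pullback (F : M -> C) : cmeas_on Kb F -> cmeas (fun s : T => F (bp s)).
Proof.
have mK : measurable (Kb : set (borel M)) by exact: mchart_ball.
have mb := mball_point R00 Hbd.
have sub : [set bp s | s in [set: T]] `<=` Kb by move=> _ [s _ <-]; exact: ball_point_in.
by move=> [m1 m2]; split; [apply: (measurable_comp mK sub m1 mb)|apply: (measurable_comp mK sub m2 mb)].
Qed.

Lemma cmeas_herm (s1 : section E) : smooth_section s1 -> cmeas_on Kb (fun x => h (u x) (s1 x)).
Proof.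
move=> ss; have sG a : csmooth_on O (fun x => h (frame a x) (s1 x)).
  apply: (csmooth_herm hh tt oO Ot (s1 := fun x => frame a x)) => b'; last exact: csmooth_tfwd.
  apply: (csm_on_ext oO _ (csm_on_cst O ((delta_mx 0 a : 'rV[C]_r) 0 b'))) => x /Ot tx. by rewrite tbwdK.
have [m1 m2] := cmeas_on_sum (index_enum 'I_r) (fun a => cmeas_onM (cmeas_tfwd a) (cmeas_on_ball oO Oc Hb (sG a))).
have EQ x : Kb x -> h (u x) (s1 x) = \sum_a tfwd t (u x) 0 a * h (frame a x) (s1 x).
  move=> /KO/Ot tx; rewrite [in LHS](frame_decomp (u x) tx) (herm_suml hh).
  by apply: eq_bigr => a _; rewrite (hermZl hh).
split; [move: m1|move: m2]; apply: eq_measurable_fun => x; rewrite inE => Kx; by rewrite EQ.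
Qed.

Lemma ae_cintegral (f1 f2 : T -> C) : cmeas f1 -> cmeas f2 -> {ae leb, forall s, f1 s = f2 s} ->
  cintegral leb f1 = cintegral leb f2.
Proof.
move=> [m11 m12] [m21 m22] H; rewrite /cintegral /Rintegral.
rewrite (@ae_eq_integral _ _ _ leb setT (fun x => (complex.Re (f1 x))%:E) (fun x => (complex.Re (f2 x))%:E) measurableT); last 3 first.
- exact/mEFinP.
- exact/mEFinP.
- by apply: filterS H => s -> _.
rewrite (@ae_eq_integral _ _ _ leb setT (fun x => (complex.Im (f1 x))%:E) (fun x => (complex.Im (f2 x))%:E) measurableT) //.
- exact/mEFinP.
- exact/mEFinP.
- by apply: filterS H => s -> _.
Qed.

(** The weak equation is tested on the dual section of [phi]. Expanding [u] in the frame,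
    [adjoint_coef] gives the left side, while [adjoint_support] confines it to the coordinate
    ball. *)
Lemma local_weak b phi : (forall v, smooth_section v -> compact (supp v) -> pairing h lam u (D' v) = pairing h lam f v) ->
  (forall a, cintg leb (qcoef a)) -> test_in y0 rho phi ->
  cintegral leb (fun s => lie_adj lcoef phi (rowt s) * qcoef b s) =
  cintegral leb (fun s => phi (rowt s) * (fcoef b (rowt s) - \sum_a ccoef a b (rowt s) * qcoef a s)).
Proof.
move=> wk iq tphi; set v := dual_section phi b.
have sv : smooth_section v := smooth_dual_section b tphi.
have sD' : smooth_section (D' v) by exact: (proj1 adj).
have [s0 s0r [zphi vfar]] := dual_section_supp b tphi.
have s0R : s0 <= R0 by rewrite ltW// (lt_trans s0r).
have sub' x : chart_ball c y0 s0 x -> Kb x. by move=> [z hz <-]; exists z => //=; apply: le_trans hz s0R.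
have sv0 := supp_dual_section (b := b) zphi s0r.
have D0 x : ~ chart_ball c y0 s0 x -> D' v x = 0. move=> nx; have nsx : ~ supp v x by move=> /sv0.
  exact: (@adjoint_support R n M r E g lam h gm gl hh nabla Z D' cn sZ adj v x sv (compact_supp_dual (b := b) tphi) nsx).
have := wk v sv (compact_supp_dual (b := b) tphi).
have mh := cmeas_herm sD'.
have mf : cmeas_on Kb (fun x => h (f x) (v x)).
  by apply: (cmeas_on_ball oO Oc Hb); apply: (csmooth_herm hh tt oO Ot) => a; exact: csmooth_tfwd.
rewrite /pairing (chart_cintegral gm gl ac R00 Hbd mh); last by move=> x nK; rewrite D0 ?(herm0r hh)// => /sub'.
rewrite (chart_cintegral gm gl ac R00 Hbd mf); last by move=> x nK; rewrite /v vfar ?(herm0r hh)// => /sub'.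
have inball s : `|rowt s - y0| <= rho ->
    [/\ cmap c (bp s) = rowt s, bp s = cinv c (rowt s) & (bv s)%:C = (volume g c (bp s))%:C :> C].
  move=> hs; have hR := le_trans hs (ltW rhoR).
  by split; [exact: ball_pointE|rewrite /ball_point hR|rewrite /ball_volume /ball_point hR].
have bfar s : s0 < `|rowt s - y0| -> `|rowt s - y0| <= R0 -> ~ chart_ball c y0 s0 (bp s).
  move=> far hs [z hz E1]; have [x' cx' E2] := Hbd (le_trans hz s0R).
  have := ball_pointE Hbd hs; rewrite -E1 -E2 cmapK// E2 => Ez. by move: far; rewrite -Ez ltNge hz.
rewrite [RHS](_ : _ = cintegral leb (fun s => phi (rowt s) * fcoef b (rowt s))); last first.
  apply: eq_cintegral => s; have [hs|hs] := leP `|rowt s - y0| s0; last first.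
    rewrite zphi// mul0r; have [hR|hR] := leP `|rowt s - y0| R0; last by rewrite /ball_volume ifN ?mul0r// -ltNge.
    by rewrite /v vfar ?(herm0r hh) ?mulr0//; exact: bfar.
  have hr := le_trans hs (ltW s0r); have [e1 e2 e3] := inball s hr.
  have vV : (volume g c (bp s))%:C * ((volume g c (bp s))^-1)%:C = 1 :> C.
    by rewrite -rmorphM /= mulfV// gt_eqF// (volume_gt0 gm ac)//; exact: Oc.
  rewrite /v (herm_dual_section b tphi) // e1 e3 /fcoef (@locE R n M c y0 rho R0 rho0 rhoR _ _ hr) -e2.
  move: (_%:C) ((_^-1)%:C) (tfwd _ _ 0 b) (phi _) vV => V V' N p vV.
  rewrite (_ : V * _ = (V * V') * (p * N)); last by ring. by rewrite vV mul1r.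
pose I s := \sum_a adj_coef phi b a (rowt s) * qcoef a s.
have ta a := test_adj_coef b tphi a.
have iI : cintg leb I by apply: cintg_sum => a _; exact: test_mul_intg.
have tla := test_lie_adj tphi; have tp := test_inW tphi; have sp := proj1 tphi.
rewrite (@ae_cintegral _ I); last 3 first.
- apply: (cmeasM (f := fun s => (bv s)%:C)); last exact: (cmeas_pullback mh).
  by split; [exact: mball_volume|exact: measurable_cst].
- exact: cintg_meas iI.
(* There are finitely many frame indices, so one null set serves them all. *)
- have : {ae leb, forall s a, `|rowt s - y0| < rho -> loc (herm_vol phi b a) (rowt s) = adj_coef phi b a (rowt s)}.
    by apply: filter_forall => a; exact: adjoint_coef.
  apply: filterS => s H; have [hs|hs] := leP `|rowt s - y0| s0; last first. have za a : adj_coef phi b a (rowt s) = 0.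
      rewrite /adj_coef zphi// mulr0 addr0; case: ifP => // _.
      have zl i : cpart i (fun y => lcoef i y * phi y) (rowt s) = 0.
        have zp : suppC y0 s0 (fun y => lcoef i y * phi y) by move=> y hy; rewrite zphi// mulr0.
        exact: (suppC_cpart i zp hs). rewrite /lie_adj big1 ?oppr0// => i _; exact: zl.
    rewrite /I big1 => [|a _]; last by rewrite za mul0r.
    have [hR|hR] := leP `|rowt s - y0| R0; last by rewrite /ball_volume ifN ?mul0r// -ltNge.
    by rewrite D0 ?(herm0r hh) ?mulr0//; exact: bfar.
  have hr := le_lt_trans hs s0r; have [e1 e2 e3] := inball s (ltW hr). have tb : tdom t (bp s) by apply: Ot; exact: bpO.
  rewrite [u (bp s)](frame_decomp _ tb) (herm_suml hh) mulr_sumr; apply: eq_bigr => a _.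
  rewrite (hermZl hh) -(H a hr) (@locE R n M c y0 rho R0 rho0 rhoR _ _ (ltW hr)) /qcoef (ltW hr) e3 -e2 /herm_vol.
  by rewrite -/v; move: (h _ _) (_%:C) (tfwd _ _ 0 a) => H' V q; ring.
move=> EQ; have i1 a : cintg leb (fun s => ccoef a b (rowt s) * phi (rowt s) * qcoef a s).
  apply: (test_mul_intg (f := fun y => ccoef a b y * phi y)) => //. by apply: testM => //; exact: test_ccoef.
have i2 : cintg leb (fun s => lie_adj lcoef phi (rowt s) * qcoef b s) by exact: test_mul_intg.
have i3 : cintg leb (fun s => \sum_a ccoef a b (rowt s) * phi (rowt s) * qcoef a s) by apply: cintg_sum => a _.
have i4 : cintg leb (fun s => phi (rowt s) * fcoef b (rowt s)).
  by apply: (test_intg (f := fun y => phi y * fcoef b y)); apply: testM => //; exact: (proj1 (test_fcoef b)).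
rewrite [RHS](eq_cintegral _ (g := fun s => phi (rowt s) * fcoef b (rowt s) + (-1) * \sum_a ccoef a b (rowt s) * phi (rowt s) * qcoef a s)); last first.
  move=> s; rewrite mulrBr mulN1r mulr_sumr; congr (_ - _); apply: eq_bigr => a _. by rewrite mulrCA mulrA.
rewrite (cintegralD i4 (cintgZ (-1) i3)) (cintegralZ _ i3) -EQ mulN1r.
apply/eqP; rewrite eq_sym subr_eq -(cintegralD i2 i3); apply/eqP; apply: eq_cintegral => s.
rewrite /I /adj_coef; under eq_bigr => a _ do rewrite mulrDl.
rewrite big_split /=; congr (_ + _).
by rewrite (bigD1 b)//= eqxx big1 ?addr0// => a /negbTE ->; rewrite mul0r.
Qed.

(** A coordinate is a pairing with the dual frame, so Cauchy-Schwarz bounds its square by h(u, u)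
    times a continuous factor. [N] divides this factor by the density, to match the weight in the
    integral of h(u, u). *)
Lemma qcoef_L2 a : l2loc h lam u -> L2 (qcoef a).
Proof.
move=> [_ lu].
have mq : cmeas (qcoef a). have [m1 m2] := cmeas_pullback (cmeas_tfwd a).
  have mI : mfunT (\1_[set s : T | `|rowt s - y0| <= rho] : T -> R).
    by apply: measurable_indic; exact: mnorm_le.
  have EI s : qcoef a s = (\1_[set s : T | `|rowt s - y0| <= rho] s)%:C * tfwd t (u (bp s)) 0 a.
    rewrite /qcoef indicE; case: ifPn => hs; first by rewrite mem_set// mul1r. by rewrite memNset ?mul0r//=; exact/negP.
  split; under eq_fun do rewrite EI ?RecZ ?ImcZ; exact: mfunM.
pose N x : C := h (dual_frame h t a x) (dual_frame h t a x) * ((volume g c x)^-1)%:C.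
have sN : csmooth_on O N. apply: csmooth_onM => //; last exact: csmooth_volumeV.
  apply: (csmooth_herm hh tt oO Ot (s1 := dual_frame h t a) (s2 := dual_frame h t a)) => b;
  apply: (csm_on_ext oO _ (csm_on_conj oO (csm_on_sub Ot (csmooth_invgram hh tt b a)))) => x /Ot tx;
  by rewrite /dual_frame -(_ : tbwd t x (\row_b (invmx (gram h t x) b a)^*%C) = \sum_b _) ?tbwdK ?mxE// tbwdE//;
    apply: eq_bigr => b' _; rewrite mxE.
have [B B0 HB] := test_bounded (test_loc ac oO Oc rho0 rhoR Hb sN).
have mhu : cmeas_on Kb (fun x => h (u x) (u x)).
  have EQ x : Kb x -> h (u x) (u x) = \sum_a' \sum_b tfwd t (u x) 0 a' * (tfwd t (u x) 0 b)^*%C * gram h t x a' b.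
    by move=> /KO/Ot tx; rewrite (hermE hh _ _ tx). have mc b : cmeas_on Kb (fun x => (tfwd t (u x) 0 b)^*%C).
    have [c1 c2] := cmeas_tfwd b; split; first by move: c1; apply: eq_measurable_fun => x _; case: (tfwd _ _ 0 b).
    by move: (measurable_funN c2); apply: eq_measurable_fun => x _ /=; case: (tfwd _ _ 0 b).
  have [m1 m2] := cmeas_on_sum (index_enum 'I_r) (fun a' => cmeas_on_sum (index_enum 'I_r) (fun b =>
    cmeas_onM (cmeas_onM (cmeas_tfwd a') (mc b)) (cmeas_on_ball oO Oc Hb (csm_on_sub Ot (csmooth_gram hh tt a' b))))).
  by split; [move: m1|move: m2]; apply: eq_measurable_fun => x; rewrite inE => Kx; rewrite EQ.
have [_ hu0] : True /\ forall x, 0 <= complex.Re (h (u x) (u x)) by split=> // x; have [] := herm_ge0 hh (u x).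
have fin : (\int[leb]_s ((complex.Re (h (u (bp s)) (u (bp s))))%:E * (bv s)%:E) < +oo)%E.
  rewrite -(@ge0_chart_integral R n M g lam gm gl c y0 R0 ac R00 Hbd (fun x => (complex.Re (h (u x) (u x)))%:E)).
  - by apply: lu; exact: compact_chart_ball.
  - by apply/mEFinP; exact: (proj1 mhu).
  - by move=> x _; rewrite lee_fin.
have bnd s : normsq (qcoef a s) <= B * (complex.Re (h (u (bp s)) (u (bp s))) * bv s).
  rewrite /qcoef; case: ifPn => hs; last first.
    by rewrite /normsq /= expr0n addr0 mulr_ge0 ?(ltW B0)// mulr_ge0// ball_volume_ge0.
  have tb : tdom t (bp s) by apply: Ot; exact: bpO.
  rewrite -(dual_frameE hh) //; apply: le_trans (cauchy_schwarz hh _ _) _. have hR := le_trans hs (ltW rhoR).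
  have v0 : 0 < volume g c (bp s) by apply: (volume_gt0 gm ac); apply: Oc; exact: bpO.
  have := le_trans (ler_norm _) (le_trans (ncRe _) (HB (rowt s))).
  rewrite (@locE R n M c y0 rho R0 rho0 rhoR _ _ hs) (_ : cinv c (rowt s) = bp s); last by rewrite /ball_point hR.
  rewrite /N mulrC RecZ mulrC ler_pdivrMr// => Hd.
  rewrite (_ : bv s = volume g c (bp s)); last by rewrite /ball_volume /ball_point hR. by rewrite mulrCA ler_wpM2l.
have inq : leb.-integrable setT (fun s => (normsq (qcoef a s))%:E).
  apply/integrableP; split; first by apply/mEFinP; exact: cmeas_normsq.
  apply: (@le_lt_trans _ _ (B%:E * \int[leb]_s ((complex.Re (h (u (bp s)) (u (bp s))))%:E * (bv s)%:E))%E); last first.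
    by rewrite lte_mul_pinfty// lee_fin ltW.
  have mb : mfunT (fun s => complex.Re (h (u (bp s)) (u (bp s))) * bv s).
    apply: mfunM; first by have [] := cmeas_pullback mhu. exact: mball_volume.
  rewrite -ge0_integralZl_EFin//; last 3 first.
  - by move=> s _; rewrite -EFinM lee_fin mulr_ge0// ball_volume_ge0.
  - exact/mEFinP.
  - exact: ltW. apply: ge0_le_integral => //.
  - by apply: mcompT => //; apply/mEFinP; exact: cmeas_normsq.
  - by under eq_fun do rewrite -!EFinM; apply/mEFinP; exact: mfunM.
  - by move=> s _; rewrite -!EFinM lee_fin ger0_norm ?normsq_ge0.
split=> //.
have i1 : leb.-integrable setT (EFin \o \1_[set s : T | `|rowt s - y0| <= rho]).
  apply: (@intg_supp R n y0 rho 1 (\1_[set s : T | `|rowt s - y0| <= rho])).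
  - by apply: measurable_indic; exact: mnorm_le.
  - by move=> s; rewrite indicE ger0_norm// lern1 leq_b1.
  - by move=> s hs; rewrite indicE memNset//=; apply/negP; rewrite -ltNge.
apply: (@cintg_bound _ _ _ _ _ (fun s => \1_[set s : T | `|rowt s - y0| <= rho] s + normsq (qcoef a s)) mq).
  by have := integrableD measurableT i1 inq.
move=> s; rewrite indicE /qcoef; case: ifPn => hs; last first. by rewrite nc0 addr_ge0 ?normsq_ge0.
(* Integrability follows from square integrability on the ball through x <= 1 + x^2. *)
rewrite mem_set// -nc_sqr; move: (nc _) (nc_ge0 (tfwd t (u (bp s)) 0 a)) => x x0 /=.
by have := sqr_ge0 (x - 1); rewrite sqrrB; move: (sqr_ge0 x); lra.
Qed.

End weak_equation.
End local_system.

Lemma smooth_cutoffM (R : realType) n (W : set 'rV[R]_n) (y0 : 'rV[R]_n) (r1 r2 : R) (u : 'rV[R]_n -> R) :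
  open W -> 0 <= r1 -> r1 < r2 -> [set z | `|z - y0| <= r2] `<=` W -> smooth W u ->
  smooth setT (fun y => cutoff y0 r1 r2 y * u y).
Proof.
move=> oW r10 r12 sub su; apply: smooth_local => y _.
have [Wy|nWy] := pselect (W y). by exists W => //; apply: smoothM => //; exact: smooth_cutoff.
exists [set z | r2 < `|z - y0|]; first by rewrite /= ltNge; apply/negP => h; apply: nWy; exact: sub.
apply: (@smooth_ext _ _ _ (fun=> 0)); [exact: open_norm_gt| |exact: smooth_cst].
by move=> z; rewrite inE => h; rewrite (cutoff_supp r10 r12 h) mul0r.
Qed.

(** * The subelliptic estimate in coordinates *)

Section subelliptic_chart.
Context (R : realType) (n : nat) (M : manifold R n).
Notation X := 'rV[R]_n.
Notation T := (n.-tuple R).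
Notation C := R[i].
Variables (g : M -> 'M[R]_n) (lam : {measure set (borel M) -> \bar R}).
Hypotheses (gm : is_riemannian_metric g) (gl : is_riemannian_density g lam).
Variables (c : chart R M n) (O : set M) (y0 : X) (rho R0 : R).
Hypotheses (ac : atlas c) (oO : open O) (Oc : O `<=` cdom c) (rho0 : 0 < rho) (rhoR : rho < R0)
  (Hb : [set z | `|z - y0| <= R0] `<=` cmap c @` O).

Let Hbd := Hball_dom Oc Hb.
Let R00 : 0 <= R0. Proof. exact: ltW (lt_trans rho0 rhoR). Qed.
Let KO x : chart_ball c y0 R0 x -> O x := @chart_ball_sub _ _ _ _ _ _ _ Oc Hb x.

Let Hsub s : s < rho -> [set z | `|z - y0| <= s] `<=` cmap c @` cdom c.
Proof. by move=> sr z hz; apply: Hbd; apply: le_trans hz (ltW (lt_trans sr rhoR)). Qed.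

Lemma csm_transplant_in w : test_in y0 rho w -> csmooth (transplant c w).
Proof. by move=> [sw [s sr zs]]; exact: (csm_transplant ac sw zs (Hsub sr)). Qed.

Lemma vf_apply_transplant (Z : cvfield M) w x : test_in y0 rho w ->
  vf_apply Z (transplant c w) x = transplant c (lieD (lcoef Z c y0 rho R0) w) x.
Proof.
move=> tw; have [sw [s sr zs]] := tw; have sT := csm_transplant_in tw.
have [Kx|nKx] := pselect (chart_ball c y0 s x); last first. rewrite vf_apply_near0; last first.
    have : nbhs x (~` chart_ball c y0 s). by apply: open_nbhs_nbhs; split => //; exact: open_far (Hsub sr).
    by apply: filterS => y; exact: transplant_far zs.
  rewrite (transplant_far _ nKx)// => y hy; rewrite /lieD big1// => i _. by rewrite (suppC_cpart i zs hy) mulr0.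
have [cx hx] : cdom c x /\ `|cmap c x - y0| <= s.
  by move: Kx => [z hz <-]; have [x' cx' E] := Hsub sr hz; rewrite -E cmapK// E.
have hr := le_trans hx (ltW sr).
rewrite transplantE// (vf_applyE Z ac cx (cdom_open c) cx (csm_on_sub (@subsetT _ _) sT)) /lieD.
apply: eq_bigr => i _; rewrite /lcoef (@locE R n M c y0 rho R0 rho0 rhoR _ _ hr) cmapK//; congr (_ * _).
have oI := cmap_open_image (cdom_open c) (@subset_refl _ (cdom c)).
have Ix : (cmap c @` cdom c) (cmap c x) by exists x.
rewrite /cpart; congr (_ +i* _); apply: near_eq_derive; apply: (near_open oI _ Ix) => y.
  by rewrite inE => -[z cz <-]; rewrite cmapK// transplantE.
by rewrite inE => -[z cz <-]; rewrite cmapK// transplantE.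
Qed.

Lemma in_coordinates_transplant w : test_in y0 rho w -> in_coordinates c (transplant c w) = w.
Proof.
move=> [sw [s sr zs]]; apply/funext => y; rewrite /in_coordinates; case: ifPn => [|/negP]; rewrite inE.
  by move=> [x cx <-]; rewrite cmapK// transplantE.
by move=> ny; rewrite zs// ltNge; apply/negP => hy; apply: ny; exact: (Hsub sr).
Qed.

(** The two L^2 norms differ by the volume density, which is bounded on the ball. *)
Lemma l2_transplant : exists2 B, 0 <= B & forall w, test_in y0 rho w -> (l2_sq lam (transplant c w) <= B%:E * l2n w)%E.
Proof.
have sv : csmooth_on O (fun x => (volume g c x)%:C).
  by split; [exact: smooth_on_sub Oc (smooth_volume gm ac)|exact: smooth_on_cst].
have [B B0 HB] := test_bounded (test_loc ac oO Oc rho0 rhoR Hb sv).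
exists B; first exact: ltW.
move=> w tw; have [sw [s sr zs]] := tw; have sT := csm_transplant_in tw.
have sO := csm_on_sub (@subsetT _ O) sT.
have mK : measurable (chart_ball c y0 R0 : set (borel M)) by exact: mchart_ball.
have mf : measurable_fun (chart_ball c y0 R0 : set (borel M)) (fun x : borel M => (normsq (transplant c w x))%:E).
  have [m1 m2] := cmeas_on_ball oO Oc Hb sO.
  by apply/mEFinP; apply: mfunD; exact: measurable_funX.
rewrite /l2_sq (_ : (\int[lam]_x _ = \int[lam]_(x in (chart_ball c y0 R0 : set (borel M))) (normsq (transplant c w x))%:E)%E); last first.
  rewrite [RHS]integral_mkcond; apply: eq_integral => x _; rewrite patchE; case: ifPn => //.
  rewrite notin_setE => nK; rewrite (transplant_far zs) ?/normsq /= ?expr0n ?addr0// => -[z hz E].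
  by apply: nK; exists z => //=; apply: le_trans hz (ltW (lt_trans sr rhoR)).
rewrite (ge0_chart_integral gm gl ac R00 Hbd mf); last by move=> x _; rewrite lee_fin normsq_ge0.
have mw : mfunT (fun t : T => normsq (w (rowt t))) by apply: cmeas_normsq; exact: cmeas_rowt.
rewrite /l2n -ge0_integralZl_EFin//; last 3 first.
- by move=> t _; rewrite lee_fin normsq_ge0.
- exact/mEFinP.
- exact: ltW.
apply: ge0_le_integral => //.
- by move=> t _; rewrite -EFinM lee_fin mulr_ge0 ?normsq_ge0// ball_volume_ge0.
- apply: emeasurable_funM; last by apply/mEFinP; exact: mball_volume.
  apply: (measurable_comp (F := chart_ball c y0 R0 : set (borel M))) mK _ mf (mball_point R00 Hbd).
  by move=> _ [t _ <-]; exact: ball_point_in.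
- by apply/mEFinP; apply: mfunM => //; exact: measurable_cst.
- move=> t _; rewrite -!EFinM lee_fin /ball_volume; case: ifPn => hR; last by rewrite mulr0 mulr_ge0 ?normsq_ge0// ltW.
  have bK := ball_point_in c y0 R00 t; have Ob := KO bK; have cb := Oc Ob. rewrite transplantE// (ball_pointE Hbd hR).
  have [hs|hs] := leP `|rowt t - y0| s; last by rewrite zs// /normsq /= expr0n addr0 mul0r mulr0.
  rewrite mulrC ler_wpM2r ?normsq_ge0//; apply: le_trans (ler_norm _) _.
  have := HB (rowt t); rewrite (@locE R n M c y0 rho R0 rho0 rhoR _ _ (le_trans hs (ltW sr))). by rewrite ncR.
Qed.

(** Applied to the transplant of [w], the estimate has the Sobolev norm of [w] itself on the left;
    on the right the field acts in coordinates, and [l2_transplant] replaces the norms on M. *)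
Lemma subelliptic_coordinates (U : set M) eps Kc m (L : 'I_m -> cvfield M) : O `<=` U -> 0 <= Kc ->
  (forall f, test_function U f -> (sobolev_sq eps (in_coordinates c f) <=
     Kc%:E * (l2_sq lam f + \sum_(j < m) l2_sq lam (vf_apply (L j) f)))%E) ->
  (forall j i, csmooth_on O (fun x => components c (L j) x 0 i)) -> exists2 K, 0 <= K & forall w, test_in y0 rho w ->
    (sobolev_sq eps w <= K%:E * (l2n w + \sum_j l2n (lieD (lcoef (L j) c y0 rho R0) w)))%E.
Proof.
move=> OU K0 sub sL; have [B B0 HB] := l2_transplant; exists (Kc * B); first exact: mulr_ge0.
move=> w tw; have [sw [s sr zs]] := tw.
have tl j : test_in y0 rho (lieD (lcoef (L j) c y0 rho R0) w). split.
    apply: smoothC_sum => i _; apply: smoothCM; last exact: smoothC_cpart. exact: (smoothC_loc ac oO Oc rho0 rhoR Hb).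
  by exists s => // y hy; rewrite /lieD big1// => i _; rewrite (suppC_cpart i zs hy) mulr0.
have tf : test_function U (transplant c w). have cl : closed (chart_ball c y0 s).
    by apply: compact_closed; [exact: manifold_hausdorff|exact: compact_chart_ball (Hsub sr)].
  have S : closure [set x | transplant c w x != 0] `<=` chart_ball c y0 s.
    rewrite [X in _ `<=` X]((closure_id _).1 cl); apply: closure_subset => x /= v0; apply: contrapT => nx.
    by move: v0; rewrite (transplant_far zs nx) eqxx. split; first exact: csm_transplant_in.
    exact: (subclosed_compact (@closed_closure _ _) (compact_chart_ball (Hsub sr))).
  move=> x /S[z hz <-]; apply/OU/KO; exists z => //=; apply: le_trans hz (ltW (lt_trans sr rhoR)).
have := sub _ tf; rewrite in_coordinates_transplant// => H; apply: le_trans H _.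
rewrite EFinM -muleA; apply: lee_wpmul2l; first by rewrite lee_fin.
rewrite ge0_muleDr ?l2n_ge0//; last by apply: sume_ge0 => j _; exact: l2n_ge0.
apply: leeD; first exact: HB.
rewrite ge0_sume_distrr; last by move=> j _; exact: l2n_ge0.
apply: lee_sum => j _; rewrite (_ : vf_apply (L j) _ = transplant c (lieD (lcoef (L j) c y0 rho R0) w)); first exact: HB.
by apply/funext => x; exact: vf_apply_transplant.
Qed.

End subelliptic_chart.

Theorem theorem4p1 (R : realType) (n : nat) (M : manifold R n)
    (ZM : set (cvfield M)) (r : nat) (E : vbundle M r)
    (nabla : connection E)
    (g : M -> 'M[R]_n) (lam : {measure set (borel M) -> \bar R})
    (h : forall x : M, E x -> E x -> R[i])
    (nabla_adj : cvfield M -> section E -> section E)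
    (p0 : M) (u : section E) :
  is_distribution ZM ->
  is_connection nabla ->
  is_riemannian_metric g ->
  is_riemannian_density g lam ->
  is_hermitian_metric h ->
  (forall Z, smooth_cvfield Z ->
     is_formal_adjoint h lam (cnabla nabla Z) (nabla_adj Z)) ->
  subelliptic lam ZM p0 ->
  l2loc h lam u ->
  weak_solution h lam nabla_adj ZM u ->
  exists (U : set M) (s : section E),
    [/\ open U, U p0, smooth_section s &
        {ae lam, forall x, U x -> u x = s x}].
Proof.
move=> [sZM _ _ _] cn gm gl hh adj [c [U0 [eps [Kc [m [L [[ac oU0 U0p U0c] eps0 Kc0 LZ sub]]]]]]] lu wk.
have [t tt tp] := trivs_cover E p0; have mu_ := proj1 lu.
pose O := U0 `&` tdom t; have oO : open O by apply: openI => //; exact: tdom_open.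
have OD : O `<=` cdom c `&` tdom t by move=> x [/U0c].
have Oc : O `<=` cdom c by move=> x [/U0c].
have Op : O p0 by [].
(* Radii R0 > rho > rho1 > r2 > r1: coefficients are cut off between rho and R0, the coordinates of
   u are regular within rho1, and a last cutoff between r1 and r2 turns them into a global
   section. *)
pose y0 := cmap c p0; have [R0 R00 Hb] := chart_radius oO Oc Op; rewrite -/y0 in Hb.
pose rho := R0 / 2; have rho0 : 0 < rho by exact: divr_gt0.
have rhoR : rho < R0 by rewrite gtr_pMr// invf_lt1// ltr1n.
have Hbd := Hball_dom Oc Hb; have cp : cdom c p0 := Oc _ Op.
have sZ j : smooth_cvfield (L j) := sZM _ (LZ j).
(* The system is built from the finitely many fields of the subelliptic estimate. *)
have /choice[f Hf] j : exists f, smooth_section f /\ forall v, smooth_section v -> compact (supp v) ->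
    pairing h lam u (nabla_adj (L j) v) = pairing h lam f v. by have [f sf ?] := wk _ (LZ j); exists f.
have [K K0 subell] := subelliptic_coordinates gm gl ac oO Oc rho0 rhoR Hb (@subIsetl _ _ _) (ltW Kc0) sub
  (fun j i => csm_on_sub Oc (sZ j c ac i)).
have qL2 a := qcoef_L2 gm gl hh ac tt oO OD rho0 rhoR Hb mu_ a lu.
have tal j i := test_lcoef (sZ j) ac oO OD rho0 rhoR Hb i.
have tGam j a b := test_ccoef cn (sZ j) ac tt oO OD rho0 rhoR Hb a b.
have tF j a := test_fcoef ac tt oO OD rho0 rhoR Hb (proj1 (Hf j)) a.
have weak j b phi := local_weak gm gl hh cn (sZ j) (adj _ (sZ j)) ac tt oO OD rho0 rhoR Hb mu_ (proj1 (Hf j)) b (phi := phi)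
  (proj2 (Hf j)) (fun a => proj1 (qL2 a)).
pose rho1 := rho / 2; have rho10 : 0 < rho1 by exact: divr_gt0.
have rho1r : rho1 < rho by rewrite gtr_pMr// invf_lt1// ltr1n.
have /choice[w Hw] a : exists w : ('rV[R]_n -> R) * ('rV[R]_n -> R),
    [/\ smooth [set x | `|x - y0| < rho1] w.1, smooth [set x | `|x - y0| < rho1] w.2 &
    {ae leb R n, forall s, `|rowt s - y0| < rho1 -> qcoef c t y0 rho R0 u a s = (w.1 (rowt s) +i* w.2 (rowt s))%C}].
  have [w1 [w2 H]] := system_regularity rho0 tal qL2 tGam tF weak eps0 K0 subell a rho10 rho1r. by exists (w1, w2).
pose r2 := rho1 / 2; have r20 : 0 < r2 by exact: divr_gt0.
have r21 : r2 < rho1 by rewrite gtr_pMr// invf_lt1// ltr1n.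
pose r1 := r2 / 2; have r10 : 0 < r1 by exact: divr_gt0.
have r12 : r1 < r2 by rewrite gtr_pMr// invf_lt1// ltr1n.
have rR : r2 < R0 by exact: lt_trans r21 (lt_trans rho1r rhoR).
(* The smooth representatives, unchanged within r1 and extended by 0 beyond r2. *)
pose phi a (y : 'rV[R]_n) : R[i] := (cutoff y0 r1 r2 y * (w a).1 y +i* (cutoff y0 r1 r2 y * (w a).2 y))%C.
have oW := @open_W R n y0 rho1.
have sphi a : smoothC (phi a). have [s1 s2 _] := Hw a.
  have subW : [set z | `|z - y0| <= r2] `<=` [set x : 'rV[R]_n | `|x - y0| < rho1].
    by move=> z hz; exact: le_lt_trans hz r21.
  by split; [exact: smooth_cutoffM oW (ltW r10) r12 subW s1|exact: smooth_cutoffM oW (ltW r10) r12 subW s2].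
have zphi a : suppC y0 r2 (phi a). by move=> y hy; rewrite /phi (cutoff_supp (ltW r10) r12 hy) !mul0r.
have HbD : [set z | `|z - y0| <= r2] `<=` cmap c @` (cdom c `&` tdom t).
  by move=> z hz; have [x Ox <-] := Hb _ (le_trans hz (ltW rR)); exists x => //; exact: OD.
pose s := section_of c t phi.
have ss : smooth_section s by exact: (smooth_section_of ac tt sphi zphi HbD).
pose V := cmap c @^-1` [set y | `|y - y0| < r1]; pose U := cdom c `&` V.
have oU : open U. rewrite openE => x [cx Vx].
  have n1 : nbhs x (cdom c) by apply: open_nbhs_nbhs; split => //; exact: cdom_open.
  have n2 : nbhs (cmap c x) [set y | `|y - y0| < r1]. by apply: open_nbhs_nbhs; split => //; exact: (@open_W R n y0 r1).
  exact: filterI n1 (@cmap_continuous _ _ _ c x cx _ n2).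
have Up : U p0 by split => //; rewrite /V /= subrr normr0.
exists U, s; split=> //.
pose Kb := chart_ball c y0 R0; have R0ge := ltW R00.
have KO x : Kb x -> O x := @chart_ball_sub _ _ _ _ _ _ _ Oc Hb x.
have UK x : U x -> Kb x. move=> [cx Vx]; exists (cmap c x); last exact: cmapK.
  by apply/ltW/(lt_trans Vx)/(lt_trans r12).
pose d a x := tfwd t (u x) 0 a - tfwd t (s x) 0 a.
(* One measurable function on the ball whose zeros are the points where u and s agree. *)
pose D x : R := \sum_a normsq (d a x).
have md a : cmeas_on Kb (d a). have [m1 m2] := cmeas_tfwd tt OD Hb mu_ a.
  have [m3 m4] := cmeas_on_ball oO Oc Hb (csmooth_tfwd tt OD a ss). split.
    by under eq_fun do rewrite /d ReD ReN; exact: measurable_funB.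
  by under eq_fun do rewrite /d ImD ImN; exact: measurable_funB.
have mD : measurable_fun (Kb : set (borel M)) (D : borel M -> R). apply: measurable_sum => a; have [m1 m2] := md a.
  by apply: mfunD; exact: measurable_funX.
have mK : measurable (Kb : set (borel M)) by exact: mchart_ball.
have mU : measurable (U : set (borel M)) by exact: sub_sigma_algebra.
(* A measurable set containing all exceptional points; the statement almost everywhere asks for such
   a set of measure 0. *)
pose B := (Kb `&` D @^-1` [set~ 0]) `&` U.
have mB : measurable (B : set (borel M)).
  apply: measurableI => //; apply: mD => //; apply: measurableC; exact: measurable_set1.
exists B; split=> //; last first. move=> x /= /not_implyP[Ux us]; split=> //; split; first exact: UK.
  have tx : tdom t x by have [_] := OD _ (KO _ (UK _ Ux)).
  move=> /= Dx; apply: us; apply: (can_inj (tfwdK tx)); apply/rowP => a. have : normsq (d a x) = 0.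
    by move: Dx => /eqP; rewrite psumr_eq0 => [/allP/(_ a (mem_index_enum _))/= /eqP|i _]; rewrite ?normsq_ge0.
  rewrite /normsq => /eqP; rewrite paddr_eq0 ?sqr_ge0// !sqrf_eq0 => /andP[/eqP e1 /eqP e2].
  by apply/eqP; rewrite -subr_eq0 eq_complex -/(d a x) e1 e2 /= !eqxx.
rewrite (chart_ball_measure gl ac R0ge Hbd mB); last by move=> x [[]].
pose bp := ball_point c y0 R0.
have mbB : measurable (bp @^-1` B). by rewrite -[X in measurable X]setTI; apply: (mball_point R0ge Hbd).
have mv := mball_volume gm ac R0ge Hbd.
(* In coordinates the integrand vanishes almost everywhere on the preimage of [B]: where the weight
   is nonzero, u and s have the same coordinates for almost every z, which contradicts membership in
   [B]. *)
rewrite (@ae_eq_integral _ _ _ (leb R n) (bp @^-1` B) (fun=> 0%E) (fun x => (ball_volume g c y0 R0 x)%:E) mbB); last 3 first.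
- by apply/mEFinP; exact: measurable_funTS.
- exact: measurable_cst.
- have : {ae leb R n, forall z a, `|rowt z - y0| < rho1 ->
      qcoef c t y0 rho R0 u a z = ((w a).1 (rowt z) +i* (w a).2 (rowt z))%C}.
    by apply: filter_forall => a; have [_ _] := Hw a. apply: filterS => z H [[Kz Dz] [cz Vz]].
  rewrite /ball_volume; case: ifPn => // hz; exfalso; apply: Dz.
  have e1 := ball_pointE Hbd hz; rewrite /V /= -/bp e1 in Vz.
  have hz1 : `|rowt z - y0| < rho1 by exact: lt_trans Vz (lt_trans r12 r21). have Dz := OD _ (KO _ Kz).
  rewrite /= /D big1// => a _; rewrite /d (_ : _ - _ = 0) ?/normsq /= ?expr0n ?addr0//.
  have := H a hz1; rewrite /qcoef (ltW (lt_trans hz1 rho1r)) => ->.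
  rewrite /s section_ofE// mxE -/bp e1 /phi (cutoff1 (ltW r10) r12 (ltW Vz)) !mul1r. by rewrite subrr.
by rewrite integral0.
Qed.
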